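(* Let $D\in W^{2,\infty}(U)$ be the (periodic) interaction potential, let $\Omega=\mathbb S^2$ with uniform probability measure $\mu$, and let $A$ be the spherical graphop on $L^2(\mathbb S^2,\mu)$. If $\kappa>0$ satisfies $$\kappa<\frac{2\pi^2}{L^2\,\|\Delta_xD\|_{L^\infty(U)}},$$ then for every admissible initial datum $\rho_0$ with $\hat H(\rho_0|\rho_\infty)<\infty$, the classical solution $\rho$ of $$\partial_t\rho=\kappa\,\mathrm{div}_x\big(\rho V[A](\rho)\big)+\Delta_x\rho,\qquad\rho(0)=\rho_0,$$ satisfies $$\hat H(\rho(t)|\rho_\infty)\le e^{-\hat\alpha(A)t}\,\hat H(\rho_0|\rho_\infty),\quad t\ge0,\qquad \hat\alpha(A):=\frac{4\pi^2}{L^2}-2\kappa\,\|\Delta_xD\|_{L^\infty(U)} .$$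
   Context: Setting. $d\ge1$, $L>0$, and $U=[-\frac L2,\frac L2]^d$ is the $d$-dimensional flat torus of side length $L$ (all functions of $x\in U$, including $D$, are periodic; Sobolev spaces on $U$ are those of the torus). $\mathcal P_{\rm ac}(U)$ denotes probability densities on $U$ with respect to $dx$. Spherical graphop. $\mathbb S^2=\{\xi\in\mathbb R^3:|\xi|=1\}$, $\mu$ is the uniform probability measure on $\mathbb S^2$, and for $\xi\in\mathbb S^2$, $\xi^\perp:=\{\tilde\xi\in\mathbb S^2:\xi^T\tilde\xi=0\}$ is the $\xi$-equator with $\nu_\xi$ the uniform probability measure on $\xi^\perp$. The spherical graphop is $A:L^2(\mathbb S^2,\mu)\to L^2(\mathbb S^2,\mu)$, $$(Af)(\xi):=\int_{\xi^\perp}f(\tilde\xi)\,d\nu_\xi(\tilde\xi).$$ Equation. The unknown is $\rho=\rho(t,x,\xi)$, $t\ge0$, $x\in U$, $\xi\in\Omega=\mathbb S^2$, and $$V[A](\rho)(t,x,\xi):=\int_U\nabla_xD(x-\tilde x)\,(A\rho)(t,\tilde x,\xi)\,d\tilde x,$$ where $(A\rho)(t,\tilde x,\xi):=[A\rho(t,\tilde x,\cdot)](\xi)$, i.e. $A$ acts only on $\xi$. A classical solution is one such that for a.e. $\xi\in\Omega$, $\rho(\cdot,\cdot,\xi)\in C^1(0,\infty;C^2(U))$ solves the equation with interaction term $V[A](\rho)(\cdot,\cdot,\xi)$. Admissible data. $\rho_0$ is admissible if $\rho_0(\cdot,\xi)\in H^{3+d}(U)\cap\mathcal P_{\rm ac}(U)$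 for a.e. $\xi\in\Omega$, and $\rho_0(x,\cdot)\in L^\infty(\Omega,\mu)$ for each $x\in U$. Entropy. $\rho_\infty(x,\xi):=L^{-d}$ and $\hat H(\rho|\rho_\infty):=\int_\Omega\int_U\rho\log\big(\tfrac{\rho}{\rho_\infty}\big)\,dx\,d\mu(\xi)$. Convention: the upper bound on $\kappa$ is read as $+\infty$ if its denominator vanishes. *)

(* Defs.v *)
From HB Require Import structures.
From mathcomp Require Import all_boot all_order all_algebra.
From mathcomp Require Import ring lra.
From mathcomp Require Import all_classical all_reals all_analysis.
From mathcomp Require Import measurable_realfun.

Set Implicit Arguments.
Unset Strict Implicit.
Unset Printing Implicit Defensive.

Import Order.TTheory GRing.Theory Num.Theory.
Import numFieldNormedType.Exports.

Local Open Scope classical_set_scope.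
Local Open Scope ring_scope.

Definition measure_rV_display : measure_display -> measure_display.
Proof. exact. Qed.

Section measurable_rV.
Context {d : measure_display} {T : sigmaRingType d} (n : nat).

Let coord : 'I_n -> 'rV[T]_n -> T := fun i v => v ord0 i.

Let rV_set0 : g_sigma_preimage coord set0.
Proof. exact: sigma_algebra0. Qed.

Let rV_setC A : g_sigma_preimage coord A -> g_sigma_preimage coord (~` A).
Proof. exact: sigma_algebraC. Qed.

Let rV_bigcup (F : _^nat) : (forall i, g_sigma_preimage coord (F i)) ->
  g_sigma_preimage coord (\bigcup_i (F i)).
Proof. exact: sigma_algebra_bigcup. Qed.

HB.instance Definition _ := @isMeasurable.Build (measure_rV_display d)
  'rV[T]_n (g_sigma_preimage coord) rV_set0 rV_setC rV_bigcup.

End measurable_rV.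


Lemma measurable_coord {d : measure_display} {T : measurableType d} n (i : 'I_n) :
  measurable_fun setT (fun v : 'rV[T]_n => v ord0 i).
Proof.
move=> _ Y mY; rewrite setTI; apply: sub_sigma_algebra => /=.
rewrite -bigcup_seq/=; exists i => /=; first by rewrite mem_index_enum.
by exists Y => //; rewrite setTI.
Qed.

Lemma measurable_fun_rVP {d1 d2 : measure_display} {T1 : measurableType d1}
    {T2 : measurableType d2} n (f : T1 -> 'rV[T2]_n) :
  measurable_fun setT f <->
  forall i, measurable_fun setT (fun x => f x ord0 i).
Proof.
split=> [mf i|mf].
  exact: (measurableT_comp (measurable_coord i) mf).
move=> _ A mA; rewrite setTI.
suff : preimage_set_system setT f measurable `<=` measurable.
  by apply; exists A => //; rewrite setTI.
rewrite [X in preimage_set_system _ _ X](_ : _ =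
    g_sigma_preimage (fun (i : 'I_n) (v : 'rV[T2]_n) => v ord0 i))//.
rewrite -g_sigma_preimage_comp.
apply: smallest_sub; first exact: sigma_algebra_measurable.
move=> {A mA}; case: n => [|n] in f mf *; first by rewrite big_ord0.
rewrite -bigcup_mkord_ord; apply: bigcup_sub => i Ii.
by move=> B [C mC <-]; exact: mf.
Qed.

Section sigma_finite_prod.
Context d1 d2 (T1 : measurableType d1) (T2 : measurableType d2) (R : realType).
Variables (m1 : {sigma_finite_measure set T1 -> \bar R})
  (m2 : {sigma_finite_measure set T2 -> \bar R}).

Lemma sigma_finite_prod : sigma_finite setT (m1 \x m2)%E.
Proof.
have /sigma_finiteP[F [TF ndF Foo]] := sigma_finiteT m1.
have /sigma_finiteP[G [TG ndG Goo]] := sigma_finiteT m2.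
exists (fun n => F n `*` G n).
  rewrite -setXTT TF TG predeqE => -[x y]; split.
    move=> [/= [n _ Fnx] [k _ Gky]]; exists (maxn n k) => //; split.
    - by move: x Fnx; exact/subsetPset/ndF/leq_maxl.
    - by move: y Gky; exact/subsetPset/ndG/leq_maxr.
  by move=> [n _ []/= ? ?]; split; exists n.
move=> k; have [? ?] := Foo k; have [? ?] := Goo k.
split; first exact: measurableX.
by rewrite product_measure1E// lte_mul_pinfty// ge0_fin_numE.
Qed.

End sigma_finite_prod.

Section lebesgue_rV.
Context {R : realType}.

Definition cons_rV n (p : R * 'rV[R]_n) : 'rV[R]_n.+1 :=
  row_mx (const_mx p.1 : 'rV_1) p.2.

Fixpoint lebesgue_rV n : set 'rV[R]_n -> \bar R :=
  match n return set 'rV[R]_n -> \bar R with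
  | 0 => dirac (0 : 'rV[R]_0)
  | m.+1 => pushforward (lebesgue_measure \x @lebesgue_rV m)%E (@cons_rV m)
  end.

Let cons_rV_head n (p : R * 'rV[R]_n) : cons_rV p ord0 ord0 = p.1.
Proof.
have := row_mxEl (const_mx p.1 : 'rV_1) p.2 ord0 ord0; rewrite [RHS]mxE => <-.
by congr (fun_of_matrix _ _ _); exact/val_inj.
Qed.

Let cons_rV_tail n (p : R * 'rV[R]_n) i :
  cons_rV p ord0 (lift ord0 i) = p.2 ord0 i.
Proof.
rewrite -(row_mxEr (const_mx p.1 : 'rV_1) p.2 ord0 i).
by congr (fun_of_matrix _ _ _); exact/val_inj.
Qed.

Lemma measurable_cons_rV n : measurable_fun setT (@cons_rV n).
Proof.
apply/measurable_fun_rVP => i; have [j ->|->] := unliftP ord0 i.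
- rewrite (_ : (fun _ => _) = (fun v : 'rV[R]_n => v ord0 j) \o snd).
    by apply: measurableT_comp => //; exact: measurable_coord.
  by apply/funext => x; exact: cons_rV_tail.
- rewrite (_ : (fun _ => _) = fst)//.
  by apply/funext => x; exact: cons_rV_head.
Qed.

Let uncons n (v : 'rV[R]_n.+1) : R * 'rV[R]_n :=
  (v ord0 ord0, \row_i v ord0 (lift ord0 i)).

Let cons_rVK n : cancel (@cons_rV n) (@uncons n).
Proof.
move=> [x v]; rewrite /uncons cons_rV_head; congr pair.
by apply/rowP => i; rewrite mxE cons_rV_tail.
Qed.

Let measurable_uncons n : measurable_fun setT (@uncons n).
Proof.
apply/measurable_fun_pairP; split; first exact: measurable_coord.
apply/measurable_fun_rVP => i /=.
rewrite (_ : (fun _ => _) = fun v : 'rV[R]_n.+1 => v ord0 (lift ord0 i)).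
  exact: measurable_coord.
by apply/funext => v /=; rewrite mxE.
Qed.

Let lebesgue_rV_spec n : [/\ lebesgue_rV (set0 : set 'rV[R]_n) = 0%E,
  forall A : set 'rV[R]_n, (0 <= lebesgue_rV A)%E,
  semi_sigma_additive (@lebesgue_rV n) &
  sigma_finite setT (@lebesgue_rV n)].
Proof.
elim: n => [|n [m0 m_ge0 m_sigma m_sigmaf]].
  split=> /=; [exact: measure0|by move=> A; exact: measure_ge0|
    exact: measure_semi_sigma_additive|exact: sigma_finiteT].
pose mM := isMeasure.Build _ _ _ (@lebesgue_rV n) m0 m_ge0 m_sigma.
pose m : {measure set 'rV[R]_n -> \bar R} := HB.pack (@lebesgue_rV n) mM.
pose sM := Measure_isSigmaFinite.Build _ _ _ m m_sigmaf.
pose s : {sigma_finite_measure set 'rV[R]_n -> \bar R} := HB.pack (@lebesgue_rV n) mM sM.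
have mc := @measurable_cons_rV n.
have E A : lebesgue_rV A =
  pushforward (lebesgue_measure \x s)%E (@cons_rV n) A by [].
split.
- by rewrite E; exact: measure0.
- by move=> A; rewrite E; exact: measure_ge0.
- exact: (@measure_semi_sigma_additive _ _ _
    (pushforward (lebesgue_measure \x s)%E (@cons_rV n))).
- have [F FT Ffin] : sigma_finite setT (lebesgue_measure \x s)%E.
    exact: sigma_finite_prod.
  exists (fun k => @uncons n @^-1` F k).
    by rewrite -preimage_bigcup -FT preimage_setT.
  move=> k; have [mF Foo] := Ffin k; split.
    by rewrite -[X in measurable X]setTI; exact: measurable_uncons.
  rewrite E /pushforward -comp_preimage.
  by rewrite (_ : _ \o _ = id) ?preimage_id//; exact/funext/cons_rVK.
Qed.

HB.instance Definition _ n := isMeasure.Build _ _ _ (@lebesgue_rV n)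
  (let: And4 h _ _ _ := lebesgue_rV_spec n in h)
  (let: And4 _ h _ _ := lebesgue_rV_spec n in h)
  (let: And4 _ _ h _ := lebesgue_rV_spec n in h).

HB.instance Definition _ n := Measure_isSigmaFinite.Build _ _ _ (@lebesgue_rV n)
  (let: And4 _ _ _ h := lebesgue_rV_spec n in h).

End lebesgue_rV.

Section sphere.
Context {R : realType}.

Definition dot n (u v : 'rV[R]_n) : R := \sum_i u ord0 i * v ord0 i.

Definition vec3 (a b c : R) : 'rV[R]_3 := \row_(i < 3) [:: a; b; c]`_i.

Definition cross (u v : 'rV[R]_3) : 'rV[R]_3 :=
  let: (u1, u2, u3) := (u ord0 0, u ord0 1, u ord0 2%:R) in
  let: (v1, v2, v3) := (v ord0 0, v ord0 1, v ord0 2%:R) in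
  vec3 (u2 * v3 - u3 * v2) (u3 * v1 - u1 * v3) (u1 * v2 - u2 * v1).

Definition sphere : Type := {x : 'rV[R]_3 | dot x x == 1}.

HB.instance Definition _ := SubChoice.on sphere.

Lemma dot_vec3 a b c a' b' c' :
  dot (vec3 a b c) (vec3 a' b' c') = a * a' + b * b' + c * c'.
Proof. by rewrite /dot !big_ord_recr big_ord0 !mxE /= add0r. Qed.

Lemma vec3_eta (u : 'rV[R]_3) : u = vec3 (u ord0 0) (u ord0 1) (u ord0 2%:R).
Proof.
by apply/rowP => -[[|[|[|//]]] i3]; rewrite mxE /=; congr (u _ _); exact/val_inj.
Qed.

Let north_on_sphere : dot (vec3 0 0 1) (vec3 0 0 1) == 1.
Proof. by rewrite dot_vec3 !mulr0 mulr1 !add0r. Qed.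

Definition north : sphere := Sub (vec3 0 0 1) north_on_sphere.

HB.instance Definition _ := isPointed.Build sphere north.

Let incl : sphere -> 'rV[R]_3 := val.

Let sphere_set0 : preimage_set_system setT incl measurable set0.
Proof. by exists set0 => //; rewrite preimage_set0 setI0. Qed.

Let sphere_setC A : preimage_set_system setT incl measurable A ->
  preimage_set_system setT incl measurable (~` A).
Proof.
move=> [B mB] <-; exists (~` B); first exact: measurableC.
by rewrite !setTI preimage_setC.
Qed.

Let sphere_bigcup (F : (set sphere)^nat) :
  (forall i, preimage_set_system setT incl measurable (F i)) ->
  preimage_set_system setT incl measurable (\bigcup_i F i).
Proof.
move=> /(_ _)/cid2 mF; exists (\bigcup_i sval (mF i)).
  by apply: bigcup_measurable => k _; case: (mF k).
rewrite setTI preimage_bigcup; apply: eq_bigcupr => k _.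
by case: (mF k) => B mB /=; rewrite setTI.
Qed.

HB.instance Definition _ := @isMeasurable.Build default_measure_display
  sphere (preimage_set_system setT incl measurable)
  sphere_set0 sphere_setC sphere_bigcup.


Lemma measurable_vec3 d (T : measurableType d) (a b c : T -> R) :
  measurable_fun setT a -> measurable_fun setT b -> measurable_fun setT c ->
  measurable_fun setT (fun t => vec3 (a t) (b t) (c t)).
Proof.
move=> ma mb mc; apply/measurable_fun_rVP => -[[|[|[|//]]] i3].
- by rewrite (_ : (fun _ => _) = a)//; apply/funext => t; rewrite mxE.
- by rewrite (_ : (fun _ => _) = b)//; apply/funext => t; rewrite mxE.
- by rewrite (_ : (fun _ => _) = c)//; apply/funext => t; rewrite mxE.
Qed.

Lemma measurable_dot d (T : measurableType d) n (f g : T -> 'rV[R]_n) :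
  measurable_fun setT f -> measurable_fun setT g ->
  measurable_fun setT (fun t => dot (f t) (g t)).
Proof.
move=> /measurable_fun_rVP mf /measurable_fun_rVP mg.
by apply: measurable_sum => i; exact: measurable_funM.
Qed.

Lemma measurable_insubd_sphere d (T : measurableType d) (f : T -> 'rV[R]_3) :
  measurable_fun setT f -> measurable_fun setT (fun t => insubd north (f t) : sphere).
Proof.
move=> mf _ _ [B mB <-]; rewrite !setTI.
pose g t := if dot (f t) (f t) == 1 then f t else \val (north : sphere).
have mg : measurable_fun setT g.
  apply: measurable_fun_if => //.
  - by apply: measurable_fun_eqr => //; exact: measurable_dot.
  - exact: measurable_funTS.
have := mg measurableT _ mB; rewrite setTI; congr measurable.
rewrite -comp_preimage; congr (_ @^-1` B).
by apply/funext => t; rewrite /g /comp /incl val_insubd.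
Qed.

(* Cylindrical chart [(z, phi)] of the sphere. Its area element is [dz dphi], so
   the image of the uniform law on [-1, 1] x [0, 2 pi] is normalized area. *)
Definition sphere_chart (p : R * R) : sphere :=
  insubd north (vec3 (Num.sqrt (1 - p.1 ^+ 2) * cos p.2)
                     (Num.sqrt (1 - p.1 ^+ 2) * sin p.2) p.1).

Lemma val_sphere_chart p : -1 <= p.1 <= 1 ->
  \val (sphere_chart p) = vec3 (Num.sqrt (1 - p.1 ^+ 2) * cos p.2)
                               (Num.sqrt (1 - p.1 ^+ 2) * sin p.2) p.1.
Proof.
move=> p11; rewrite val_insubd dot_vec3 ifT//.
have p2 : 0 <= 1 - p.1 ^+ 2 by nra.
apply/eqP; have := sqr_sqrtr p2; have := cos2Dsin2 p.2.
move: (cos p.2) (sin p.2) => c s cs; set r := Num.sqrt _ => rz; set z := p.1.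
have -> : r * c * (r * c) + r * s * (r * s) + z * z =
  r ^+ 2 * (c ^+ 2 + s ^+ 2) + z ^+ 2 by ring.
by rewrite cs rz; ring.
Qed.

Lemma measurable_sphere_chart : measurable_fun setT sphere_chart.
Proof.
have m1 : measurable_fun setT (fun p : R * R => Num.sqrt (1 - p.1 ^+ 2)).
  apply: (measurableT_comp (continuous_measurable_fun (@sqrt_continuous R))).
  apply: measurable_funB => //; exact: measurable_funX.
apply/measurable_insubd_sphere/measurable_vec3 => //.
- apply: measurable_funM => //.
  exact: (measurableT_comp (continuous_measurable_fun (@continuous_cos R))).
- apply: measurable_funM => //.
  exact: (measurableT_comp (continuous_measurable_fun (@continuous_sin R))).
Qed.

Let ltN11 : -1 < 1 :> R. Proof. by lra. Qed.
Let twopi_gt0 : 0 < 2 * pi :> R. Proof. by rewrite mulr_gt0// pi_gt0. Qed.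

Definition sphere_unif : set (sphere) -> \bar R :=
  pushforward (uniform_prob ltN11 \x uniform_prob twopi_gt0)%E sphere_chart.

Let sphere_unif0 : sphere_unif set0 = 0%E.
Proof.
have mc := measurable_sphere_chart.
rewrite /sphere_unif; exact: measure0.
Qed.

Let sphere_unif_ge0 A : (0 <= sphere_unif A)%E.
Proof.
have mc := measurable_sphere_chart.
rewrite /sphere_unif; exact: measure_ge0.
Qed.

Let sphere_unif_sigma : semi_sigma_additive sphere_unif.
Proof.
have mc := measurable_sphere_chart.
rewrite /sphere_unif; exact: measure_semi_sigma_additive.
Qed.

HB.instance Definition _ := isMeasure.Build _ _ _ sphere_unif
  sphere_unif0 sphere_unif_ge0 sphere_unif_sigma.

Let sphere_unifT : sphere_unif setT = 1%E.
Proof. by rewrite /sphere_unif /pushforward preimage_setT probability_setT. Qed.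

HB.instance Definition _ :=
  Measure_isProbability.Build _ _ _ sphere_unif sphere_unifT.

(* Orthonormal basis of the plane orthogonal to [xi] (see [frameP]); [frame1 xi]
   is horizontal, and set by convention at the two poles. *)
Definition frame1 (xi : sphere) : 'rV[R]_3 :=
  let: (x, y) := (\val xi ord0 0, \val xi ord0 1) in
  let: r := Num.sqrt (x ^+ 2 + y ^+ 2) in
  if r == 0 then vec3 1 0 0 else vec3 (- (y / r)) (x / r) 0.

Definition frame2 (xi : sphere) : 'rV[R]_3 := cross (\val xi) (frame1 xi).

Definition equator (xi : sphere) : set sphere :=
  [set eta : sphere | dot (\val xi) (\val eta) = 0].

Definition circle_chart (xi : sphere) (theta : R) : sphere :=
  insubd north (cos theta *: frame1 xi + sin theta *: frame2 xi).

Lemma dotC n (u v : 'rV[R]_n) : dot u v = dot v u.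
Proof. by apply: eq_bigr => i _; rewrite mulrC. Qed.

Lemma frameP (xi : sphere) :
  [/\ dot (frame1 xi) (frame1 xi) = 1, dot (frame2 xi) (frame2 xi) = 1,
      dot (frame1 xi) (frame2 xi) = 0, dot (\val xi) (frame1 xi) = 0 &
      dot (\val xi) (frame2 xi) = 0].
Proof.
have /eqP := valP xi; rewrite /frame2 /frame1 /cross.
have [x [y [z ->]]] : exists x y z, \val xi = vec3 x y z.
  by do 3 eexists; exact: vec3_eta.
rewrite dot_vec3 !(mxE, dot_vec3) /= => xyz1.
have r2 : 0 <= x ^+ 2 + y ^+ 2 by rewrite addr_ge0// sqr_ge0.
have := sqr_sqrtr r2; case: eqP => [->|/eqP].
  rewrite expr0n/= => /esym/eqP; rewrite paddr_eq0 ?sqr_ge0// !sqrf_eq0.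
  move=> /andP[/eqP x0 /eqP y0]; rewrite !(mxE, dot_vec3)/= x0 y0.
  by split; nra.
move: (Num.sqrt _) => r r0 rxy; rewrite !(mxE, dot_vec3)/=.
have zz : z * z = 1 - r ^+ 2 by rewrite rxy; nra.
have ab1 : (x / r) ^+ 2 + (y / r) ^+ 2 = 1.
  by rewrite !expr_div_n -mulrDl -rxy divff// sqrf_eq0.
have := divfK r0 x; have := divfK r0 y.
move: (x / r) (y / r) ab1 => a b ab1 <- <-.
split.
- by rewrite -ab1; ring.
- transitivity ((a ^+ 2 + b ^+ 2) * (z * z + r ^+ 2 * (a ^+ 2 + b ^+ 2))).
    by ring.
  by rewrite ab1 zz; ring.
- by ring.
- by ring.
- by ring.
Qed.

Lemma dotDr n (u v w : 'rV[R]_n) : dot u (v + w) = dot u v + dot u w.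
Proof. by rewrite -big_split; apply: eq_bigr => i _; rewrite mxE mulrDr. Qed.

Lemma dotZr n k (u v : 'rV[R]_n) : dot u (k *: v) = k * dot u v.
Proof. by rewrite mulr_sumr; apply: eq_bigr => i _; rewrite mxE mulrCA. Qed.

Lemma val_circle_chart (xi : sphere) (theta : R) : \val (circle_chart xi theta)
  = cos theta *: frame1 xi + sin theta *: frame2 xi.
Proof.
have [f11 f22 f12 _ _] := frameP xi; rewrite val_insubd ifT//.
rewrite dotDr !dotZr ![dot (_ + _) _]dotC !dotDr !dotZr f11 f22.
rewrite ?[dot (frame2 xi) (frame1 xi)]dotC f12; apply/eqP.
by transitivity (cos theta ^+ 2 + sin theta ^+ 2);
  [ring|exact: cos2Dsin2].
Qed.

Lemma circle_chart_equator (xi : sphere) (theta : R) :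
  equator xi (circle_chart xi theta).
Proof.
have [_ _ _ x1 x2] := frameP xi.
by rewrite /equator/= val_circle_chart dotDr !dotZr x1 x2 !mulr0 addr0.
Qed.

Lemma measurable_circle_chart (xi : sphere) :
  measurable_fun setT (circle_chart xi).
Proof.
apply/measurable_insubd_sphere/measurable_fun_rVP => i.
rewrite (_ : (fun _ => _) =
    fun t : R => cos t * frame1 xi ord0 i + sin t * frame2 xi ord0 i).
  apply: measurable_funD; apply: measurable_funM => //.
    exact: (continuous_measurable_fun (@continuous_cos R)).
  exact: (continuous_measurable_fun (@continuous_sin R)).
by apply/funext => t; rewrite !mxE.
Qed.

Definition equator_unif (xi : sphere) : set sphere -> \bar R :=
  pushforward (uniform_prob twopi_gt0) (circle_chart xi).

Let equator_unif0 xi : equator_unif xi set0 = 0%E.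
Proof.
have mc := measurable_circle_chart xi.
rewrite /equator_unif; exact: measure0.
Qed.

Let equator_unif_ge0 xi A : (0 <= equator_unif xi A)%E.
Proof.
have mc := measurable_circle_chart xi.
rewrite /equator_unif; exact: measure_ge0.
Qed.

Let equator_unif_sigma xi : semi_sigma_additive (equator_unif xi).
Proof.
have mc := measurable_circle_chart xi.
rewrite /equator_unif; exact: measure_semi_sigma_additive.
Qed.

HB.instance Definition _ xi := isMeasure.Build _ _ _ (equator_unif xi)
  (equator_unif0 xi) (@equator_unif_ge0 xi) (@equator_unif_sigma xi).

Let equator_unifT xi : equator_unif xi setT = 1%E.
Proof. by rewrite /equator_unif /pushforward preimage_setT probability_setT. Qed.

HB.instance Definition _ xi :=
  Measure_isProbability.Build _ _ _ (equator_unif xi) (equator_unifT xi).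

Definition spherical_graphop (f : sphere -> R) (xi : sphere) : R :=
  \int[equator_unif xi]_(eta in equator xi) f eta.

End sphere.
Arguments sphere : clear implicits.

(* Functions on the flat torus of side [L] are represented by [L]-periodic
   functions on 'rV[R]_d, integrated over the fundamental cell [cell]. *)
Section torus.
Context {R : realType} (L : R) {d : nat}.
Implicit Types (f g phi : 'rV[R]_d -> R) (s : seq 'I_d).

Definition periodic f := forall x i, f (x + L *: delta_mx ord0 i) = f x.

Definition cell : set 'rV[R]_d :=
  [set x | forall i, - (L / 2) <= x ord0 i <= L / 2].

Lemma measurable_cell : measurable cell.
Proof.
rewrite (_ : cell = \bigcap_(i in [set: 'I_d])
    (fun x : 'rV[R]_d => x ord0 i) @^-1` `[- (L / 2), L / 2]).
  apply: fin_bigcap_measurable => // i _.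
  rewrite -[X in measurable X]setTI; exact: measurable_coord.
apply/seteqP; split=> x /=.
  by move=> xL i _ /=; rewrite in_itv/=; exact: xL.
by move=> xL i; have := xL i I; rewrite /= in_itv.
Qed.

Definition dx := mrestr (@lebesgue_rV R d) measurable_cell.
HB.instance Definition _ := Measure.on dx.

Definition partial (i : 'I_d) f : 'rV[R]_d -> R := 'D_(delta_mx ord0 i) f.

Definition partials s f := foldr partial f s.

Fixpoint Ck (k : nat) f : Prop :=
  continuous f /\
  if k is m.+1 then
    forall i, (forall x, derivable f x (delta_mx ord0 i)) /\ Ck m (partial i f)
  else True.

Definition Ck_torus k f := periodic f /\ Ck k f.

Definition test_function phi := forall k, Ck_torus k phi.

Definition is_weak_partials s f g :=
  [/\ periodic f, periodic g, f \in Lfun dx 1%:E, g \in Lfun dx 1%:E &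
   forall phi, test_function phi ->
     \int[dx]_x (f x * partials s phi x) =
     (-1) ^+ size s * \int[dx]_x (g x * phi x)].

(* Unique up to a null set when it exists; 0 by convention otherwise. *)
Definition weak_partials s f : 'rV[R]_d -> R :=
  xget (fun=> 0) [set g | is_weak_partials s f g].

Definition sobolev (k : nat) (p : \bar R) : set ('rV[R]_d -> R) :=
  [set f | forall s, (size s <= k)%N ->
    exists2 g, is_weak_partials s f g & g \in Lfun dx p].

Definition weak_laplacian f x := \sum_i weak_partials [:: i; i] f x.

Definition Linfty_norm f : R := fine 'N[dx]_+oo[EFin \o f].

Definition Pac : set ('rV[R]_d -> R) :=
  [set f | [/\ f \in Lfun dx 1%:E, {ae dx, forall x, 0 <= f x} &
              \int[dx]_x f x = 1]].

Definition C2norm f : \bar R :=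
  ereal_sup [set z | exists s x, (size s <= 2)%N /\ z = `|partials s f x|%:E].

(* [C^1(0, oo; C^2)] *)
Definition C1_C2 (u : R -> 'rV[R]_d -> R) := exists u' : R -> 'rV[R]_d -> R,
  forall t, 0 < t ->
  [/\ Ck_torus 2 (u t), Ck_torus 2 (u' t),
      C2norm (fun x => h^-1 * (u (t + h) x - u t x) - u' t x) @[h --> 0^'] --> 0%E &
      C2norm (fun x => u' r x - u' t x) @[r --> t] --> 0%E].

Section equation.
Context {dO : measure_display} {Omega : measurableType dO}
  (mu : {measure set Omega -> \bar R})
  (A : (Omega -> R) -> (Omega -> R)).
Implicit Types (D : 'rV[R]_d -> R)
  (rho : R -> 'rV[R]_d -> Omega -> R).

Definition interaction D rho t x xi (i : 'I_d) : R :=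
  \int[dx]_y (weak_partials [:: i] D (x - y) * A (rho t y) xi).

Definition solves_at kappa D rho t x xi :=
  derive1 (fun r => rho r x xi) t =
    kappa * \sum_i partial i (fun z => rho t z xi * interaction D rho t z xi i) x
    + \sum_i partials [:: i; i] (fun z => rho t z xi) x.

Definition admissible (rho0 : 'rV[R]_d -> Omega -> R) :=
  [/\ forall xi, periodic (rho0 ^~ xi),
      {ae mu, forall xi, sobolev (3 + d)%N 2%:E (rho0 ^~ xi) /\ Pac (rho0 ^~ xi)} &
      forall x, rho0 x \in Lfun mu +oo].

(* The second clause says that [A] acts on [rho t x] within L^2(Omega, mu), the
   third that the convolution integral defining [interaction] makes sense; the
   initial datum is attained in L^2 of the torus for almost every [xi]. *)
Definition classical_solution kappa D (rho0 : 'rV[R]_d -> Omega -> R) rho :=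
  [/\ forall t xi, 0 <= t -> periodic (rho t ^~ xi),
      forall t x, 0 < t -> rho t x \in Lfun mu 2%:E,
      {ae mu, forall xi, forall t, 0 < t ->
        (fun y => A (rho t y) xi) \in Lfun dx 1%:E},
      {ae mu, forall xi, C1_C2 (fun t => rho t ^~ xi) /\
        forall t x, 0 < t -> solves_at kappa D rho t x xi} &
      rho 0 = rho0 /\
      {ae mu, forall xi,
        ('N[dx]_2%:E[EFin \o (fun x => rho t x xi - rho0 x xi)%R])%E
          @[t --> 0^'+] --> 0%E}].

Definition rho_infty : R := L ^- d.

Definition entropy (f : 'rV[R]_d -> Omega -> R) : \bar R :=
  (\int[mu]_xi \int[dx]_x (f x xi * ln (f x xi / rho_infty))%:E)%E.

End equation.
End torus.

(* Main.v *)
Require Import Defs.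
From HB Require Import structures.
From mathcomp Require Import all_boot all_order all_algebra.
From mathcomp Require Import ring lra.
From mathcomp Require Import all_classical all_reals all_analysis.
From mathcomp Require Import measurable_realfun.

Set Implicit Arguments.
Unset Strict Implicit.
Unset Printing Implicit Defensive.

Import Order.TTheory GRing.Theory Num.Theory.
Import numFieldNormedType.Exports.
Local Open Scope classical_set_scope.
Local Open Scope ring_scope.
Local Notation periodic := Defs.periodic.

(* For almost every [xi] the slice [u = rho(., ., xi)] solves a linear equation
   [u' = kappa div (u V) + Lap u] with [V = grad D * w] and [w = A rho]. Testing
   with [sign u] and using the initial condition shows that [u >= 0] has mass 1.
   The entropy [H] of [u] relative to [m = L^-d] satisfies
     [H' <= - Fisher(u) + kappa \int (u - m) (Lap D * (w - m))]
        [<= - 4 pi^2 / L^2 H + kappa |Lap D|_oo |u - m|_1 |w - m|_1]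
   by the logarithmic Sobolev inequality; since [u] may vanish, this is obtained
   as the limit of the same estimate for [(u + e) ln ((u + e) / (m + e))].
   Now integrate in [xi]. The norm [|w - m|_1] is at most the average of
   [|rho(., ., eta) - m|_1] over the equator of [xi], and averaging over equators
   preserves [mu] (Archimedes' hat-box theorem), hence contracts [L^2(mu)]. With
   Pinsker's inequality [|u - m|_1 ^ 2 <= 2 H] the interaction term is at most
   [2 kappa |Lap D|_oo] times the mean entropy, and Gronwall's lemma applies. *)

(** * Integration over the torus *)

(** The logarithmic Sobolev constant proved here is twice the optimal one of the torus. This slack
    is what admits a proof by one-variable calculus, and the factor [4 * pi ^ 2 / L ^ 2] is exactly
    what the rate of the statement asks for. The loss [2 * kappa * M] is [kappa * M] times the
    constant 2 of Pinsker's inequality. Three obstacles shape the rest. The equation holds for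
    almost every [xi], whereas [A rho] at a good [xi] reads [rho] along an equator, itself a null
    set: the bad set has to be shown null on almost every equator. The initial datum is attained in
    L^2 only, so continuity of the entropy at time 0 is out of reach: the entropy at time [s] is
    bounded by its initial value plus a multiple of [s], Gronwall's lemma starts at [s > 0], and [s]
    tends to 0. Finally, measurability in [(x, xi)] jointly is recovered from continuity in [x], and
    integrands not known to be measurable in [xi] are compared with measurable bounds off a null
    set. *)

Section restriction.
Context d (T : measurableType d) (R : realType)
  (mu : {measure set T -> \bar R}) (D : set T) (mD : measurable D).
Local Open Scope ereal_scope.

Lemma ge0_integral_mrestr (f : T -> \bar R) :
  measurable_fun setT f -> (forall x, 0 <= f x) ->
  \int[mrestr mu mD]_x f x = \int[mu]_(x in D) f x.
Proof.
move=> mf f0; rewrite -[in LHS](setUv D) ge0_integral_setU//=.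
- rewrite [X in _ + X](_ : _ = 0) ?adde0.
    apply: eq_measure_integral => A mA AD.
    by rewrite /= /mrestr setIidl.
  rewrite (eq_measure_integral mzero) ?integral_measure_zero//.
  move=> A mA AD; rewrite /= /mrestr /mzero (_ : A `&` D = set0) ?measure0//.
  by apply/seteqP; split => // x [Ax Dx]; exact: (AD _ Ax).
- exact: measurableC.
- by rewrite setUv.
- by apply/disj_setPCl.
Qed.

End restriction.

Section cons_rV.
Context {R : realType}.

Lemma cons_rV_head n (p : R * 'rV[R]_n) : cons_rV p ord0 ord0 = p.1.
Proof.
have := row_mxEl (const_mx p.1 : 'rV_1) p.2 ord0 ord0; rewrite [RHS]mxE => <-.
by congr (fun_of_matrix _ _ _); exact/val_inj.
Qed.

Lemma cons_rV_tail n (p : R * 'rV[R]_n) i :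
  cons_rV p ord0 (lift ord0 i) = p.2 ord0 i.
Proof.
rewrite -(row_mxEr (const_mx p.1 : 'rV_1) p.2 ord0 i).
by congr (fun_of_matrix _ _ _); exact/val_inj.
Qed.

Lemma cons_rVD n (s s' : R) (v v' : 'rV[R]_n) :
  cons_rV (s + s', v + v') = cons_rV (s, v) + cons_rV (s', v').
Proof.
apply/rowP => i; rewrite [RHS]mxE; have [j ->|->] := unliftP ord0 i.
  by rewrite !cons_rV_tail/= mxE.
by rewrite !cons_rV_head.
Qed.

Lemma cons_rVN n (s : R) (v : 'rV[R]_n) : cons_rV (- s, - v) = - cons_rV (s, v).
Proof.
apply/rowP => i; rewrite [RHS]mxE; have [j ->|->] := unliftP ord0 i.
  by rewrite !cons_rV_tail/= mxE.
by rewrite !cons_rV_head.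
Qed.

Lemma cons_rV_eta n (x : 'rV[R]_n.+1) :
  x = cons_rV (x ord0 ord0, \row_i x ord0 (lift ord0 i)).
Proof.
apply/rowP => i; have [j ->|->] := unliftP ord0 i.
  by rewrite !cons_rV_tail/= mxE.
by rewrite !cons_rV_head.
Qed.

Lemma cons_rV_delta0 n (k : R) :
  cons_rV (k, 0 : 'rV[R]_n) = k *: delta_mx ord0 ord0.
Proof.
apply/rowP => i; have [j ->|->] := unliftP ord0 i.
  by rewrite !cons_rV_tail/= !mxE mulr0.
by rewrite !cons_rV_head/= !mxE/= mulr1.
Qed.

Lemma cons_rV_delta n (k : R) (j : 'I_n) :
  cons_rV (0, k *: delta_mx ord0 j) = k *: delta_mx ord0 (lift ord0 j).
Proof.
apply/rowP => i; have [l ->|->] := unliftP ord0 i.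
  by rewrite !cons_rV_tail/= !mxE (inj_eq lift_inj).
by rewrite !cons_rV_head/= !mxE/= mulr0.
Qed.

End cons_rV.

Section torus_measure.
Context {R : realType} (L : R).
Local Notation leb := (@lebesgue_measure R).
Local Open Scope ereal_scope.

Lemma cons_rV_cell n :
  @cons_rV R n @^-1` cell L = `[(- (L / 2))%R, (L / 2)%R]%classic `*` cell L.
Proof.
apply/seteqP; split => -[s v] /=.
  move=> h; split => /=.
    by have := h ord0; rewrite cons_rV_head/= in_itv.
  by move=> i; have := h (lift ord0 i); rewrite cons_rV_tail.
move=> [] /=; rewrite in_itv/= => hs hv i; have [j ->|->] := unliftP ord0 i.
  by rewrite cons_rV_tail.
by rewrite cons_rV_head.
Qed.

Lemma ge0_integral_dx n (F : 'rV[R]_n -> \bar R) :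
  measurable_fun setT F -> (forall x, 0 <= F x) ->
  \int[dx L]_x F x = \int[lebesgue_rV (n:=n)]_(x in cell L) F x.
Proof. by move=> mF F0; exact: ge0_integral_mrestr. Qed.

(** Tonelli along the recursion that defines [lebesgue_rV]: the first coordinate is split off. The
    inductions on the dimension below rest on it. *)
Lemma ge0_integral_dxS n (F : 'rV[R]_n.+1 -> \bar R) :
  measurable_fun setT F -> (forall x, 0 <= F x) ->
  \int[dx L]_x F x =
  \int[leb]_(s in `[(- (L / 2))%R, (L / 2)%R]) \int[dx L]_v F (cons_rV (s, v)).
Proof.
move=> mF F0; rewrite ge0_integral_dx// integral_mkcond.
have mc := @measurable_cons_rV R n.
have mFc : measurable_fun setT (F \_ (cell L)).
  apply/(measurable_restrictT _ _).1 => //; first exact: measurable_cell.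
  exact: measurable_funTS.
have -> : \int[lebesgue_rV (n:=n.+1)]_x (F \_ (cell L)) x =
   \int[pushforward (leb \x lebesgue_rV (n:=n)) (@cons_rV R n)]_x (F \_ (cell L)) x by [].
rewrite ge0_integral_pushforward//; last first.
  by move=> x _; rewrite /patch; case: ifP.
rewrite preimage_setT fubini_tonelli1/=; [|exact: measurableT_comp|by move=> x; rewrite /= /patch; case: ifP].
rewrite [RHS]integral_mkcond; apply: eq_integral => s _.
rewrite /fubini_F /= [RHS]patchE; have E v : (F \_ (cell L)) (cons_rV (s, v)) =
   if s \in `[(- (L / 2))%R, (L / 2)%R]%classic then ((fun v => F (cons_rV (s, v))) \_ (cell L)) v else 0.
  rewrite !patchE; have := congr1 (fun S => S (s, v)) (cons_rV_cell n) => /= h.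
  have -> : (cons_rV (s, v) \in cell L) = (s \in `[(- (L / 2))%R, (L / 2)%R]%classic) && (v \in cell L).
    apply/idP/andP; rewrite !inE; first by rewrite h => -[].
    by move=> [? ?]; rewrite h.
  by case: (s \in _); case: (v \in _).
case: ifP => sL.
  rewrite ge0_integral_dx//; last first.
    by apply: (measurableT_comp mF); apply: (measurableT_comp mc); exact: pair1_measurable.
  by rewrite [RHS]integral_mkcond; apply: eq_integral => v _; rewrite E sL.
by under eq_integral do rewrite E sL; rewrite integral0.
Qed.

Lemma dx_setTS n : dx L [set: 'rV[R]_n.+1] =
  dx L [set: 'rV[R]_n] * leb `[(- (L / 2))%R, (L / 2)%R].
Proof.
rewrite -[LHS]mul1e -integral_cst// ge0_integral_dxS//.
under eq_integral do rewrite integral_cst// mul1e.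
by rewrite integral_cst.
Qed.

Lemma dx_setT n : (0 <= L)%R -> dx L [set: 'rV[R]_n] = (L ^+ n)%:E.
Proof.
move=> L0; elim: n => [|n IH]; last first.
  rewrite dx_setTS IH lebesgue_measure_itv/= lte_fin; case: ifPn => h.
    by rewrite -EFinD -EFinM opprK -splitr exprSr.
  have -> : L = 0%R by apply/eqP; rewrite eq_le L0 andbT; move: h; rewrite -leNgt; lra.
  by rewrite mule0 expr0n.
rewrite /dx /mrestr/= setTI diracE mem_set// => -[]//.
Qed.

(** The instance of finite measure that follows cannot carry a proof of [0 <= L]; finiteness is
    therefore obtained by induction on [n], one finite interval at a time. *)
Lemma dx_fin n : fin_num_fun (dx L : set 'rV[R]_n -> \bar R).
Proof.
have H : dx L [set: 'rV[R]_n] \is a fin_num.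
  elim: n => [|n IH].
    rewrite /dx /mrestr/= setTI diracE mem_set// => -[]//.
  by rewrite dx_setTS fin_numM// lebesgue_measure_itv/=; case: ifP.
move=> A mA; rewrite ge0_fin_numE//.
apply: (@le_lt_trans _ _ (dx L [set: 'rV[R]_n])); last first.
  by rewrite -ge0_fin_numE.
by apply: le_measure => //; rewrite inE.
Qed.

HB.instance Definition _ n := Measure_isFinite.Build _ _ _
  (dx L : set 'rV[R]_n -> \bar R) (@dx_fin n).

End torus_measure.

(** * Translation and reflection invariance of integrals of periodic functions *)

Section periodic1.
Context {R : realType} (L : R).
Hypothesis L0 : (0 < L)%R.
Local Notation leb := (@lebesgue_measure R).
Local Open Scope ereal_scope.
Implicit Type G : R -> \bar R.

Lemma lebesgue_measure_shift (a : R) (A : set R) : measurable A ->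
  pushforward leb (fun x : measurableTypeR R => (x + a)%R : measurableTypeR R) A = leb A.
Proof.
have ma : measurable_fun setT (fun x : measurableTypeR R => (x + a)%R : measurableTypeR R).
  exact: measurable_funD.
move=> mA; apply/esym/lebesgue_measure_unique => //= _ [[b c]] _ <-.
rewrite /pushforward/= [X in _ = leb X](_ : _ = `](b - a)%R, (c - a)%R]%classic); last first.
  by apply/seteqP; split => x /=; rewrite !in_itv/= ltrBlDr lerBrDr.
by rewrite !lebesgue_measure_itv/= !lte_fin ltrD2r; case: ifP => // _; rewrite -!EFinD; congr EFin; ring.
Qed.

Lemma ge0_integral_shift (a b c : R) G :
  measurable_fun setT G -> (forall x, 0 <= G x) ->
  \int[leb]_(x in `[b, c]) G (x + a)%R = \int[leb]_(x in `[(b + a)%R, (c + a)%R]) G x.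
Proof.
move=> mG G0.
have ma : measurable_fun setT (fun x : measurableTypeR R => (x + a)%R : measurableTypeR R).
  exact: measurable_funD.
transitivity (\int[pushforward leb (fun x : measurableTypeR R => (x + a)%R : measurableTypeR R)]_(x in `[(b + a)%R, (c + a)%R]) G x).
  rewrite ge0_integral_pushforward//=; last exact: measurable_funTS.
  congr (integral _ _ _); apply/seteqP; split => x /=; rewrite !in_itv/= !lerD2r//.
by apply: eq_measure_integral => A mA _; exact: lebesgue_measure_shift.
Qed.

Lemma ge0_integral_reflect (b : R) G :
  measurable_fun setT G -> (forall x, 0 <= G x) ->
  \int[leb]_(x in `[(- b)%R, b]) G (- x)%R = \int[leb]_(x in `[(- b)%R, b]) G x.
Proof.
move=> mG G0.
transitivity (\int[pushforward leb (-%R : _ -> measurableTypeR R)]_(x in `[(- b)%R, b]) G x).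
  rewrite ge0_integral_pushforward//=; last exact: measurable_funTS.
  congr (integral _ _ _); apply/seteqP; split => x /=; rewrite !in_itv/= => /andP[? ?]; apply/andP; split; lra.
by apply: eq_measure_integral => A mA _; exact: lebesgue_measureN.
Qed.

Lemma ge0_integral_cat (a b c : R) G : (a <= b)%R -> (b <= c)%R ->
  measurable_fun setT G -> (forall x, 0 <= G x) ->
  \int[leb]_(x in `[a, c]) G x =
  \int[leb]_(x in `[a, b]) G x + \int[leb]_(x in `[b, c]) G x.
Proof.
move=> ab bc mG G0; rewrite (@itv_bndbnd_setU _ _ _ (BRight b))//= ?bnd_simp//.
rewrite ge0_integral_setU//=.
- by rewrite integral_itv_obnd_cbnd//; exact: measurable_funTS.
- exact: measurable_funTS.
- apply/disj_setPS => x []/=; rewrite !in_itv/= => /andP[_ +] /andP[+ _].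
  by move=> h1 /(le_lt_trans h1); rewrite ltxx.
Qed.

(** The shifted interval sticks out by [[L / 2, L / 2 + a]]; moved back by one period, this piece
    fills the gap at the left end. The bound [a <= L] keeps [L / 2] inside the shifted interval. *)
Let ge0_integral_periodic_small (a : R) G :
  measurable_fun setT G -> (forall x, 0 <= G x) -> (forall x, G (x + L)%R = G x) ->
  (0 <= a <= L)%R ->
  \int[leb]_(x in `[(- (L / 2))%R, (L / 2)%R]) G (x + a)%R =
  \int[leb]_(x in `[(- (L / 2))%R, (L / 2)%R]) G x.
Proof.
move=> mG G0 pG /andP[a0 aL]; rewrite ge0_integral_shift//.
rewrite (@ge0_integral_cat _ (L / 2)%R)//; [|lra|lra].
rewrite addeC (_ : `[(L / 2)%R, (L / 2 + a)%R]%classic = `[(- (L / 2) + L)%R, (- (L / 2) + a + L)%R]%classic); last first.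
  by rewrite addrAC (_ : - (L / 2) + L = L / 2)%R//; lra.
rewrite -ge0_integral_shift//; under eq_integral do rewrite pG.
by rewrite -ge0_integral_cat//; lra.
Qed.

Lemma ge0_integral_periodic1 (a : R) G :
  measurable_fun setT G -> (forall x, 0 <= G x) -> (forall x, G (x + L)%R = G x) ->
  \int[leb]_(x in `[(- (L / 2))%R, (L / 2)%R]) G (x + a)%R =
  \int[leb]_(x in `[(- (L / 2))%R, (L / 2)%R]) G x.
Proof.
wlog a0 : a G / (0 <= a)%R.
  move=> H mG G0 pG; have [/H|a0] := leP 0%R a; first exact.
  rewrite -(H (- a)%R (fun x => G (x + a)%R))//.
  - by apply: eq_integral => x _; rewrite subrK.
  - lra.
  - by apply: measurableT_comp => //; exact: measurable_funD.
  - by move=> x; rewrite addrAC pG.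
move=> mG G0 pG.
(* The shift is cut into [n + 1] equal shifts of at most one period each. *)
have [n nP] : exists n : nat, (a <= n.+1%:R * L)%R.
  exists (Num.bound (a / L)); rewrite -ler_pdivrMr// ltW//.
  by rewrite (lt_le_trans (archi_boundP (divr_ge0 a0 (ltW L0))))// ler_nat.
have step k : \int[leb]_(x in `[(- (L / 2))%R, (L / 2)%R]) G (x + k%:R * (a / n.+1%:R))%R =
  \int[leb]_(x in `[(- (L / 2))%R, (L / 2)%R]) G x.
  elim: k => [|k IH]; first by under eq_integral do rewrite mul0r addr0.
  rewrite -IH -[RHS](@ge0_integral_periodic_small (a / n.+1%:R)%R (fun x => G (x + k%:R * (a / n.+1%:R))%R))//.
  - apply: eq_integral => x _; congr G; rewrite -natr1; ring.
  - by apply: measurableT_comp => //; exact: measurable_funD.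
  - by move=> x; rewrite addrAC pG.
  - by rewrite divr_ge0//= ler_pdivrMr// mulrC.
by rewrite -[RHS](step n.+1); apply: eq_integral => x _; rewrite mulrC divfK.
Qed.

End periodic1.

Section periodic_rV.
Context {R : realType} (L : R).
Hypothesis L0 : (0 < L)%R.
Local Notation leb := (@lebesgue_measure R).
Local Open Scope ereal_scope.

Definition periodice n (F : 'rV[R]_n -> \bar R) :=
  forall x i, F (x + L *: delta_mx ord0 i)%R = F x.

Lemma measurable_rVD n (a : 'rV[R]_n) :
  measurable_fun setT (fun x : 'rV[R]_n => (x + a)%R).
Proof.
apply/measurable_fun_rVP => i.
rewrite (_ : (fun _ => _) = fun x : 'rV[R]_n => (x ord0 i + a ord0 i)%R).
  by apply: measurable_funD => //; exact: measurable_coord.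
by apply/funext => x; rewrite mxE.
Qed.

Lemma measurable_rVN n : measurable_fun setT (fun x : 'rV[R]_n => (- x)%R).
Proof.
apply/measurable_fun_rVP => i.
rewrite (_ : (fun _ => _) = fun x : 'rV[R]_n => (- x ord0 i)%R).
  by apply: measurableT_comp => //; exact: measurable_coord.
by apply/funext => x; rewrite mxE.
Qed.

Lemma measurable_cons_pair n s : measurable_fun setT (fun v : 'rV[R]_n => cons_rV (s, v)).
Proof. by apply: (measurableT_comp (@measurable_cons_rV R n)); exact: pair1_measurable. Qed.

Lemma measurable_fun_dx_slice n (F : 'rV[R]_n.+1 -> \bar R) :
  measurable_fun setT F -> (forall x, 0 <= F x) ->
  measurable_fun setT (fun s : R => \int[dx L]_v F (cons_rV (s, v))).
Proof.
move=> mF F0.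
apply: (@measurable_fun_fubini_tonelli_F _ _ _ _ _ (dx L) (F \o @cons_rV R n)) => /=.
  by apply: measurableT_comp => //; exact: measurable_cons_rV.
by move=> [s v] /=.
Qed.

Lemma periodice_tail n (F : 'rV[R]_n.+1 -> \bar R) s :
  periodice F -> periodice (fun v => F (cons_rV (s, v))).
Proof.
move=> pF v i; rewrite -[X in F (cons_rV (X, _))]addr0 cons_rVD cons_rV_delta.
exact: pF.
Qed.

Lemma periodice_head n (F : 'rV[R]_n.+1 -> \bar R) s v :
  periodice F -> F (cons_rV (s + L, v)%R) = F (cons_rV (s, v)).
Proof.
move=> pF; rewrite -[X in F (cons_rV (_, X))]addr0 cons_rVD cons_rV_delta0.
exact: pF.
Qed.

(** Induction on the dimension: one-variable periodicity moves the first coordinate, the induction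
    hypothesis the others, since slices of a periodic function are periodic. *)
Lemma ge0_integral_translate n (a : 'rV[R]_n) (F : 'rV[R]_n -> \bar R) :
  measurable_fun setT F -> (forall x, 0 <= F x) -> periodice F ->
  \int[dx L]_x F (x + a)%R = \int[dx L]_x F x.
Proof.
elim: n a F => [|n IH] a F mF F0 pF.
  by apply: eq_integral => x _; congr F; rewrite [x]thinmx0 [a]thinmx0 addr0.
have mFa : measurable_fun setT (fun x : 'rV[R]_n.+1 => F (x + a)%R).
  by apply: measurableT_comp => //; exact: measurable_rVD.
rewrite (ge0_integral_dxS L mF F0) (ge0_integral_dxS L mFa (fun x => F0 _)).
have mG := measurable_fun_dx_slice mF F0.
have G0 s : 0 <= \int[dx L]_v F (cons_rV (s, v)) by exact: integral_ge0.
have pG s : \int[dx L]_v F (cons_rV (s + L, v))%R = \int[dx L]_v F (cons_rV (s, v)).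
  by apply: eq_integral => v _; exact: periodice_head.
apply: etrans (ge0_integral_periodic1 L0 (a ord0 ord0) mG G0 pG).
apply: eq_integral => s _.
apply: etrans (IH (\row_i a ord0 (lift ord0 i)) (fun v => F (cons_rV (s + a ord0 ord0, v))%R) _ _ _) => //.
- by apply: eq_integral => v _; rewrite cons_rVD -cons_rV_eta.
- by apply: measurableT_comp => //; exact: measurable_cons_pair.
- exact: periodice_tail.
Qed.

Lemma ge0_integral_opp n (F : 'rV[R]_n -> \bar R) :
  measurable_fun setT F -> (forall x, 0 <= F x) ->
  \int[dx L]_x F (- x)%R = \int[dx L]_x F x.
Proof.
elim: n F => [|n IH] F mF F0.
  by apply: eq_integral => x _; congr F; rewrite [x]thinmx0 oppr0.
have mFa : measurable_fun setT (fun x : 'rV[R]_n.+1 => F (- x)%R).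
  by apply: measurableT_comp => //; exact: measurable_rVN.
rewrite (ge0_integral_dxS L mF F0) (ge0_integral_dxS L mFa (fun x => F0 _)).
have mG := measurable_fun_dx_slice mF F0.
have G0 s : 0 <= \int[dx L]_v F (cons_rV (s, v)) by exact: integral_ge0.
apply: etrans (ge0_integral_reflect (L / 2) mG G0).
apply: eq_integral => s _.
apply: etrans (IH (fun v => F (cons_rV (- s, v))%R) _ _) => //.
- by apply: eq_integral => v _; rewrite cons_rVN.
- by apply: measurableT_comp => //; exact: measurable_cons_pair.
Qed.

Lemma integral_translate n (a : 'rV[R]_n) (F : 'rV[R]_n -> \bar R) :
  measurable_fun setT F -> periodice F ->
  \int[dx L]_x F (x + a)%R = \int[dx L]_x F x.
Proof.
move=> mF pF; rewrite integralE [RHS]integralE; congr (_ - _).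
- rewrite -[RHS](@ge0_integral_translate _ a F^\+)//.
  + by apply: eq_integral => x _; rewrite /= !funeposE.
  + exact: measurable_funepos.
  + by move=> x i; rewrite !funeposE pF.
- rewrite -[RHS](@ge0_integral_translate _ a F^\-)//.
  + by apply: eq_integral => x _; rewrite /= !funenegE.
  + exact: measurable_funeneg.
  + by move=> x i; rewrite !funenegE pF.
Qed.

Lemma integral_opp n (F : 'rV[R]_n -> \bar R) : measurable_fun setT F ->
  \int[dx L]_x F (- x)%R = \int[dx L]_x F x.
Proof.
move=> mF; rewrite integralE [RHS]integralE; congr (_ - _).
- rewrite -[RHS](@ge0_integral_opp _ F^\+)//; last exact: measurable_funepos.
  by apply: eq_integral => x _; rewrite /= !funeposE.
- rewrite -[RHS](@ge0_integral_opp _ F^\-)//; last exact: measurable_funeneg.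
  by apply: eq_integral => x _; rewrite /= !funenegE.
Qed.

Lemma integral_reflect n (a : 'rV[R]_n) (F : 'rV[R]_n -> \bar R) :
  measurable_fun setT F -> periodice F ->
  \int[dx L]_x F (a - x)%R = \int[dx L]_x F x.
Proof.
move=> mF pF; rewrite -(@integral_translate _ a F)// -[RHS]integral_opp.
  by apply: eq_integral => x _; rewrite addrC.
by apply: measurableT_comp => //; exact: measurable_rVD.
Qed.

(** Opposite faces of the cell are the same points of the torus. As faces are null, the half-open
    [hcell] can replace [cell] in almost-everywhere statements. *)
Lemma dx_face n (i : 'I_n) (c : R) : dx L [set x : 'rV[R]_n | x ord0 i = c] = 0.
Proof.
have mf m (j : 'I_m) : measurable [set x : 'rV[R]_m | x ord0 j = c].
  rewrite (_ : [set x | _] = (fun x : 'rV[R]_m => x ord0 j) @^-1` [set c])//.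
  by rewrite -[X in measurable X]setTI; apply: measurable_coord => //; exact: measurable_set1.
elim: n i => [[]//|n IH] i.
rewrite (_ : dx L _ = \int[dx L]_x (\1_[set x : 'rV[R]_n.+1 | x ord0 i = c] x : R)%:E); last first.
  by have := integral_indic (dx L) measurableT (mf _ i); rewrite setIT.
have mE : measurable_fun setT (fun x : 'rV[R]_n.+1 => (\1_[set x : 'rV[R]_n.+1 | x ord0 i = c] x : R)%:E).
  have mI := @measurable_indic _ _ R setT _ (mf _ i).
  exact: (measurableT_comp (@EFin_measurable R setT) mI).
rewrite (ge0_integral_dxS L mE)//.
have [j ->|->] := unliftP ord0 i.
  rewrite (eq_integral (cst 0)) ?integral0// => s _.
  rewrite (_ : cst 0 s = dx L [set x : 'rV[R]_n | x ord0 j = c]); last by rewrite IH.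
  rewrite -[in RHS](setIT [set x : 'rV[R]_n | _]) -integral_indic//; last exact: mf.
  apply: eq_integral => v _; rewrite /= !indicE; congr ((nat_of_bool _)%:R%:E).
  by apply/idP/idP; rewrite !inE/= cons_rV_tail.
have E s : \int[dx L]_v (\1_[set x : 'rV[R]_n.+1 | x ord0 ord0 = c] (cons_rV (s, v)) : R)%:E =
    (\1_[set c] s)%:E * dx L [set: 'rV[R]_n].
  rewrite -integral_cst//; apply: eq_integral => v _; rewrite !indicE; congr ((nat_of_bool _)%:R%:E).
  by apply/idP/idP; rewrite !inE/= cons_rV_head.
under eq_integral do rewrite E.
rewrite ge0_integralZr//=; last exact/measurable_EFinP/measurable_indic.
rewrite integral_indic//= (_ : leb _ = 0) ?mul0e//.
apply/eqP; rewrite -measure_le0 -(lebesgue_measure_set1 c).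
by apply: le_measure; rewrite ?inE//; exact: measurableI.
Qed.

End periodic_rV.

(** * Continuity, measurability and compactness for row vectors *)

Section rV_topology.
Context {R : realType}.

Lemma cvg_rV {T : Type} (F : set_system T) {FF : Filter F} n (x_ : T -> 'rV[R]_n) (x : 'rV[R]_n) :
  (forall i, x_ t ord0 i @[t --> F] --> x ord0 i) -> x_ t @[t --> F] --> x.
Proof.
move=> h; apply/cvg_ballP => e e0.
have : \forall t \near F, forall i, ball (x ord0 i) e (x_ t ord0 i).
  apply: filter_forall => i.
  by have /cvg_ballP/(_ _ e0) := h i.
apply: filterS => t ht; split => // i j.
by rewrite (ord1 i); exact: ht.
Qed.

(** The point of the lattice of mesh [1 / (k + 1)] just below [x] in each coordinate; it takes
    countably many values. *)
Let grid n k (x : 'rV[R]_n) : 'rV[R]_n :=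
  \row_i ((Num.floor (k.+1%:R * x ord0 i))%:~R / k.+1%:R).

Let grid_cvg n (x : 'rV[R]_n) : grid k x @[k --> \oo] --> x.
Proof.
apply: cvg_rV => i; apply/cvgrPdist_le => e e0.
near=> k; rewrite mxE.
have k0 : 0 < k.+1%:R :> R by [].
rewrite -(ler_pM2l k0) -{1}(gtr0_norm k0) -normrM mulrBr mulrCA divff ?gt_eqF// mulr1.
have /andP[h1 h2] := floor_itv (k.+1%:R * x ord0 i).
rewrite ger0_norm ?subr_ge0//; apply: (@le_trans _ _ 1).
  by rewrite lerBlDr ltW// addrC -[X in _ + X]/(1%:~R) -intrD.
rewrite -ler_pdivrMr//; near: k.
exists (Num.bound (1 / e)) => // k /= ek.
apply: (le_trans (ltW (archi_boundP (divr_ge0 ler01 (ltW e0))))).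
by rewrite ler_nat leqW.
Unshelve. all: end_near. Qed.

(** With [x] rounded by [grid k], the function is constant in [x] on each of countably many boxes,
    hence measurable; continuity in [x] makes [F] the pointwise limit of these. It supplies the
    joint measurability of the slices. *)
Lemma measurable_caratheodory d (T : measurableType d) n (F : 'rV[R]_n -> T -> R) :
  (forall w, continuous (F ^~ w)) -> (forall x, measurable_fun setT (F x)) ->
  measurable_fun setT (fun p : 'rV[R]_n * T => F p.1 p.2).
Proof.
move=> cF mF.
apply: (@measurable_fun_cvg _ _ _ _ (fun k p => F (grid k p.1) p.2)) => [k|[x w] _ /=]; last first.
  exact: (cvg_comp _ _ (@grid_cvg n x) (cF w x)).
move=> _ Y mY; rewrite setTI.
pose G (m : 'rV[int]_n) : 'rV[R]_n := \row_i ((m ord0 i)%:~R / k.+1%:R).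
pose B (m : 'rV[int]_n) := [set x : 'rV[R]_n | forall i, Num.floor (k.+1%:R * x ord0 i) = m ord0 i].
rewrite [X in measurable X](_ : _ = \bigcup_(m : 'rV[int]_n) (B m `*` (F (G m) @^-1` Y))); last first.
  apply/seteqP; split => [[x w] /= h|[x w] [m _ []/= h1 h2]].
    exists (\row_i Num.floor (k.+1%:R * x ord0 i)) => //; split => /=.
      by move=> i; rewrite mxE.
    by rewrite (_ : G _ = grid k x)//; apply/rowP => i; rewrite !mxE.
  by rewrite (_ : grid k x = G m)//; apply/rowP => i; rewrite !mxE h1.
apply: countable_bigcupT_measurable => [|m]; first exact: countableP.
apply: measurableX; last first.
  by rewrite -[X in measurable X]setTI; exact: mF.
rewrite (_ : B m = \bigcap_(i in [set: 'I_n])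
    (fun x : 'rV[R]_n => x ord0 i) @^-1` `[(m ord0 i)%:~R / k.+1%:R, (m ord0 i + 1)%:~R / k.+1%:R[); last first.
  have k0 : 0 < k.+1%:R :> R by [].
  apply/seteqP; split => x /= h i; have := h i.
    by move/eqP; rewrite floor_eq => h' _; rewrite /= in_itv/= ler_pdivrMr// ltr_pdivlMr// ![_ * k.+1%:R]mulrC.
  by rewrite /= in_itv/= ler_pdivrMr// ltr_pdivlMr// ![_ * k.+1%:R]mulrC => /(_ I) h'; apply/eqP; rewrite floor_eq.
apply: fin_bigcap_measurable => // i _.
rewrite -[X in measurable X]setTI; exact: measurable_coord.
Qed.

(** The sigma-algebra on row vectors is defined by the coordinates rather than by open sets, so this
    is again an approximation on grids, with [unit] as parameter space. *)
Lemma continuous_measurable_rV n (f : 'rV[R]_n -> R) : continuous f -> measurable_fun setT f.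
Proof.
move=> cf.
have mf : measurable_fun setT (fun p : 'rV[R]_n * unit => f p.1).
  exact: (@measurable_caratheodory _ unit n (fun x _ => f x)).
rewrite (_ : f = (fun p : 'rV[R]_n * unit => f p.1) \o (pair ^~ tt))//.
by apply: measurableT_comp => //; exact: pair2_measurable.
Qed.

Lemma continuous_bounded_box n (f : 'rV[R]_n -> R) (K : R) : continuous f ->
  exists C, forall x : 'rV[R]_n, (forall i : 'I_n, `|x ord0 i| <= K) -> `|f x| <= C.
Proof.
move=> cf; pose A : set 'rV[R]_n := [set x | forall i, `|x ord0 i| <= K].
have [A0|/set0P/negP] := pselect (A !=set0); last first.
  by rewrite negbK => /eqP A0; exists 0 => x Ax; have : A x by []; rewrite A0.
have cA : compact A.
  rewrite (_ : A = [set v | forall i, `[- K, K]%classic (v ord0 i)]); last first.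
    by apply/seteqP; split => x /= h i; have := h i; rewrite in_itv/= ler_norml.
  by apply: (@rV_compact R n (fun=> `[- K, K]%classic)) => i; exact: segment_compact.
have cf' : {within A, continuous (fun x => `|f x|)}.
  by apply: continuous_subspaceT => x; apply: continuous_comp; [exact: cf|exact: norm_continuous].
have [c Ac hc] := EVT_max_rV A0 cA cf'.
by exists `|f c| => x Ax; apply: hc; rewrite inE.
Qed.

End rV_topology.

Notation intg mu f := (mu.-integrable setT (EFin \o f)) (only parsing).

Section real_integral.
Context d (T : measurableType d) (R : realType) (mu : {measure set T -> \bar R}).
Implicit Types f g : T -> R.

Lemma intg_measurable f : intg mu f -> measurable_fun setT f.
Proof. by move=> /integrableP[/measurable_EFinP]. Qed.

Lemma intg_ae_le f g : measurable_fun setT f -> intg mu g ->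
  {ae mu, forall x, `|f x| <= g x} -> intg mu f.
Proof.
move=> mf ig fg; apply/integrableP; split; first exact/measurable_EFinP.
have /integrableP[_] := ig; apply: le_lt_trans.
apply: ae_ge0_le_integral => //.
- by apply: measurableT_comp => //; exact/measurable_EFinP.
- by apply: measurableT_comp => //; exact/measurable_EFinP/intg_measurable.
by apply: filterS fg => x h _ /=; rewrite lee_fin (le_trans h)// ler_norm.
Qed.

Lemma intgD f g : intg mu f -> intg mu g -> intg mu (fun x => f x + g x).
Proof. by move=> h1 h2; exact: (integrableD measurableT h1 h2). Qed.

Lemma intgB f g : intg mu f -> intg mu g -> intg mu (fun x => f x - g x).
Proof. by move=> h1 h2; exact: (integrableB measurableT h1 h2). Qed.

Lemma intgZ k f : intg mu f -> intg mu (fun x => k * f x).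
Proof. by move=> h; exact: (integrableZl measurableT k h). Qed.

Lemma intg_norm f : intg mu f -> intg mu (fun x => `|f x|).
Proof. by move=> h; exact: integrable_abse h. Qed.

Lemma intg_sum (I : Type) (s : seq I) (F : I -> T -> R) :
  (forall i, intg mu (F i)) -> intg mu (fun x => \sum_(i <- s) F i x).
Proof.
move=> h; rewrite (_ : _ \o _ = fun x => (\sum_(i <- s) (F i x)%:E)%E); last first.
  by apply/funext => x; rewrite /= sumEFin.
exact: (integrable_sum measurableT s (fun i _ => h i)).
Qed.

Lemma intgM_bdd f (b : T -> R) C : intg mu f -> measurable_fun setT b ->
  {ae mu, forall x, `|b x| <= C} -> intg mu (fun x => f x * b x).
Proof.
move=> If mb bC; apply: (@intg_ae_le _ (fun x => C * `|f x|)).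
- by apply: measurable_funM => //; exact: intg_measurable.
- exact/intgZ/intg_norm.
by apply: filterS bC => x bC; rewrite normrM mulrC ler_wpM2r.
Qed.

Lemma RintD f g : intg mu f -> intg mu g ->
  \int[mu]_x (f x + g x) = \int[mu]_x f x + \int[mu]_x g x.
Proof. by move=> h1 h2; rewrite RintegralD. Qed.

Lemma RintB f g : intg mu f -> intg mu g ->
  \int[mu]_x (f x - g x) = \int[mu]_x f x - \int[mu]_x g x.
Proof. by move=> h1 h2; rewrite RintegralB. Qed.

Lemma RintZ k f : intg mu f -> \int[mu]_x (k * f x) = k * \int[mu]_x f x.
Proof. by move=> h; rewrite RintegralZl. Qed.

Lemma RintN f : intg mu f -> \int[mu]_x (- f x) = - \int[mu]_x f x.
Proof. by move=> h; rewrite -mulN1r -RintZ//; under eq_Rintegral do rewrite -mulN1r. Qed.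

Lemma EFin_Rint f : intg mu f -> (\int[mu]_x f x)%:E = (\int[mu]_x (f x)%:E)%E.
Proof. by move=> h; rewrite /Rintegral fineK//; exact: integrable_fin_num. Qed.

Lemma Rint_sum (I : Type) (s : seq I) (F : I -> T -> R) :
  (forall i, intg mu (F i)) ->
  \int[mu]_x (\sum_(i <- s) F i x) = \sum_(i <- s) \int[mu]_x F i x.
Proof.
move=> h; elim: s => [|a s IH].
  by under eq_Rintegral do rewrite big_nil; rewrite big_nil /Rintegral integral0.
under eq_Rintegral do rewrite big_cons.
by rewrite big_cons RintD ?IH//; exact: intg_sum.
Qed.

Lemma Rint_ae_eq f g : measurable_fun setT f -> measurable_fun setT g ->
  {ae mu, forall x, f x = g x} -> \int[mu]_x f x = \int[mu]_x g x.
Proof.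
move=> mf mg fg; rewrite /Rintegral; congr fine; apply: ae_eq_integral => //.
- exact/measurable_EFinP.
- exact/measurable_EFinP.
by apply: filterS fg => x /= -> _.
Qed.

Lemma Rint_ae_le f g : intg mu f -> intg mu g ->
  {ae mu, forall x, f x <= g x} -> \int[mu]_x f x <= \int[mu]_x g x.
Proof.
move=> If Ig fg; rewrite -subr_ge0 -RintB//.
rewrite (@Rint_ae_eq _ (fun x => `|g x - f x|)).
- exact: Rintegral_ge0.
- exact/intg_measurable/intgB.
- exact/intg_measurable/intg_norm/intgB.
by apply: filterS fg => x fg; rewrite ger0_norm// subr_ge0.
Qed.

Lemma Rint_norm_le f : intg mu f -> `|\int[mu]_x f x| <= \int[mu]_x `|f x|.
Proof. by move=> h; apply: le_normr_Rintegral. Qed.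

Lemma Rint_ge0_eq0 f : intg mu f -> {ae mu, forall x, 0 <= f x} ->
  \int[mu]_x f x = 0 -> {ae mu, forall x, f x = 0}.
Proof.
move=> If f0 h0.
have mf := intg_measurable If.
have : (\int[mu]_x `|(f x)%:E|)%E = 0%E.
  have := EFin_Rint If; rewrite h0 => h; rewrite [RHS]h.
  apply: ae_eq_integral => //.
  - by apply: measurableT_comp => //; exact/measurable_EFinP.
  - exact/measurable_EFinP.
  by apply: filterS f0 => x fx _ /=; rewrite ger0_norm.
move/(ae_eq_integral_abs mu measurableT) => H.
have {}H := H ((measurable_EFinP _ _).2 mf).
by apply: filterS H => x /(_ I)/= [].
Qed.

Lemma Rint_dct (F : nat -> T -> R) f g :
  (forall n, measurable_fun setT (F n)) -> measurable_fun setT f -> intg mu g ->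
  {ae mu, forall x n, `|F n x| <= g x} ->
  {ae mu, forall x, F n x @[n --> \oo] --> f x} ->
  \int[mu]_x F n x @[n --> \oo] --> \int[mu]_x f x.
Proof.
move=> mF mf Ig Fg Ff.
have [||||If _ h] := @dominated_convergence _ _ _ mu _ measurableT
  (fun n => EFin \o F n) (EFin \o f) (EFin \o g) _ _ _ Ig _.
- by move=> n; exact/measurable_EFinP.
- exact/measurable_EFinP.
- by apply: filterS Ff => x h _; apply: cvg_EFin; first exact: nearW.
- by apply: filterS Fg => x h n _; rewrite /= lee_fin.
apply: fine_cvg; rewrite fineK//; last exact: integrable_fin_num.
Qed.

End real_integral.

Section finite_integral.
Context d (T : measurableType d) (R : realType) (mu : {finite_measure set T -> \bar R}).
Implicit Types f g : T -> R.

Lemma intg_cst (c : R) : intg mu (fun _ : T => c).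
Proof. exact: finite_measure_integrable_cst. Qed.

Lemma intg_bdd f C : measurable_fun setT f -> {ae mu, forall x, `|f x| <= C} -> intg mu f.
Proof. by move=> mf; apply: intg_ae_le => //; exact: intg_cst. Qed.

Lemma Rint_cst (c : R) : \int[mu]_x c = c * fine (mu setT).
Proof. by rewrite Rintegral_cst. Qed.

End finite_integral.

Section torus_integral.
Context {R : realType} (L : R) (n : nat).
Local Notation dx := (dx L (d:=n)).
Implicit Types f g : 'rV[R]_n -> R.

Lemma ae_cell (P : 'rV[R]_n -> Prop) : (forall x, cell L x -> P x) -> {ae dx, forall x, P x}.
Proof.
move=> h; exists (~` cell L); split.
- by apply: measurableC; exact: measurable_cell.
- by rewrite /dx /mrestr setICl measure0.
- by move=> x /=; apply: contra_not; exact: h.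
Qed.

Definition hcell : set 'rV[R]_n := [set x | forall i, - (L / 2) <= x ord0 i < L / 2].

Lemma ae_hcell (L0 : 0 < L) (P : 'rV[R]_n -> Prop) :
  (forall x, hcell x -> P x) -> {ae dx, forall x, P x}.
Proof.
move=> h.
have : {ae dx, forall x : 'rV[R]_n, forall i : 'I_n, x ord0 i != L / 2}.
  apply: filter_forall => i; exists [set x : 'rV[R]_n | x ord0 i = L / 2]; split.
  - rewrite (_ : [set x : 'rV[R]_n | _] = (fun x : 'rV[R]_n => x ord0 i) @^-1` [set L / 2])//.
    by rewrite -[X in measurable X]setTI; apply: measurable_coord => //; exact: measurable_set1.
  - exact: dx_face.
  - by move=> x /= /negP; rewrite negbK => /eqP.
have : {ae dx, forall x, cell L x} by exact: ae_cell.
apply: filterS2 => x hx hn; apply: h => i.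
by have /andP[-> h2] := hx i; rewrite lt_neqAle hn.
Qed.

End torus_integral.

(** * Periodic functions and their partial derivatives *)

Section torus_calculus.
Context {R : realType} (L : R) (n : nat).
Hypothesis L0 : 0 < L.
Local Notation dx := (dx L (d:=n)).
Implicit Types f g F : 'rV[R]_n -> R.

Lemma periodic_reduce (x : 'rV[R]_n) : exists2 y, cell L y &
  forall (T : Type) (f : 'rV[R]_n -> T), (forall x i, f (x + L *: delta_mx ord0 i) = f x) -> f y = f x.
Proof.
(* The number of periods to add so that [x_i / L] lands in [[-1/2, 1/2)]. *)
pose k i : int := - Num.floor (x ord0 i / L + 2^-1).
exists (x + \sum_i (L * (k i)%:~R) *: delta_mx ord0 i).
  move=> i; rewrite mxE summxE (bigD1 i)//= !mxE !eqxx mulr1 big1 => [|j ji]; last first.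
    by rewrite !mxE eqxx eq_sym (negbTE ji) mulr0.
  rewrite addr0 /k rmorphN/=; set m := Num.floor _.
  have /andP[h1 h2] : m%:~R <= x ord0 i / L + 2^-1 < (m + 1)%:~R by exact: floor_itv.
  have E : x ord0 i = x ord0 i / L * L by rewrite divfK// gt_eqF.
  move: h2; rewrite intrD => h2; rewrite E; move: (x ord0 i / L) h1 h2 => z h1 h2.
  have {}h1 : m%:~R * L <= (z + 2^-1) * L by rewrite ler_pM2r.
  have {}h2 : (z + 2^-1) * L < (m%:~R + 1) * L by rewrite ltr_pM2r.
  by apply/andP; split; [lra|nra].
move=> T f pf.
have pfn m y i : f (y + (L * m%:R) *: delta_mx ord0 i) = f y.
  elim: m => [|m IH]; first by rewrite mulr0 scale0r addr0.
  by rewrite -natr1 mulrDr mulr1 scalerDl addrA pf.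
have pfz (z : int) y i : f (y + (L * z%:~R) *: delta_mx ord0 i) = f y.
  case: z => m; first exact: pfn.
  rewrite NegzE rmorphN/= mulrN scaleNr.
  by rewrite -[LHS](pfn m.+1 _ i) -addrA addNr addr0.
have H s y : f (y + \sum_(i <- s) (L * (k i)%:~R) *: delta_mx ord0 i) = f y.
  elim: s y => [|j s IH] y; first by rewrite big_nil addr0.
  by rewrite big_cons addrA IH pfz.
exact: H.
Qed.

Lemma continuous_periodic_bounded f : continuous f -> periodic L f ->
  exists C, forall x, `|f x| <= C.
Proof.
move=> cf pf; have [C hC] := continuous_bounded_box (L / 2) cf.
exists C => x; have [y cy hy] := periodic_reduce x.
by rewrite -(hy _ f pf); apply: hC => i; rewrite ler_norml; exact: cy.
Qed.

Lemma Rint_translate a f : measurable_fun setT f -> periodic L f ->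
  \int[dx]_x f (x + a) = \int[dx]_x f x.
Proof.
move=> mf pf; rewrite /Rintegral; congr fine.
apply: (@integral_translate _ _ L0 _ a (EFin \o f)); first exact/measurable_EFinP.
by move=> x i /=; rewrite pf.
Qed.

Lemma Rint_reflect a f : measurable_fun setT f -> periodic L f ->
  \int[dx]_x f (a - x) = \int[dx]_x f x.
Proof.
move=> mf pf; rewrite /Rintegral; congr fine.
apply: (@integral_reflect _ _ L0 _ a (EFin \o f)); first exact/measurable_EFinP.
by move=> x i /=; rewrite pf.
Qed.

Lemma measurable_reflect (a : 'rV[R]_n) : measurable_fun setT (fun x : 'rV[R]_n => a - x).
Proof.
rewrite (_ : (fun _ => _) = (fun x : 'rV[R]_n => x + a) \o (fun x => - x)); last first.
  by apply/funext => x /=; rewrite addrC.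
by apply: measurableT_comp; [exact: measurable_rVD|exact: measurable_rVN].
Qed.

(** The kernels of the convolutions are bounded only almost everywhere; this carries such a bound to
    the argument [x - y] with [x] fixed. *)
Lemma ae_reflect (B : set 'rV[R]_n) (a : 'rV[R]_n) : measurable B ->
  (forall x i, B (x + L *: delta_mx ord0 i) = B x) ->
  {ae dx, forall x, ~ B x} -> {ae dx, forall x, ~ B (a - x)}.
Proof.
move=> mB pB [N [mN N0 BN]].
have B0 : dx B = 0%E.
  apply/eqP; rewrite -measure_le0 -N0; apply: le_measure; rewrite ?inE//.
  by move=> x Bx; apply: BN => /=; apply.
exists [set x | B (a - x)]; split.
- rewrite (_ : [set x | _] = (fun x => a - x) @^-1` B)//.
  by rewrite -[X in measurable X]setTI; exact: measurable_reflect.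
- have mI := @measurable_indic _ _ R setT _ mB.
  have mE := measurableT_comp (@EFin_measurable R setT) mI.
  have := integral_reflect L0 a mE _.
  have : periodice L (EFin \o (\1_B : _ -> R)).
    by move=> x i /=; rewrite !indicE; congr ((nat_of_bool _)%:R%:E); apply/idP/idP; rewrite !inE pB.
  move=> /[swap] /[apply].
  have -> : (\int[dx]_x (EFin \o (\1_B : _ -> R)) x = 0)%E.
    by have := integral_indic dx measurableT mB; rewrite setIT => h; exact: etrans h B0.
  move=> <-; have mB' : measurable [set x | B (a - x)].
    rewrite (_ : [set x | _] = (fun x => a - x) @^-1` B)//.
    by rewrite -[X in measurable X]setTI; exact: measurable_reflect.
  have := integral_indic dx measurableT mB'; rewrite setIT => <-.
  by apply: eq_integral => x _ /=; rewrite !indicE; congr ((nat_of_bool _)%:R%:E); apply/idP/idP; rewrite !inE.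
- by move=> x /= /contrapT.
Qed.

Lemma is_derive_line (f : 'rV[R]_n -> R) (x v : 'rV[R]_n) (s : R) :
  derivable f (x + s *: v) v ->
  is_derive s 1 (fun r : R => f (x + r *: v)) ('D_v f (x + s *: v)).
Proof.
move=> df.
have E : (fun h : R => h^-1 *: (((fun r : R => f (x + r *: v)) \o shift s) (h *: 1) - f (x + s *: v))) =
         (fun h : R => h^-1 *: ((f \o shift (x + s *: v)) (h *: v) - f (x + s *: v))).
  apply/funext => h /=; congr (_ *: (f _ - _)).
  by rewrite [h *: 1]mulr1 scalerDl addrCA.
by split; [rewrite /derivable E|rewrite /derive E].
Qed.

Lemma is_derive_of_line (f : 'rV[R]_n -> R) (x v : 'rV[R]_n) (l : R) :
  is_derive (0 : R) 1 (fun r : R => f (x + r *: v)) l -> is_derive x v f l.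
Proof.
move=> [dl El].
have E : (fun h : R => h^-1 *: (((fun r : R => f (x + r *: v)) \o shift 0) (h *: 1) - f (x + 0 *: v))) =
         (fun h : R => h^-1 *: ((f \o shift x) (h *: v) - f x)).
  apply/funext => h /=; congr (_ *: (f _ - f _)); last by rewrite scale0r addr0.
  by rewrite [h *: 1]mulr1 addr0 addrC.
by split; [move: dl; rewrite /derivable E|move: El; rewrite /derive E].
Qed.

Lemma partial_periodic f i : periodic L f -> periodic L (partial i f).
Proof.
move=> pf x j; rewrite /partial /derive.
rewrite (_ : (fun h : R => h^-1 *: ((f \o shift (x + L *: delta_mx ord0 j)) (h *: delta_mx ord0 i) - f (x + L *: delta_mx ord0 j))) =
  (fun h : R => h^-1 *: ((f \o shift x) (h *: delta_mx ord0 i) - f x)))//.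
by apply/funext => h /=; rewrite addrA pf pf.
Qed.

Lemma partial_lipschitz f i C : (forall x, derivable f x (delta_mx ord0 i)) ->
  (forall x, `|partial i f x| <= C) ->
  forall x s, `|f (x + s *: delta_mx ord0 i) - f x| <= C * `|s|.
Proof.
move=> df bC x s; set v := delta_mx _ _.
have D (r : R) : is_derive r 1 (fun r : R => f (x + r *: v)) (partial i f (x + r *: v)).
  exact: is_derive_line.
have cont : continuous (fun r : R => f (x + r *: v)).
  by move=> r; apply: differentiable_continuous; apply/derivable1_diffP; have [] := D r.
have E0 : f x = f (x + 0 *: v) by rewrite scale0r addr0.
rewrite E0; have [s0|s0] := leP 0 s.
  have [c _ ->] := MVT_segment s0 (fun r _ => D r) (continuous_subspaceT cont).
  by rewrite subr0 normrM ler_wpM2r.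
have [c _] := MVT_segment (ltW s0) (fun r _ => D r) (continuous_subspaceT cont).
rewrite distrC => ->.
by rewrite sub0r normrM normrN ler_wpM2r.
Qed.

Lemma partial_cvg f i x : derivable f x (delta_mx ord0 i) ->
  k.+1%:R * (f (x + k.+1%:R^-1 *: delta_mx ord0 i) - f x) @[k --> \oo] --> partial i f x.
Proof.
move=> df.
have : (h^-1 *: ((f \o shift x) (h *: delta_mx ord0 i) - f x)) @[h --> 0^'] --> partial i f x by [].
move/cvgr_dnbhsP => /(_ (@harmonic R)) H.
have {}H := H (conj (fun k => invr_neq0 (lt0r_neq0 (ltr0Sn _ k))) (@cvg_harmonic R)).
apply: cvg_trans H; apply: near_eq_cvg; apply: nearW => k /=.
by rewrite /harmonic /= invrK; congr (_ * (f _ - _)); exact: addrC.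
Qed.

Lemma intg_translate a f : periodic L f -> intg dx f -> intg dx (fun x => f (x + a)).
Proof.
move=> pf If; have mf := intg_measurable If.
apply/integrableP; split.
  by apply/measurable_EFinP; apply: measurableT_comp => //; exact: measurable_rVD.
have /integrableP[_] := If; congr (_ < _)%E.
rewrite -(@integral_translate _ _ L0 _ a (abse \o EFin \o f)).
- exact: eq_integral.
- by apply: measurableT_comp => //; exact/measurable_EFinP.
- by move=> x i /=; rewrite pf.
Qed.

(** The source of all integrations by parts. The difference quotients of [F] have zero integral by
    translation invariance and are bounded by [C] by the mean value theorem, so dominated
    convergence applies. *)
Lemma Rint_partial_eq0 F i C : periodic L F -> intg dx F ->
  (forall x, derivable F x (delta_mx ord0 i)) ->
  (forall x, `|partial i F x| <= C) -> \int[dx]_x partial i F x = 0.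
Proof.
move=> pF IF dF bC; have mF := intg_measurable IF.
pose G k x := k.+1%:R * (F (x + k.+1%:R^-1 *: delta_mx ord0 i) - F x).
have IFs a : intg dx (fun x => F (x + a)) by exact: intg_translate.
have G0 k : \int[dx]_x G k x = 0.
  by rewrite RintZ; [rewrite RintB// Rint_translate// subrr mulr0|exact: intgB].
have mG k : measurable_fun setT (G k).
  by apply: intg_measurable; apply: intgZ; exact: intgB.
have Gcvg x : G k x @[k --> \oo] --> partial i F x by exact: partial_cvg.
have mpF : measurable_fun setT (partial i F).
  by apply: (measurable_fun_cvg mG) => x _; exact: Gcvg.
have : \int[dx]_x G k x @[k --> \oo] --> \int[dx]_x partial i F x.
  apply: (@Rint_dct _ _ _ _ _ _ (fun=> C)) => //.
  - exact: intg_cst.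
  - apply: aeW => x k; rewrite /G normrM gtr0_norm//.
    have := partial_lipschitz dF bC x k.+1%:R^-1.
    by rewrite (@gtr0_norm _ k.+1%:R^-1)// => h; rewrite -ler_pdivlMl// mulrC.
  - exact: aeW.
under eq_fun do rewrite G0.
by move=> /(cvg_unique _ (cvg_cst 0)) <-.
Qed.

End torus_calculus.

Lemma cvg_le_cst (R : realType) (u : nat -> R) l M :
  u k @[k --> \oo] --> l -> (forall k, u k <= M) -> l <= M.
Proof.
move=> ul uM; rewrite -(cvg_lim _ ul)//; apply: limr_le; last exact: nearW.
by apply/cvg_ex; exists l.
Qed.

(** * Density of trigonometric polynomials *)

Section trigonometric.
Context {R : realType} (L : R) (n : nat).
Hypothesis L0 : 0 < L.
Local Notation dx := (dx L (d:=n)).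
Local Notation hcell := (@hcell R L n).
Implicit Types f g p : 'rV[R]_n -> R.

(** The free phase [a] yields the sines too, which makes the class stable under derivatives and
    reflections; products make it an algebra. *)
Inductive trig : ('rV[R]_n -> R) -> Prop :=
| trig_cst c : trig (fun=> c)
| trig_cos i a : trig (fun x => cos (2 * pi / L * x ord0 i + a))
| trigD p q : trig p -> trig q -> trig (fun x => p x + q x)
| trigM p q : trig p -> trig q -> trig (fun x => p x * q x).

Lemma trigZ c p : trig p -> trig (fun x => c * p x).
Proof. by move=> tp; apply: trigM => //; exact: trig_cst. Qed.

Lemma trig_eq p q : p =1 q -> trig p -> trig q.
Proof. by move=> /funext ->. Qed.

Lemma trig_reflect p : trig p -> forall a, trig (fun x => p (a - x)).
Proof.
move=> tp a; elim: tp => [c|i b|{}p q _ hp _ hq|{}p q _ hp _ hq].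
- exact: trig_cst.
- apply: trig_eq (trig_cos i (- (2 * pi / L * a ord0 i + b))) => x /=.
  by rewrite !mxE -[RHS]cosN; congr cos; ring.
- exact: trigD.
- exact: trigM.
Qed.

Lemma continuous_coord (i : 'I_n) : continuous (fun x : 'rV[R]_n => x ord0 i).
Proof. exact: coord_continuous. Qed.

Lemma trig_continuous p : trig p -> continuous p.
Proof.
elim=> [c|i b|{}p q _ hp _ hq|{}p q _ hp _ hq] x.
- exact: cst_continuous.
- apply: (@continuous_comp _ _ _ (fun x : 'rV[R]_n => 2 * pi / L * x ord0 i + b) cos); last exact: continuous_cos.
  apply: (@continuousD _ _ _ (fun x1 : 'rV[R]_n => 2 * pi / L * x1 ord0 i) (cst b)); last exact: cst_continuous.
  by apply: (@continuousM R _ (cst (2 * pi / L)) (fun x1 : 'rV[R]_n => x1 ord0 i)); [exact: cst_continuous|exact: continuous_coord].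
- exact: (@continuousD _ _ _ p q x (hp x) (hq x)).
- exact: (@continuousM R _ p q x (hp x) (hq x)).
Qed.

Lemma trig_periodic p : trig p -> periodic L p.
Proof.
elim=> [c|i b|{}p q _ hp _ hq|{}p q _ hp _ hq] x j //.
- rewrite !mxE eqxx/= eq_sym; case: eqP => _ /=; last by rewrite mulr0 addr0.
  rewrite mulr1 mulrDr divfK ?gt_eqF// addrAC -[2 * pi]/(2%:R * pi) mulr_natl.
  exact: cosD2pi.
- by rewrite hp hq.
- by rewrite hp hq.
Qed.

Lemma trig_derive p i : trig p ->
  exists2 q, trig q & forall x, is_derive x (delta_mx ord0 i : 'rV[R]_n) p (q x).
Proof.
elim=> [c|j b|{}p q _ [p' tp' hp] _ [q' tq' hq]|{}p q tp [p' tp' hp] tq [q' tq' hq]].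
- by exists (fun=> 0); [exact: trig_cst|move=> x; exact: is_derive_cst].
(* A phase shift by [pi / 2] writes minus the sine as a cosine. *)
- exists (fun x => (2 * pi / L * (i == j)%:R) * cos (2 * pi / L * x ord0 j + (b + pi / 2))).
    by apply: trigZ; exact: trig_cos.
  move=> x; apply: is_derive_of_line.
  rewrite (_ : (fun r : R => _) = cos \o (fun r => (2 * pi / L * (i == j)%:R) * r + (2 * pi / L * x ord0 j + b))); last first.
    apply/funext => r /=; rewrite !mxE eqxx/= eq_sym; congr cos; ring.
  have : is_derive (0:R) 1 (fun r => (2 * pi / L * (i == j)%:R) * r + (2 * pi / L * x ord0 j + b)) (2 * pi / L * (i == j)%:R).
    by apply: is_derive_eq; rewrite /GRing.scale/= mulr1 addr0.
  move/(is_derive1_comp (is_derive_cos _)); rewrite mulr0 add0r => h.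
  by apply: is_derive_eq h _; rewrite addrA cosDpihalf mulrC.
- exists (fun x => p' x + q' x); first exact: trigD.
  by move=> x; have := hp x; have := hq x; move=> ? ?; exact: is_deriveD.
- exists (fun x => p x * q' x + q x * p' x); first by apply: trigD; exact: trigM.
  by move=> x; have := hp x; have := hq x; move=> ? ?; exact: is_deriveM.
Qed.

Lemma trig_partial p i : trig p -> trig (partial i p).
Proof.
move=> /(trig_derive i)[q tq h]; apply: trig_eq tq => x.
by have [_ <-] := h x.
Qed.

Lemma trig_derivable p i x : trig p -> derivable p x (delta_mx ord0 i).
Proof. by move=> /(trig_derive i)[q tq h]; have [] := h x. Qed.

Lemma trig_test p : trig p -> test_function L p.
Proof.
move=> tp k; split; first exact: trig_periodic.
elim: k p tp => [|k IH] p tp /=; split => //; try exact: trig_continuous.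
move=> i; split; first by move=> x; exact: trig_derivable.
by apply: IH; exact: trig_partial.
Qed.

Lemma trig_bounded p : trig p -> exists C, forall x, `|p x| <= C.
Proof.
move=> tp; apply: (continuous_periodic_bounded L0); first exact: trig_continuous.
exact: trig_periodic.
Qed.

Lemma trig_measurable p : trig p -> measurable_fun setT p.
Proof. by move=> tp; apply: continuous_measurable_rV; exact: trig_continuous. Qed.

Lemma trig_intg p : trig p -> intg dx p.
Proof.
move=> tp; have [C hC] := trig_bounded tp.
by apply: (intg_bdd (C := C)); [exact: trig_measurable|exact: aeW].
Qed.

(* The class is closed under bounded limits on the half-open cell, on which the
   opposite faces of the cube are not identified. *)
Inductive baire : ('rV[R]_n -> R) -> Prop :=
| baire_trig p : trig p -> baire p
| baireD f g : baire f -> baire g -> baire (fun x => f x + g x)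
| baireM f g : baire f -> baire g -> baire (fun x => f x * g x)
| baire_lim (F : nat -> 'rV[R]_n -> R) f M : (forall k, baire (F k)) ->
    measurable_fun setT f -> (forall k x, hcell x -> `|F k x| <= M) ->
    (forall x, hcell x -> F k x @[k --> \oo] --> f x) -> baire f.

Lemma baire_measurable f : baire f -> measurable_fun setT f.
Proof.
elim=> // {}f.
- exact: trig_measurable.
- by move=> g _ mf _ mg; exact: measurable_funD.
- by move=> g _ mf _ mg; exact: measurable_funM.
Qed.

Lemma baire_bounded f : baire f -> exists C, forall x, hcell x -> `|f x| <= C.
Proof.
elim=> {f} [p tp|f g _ [C hC] _ [C' hC']|f g _ [C hC] _ [C' hC']|F f M _ _ _ FM Ff].
- by have [C hC] := trig_bounded tp; exists C.
- by exists (C + C') => x hx; rewrite (le_trans (ler_normD _ _))// lerD ?hC ?hC'.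
- by exists (C * C') => x hx; rewrite normrM ler_pM ?hC ?hC'.
- exists M => x hx; have h := cvg_norm (Ff _ hx).
  by apply: (cvg_le_cst (h _)) => k; exact: FM.
Qed.

Lemma baire_cst c : baire (fun=> c).
Proof. by apply: baire_trig; exact: trig_cst. Qed.

Lemma baire_eq f g : baire f -> measurable_fun setT g ->
  (forall x, hcell x -> f x = g x) -> baire g.
Proof.
move=> bf mg fg; have [C hC] := baire_bounded bf.
apply: (@baire_lim (fun=> f) g C) => //.
by move=> x hx; rewrite -fg//; exact: cvg_cst.
Qed.

Lemma baireB f g : baire f -> baire g -> baire (fun x => f x - g x).
Proof.
move=> bf bg; rewrite (_ : (fun x => _) = (fun x => f x + (-1) * g x)); last first.
  by apply/funext => x; rewrite mulN1r.
by apply: baireD => //; apply: baireM => //; exact: baire_cst.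
Qed.

Lemma baire_exp f k : baire f -> baire (fun x => f x ^+ k).
Proof.
move=> bf; elim: k => [|k IH].
  by rewrite (_ : (fun x => _) = cst 1); [exact: baire_cst|apply/funext => x; rewrite expr0].
rewrite (_ : (fun x => _) = (fun x => f x * f x ^+ k)); first exact: baireM.
by apply/funext => x; rewrite exprS.
Qed.

Let bernoulli (x : R) k : 0 <= x -> 1 + k%:R * x <= (1 + x) ^+ k.
Proof.
move=> x0; elim: k => [|k IH]; first by rewrite mul0r addr0 expr0.
rewrite exprS; apply: (@le_trans _ _ ((1 + x) * (1 + k%:R * x))).
  rewrite -natr1; have : 0 <= k%:R * x * x by rewrite !mulr_ge0.
  nra.
by rewrite ler_wpM2l// addr_ge0.
Qed.

Let bernoulliN (x : R) k : 0 <= x <= 1 -> 1 - k%:R * x <= (1 - x) ^+ k.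
Proof.
move=> /andP[x0 x1]; elim: k => [|k IH]; first by rewrite mul0r subr0 expr0.
rewrite exprS; apply: (@le_trans _ _ ((1 - x) * (1 - k%:R * x))).
  rewrite -natr1; have : 0 <= k%:R * x * x by rewrite !mulr_ge0.
  nra.
by rewrite ler_wpM2l// subr_ge0.
Qed.

(** Polynomials in [t] known from elementary proofs of the Stone-Weierstrass theorem: on [[0, 1]]
    they converge to the indicator of [[0, 1/2]]. The extra [j] in the inner exponent settles the
    point [t = 1/2], where [2 ^ (j ^ 2) * t ^ (j ^ 2 + j) = 2 ^ (- j)] tends to 0. *)
Let step (t : R) j := (1 - t ^+ (j ^ 2 + j)) ^+ (2 ^ (j ^ 2)).

Let step_itv (t : R) j : 0 <= t <= 1 -> 0 <= step t j <= 1.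
Proof.
move=> /andP[t0 t1].
have h : 0 <= 1 - t ^+ (j ^ 2 + j) <= 1.
  by rewrite subr_ge0 exprn_ile1//= gerBl exprn_ge0.
by have /andP[? ?] := h; rewrite exprn_ge0//= exprn_ile1.
Qed.

Let half_cvg : 2^-1 ^+ k @[k --> \oo] --> (0:R).
Proof. by apply: cvg_expr; rewrite ger0_norm; lra. Qed.

Let step_lo (t : R) : 0 <= t <= 2^-1 -> step t k @[k --> \oo] --> (1:R).
Proof.
move=> /andP[t0 t1].
have t01 : 0 <= t <= 1 by apply/andP; split; lra.
apply: (@squeeze_cvgr _ _ _ _ (fun k => 1 - 2^-1 ^+ k) (fun=> 1)).
- apply: nearW => k; have /andP[_ ->] := step_itv k t01; rewrite andbT.
  apply: (@le_trans _ _ (1 - (2 ^ (k ^ 2))%:R * t ^+ (k ^ 2 + k))); last first.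
    by apply: bernoulliN; rewrite exprn_ge0//= exprn_ile1//; lra.
  rewrite lerD2l lerN2 exprD mulrA natrX -exprMn -[leRHS]mul1r.
  apply: ler_pM; rewrite ?exprn_ge0//; try lra.
  - by rewrite exprn_ile1//; lra.
  - by rewrite lerXn2r ?nnegrE//; lra.
- rewrite -[X in _ --> X](subr0 1); apply: cvgB; [exact: cvg_cst|exact: half_cvg].
- exact: cvg_cst.
Qed.

Let step_hi (t : R) : 2^-1 < t <= 1 -> step t k @[k --> \oo] --> (0:R).
Proof.
move=> /andP[t0 t1].
have t01 : 0 <= t <= 1 by apply/andP; split; lra.
apply: (@squeeze_cvgr _ _ _ _ (fun=> 0) (fun k => 2^-1 ^+ k)); last 2 first.
- exact: cvg_cst.
- exact: half_cvg.
have cv : (2 * t)^-1 ^+ k @[k --> \oo] --> (0:R).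
  apply: cvg_expr; rewrite ger0_norm ?invr_ge0; last lra.
  by rewrite invf_lt1; lra.
have /(cvgrPdist_le _ _).1 /(_ (t / 2)) := cv.
move=> /(_ _)/wrap[]; first lra.
apply: filterS => k; rewrite sub0r normrN ger0_norm ?exprn_ge0 ?invr_ge0//; last lra.
move=> tk; rewrite /=.
rewrite /step; set u := t ^+ (k ^ 2 + k).
have u0 : 0 <= u by rewrite exprn_ge0//; lra.
have h1 := bernoulli (2 ^ (k ^ 2)) u0.
have h2 : (1 - u) ^+ (2 ^ (k ^ 2)) * (1 + u) ^+ (2 ^ (k ^ 2)) <= 1.
  have u1 : u <= 1 by rewrite exprn_ile1//; lra.
  rewrite -exprMn exprn_ile1//; first by rewrite mulr_ge0 ?subr_ge0 ?addr_ge0.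
  by rewrite -subr_sqr expr1n gerBl sqr_ge0.
(* The right side is [((2 t) ^ k * t) ^ k], and [(2 t) ^ k * t >= 2] for the large [k] considered,
   because [2 t > 1]. *)
have h3 : 2 ^+ k <= (2 ^ (k ^ 2))%:R * u.
  rewrite /u exprD mulrA natrX -exprMn expnS expn1 exprM -exprMn lerXn2r ?nnegrE//.
    by rewrite mulr_ge0 ?exprn_ge0//; lra.
  have tk0 : 0 < (2 * t) ^+ k by rewrite exprn_gt0//; lra.
  move: tk; rewrite exprVn; move: tk0; set z := _ ^+ k => z0 h.
  have : z^-1 * z <= t / 2 * z by rewrite ler_pM2r.
  by rewrite mulVf ?gt_eqF//; lra.
have h4 : 2 ^+ k <= (1 + u) ^+ (2 ^ (k ^ 2)) by apply: le_trans h1; lra.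
rewrite exprVn -[leRHS]mul1r ler_pdivlMr ?exprn_gt0//.
  apply: le_trans h2; rewrite ler_wpM2l//.
  by have /andP[] := step_itv k t01.
by rewrite subr_ge0 exprn_ile1//; lra.
Qed.

Lemma baire_ge q s : trig q -> (forall x, `|q x| <= 1) -> -1 <= s <= 1 ->
  baire (\1_[set x : 'rV[R]_n | s <= q x] : _ -> R).
Proof.
move=> tq q1 /andP[s1 s2].
(* [t x <= 1/2] exactly where [s <= q x]; the divisor 8 keeps [t] in [[0, 1]]. *)
pose t x := 2^-1 + (s - q x) / 8%:R.
have bt : baire t.
  apply: baireD; first exact: baire_cst.
  by apply: baireM; [apply: baireB; [exact: baire_cst|exact: baire_trig]|exact: baire_cst].
have t01 x : 0 <= t x <= 1.
  by have := q1 x; rewrite /t ler_norml => /andP[h1 h2]; apply/andP; split; lra.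
apply: (@baire_lim (fun k x => step (t x) k) _ 1).
- move=> k; apply: baire_exp; apply: baireB; first exact: baire_cst.
  exact: baire_exp.
- apply: measurable_indic.
  rewrite (_ : [set x | _] = q @^-1` `[s, +oo[); last first.
    by apply/seteqP; split => x /=; rewrite in_itv/= andbT.
  rewrite -[X in measurable X]setTI; apply: trig_measurable => //.
- by move=> k x _; have /andP[h1 h2] := step_itv k (t01 x); rewrite ger0_norm.
- move=> x _; have /andP[h1 h2] := t01 x; rewrite indicE.
  case: (boolP (s <= q x)) => sq.
    by rewrite mem_set//=; apply: step_lo; rewrite h1/= /t; lra.
  rewrite memNset//=; last exact/negP.
  by apply: step_hi; rewrite h2 andbT /t; move: sq; rewrite -ltNge => sq; lra.
Qed.

(** Within one period, [x_i <= c] says that [x_i] lies in the arc from [- L / 2] to [c], a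
    superlevel set of the cosine that peaks at the midpoint of the arc. The value [L / 2], which no
    periodic function can tell from [- L / 2], does not occur in the half-open cell. *)
Lemma baire_ray (i : 'I_n) (c : R) : baire (\1_[set x : 'rV[R]_n | x ord0 i <= c] : _ -> R).
Proof.
have mI : measurable_fun setT (\1_[set x : 'rV[R]_n | x ord0 i <= c] : _ -> R).
  apply: measurable_indic.
  rewrite (_ : [set x : 'rV[R]_n | _] = (fun x : 'rV[R]_n => x ord0 i) @^-1` `]-oo, c]); last first.
    by apply/seteqP; split => x /=; rewrite in_itv.
  by rewrite -[X in measurable X]setTI; exact: measurable_coord.
have [cL|cL] := ltP c (- (L / 2)).
  apply: (baire_eq (baire_cst 0) mI) => x hx; rewrite indicE memNset//= => xc.
  by have /andP[h1 _] := hx i; lra.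
have [Lc|Lc] := leP (L / 2) c.
  apply: (baire_eq (baire_cst 1) mI) => x hx; rewrite indicE mem_set//=.
  by have /andP[_ h1] := hx i; lra.
pose g := 2 * pi / L * c.
pose q (x : 'rV[R]_n) := cos (2 * pi / L * x ord0 i + (pi - g) / 2).
have bq := @baire_ge q (cos ((g + pi) / 2)) (trig_cos _ _).
apply: (baire_eq (bq _ _) mI).
- by move=> x; rewrite ler_norml cos_geN1 cos_le1.
- by rewrite cos_geN1 cos_le1.
move=> x hx; rewrite !indicE; congr ((nat_of_bool _)%:R).
have /andP[h1 h2] := hx i.
have pL0 : 0 < 2 * pi / L :> R by rewrite divr_gt0// mulr_gt0// pi_gt0.
have pl y : 2 * pi / L * y = 2 * (pi * (y / L)) by rewrite -!mulrA [L^-1 * y]mulrC.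
(* The cosines to compare are [cos (A + B)] and [cos (A - B)], so everything depends on the sign of
   [sin A * sin B], where [sin B >= 0] on the cell. *)
pose A := pi * ((x ord0 i - c) / L); pose B := pi * ((x ord0 i) / L + 2^-1).
have EA : cos (2 * pi / L * x ord0 i + (pi - g) / 2) = cos (A + B).
  by congr cos; rewrite /A /B /g !pl; lra.
have EB : cos ((g + pi) / 2) = cos (A - B).
  by rewrite -cosN; congr cos; rewrite /A /B /g !pl; lra.
have E : (cos (A - B) <= cos (A + B)) = (sin A * sin B <= 0).
  by rewrite cosB cosD; apply/idP/idP; lra.
have pi0 := @pi_gt0 R.
have xL1 : - 2^-1 <= x ord0 i / L by rewrite ler_pdivlMr//; lra.
have xL2 : x ord0 i / L < 2^-1 by rewrite ltr_pdivrMr//; lra.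
have cL1 : - 2^-1 <= c / L by rewrite ler_pdivlMr//; lra.
have cL2 : c / L < 2^-1 by rewrite ltr_pdivrMr//; lra.
have B0 : 0 <= sin B by apply: sin_ge0_pi; rewrite /B; nra.
apply/idP/idP; rewrite !inE/= /q EA EB E.
- move=> sAB; rewrite leNgt; apply/negP => cx.
  have A0 : 0 < sin A.
    apply: sin_gt0_pi; rewrite /A mulrBl.
    have : c / L < x ord0 i / L by rewrite ltr_pM2r// invr_gt0.
    by nra.
  have : 0 < sin B.
    apply: sin_gt0_pi; rewrite /B.
    have : c / L < x ord0 i / L by rewrite ltr_pM2r// invr_gt0.
    by nra.
  by nra.
- move=> xc.
  have : 0 <= sin (- A).
    apply: sin_ge0_pi; rewrite /A mulrBl.
    have : x ord0 i / L <= c / L by rewrite ler_pM2r// invr_gt0.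
    by nra.
  by rewrite sinN; nra.
Qed.

Let bset (Y : set 'rV[R]_n) := measurable Y /\ baire (\1_Y : _ -> R).

Let bset_sigma : sigma_algebra setT bset.
Proof.
split.
- by split => //; rewrite indic0; exact: baire_cst.
- move=> Y [mY bY]; rewrite setTD; split; first exact: measurableC.
  rewrite (_ : \1_(~` Y) = (fun x => 1 - \1_Y x)); first by apply: baireB => //; exact: baire_cst.
  by apply/funext => x; rewrite !indicE in_setC; case: (x \in Y); rewrite ?subrr ?subr0.
- move=> F bF; have mF : measurable (\bigcup_i F i) by apply: bigcupT_measurable => k; have [] := bF k.
  split => //.
  (* The indicator of the union of the first [k] sets, as a polynomial in their indicators. *)
  pose G k (x : 'rV[R]_n) : R := 1 - \prod_(i < k) (1 - \1_(F i) x).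
  have f01 i x : 0 <= 1 - (\1_(F i) x : R) <= 1.
    by rewrite indicE; case: (x \in F i); rewrite ?subrr ?subr0 ?lexx ?ler01.
  apply: (@baire_lim G _ 1) => [k|||x _].
  + apply: baireB; first exact: baire_cst.
    elim: k => [|k IH].
      by rewrite (_ : (fun x => _) = cst 1); [exact: baire_cst|apply/funext => x; rewrite big_ord0].
    rewrite (_ : (fun x => _) = (fun x => (\prod_(i < k) (1 - \1_(F i) x)) * (1 - \1_(F k) x))).
      by apply: baireM => //; apply: baireB; [exact: baire_cst|have [] := bF k].
    by apply/funext => x; rewrite big_ord_recr.
  + exact: measurable_indic.
  + move=> k x _; have h : 0 <= \prod_(i < k) (1 - (\1_(F i) x : R)) <= 1.
      apply: (big_ind (fun z : R => 0 <= z <= 1)) => [|y z /andP[y0 y1] /andP[z0 z1]|i _].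
      + by rewrite ler01 lexx.
      + by rewrite mulr_ge0//= mulr_ile1.
      + exact: f01.
    by rewrite /G ger0_norm; have /andP[? ?] := h; lra.
  + apply: cvg_near_cst; rewrite indicE; have [[N _ FN]|nF] := pselect ((\bigcup_i F i) x).
      exists N.+1 => // k /= Nk; rewrite /G (bigD1 (Ordinal Nk))//= indicE (mem_set FN) subrr mul0r subr0.
      by rewrite mem_set//; exists N.
    apply: nearW => k; rewrite /G big1 ?subrr ?memNset// => i _.
    by rewrite indicE memNset ?subr0// => Fx; apply: nF; exists i.
Qed.

Lemma baire_indic (Y : set 'rV[R]_n) : measurable Y -> baire (\1_Y : _ -> R).
Proof.
suff H : measurable `<=` bset by move=> /H[].
have H i (Z : set R) : measurable Z -> bset ((fun x : 'rV[R]_n => x ord0 i) @^-1` Z).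
  move=> mZ; have {mZ} : <<s @RGenOInfty.G R >> Z.
    exact: (eq_ind _ id mZ _ (congr1 (fun S : set (set R) => S Z) (@RGenOInfty.measurableE R))).
  move: Z.
  apply: smallest_sub.
    split; have [h1 h2 h3] := bset_sigma.
    - by rewrite /= preimage_set0.
    - by move=> A /= hA; have := h2 _ hA; rewrite !setTD preimage_setC.
    - by move=> F hF /=; rewrite preimage_bigcup; exact: h3.
  move=> _ [c ->] /=.
  have [_ h2 _] := bset_sigma; have := h2 [set x : 'rV[R]_n | x ord0 i <= c].
  rewrite setTD (_ : ~` _ = (fun x : 'rV[R]_n => x ord0 i) @^-1` `]c, +oo[); last first.
    by apply/seteqP; split => x /=; rewrite in_itv/= andbT ltNge => /negP.
  apply; split; last exact: baire_ray.
  rewrite (_ : [set x : 'rV[R]_n | _] = (fun x : 'rV[R]_n => x ord0 i) @^-1` `]-oo, c]); last first.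
    by apply/seteqP; split => x /=; rewrite in_itv.
  by rewrite -[X in measurable X]setTI; exact: measurable_coord.
apply: smallest_sub; first exact: bset_sigma.
rewrite -bigcup_seq => A [i _ [Z mZ <-]]; rewrite setTI.
exact: H.
Qed.

Let dense f := intg dx f /\ forall e, 0 < e -> exists2 p, trig p & \int[dx]_x `|f x - p x| <= e.

Let dense_add f g : dense f -> dense g -> dense (fun x => f x + g x).
Proof.
move=> [If df] [Ig dg]; split; first exact: intgD.
move=> e e0; have e2 : 0 < e / 2 by lra.
have [p tp hp] := df _ e2; have [q tq hq] := dg _ e2.
exists (fun x => p x + q x); first exact: trigD.
apply: (@le_trans _ _ (\int[dx]_x (`|f x - p x| + `|g x - q x|))).
  apply: Rint_ae_le.
  - by apply/intg_norm/intgB; [exact: intgD|exact: trig_intg (trigD _ _)].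
  - by apply: intgD; apply/intg_norm/intgB => //; exact: trig_intg.
  apply: aeW => x; have -> : f x + g x - (p x + q x) = (f x - p x) + (g x - q x) by ring.
  exact: ler_normD.
rewrite RintD; first lra.
- by apply/intg_norm/intgB => //; exact: trig_intg.
- by apply/intg_norm/intgB => //; exact: trig_intg.
Qed.

Let dense_close f : intg dx f -> (forall e, 0 < e -> exists2 g, dense g & \int[dx]_x `|f x - g x| <= e) -> dense f.
Proof.
move=> If h; split => // e e0; have e2 : 0 < e / 2 by lra.
have [g [Ig dg] hg] := h _ e2; have [p tp hp] := dg _ e2; exists p => //.
apply: (@le_trans _ _ (\int[dx]_x (`|f x - g x| + `|g x - p x|))).
  apply: Rint_ae_le.
  - by apply/intg_norm/intgB => //; exact: trig_intg.
  - by apply: intgD; apply/intg_norm/intgB => //; exact: trig_intg.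
  apply: aeW => x; have -> : f x - p x = (f x - g x) + (g x - p x) by ring.
  exact: ler_normD.
rewrite RintD; first lra.
- by apply/intg_norm/intgB.
- by apply/intg_norm/intgB => //; exact: trig_intg.
Qed.

Let baire_intg f : baire f -> intg dx f.
Proof.
move=> bf; have [C hC] := baire_bounded bf.
apply: (intg_bdd (C := C)); first exact: baire_measurable.
exact: ae_hcell.
Qed.

Let baire_dense f : baire f -> dense f.
Proof.
elim=> {f} [p tp|f g bf df bg dg|f g bf [If df] bg [Ig dg]|F f M bF dF mf FM Ff].
- split; first exact: trig_intg.
  move=> e e0; exists p => //; under eq_Rintegral do rewrite subrr normr0.
  by rewrite /Rintegral integral0 ltW.
- exact: dense_add.
- split; first exact/baire_intg/baireM.
  move=> e e0; have [C hC] := baire_bounded bf.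
  have C0 : 0 < `|C| + 1 by rewrite ltr_pwDr.
  have eC : 0 < e / (2 * (`|C| + 1)) by rewrite divr_gt0// mulr_gt0.
  have [q tq hq] := dg _ eC.
  (* [q] is chosen before [p]: its bound [K] enters the tolerance required of [p]. *)
  have [K hK] := trig_bounded tq.
  have K0 : 0 < `|K| + 1 by rewrite ltr_pwDr.
  have eK : 0 < e / (2 * (`|K| + 1)) by rewrite divr_gt0// mulr_gt0.
  have [p tp hp] := df _ eK.
  exists (fun x => p x * q x); first exact: trigM.
  have I1 : intg dx (fun x => `|g x - q x|) by apply/intg_norm/intgB => //; exact: trig_intg.
  have I2 : intg dx (fun x => `|f x - p x|) by apply/intg_norm/intgB => //; exact: trig_intg.
  apply: (@le_trans _ _ (\int[dx]_x ((`|C| + 1) * `|g x - q x| + (`|K| + 1) * `|f x - p x|))).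
    apply: Rint_ae_le.
    - by apply/intg_norm/intgB; [exact/baire_intg/baireM|exact: trig_intg (trigM _ _)].
    - by apply: intgD; exact: intgZ.
    apply: ae_hcell => // x hx.
    have -> : f x * g x - p x * q x = f x * (g x - q x) + (f x - p x) * q x by ring.
    rewrite (le_trans (ler_normD _ _))// lerD// normrM.
      rewrite ler_wpM2r// (le_trans (hC x hx))// (le_trans (ler_norm _))//; lra.
    rewrite mulrC ler_wpM2r// (le_trans (hK x))// (le_trans (ler_norm _))//; lra.
  rewrite RintD; [|exact: intgZ|exact: intgZ].
  rewrite !RintZ//.
  have h1 : (`|C| + 1) * \int[dx]_x `|g x - q x| <= e / 2.
    apply: le_trans (_ : (`|C| + 1) * (e / (2 * (`|C| + 1))) <= _); first by rewrite ler_wpM2l// ltW.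
    by rewrite le_eqVlt; apply/orP; left; apply/eqP; field; rewrite gt_eqF.
  have h2 : (`|K| + 1) * \int[dx]_x `|f x - p x| <= e / 2.
    apply: le_trans (_ : (`|K| + 1) * (e / (2 * (`|K| + 1))) <= _); first by rewrite ler_wpM2l// ltW.
    by rewrite le_eqVlt; apply/orP; left; apply/eqP; field; rewrite gt_eqF.
  by rewrite (le_trans (lerD h1 h2))// -splitr.
- apply: dense_close; first exact/baire_intg/(baire_lim bF mf FM Ff).
  move=> e e0.
  have h : \int[dx]_x `|f x - F k x| @[k --> \oo] --> \int[dx]_x (0 : R).
    apply: (@Rint_dct _ _ _ _ _ _ (fun=> M + M)).
    + move=> k; apply: measurableT_comp => //; apply: measurable_funB => //.
      exact: (baire_measurable (bF k)).
    + exact: measurable_cst.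
    + exact: intg_cst.
    + apply: ae_hcell => // x hx k; rewrite normr_id (le_trans (ler_normB _ _))// lerD ?FM//.
      by apply: (cvg_le_cst (cvg_norm (Ff x hx))) => j; exact: FM.
    + apply: ae_hcell => // x hx; rewrite (_ : 0 = `|f x - f x|); last by rewrite subrr normr0.
      by apply: cvg_norm; apply: cvgB; [exact: cvg_cst|exact: Ff].
  have /(cvgrPdist_le _ _).1 /(_ e e0)[N _ /(_ N (leqnn N))] := h.
  rewrite {1}/Rintegral integral0/= sub0r normrN => hN; exists (F N) => //.
  exact: le_trans (ler_norm _) hN.
Qed.

Import HBSimple.

Lemma trig_dense f e : intg dx f -> 0 < e ->
  exists2 p, trig p & \int[dx]_x `|f x - p x| <= e.
Proof.
move=> If; suff [_ h] : dense f by exact: h.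
apply: dense_close => // {}e e0.
have [g_ [Ig _ hg]] := approximation_sfun_integrable measurableT If.
have h : (\int[dx]_x `|f x - g_ k x|)%R @[k --> \oo] --> (0:R).
  apply: fine_cvg; apply: cvg_trans hg; apply: near_eq_cvg; apply: nearW => k.
  by apply: eq_integral => x _.
have /(cvgrPdist_le _ _).1 /(_ e e0)[N _ /(_ N (leqnn N))] := h.
rewrite sub0r normrN => hN; exists (g_ N); last exact: le_trans (ler_norm _) hN.
rewrite (_ : (g_ N : _ -> R) = fun x => \sum_(y <- finmap.enum_fset (fset_set (range (g_ N)))) y * \1_(g_ N @^-1` [set y]) x); last first.
  by apply/funext => x; rewrite [LHS]fimfunE fsbig_finite.
elim: (finmap.enum_fset _) => [|y s IH].
  rewrite (_ : (fun x => _) = fun=> 0); last by apply/funext => x; rewrite big_nil.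
  by apply: baire_dense; exact: baire_cst.
rewrite (_ : (fun x => _) = (fun x => y * \1_(g_ N @^-1` [set y]) x + \sum_(y <- s) y * \1_(g_ N @^-1` [set y]) x)); last first.
  by apply/funext => x; rewrite big_cons.
apply: dense_add => //; apply: baire_dense; apply: baireM; first exact: baire_cst.
by apply: baire_indic; exact: measurable_sfunP.
Qed.

(** The fundamental lemma of the calculus of variations with trigonometric test functions. The
    bounded [psi] for which [g psi] is orthogonal to all of them are stable under multiplication by
    functions of [baire]; with the indicator of [0 < g] this makes the integral of [|g|] vanish.
    Uniqueness of weak derivatives follows. *)
Lemma trig_orthogonal g : intg dx g -> (forall p, trig p -> \int[dx]_x (g x * p x) = 0) ->
  {ae dx, forall x, g x = 0}.
Proof.
move=> Ig h; have mg := intg_measurable Ig.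
pose H (psi : 'rV[R]_n -> R) := [/\ measurable_fun setT psi, exists M, forall x, hcell x -> `|psi x| <= M &
  forall p, trig p -> \int[dx]_x (g x * psi x * p x) = 0].
have Igm psi p : H psi -> trig p -> intg dx (fun x => g x * psi x * p x).
  move=> [mpsi [M hM] _] tp; have [C hC] := trig_bounded tp.
  apply: (intgM_bdd (C := C)); [|exact: trig_measurable|exact: aeW].
  by apply: (intgM_bdd (C := M)) => //; exact: ae_hcell.
have key f : baire f -> forall psi, H psi -> H (fun x => f x * psi x).
  elim=> {f} [p tp|f1 f2 bf1 h1 bf2 h2|f1 f2 bf1 h1 bf2 h2|F f M bF hF mf FM Ff] psi Hp.
  - have [mpsi [M hM] hp] := Hp; have [C hC] := trig_bounded tp; split.
    + by apply: measurable_funM => //; exact: trig_measurable.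
    + by exists (C * M) => x hx; rewrite normrM ler_pM// hM.
    + move=> q tq; rewrite -(hp _ (trigM tp tq)); apply: eq_Rintegral => x _; ring.
  - have H1 := h1 _ Hp; have H2 := h2 _ Hp; have [m1 [C1 c1] i1] := H1; have [m2 [C2 c2] i2] := H2; split.
    + by under eq_fun do rewrite mulrDl; exact: measurable_funD.
    + by exists (C1 + C2) => x hx; rewrite mulrDl (le_trans (ler_normD _ _))// lerD ?c1 ?c2.
    + move=> q tq; rewrite -(addr0 0) -{1}(i1 _ tq) -{1}(i2 _ tq) -RintD; [|exact: Igm|exact: Igm].
      apply: eq_Rintegral => x _; ring.
  - by under eq_fun do rewrite -mulrA; apply: h1; exact: h2.
  - have [mpsi [C hC] hp] := Hp.
    have fM x : hcell x -> `|f x| <= M.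
      by move=> hx; apply: (cvg_le_cst (cvg_norm (Ff x hx))) => j; exact: FM.
    split.
    + exact: measurable_funM.
    + by exists (M * C) => x hx; rewrite normrM ler_pM// ?fM ?hC.
    + move=> q tq; have [K hK] := trig_bounded tq.
      have cv : \int[dx]_x (g x * (F k x * psi x) * q x) @[k --> \oo] --> \int[dx]_x (g x * (f x * psi x) * q x).
        apply: (@Rint_dct _ _ _ _ _ _ (fun x => `|g x| * (M * C * K))).
        * move=> k; have [m1 _ _] := hF k _ Hp.
          by apply: measurable_funM; [exact: measurable_funM|exact: trig_measurable].
        * by apply: measurable_funM; [apply: measurable_funM => //; exact: measurable_funM|exact: trig_measurable].
        * under eq_fun do rewrite mulrC; exact/intgZ/intg_norm.
        * apply: ae_hcell => // x hx k; rewrite !normrM -!mulrA ler_wpM2l//.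
          by rewrite !mulrA; apply: ler_pM => //; apply: ler_pM => //; [exact: FM|exact: hC].
        * apply: ae_hcell => // x hx; apply: cvgM; last exact: cvg_cst.
          apply: cvgM; first exact: cvg_cst.
          by apply: cvgM; [exact: Ff|exact: cvg_cst].
      have E k : \int[dx]_x (g x * (F k x * psi x) * q x) = 0.
        by have [_ _ ->] := hF k _ Hp.
      move: cv; under eq_fun do rewrite E.
      by move/(cvg_unique _ (cvg_cst 0)) => <-.
have H1 : H (fun=> 1).
  split => //; first by exists 1 => x _; rewrite normr1.
  by move=> p tp; rewrite -[RHS](h _ tp); apply: eq_Rintegral => x _; rewrite mulr1.
have mpos : measurable [set x | 0 < g x].
  rewrite (_ : [set x | _] = g @^-1` `]0, +oo[); last first.
    by apply/seteqP; split => x /=; rewrite in_itv/= andbT.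
  by rewrite -[X in measurable X]setTI; exact: mg.
have [ms [M hM] hs] := key _ (baire_indic mpos) _ H1.
pose sg x : R := 2 * \1_[set x | 0 < g x] x - 1.
have bsg x : `|sg x| <= 1.
  by rewrite /sg indicE; case: (x \in _); rewrite /= ?mulr1 ?mulr0 ler_norml; apply/andP; split; lra.
have msg : measurable_fun setT sg.
  by apply: measurable_funB => //; apply: measurable_funM => //; exact: measurable_indic.
have I0 : \int[dx]_x `|g x| = 0.
  transitivity (\int[dx]_x (2 * (g x * \1_[set x | 0 < g x] x) - g x)).
    apply: eq_Rintegral => x _; rewrite indicE.
    case: (boolP (0 < g x)) => gx.
      by rewrite mem_set// gtr0_norm//=; ring.
    rewrite memNset/=; last exact/negP.
    by rewrite mulr0 mulr0 sub0r ler0_norm// leNgt.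
  have Ii : intg dx (fun x => g x * \1_[set x | 0 < g x] x).
    apply: (intgM_bdd (C := 1) Ig); first exact: measurable_indic.
    by apply: aeW => x; rewrite indicE; case: (x \in _); rewrite /= ?normr1 ?normr0.
  rewrite RintB//; last exact: intgZ.
  rewrite RintZ//.
  have -> : \int[dx]_x (g x * \1_[set x | 0 < g x] x) = 0.
    rewrite -[RHS](hs _ (trig_cst 1)); apply: eq_Rintegral => x _; by rewrite !mulr1.
  have -> : \int[dx]_x g x = 0.
    by rewrite -[RHS](h _ (trig_cst 1)); apply: eq_Rintegral => x _; rewrite mulr1.
  by rewrite mulr0 subr0.
have := Rint_ge0_eq0 (intg_norm Ig) _ I0; move=> /(_ _)/wrap[]; first exact: aeW.
by apply: filterS => x /eqP; rewrite normr_eq0 => /eqP.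
Qed.

End trigonometric.

Lemma is_derive0_small (R : realType) (phi : R -> R) (l : R) :
  (forall eps, 0 < eps -> exists2 del, 0 < del &
    forall s, `|s| < del -> `|phi s - phi 0 - s * l| <= eps * `|s|) ->
  is_derive (0 : R) 1 phi l.
Proof.
move=> h.
have H : h^-1 *: ((phi \o shift 0) (h *: 1) - phi 0) @[h --> 0^'] --> l.
  apply/cvgrPdist_le => eps eps0; have [del del0 hd] := h _ eps0.
  near=> s; rewrite /= addr0 [s *: 1]mulr1.
  have s0 : s != 0 by near: s; exact: nbhs_dnbhs_neq.
  have -> : l - s^-1 *: (phi s - phi 0) = - (s^-1 * (phi s - phi 0 - s * l)).
    by rewrite mulrBr mulKf// opprB.
  rewrite normrN normrM normfV mulrC ler_pdivrMr ?normr_gt0//.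
  apply: hd; near: s; apply: dnbhs0_lt => //.
split; first by apply/cvg_ex; exists l.
exact: cvg_lim H.
Unshelve. all: end_near. Qed.

(** * Weak derivatives and the drift *)

Section convolution.
Context {R : realType} (L : R) (n : nat).
Hypothesis L0 : 0 < L.
Local Notation dx := (dx L (d:=n)).
Local Notation trig := (@trig R L n).
Implicit Types f g h p w : 'rV[R]_n -> R.

Definition conv g w (x : 'rV[R]_n) : R := \int[dx]_y (g (x - y) * w y).

Lemma ae_le_reflect g C a : measurable_fun setT g -> periodic L g ->
  {ae dx, forall x, `|g x| <= C} -> {ae dx, forall x, `|g (a - x)| <= C}.
Proof.
move=> mg pg gC.
have mB : measurable [set x | C < `|g x|].
  rewrite (_ : [set x | _] = (fun x => `|g x|) @^-1` `]C, +oo[); last first.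
    by apply/seteqP; split => x /=; rewrite in_itv/= andbT.
  by rewrite -[X in measurable X]setTI; apply: measurableT_comp.
have := ae_reflect L0 a mB _ _; move=> /(_ _ _)/wrap[].
- by move=> x i /=; rewrite pg.
- by apply: filterS gC => x /= h; apply/negP; rewrite -leNgt.
- by apply: filterS => x /= /negP; rewrite -leNgt.
Qed.

Section bounded_kernel.
Variables (g : 'rV[R]_n -> R) (C : R).
Hypotheses (mg : measurable_fun setT g) (pg : periodic L g) (gC : {ae dx, forall x, `|g x| <= C}).

Lemma intg_conv w x : intg dx w -> intg dx (fun y => g (x - y) * w y).
Proof.
move=> Iw; under eq_fun do rewrite mulrC.
apply: (intgM_bdd (C := C) Iw); last exact: ae_le_reflect.
by apply: measurableT_comp => //; exact: measurable_reflect.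
Qed.

Lemma convB w w' x : intg dx w -> intg dx w' ->
  conv g (fun y => w y - w' y) x = conv g w x - conv g w' x.
Proof.
move=> Iw Iw'; rewrite /conv -RintB; [|exact: intg_conv..].
by apply: eq_Rintegral => y _; rewrite mulrBr.
Qed.

Lemma conv_le w x : intg dx w -> `|conv g w x| <= C * \int[dx]_y `|w y|.
Proof.
move=> Iw; apply: (le_trans (Rint_norm_le (intg_conv x Iw))).
rewrite -RintZ; last exact: intg_norm.
apply: Rint_ae_le; [exact/intg_norm/intg_conv|exact/intgZ/intg_norm|].
by apply: filterS (ae_le_reflect x mg pg gC) => y h; rewrite normrM ler_wpM2r.
Qed.

(** Moves the variable [x] from the kernel, which is merely measurable, to the smooth factor, where
    differentiation under the integral is possible. *)
Lemma conv_reflect p x : trig p -> conv g p x = \int[dx]_z (g z * p (x - z)).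
Proof.
move=> tp; rewrite -(Rint_reflect L0 x).
- by apply: eq_Rintegral => y _; rewrite /= opprB addrCA subrr addr0.
- apply: measurable_funM => //; apply: measurableT_comp; last exact: measurable_reflect.
  exact: (trig_measurable tp).
- move=> z i; rewrite pg opprD addrA; congr (_ * _).
  by rewrite -[LHS](trig_periodic L0 tp _ i) subrK.
Qed.

End bounded_kernel.

Section weak_derivative.
Variables (g h : 'rV[R]_n -> R) (C : R) (i : 'I_n).
Hypotheses (mg : measurable_fun setT g) (pg : periodic L g) (gC : {ae dx, forall x, `|g x| <= C}).
Hypotheses (mh : measurable_fun setT h) (ph : periodic L h) (hC : {ae dx, forall x, `|h x| <= C}).
Hypothesis C0 : 0 <= C.
Hypothesis gh : forall p, trig p -> \int[dx]_x (g x * partial i p x) = - \int[dx]_x (h x * p x).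
Local Notation e := (delta_mx ord0 i : 'rV[R]_n).

Let Ig : intg dx g. Proof. exact: intg_bdd mg gC. Qed.
Let Ih : intg dx h. Proof. exact: intg_bdd mh hC. Qed.

Let partial_reflect p x z : trig p ->
  partial i (fun z => p (x - z)) z = - partial i p (x - z).
Proof.
move=> tp; suff D : is_derive z e (fun z => p (x - z)) (- partial i p (x - z)).
  by rewrite /partial; have [_ ->] := D.
apply: is_derive_of_line.
have H : is_derive (0:R) 1 (fun r : R => p (x - z + r *: e)) ('D_e p (x - z + (0:R) *: e)).
  exact: (is_derive_line (trig_derivable tp)).
rewrite (_ : (fun r => _) = (fun r : R => p (x - z + r *: e)) \o -%R); last first.
  by apply/funext => r /=; rewrite scaleNr opprD addrA.
rewrite -[- partial _ _ _]mulrN1.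
apply: is_derive1_comp; rewrite oppr0.
by rewrite -[X in partial _ _ X]addr0 -(scale0r e).
Qed.

Let conv_trig_derive p x : trig p -> is_derive x e (conv g p) (conv h p x).
Proof.
move=> tp; apply: is_derive_of_line.
have [K hK] := trig_bounded L0 (trig_partial i tp).
have [K' hK'] := trig_bounded L0 tp.
pose f (r : R) z := g z * p (x + r *: e - z).
rewrite (_ : (fun r => _) = (fun r => \int[dx]_z f r z)); last first.
  by apply/funext => r; rewrite (conv_reflect mg pg).
have df (r : R) z : is_derive r 1 (fun r => f r z) (g z * partial i p (x + r *: e - z)).
  have H : is_derive r 1 (fun r : R => p (x - z + r *: e)) (partial i p (x - z + r *: e)).
    by apply: is_derive_line; exact: (trig_derivable tp).
  rewrite /f (_ : (fun r => _) = (fun r => g z *: p (x - z + r *: e))); last first.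
    by apply/funext => s; rewrite addrAC.
  by rewrite [in X in is_derive _ _ _ X]addrAC; exact: is_deriveZ.
have mpr (q : 'rV[R]_n -> R) (a : 'rV[R]_n) : trig q -> measurable_fun setT (fun z : 'rV[R]_n => q (a - z)).
  move=> tq; apply: measurableT_comp; last exact: measurable_reflect.
  exact: (trig_measurable tq).
have If (r : R) : `](-1), 1[%classic r -> intg dx (f r).
  move=> _; apply: (intgM_bdd (C := K') Ig); first exact: mpr.
  exact: aeW.
have If' : intg dx (fun z => K * `|g z|) by exact/intgZ/intg_norm.
have K0 : 0 <= K by apply: le_trans (hK 0).
have bf (r : R) z : `](-1), 1[%classic r -> setT z -> `|partial1of2 f r z| <= K * `|g z|.
  move=> _ _; rewrite partial1of2E; have [_ ->] := df r z.
  by rewrite normrM mulrC ler_wpM2r.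
have I0 : `](-1), 1[%classic (0:R) by rewrite /= in_itv/=; apply/andP; split; lra.
have df' (r : R) z : `](-1), 1[%classic r -> setT z -> derivable (f ^~ z) r 1.
  by move=> _ _; have [] := df r z.
have G0 z : 0 <= K * `|g z| by rewrite mulr_ge0.
have := @derivable_under_integral _ _ _ dx f setT measurableT 0 (-1) 1 I0 If df' _ G0 If' bf.
have := @differentiation_under_integral _ _ _ dx f setT measurableT 0 (-1) 1 I0 If df' _ G0 If' bf.
rewrite derive1E => E dF; split => //; rewrite E.
rewrite (conv_reflect mh ph)//.
rewrite -[RHS]opprK -(gh (trig_reflect tp x)).
rewrite -RintN; last first.
  apply: (intgM_bdd (C := K) Ig).
    exact: (trig_measurable (trig_partial i (trig_reflect tp x))).
  by apply: aeW => z; rewrite partial_reflect// normrN.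
apply: eq_Rintegral => z _; rewrite partial_reflect// mulrN opprK partial1of2E.
by have [_ ->] := df 0 z; rewrite scale0r addr0.
Qed.

Let line_conv_trig p x (s : R) : trig p ->
  exists r, `|r| <= `|s| /\ conv g p (x + s *: e) - conv g p x = s * conv h p (x + r *: e).
Proof.
move=> tp.
have D (r : R) : is_derive r 1 (fun r : R => conv g p (x + r *: e)) (conv h p (x + r *: e)).
  have [d1 d2] := conv_trig_derive (x + r *: e) tp.
  by rewrite -d2; exact: is_derive_line.
have cont : continuous (fun r : R => conv g p (x + r *: e)).
  by move=> r; apply: differentiable_continuous; apply/derivable1_diffP; have [] := D r.
have E0 : conv g p x = conv g p (x + 0 *: e) by rewrite scale0r addr0.
rewrite E0; have [s0|s0] := leP 0 s.
  have [c] := MVT_segment s0 (fun r _ => D r) (continuous_subspaceT cont).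
  rewrite in_itv/= => /andP[c0 cs] ->; exists c.
  by rewrite subr0 mulrC ger0_norm// ger0_norm.
have [c] := MVT_segment (ltW s0) (fun r _ => D r) (continuous_subspaceT cont).
rewrite in_itv/= => /andP[cs c0] E; exists c; split.
  by rewrite !ler0_norm// ?lerN2// ltW.
by rewrite -opprB E; ring.
Qed.

Let conv_lip w x (s : R) : intg dx w ->
  `|conv g w (x + s *: e) - conv g w x| <= `|s| * (C * \int[dx]_y `|w y|).
Proof.
move=> Iw; apply/ler_addgt0Pr => eps eps0.
(* The error is at most [(|s| + 2) C] times the L^1 distance from [w] to [p]: [|s| C] through the
   norm of [p], and [C] for each of the two remainders. The added 1 keeps the denominator
   positive. *)
have del0 : 0 < eps / ((`|s| + 2) * C + 1).
  by rewrite divr_gt0// ltr_wpDl// mulr_ge0// addr_ge0.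
have [p tp hp] := trig_dense L0 Iw del0.
have Ip := trig_intg L0 tp.
have Iwp : intg dx (fun y => w y - p y) by exact: intgB.
have E y : conv g w y = conv g p y + conv g (fun y => w y - p y) y.
  by rewrite (convB mg pg gC)// addrC subrK.
have := conv_le mg pg gC (x + s *: e) Iwp; have := conv_le mg pg gC x Iwp.
have [r [_ hr]] := line_conv_trig x s tp.
have := conv_le mh ph hC (x + r *: e) Ip.
have I2 : \int[dx]_y `|p y| <= \int[dx]_y `|w y| + \int[dx]_y `|w y - p y|.
  rewrite -RintD; [|exact: intg_norm|exact: intg_norm].
  apply: Rint_ae_le; [exact: intg_norm|by apply: intgD; exact: intg_norm|].
  apply: aeW => y; rewrite -{1}[p y](subKr (w y)).
  by rewrite (le_trans (ler_normB _ _)).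
move: hp I2; set W := \int[dx]_y `|w y|; set P := \int[dx]_y `|p y|; set Q := \int[dx]_y _.
move=> hQ hP h1 h2 h3; rewrite !E opprD addrACA hr.
have hE : ((`|s| + 2) * C + 1) * (eps / ((`|s| + 2) * C + 1)) = eps.
  by rewrite mulrC divfK// gt_eqF// ltr_wpDl// mulr_ge0// addr_ge0.
have s0 := normr_ge0 s.
have Q0 : 0 <= Q by apply: Rintegral_ge0.
apply: (le_trans (ler_normD _ _)); rewrite normrM.
apply: (@le_trans _ _ (`|s| * (C * P) + (C * Q + C * Q))).
  by rewrite lerD ?ler_wpM2l// (le_trans (ler_normB _ _))// lerD.
apply: (@le_trans _ _ (`|s| * (C * W) + ((`|s| + 2) * C + 1) * Q)).
  have : `|s| * (C * P) <= `|s| * (C * (W + Q)) by rewrite !ler_wpM2l.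
  by lra.
rewrite lerD2l -[leRHS]hE ler_wpM2l// ltW// ltr_wpDl// mulr_ge0// addr_ge0//.
Qed.

Let conv_trig_lip p x : trig p -> exists2 K, 0 <= K & forall r,
  `|conv h p (x + r *: e) - conv h p x| <= K * `|r|.
Proof.
move=> tp; have [K hK] := trig_bounded L0 (trig_partial i tp).
have K0 : 0 <= K by apply: le_trans (hK 0).
exists (K * \int[dx]_z `|h z|); first by rewrite mulr_ge0//; apply: Rintegral_ge0.
move=> r; rewrite !(conv_reflect mh ph)//.
have I1 a : intg dx (fun z => h z * p (a - z)).
  have [K' hK'] := trig_bounded L0 tp.
  apply: (intgM_bdd (C := K') Ih); last exact: aeW.
  apply: measurableT_comp; last exact: measurable_reflect.
  exact: (trig_measurable tp).
rewrite -RintB//; apply: (le_trans (Rint_norm_le (intgB (I1 _) (I1 _)))).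
rewrite mulrAC -RintZ; last exact: intg_norm.
apply: Rint_ae_le; [exact/intg_norm/intgB|exact/intgZ/intg_norm|].
apply: aeW => z; rewrite -mulrBr normrM mulrC ler_wpM2r// addrAC.
by apply: partial_lipschitz => // y; exact: (trig_derivable tp).
Qed.

(** The kernel has only a bounded weak derivative and [w] is only integrable, yet the convolution is
    differentiable at every point. For a trigonometric [p] close to [w] this is classical; by the
    Lipschitz estimate [conv_lip], the difference quotients of the remainder are of the size of the
    L^1 norm of [w - p], uniformly in the step. *)
Lemma conv_derive w x : intg dx w -> is_derive x e (conv g w) (conv h w x).
Proof.
move=> Iw; apply/is_derive_of_line/is_derive0_small => eps eps0.
rewrite scale0r addr0.
have del0 : 0 < eps / (4 * (C + 1)) by rewrite divr_gt0// mulr_gt0// ltr_wpDl.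
have [p tp hp] := trig_dense L0 Iw del0.
have Ip := trig_intg L0 tp.
have Iwp : intg dx (fun y => w y - p y) by exact: intgB.
have [K K0 hK] := conv_trig_lip x tp.
exists (eps / (2 * (K + 1))); first by rewrite divr_gt0// mulr_gt0// ltr_wpDl.
move=> s hs.
have E y : conv g w y = conv g p y + conv g (fun y => w y - p y) y.
  by rewrite (convB mg pg gC)// addrC subrK.
have E' y : conv h w y = conv h p y + conv h (fun y => w y - p y) y.
  by rewrite (convB mh ph hC)// addrC subrK.
have [r [rs hr]] := line_conv_trig x s tp.
have h1 := conv_lip x s Iwp; have h2 := conv_le mh ph hC x Iwp; have h3 := hK r.
move: hp h1 h2; set Q := \int[dx]_y _ => hQ h1 h2.
rewrite !E E'.
have -> : conv g p (x + s *: e) + conv g (fun y => w y - p y) (x + s *: e) -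
   (conv g p x + conv g (fun y => w y - p y) x) - s * (conv h p x + conv h (fun y => w y - p y) x) =
   s * (conv h p (x + r *: e) - conv h p x) + (conv g (fun y => w y - p y) (x + s *: e) - conv g (fun y => w y - p y) x) - s * conv h (fun y => w y - p y) x.
  by move: hr => /eqP; rewrite subr_eq => /eqP ->; ring.
have s0 := normr_ge0 s.
have hC1 : (C + 1) * Q <= eps / 4%:R.
  apply: (@le_trans _ _ ((C + 1) * (eps / (4 * (C + 1))))).
    by rewrite ler_wpM2l// addr_ge0.
  by rewrite le_eqVlt; apply/orP; left; apply/eqP; field; rewrite gt_eqF// ltr_wpDl.
have Q0 : 0 <= Q by apply: Rintegral_ge0.
have hCQ : C * Q <= eps / 4%:R by lra.
have hKs : K * `|r| <= eps / 2.
  have r0 := normr_ge0 r.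
  have : (K + 1) * `|r| <= (K + 1) * (eps / (2 * (K + 1))).
    by rewrite ler_wpM2l ?addr_ge0// (le_trans rs)// ltW.
  have -> : (K + 1) * (eps / (2 * (K + 1))) = eps / 2 by field; rewrite gt_eqF// ltr_wpDl.
  by lra.
rewrite (le_trans (ler_normB _ _))//.
apply: (@le_trans _ _ (`|s| * (K * `|r|) + `|s| * (C * Q) + `|s| * (C * Q))).
  rewrite lerD//.
    by rewrite (le_trans (ler_normD _ _))// lerD// normrM ler_wpM2l.
  by rewrite normrM ler_wpM2l.
by rewrite -!mulrDr mulrC ler_wpM2r//; lra.
Qed.

End weak_derivative.

Lemma measurable_conv g w : measurable_fun setT g -> measurable_fun setT w ->
  measurable_fun setT (conv g w).
Proof.
move=> mg mw.
pose F (p : 'rV[R]_n * 'rV[R]_n) : \bar R := (g (p.1 - p.2) * w p.2)%:E.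
have mF : measurable_fun setT F.
  apply/measurable_EFinP; apply: measurable_funM; last exact: measurableT_comp.
  apply: (measurableT_comp mg); apply/measurable_fun_rVP => i.
  rewrite (_ : (fun p : 'rV[R]_n * 'rV[R]_n => (p.1 - p.2) ord0 i) = (fun p : 'rV[R]_n * 'rV[R]_n => p.1 ord0 i - p.2 ord0 i)); last first.
    by apply/funext => p; rewrite !mxE.
  by apply: measurable_funB; apply: (measurableT_comp (measurable_coord i)).
rewrite (_ : conv g w = fine \o (fun x => \int[dx]_y F^\+ (x, y) - \int[dx]_y F^\- (x, y)))%E; last first.
  apply/funext => x; rewrite /conv /Rintegral integralE /=; congr (fine (_ - _)).
  - by apply: eq_integral => y _; rewrite !funeposE.
  - by apply: eq_integral => y _; rewrite !funenegE.
apply: measurableT_comp; first exact: fine_measurable.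
apply: emeasurable_funB.
- apply: (@measurable_fun_fubini_tonelli_F _ _ _ _ _ dx (F^\+)%E) => //.
  exact: measurable_funepos.
- apply: (@measurable_fun_fubini_tonelli_F _ _ _ _ _ dx (F^\-)%E) => //.
  exact: measurable_funeneg.
Qed.

End convolution.

(** * The drift generated by a potential with bounded second derivatives *)

Section potential.
Context {R : realType} (L : R) (n : nat).
Hypothesis L0 : 0 < L.
Local Notation dx := (dx L (d:=n)).
Local Notation trig := (@trig R L n).
Variable D : 'rV[R]_n -> R.
Hypothesis D2 : sobolev L 2 +oo%E D.

(** The norm of exponent [+oo] unfolds to an essential supremum through a test on the positivity of
    the total mass. *)
Let dxT_gt0 : (0 < dx setT)%E.
Proof. by rewrite dx_setT ?ltW// lte_fin exprn_gt0. Qed.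

Lemma Lfun_oo_ae_bounded (f : 'rV[R]_n -> R) : f \in Lfun dx +oo%E ->
  exists C, {ae dx, forall x, `|f x| <= C}.
Proof.
move=> /andP[_]; rewrite inE /= /finite_norm unlock dxT_gt0 => h.
have := ess_sup_inf.ess_sup_ge dx (abse \o EFin \o f); move: h.
case E : (ess_sup_inf.ess_sup dx (abse \o EFin \o f)) => [r| |]//= _ h.
- by exists r; apply: filterS h => x /=; rewrite lee_fin.
- by exists 0; apply: filterS h => x /=.
Qed.

Let is_weak_unique s f g g' : is_weak_partials L s f g -> is_weak_partials L s f g' ->
  {ae dx, forall x, g x = g' x}.
Proof.
move=> [_ _ _ /Lfun1_integrable Ig hg] [_ _ _ /Lfun1_integrable Ig' hg'].
have : {ae dx, forall x, g x - g' x = 0}.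
  apply: (trig_orthogonal L0); first exact: intgB.
  move=> p tp; have [C hC] := trig_bounded L0 tp.
  have Igp f' : intg dx f' -> intg dx (fun x => f' x * p x).
    by move=> If'; apply: (intgM_bdd (C := C) If'); [exact: (trig_measurable tp)|exact: aeW].
  transitivity (\int[dx]_x (g x * p x - g' x * p x)).
    by apply: eq_Rintegral => x _; rewrite mulrBl.
  rewrite RintB ?Igp//; apply/eqP; rewrite subr_eq0; apply/eqP.
  have := hg' _ (trig_test L0 tp); rewrite (hg _ (trig_test L0 tp)).
  by apply: mulrI; rewrite unitrX// unitrN1.
by apply: filterS => x /eqP; rewrite subr_eq0 => /eqP.
Qed.

(** [weak_partials] is an arbitrary choice among the weak derivatives; by their uniqueness it
    inherits the essential bound of the one provided by [sobolev]. *)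
Lemma weak_partialsP s : (size s <= 2)%N -> is_weak_partials L s D (weak_partials L s D) /\
  exists2 C, 0 <= C & {ae dx, forall x, `|weak_partials L s D x| <= C}.
Proof.
move=> s2; have [g wg Lg] := D2 s2.
have wp : is_weak_partials L s D (weak_partials L s D).
  by apply: (@xgetPex _ (fun=> 0) [set g | is_weak_partials L s D g]); exists g.
split => //; have [C hC] := Lfun_oo_ae_bounded Lg.
exists `|C| => //; apply: filterS2 hC (is_weak_unique wg wp) => x h <-.
by rewrite (le_trans h)// ler_norm.
Qed.

(** [partial i p] is itself a test function: the definition of the first derivative tested with it,
    and that of the second derivative tested with [p], involve the same integral of [D]. *)
Lemma weak_partials_ibp i p : trig p ->
  \int[dx]_x (weak_partials L [:: i] D x * partial i p x) =
  - \int[dx]_x (weak_partials L [:: i; i] D x * p x).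
Proof.
move=> tp; have [[_ _ _ _ h1] _] := @weak_partialsP [:: i] isT.
have [[_ _ _ _ h2] _] := @weak_partialsP [:: i; i] isT.
have := h1 _ (trig_test L0 (trig_partial i tp)); have := h2 _ (trig_test L0 tp).
rewrite /= => ->; rewrite expr2 mulrNN !mul1r => ->.
by rewrite expr1 mulN1r opprK.
Qed.

(** [Linfty_norm] applies [fine], which sends an infinite norm to 0; the bounds on the second
    derivatives exclude that case. *)
Lemma weak_laplacian_bounded : 0 <= Linfty_norm L (weak_laplacian L D) /\
  {ae dx, forall x, `|weak_laplacian L D x| <= Linfty_norm L (weak_laplacian L D)}.
Proof.
have /choice[C hC] : forall i, exists C, {ae dx, forall x, `|weak_partials L [:: i; i] D x| <= C}.
  by move=> i; have [_ [C _ hC]] := @weak_partialsP [:: i; i] isT; exists C.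
have bC : {ae dx, forall x, (`|weak_laplacian L D x|%:E <= (\sum_i C i)%:E)%E}.
  have : {ae dx, forall x, forall i, `|weak_partials L [:: i; i] D x| <= C i}.
    exact: filter_forall.
  apply: filterS => x h; rewrite lee_fin /weak_laplacian.
  by apply: (le_trans (ler_norm_sum _ _ _)); apply: ler_sum => i _; exact: h.
have N0 := Lnorm_ge0 dx +oo%E (EFin \o weak_laplacian L D).
rewrite /Linfty_norm; split; first exact: fine_ge0.
move: N0; rewrite unlock dxT_gt0 => N0.
have h1 : (ess_sup_inf.ess_sup dx (abse \o (EFin \o weak_laplacian L D)) <= (\sum_i C i)%:E)%E.
  by apply/ess_sup_inf.ess_supP.
have := ess_sup_inf.ess_sup_ge dx (abse \o (EFin \o weak_laplacian L D)).
apply: filterS => x; rewrite /= -lee_fin fineK// ge0_fin_numE//.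
exact: le_lt_trans h1 (ltry _).
Qed.

Variable w : 'rV[R]_n -> R.
Hypothesis Iw : intg dx w.
Local Notation V i := (conv L (weak_partials L [:: i] D) w).
Local Notation W i := (conv L (weak_partials L [:: i; i] D) w).

Let wp_measurable s : (size s <= 2)%N -> measurable_fun setT (weak_partials L s D).
Proof. by move=> /weak_partialsP[[_ _ _ /Lfun1_integrable/intg_measurable]]. Qed.

Let wp_periodic s : (size s <= 2)%N -> periodic L (weak_partials L s D).
Proof. by move=> /weak_partialsP[[_ +]]. Qed.

Lemma drift_derive i x : is_derive x (delta_mx ord0 i : 'rV[R]_n) (V i) (W i x).
Proof.
have [_ [C C0 hC]] := @weak_partialsP [:: i] isT.
have [_ [C' C0' hC']] := @weak_partialsP [:: i; i] isT.
apply: (@conv_derive _ _ _ L0 _ _ (C + C')) => //; try exact: wp_measurable; try exact: wp_periodic.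
- by apply: filterS hC => y h; rewrite (le_trans h)// lerDl.
- by apply: filterS hC' => y h; rewrite (le_trans h)// lerDr.
- exact: addr_ge0.
- by move=> p tp; exact: weak_partials_ibp.
Qed.

Lemma drift_measurable i : measurable_fun setT (V i).
Proof. have m1 := @wp_measurable [:: i] isT; have m2 := intg_measurable Iw; exact: (@measurable_conv _ L n _ _ m1 m2). Qed.

Lemma drift_derive_measurable i : measurable_fun setT (W i).
Proof. have m1 := @wp_measurable [:: i; i] isT; have m2 := intg_measurable Iw; exact: (@measurable_conv _ L n _ _ m1 m2). Qed.

Lemma conv_periodic g : periodic L g -> periodic L (conv L g w).
Proof. by move=> pg x i; apply: eq_Rintegral => y _; rewrite addrAC pg. Qed.

Lemma drift_periodic i : periodic L (V i).
Proof. by apply: conv_periodic; exact: wp_periodic. Qed.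

Lemma drift_bounded i : exists C, forall x, `|V i x| <= C.
Proof.
have [_ [C C0 hC]] := @weak_partialsP [:: i] isT.
exists (C * \int[dx]_y `|w y|) => x.
by apply: conv_le => //; [exact: wp_measurable|exact: wp_periodic].
Qed.

Lemma drift_derive_bounded i : exists C, forall x, `|W i x| <= C.
Proof.
have [_ [C C0 hC]] := @weak_partialsP [:: i; i] isT.
exists (C * \int[dx]_y `|w y|) => x.
by apply: conv_le => //; [exact: wp_measurable|exact: wp_periodic].
Qed.

Let mlap : measurable_fun setT (weak_laplacian L D).
Proof. by apply: measurable_sum => i; exact: wp_measurable. Qed.

Let plap : periodic L (weak_laplacian L D).
Proof. by move=> x i; apply: eq_bigr => j _; exact: wp_periodic. Qed.

Lemma drift_div x : \sum_i W i x = conv L (weak_laplacian L D) w x.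
Proof.
rewrite /conv -Rint_sum; last first.
  move=> i; have [_ [C C0 hC]] := @weak_partialsP [:: i; i] isT.
  by apply: (intg_conv L0 _ _ hC) => //; [exact: wp_measurable|exact: wp_periodic].
by apply: eq_Rintegral => y _; rewrite /weak_laplacian mulr_suml.
Qed.

Lemma drift_div_le x : `|\sum_i W i x| <= Linfty_norm L (weak_laplacian L D) * \int[dx]_y `|w y|.
Proof.
by rewrite drift_div; have [_ h] := weak_laplacian_bounded; exact: conv_le.
Qed.

End potential.

(** * Energy identity for the linear drift-diffusion equation of one slice *)

Section energy.
Context {R : realType} (L : R) (n : nat).
Hypothesis L0 : 0 < L.
Local Notation dx := (dx L (d:=n)).
Local Notation e i := (delta_mx ord0 i : 'rV[R]_n).
Implicit Types (F G f : 'rV[R]_n -> R).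

Definition bmeas F := measurable_fun setT F /\ exists C, forall x, `|F x| <= C.

Lemma bmeas_intg F : bmeas F -> intg dx F.
Proof. by move=> [mF [C hC]]; apply: (intg_bdd (C := C)) => //; exact: aeW. Qed.

Lemma bmeas_cst c : bmeas (fun=> c).
Proof. by split => //; exists `|c|. Qed.

Lemma bmeasD F G : bmeas F -> bmeas G -> bmeas (fun x => F x + G x).
Proof.
move=> [mF [C hC]] [mG [C' hC']]; split; first exact: measurable_funD.
by exists (C + C') => x; rewrite (le_trans (ler_normD _ _))// lerD.
Qed.

Lemma bmeasM F G : bmeas F -> bmeas G -> bmeas (fun x => F x * G x).
Proof.
move=> [mF [C hC]] [mG [C' hC']]; split; first exact: measurable_funM.
by exists (C * C') => x; rewrite normrM ler_pM.
Qed.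

Lemma bmeasN F : bmeas F -> bmeas (fun x => - F x).
Proof.
move=> bF; rewrite (_ : (fun x => - F x) = (fun x => (-1) * F x)).
  exact: bmeasM (bmeas_cst _) bF.
by apply/funext => x; rewrite mulN1r.
Qed.

Lemma bmeasB F G : bmeas F -> bmeas G -> bmeas (fun x => F x - G x).
Proof. by move=> bF bG; exact: bmeasD bF (bmeasN bG). Qed.

Lemma bmeas_sum (I : Type) (s : seq I) (F : I -> 'rV[R]_n -> R) :
  (forall i, bmeas (F i)) -> bmeas (fun x => \sum_(i <- s) F i x).
Proof.
move=> bF; elim: s => [|a s IH].
  by under eq_fun do rewrite big_nil; exact: bmeas_cst.
by under eq_fun do rewrite big_cons; exact: bmeasD.
Qed.

Lemma bmeas_continuous F : continuous F -> periodic L F -> bmeas F.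
Proof.
move=> cF pF; split; first exact: continuous_measurable_rV.
exact: (continuous_periodic_bounded L0).
Qed.

Lemma C2P f : Ck_torus L 2 f -> [/\ periodic L f, continuous f,
  forall i x, derivable f x (e i), forall i, continuous (partial i f) &
  forall i, (forall x, derivable (partial i f) x (e i)) /\ continuous (partial i (partial i f))].
Proof.
move=> [pf [cf hf]]; split => //.
- by move=> i x; have [+ _] := hf i; exact.
- by move=> i; have [_ []] := hf i.
- by move=> i; have [_ [_ /(_ i)[? []]]] := hf i.
Qed.

Lemma is_derive_comp_rV (Phi : R -> R) f x v l k : is_derive (f x) 1 Phi l ->
  is_derive x v f k -> is_derive x v (fun z => Phi (f z)) (l * k).
Proof.
move=> dP [df fk]; apply: is_derive_of_line.
have D : is_derive (0:R) 1 (fun r : R => f (x + r *: v)) k.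
  have E : x = x + (0:R) *: v by rewrite scale0r addr0.
  by rewrite -fk [in X in 'D__ _ X]E; apply: is_derive_line; rewrite -E.
apply: (@is_derive1_comp _ Phi (fun r : R => f (x + r *: v)) 0 l k _ D).
by rewrite scale0r addr0.
Qed.

Variables (D : 'rV[R]_n -> R) (w : 'rV[R]_n -> R) (f ut : 'rV[R]_n -> R) (kappa : R).
Hypotheses (D2 : sobolev L 2 +oo%E D) (Iw : intg dx w) (f2 : Ck_torus L 2 f).
Local Notation V i := (conv L (weak_partials L [:: i] D) w).
Local Notation W i := (conv L (weak_partials L [:: i; i] D) w).
Hypothesis pde : forall x, ut x = kappa * \sum_i partial i (fun z => f z * V i z) x +
  \sum_i partials [:: i; i] f x.

Variables (Phi p dp : R -> R).
Hypotheses (dPhi : forall x, is_derive (f x) 1 Phi (p (f x)))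
  (dp1 : forall x, is_derive (f x) 1 p (dp (f x)))
  (cdp : continuous (fun x => dp (f x))).

Let bV i : bmeas (V i).
Proof. by split; [exact: drift_measurable|exact: drift_bounded]. Qed.

Let bW i : bmeas (W i).
Proof. by split; [exact: drift_derive_measurable|exact: drift_derive_bounded]. Qed.

Let bf : bmeas f. Proof. by have [pf cf _ _ _] := C2P f2; exact: bmeas_continuous. Qed.

Let bpf i : bmeas (partial i f).
Proof.
have [pf _ _ cf _] := C2P f2.
exact: (bmeas_continuous (cf i) (partial_periodic i pf)).
Qed.

Let bppf i : bmeas (partial i (partial i f)).
Proof.
have [pf _ _ _ /(_ i)[_ cf]] := C2P f2.
exact: (bmeas_continuous cf (partial_periodic i (partial_periodic i pf))).
Qed.

Let comp_continuous (q : R -> R) l : (forall x, is_derive (f x) 1 q (l x)) ->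
  continuous (fun x => q (f x)).
Proof.
move=> dq x; have [_ cf _ _ _] := C2P f2.
apply: continuous_comp; first exact: cf.
by apply: differentiable_continuous; apply/derivable1_diffP; have [] := dq x.
Qed.

Let bPhi : bmeas (fun x => Phi (f x)).
Proof.
have [pf _ _ _ _] := C2P f2; apply: bmeas_continuous; first exact: comp_continuous dPhi.
by move=> x i; rewrite pf.
Qed.

Let bp : bmeas (fun x => p (f x)).
Proof.
have [pf _ _ _ _] := C2P f2; apply: bmeas_continuous; first exact: comp_continuous dp1.
by move=> x i; rewrite pf.
Qed.

Let bdp : bmeas (fun x => dp (f x)).
Proof.
have [pf _ _ _ _] := C2P f2; apply: bmeas_continuous => //.
by move=> x i; rewrite pf.
Qed.

Let df i x : is_derive x (e i) f (partial i f x).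
Proof. by have [_ _ + _ _] := C2P f2; move=> /(_ i x)/derivableP. Qed.

Let ibp F G i : (forall x, is_derive x (e i) F (G x)) -> periodic L F -> bmeas F -> bmeas G ->
  \int[dx]_x G x = 0.
Proof.
move=> dF pF bF bG; have E : partial i F = G.
  by apply/funext => x; rewrite /partial; have [_ ->] := dF x.
have [_ [C hC]] := bG.
rewrite -E; apply: (Rint_partial_eq0 L0 (C := C) pF (bmeas_intg bF)).
- by move=> x; have [] := dF x.
- by move=> x; rewrite E.
Qed.

(** With [V] and [W] the drift component and its derivative, [p(f) d(f V)] equals
    [(p(f) f - Phi(f)) W + d(Phi(f) V)], and the last term integrates to zero. No derivative of [f]
    is left in the drift term. *)
Let ibp_drift i : \int[dx]_x (p (f x) * partial i (fun z => f z * V i z) x) =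
  \int[dx]_x ((p (f x) * f x - Phi (f x)) * W i x).
Proof.
have [pf _ _ _ _] := C2P f2.
have E x : partial i (fun z => f z * V i z) x = f x * W i x + V i x * partial i f x.
  have H : is_derive x (e i) (fun z => f z * V i z) (f x * W i x + V i x * partial i f x).
    by apply: is_deriveM; [exact: df|exact: drift_derive].
  by rewrite /partial; have [_ ->] := H.
have H x : is_derive x (e i) (fun z => Phi (f z) * V i z)
    (Phi (f x) * W i x + V i x * (p (f x) * partial i f x)).
  by apply: is_deriveM; [exact: is_derive_comp_rV|exact: drift_derive].
have b1 : bmeas (fun x => Phi (f x) * W i x + V i x * (p (f x) * partial i f x)).
  by apply: bmeasD; [exact: bmeasM|apply: bmeasM => //; exact: bmeasM].
have := ibp H _ _ b1; move=> /(_ _ _)/wrap[].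
- by move=> x j; rewrite pf (drift_periodic L0 D2).
- exact: bmeasM.
move=> I0; rewrite -[RHS]addr0 -I0 -RintD.
- by apply: eq_Rintegral => x _; rewrite E; ring.
- by apply: bmeas_intg; apply: bmeasM => //; apply: bmeasB => //; exact: bmeasM.
- exact: bmeas_intg.
Qed.

Let ibp_lap i : \int[dx]_x (p (f x) * partials [:: i; i] f x) =
  - \int[dx]_x (dp (f x) * partial i f x ^+ 2).
Proof.
have [pf _ _ _ /(_ i)[d2 _]] := C2P f2.
have H x : is_derive x (e i) (fun z => p (f z) * partial i f z)
    (p (f x) * partial i (partial i f) x + partial i f x * (dp (f x) * partial i f x)).
  apply: is_deriveM; first exact: is_derive_comp_rV.
  by have /derivableP := d2 x.
have b1 : bmeas (fun x => p (f x) * partial i (partial i f) x + partial i f x * (dp (f x) * partial i f x)).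
  by apply: bmeasD; [exact: bmeasM|apply: bmeasM => //; exact: bmeasM].
have := ibp H _ _ b1; move=> /(_ _ _)/wrap[].
- by move=> x j; rewrite pf (partial_periodic _ pf).
- exact: bmeasM.
move=> I0; apply/eqP; rewrite -subr_eq0 opprK -RintD.
- by rewrite -I0; apply/eqP; apply: eq_Rintegral => x _ /=; rewrite expr2; ring.
- by apply: bmeas_intg; exact: (bmeasM bp (bppf i)).
- by apply: bmeas_intg; apply: bmeasM => //; under eq_fun do rewrite expr2; exact: bmeasM.
Qed.

(** Used with three functions [Phi]: the identity for the mass, a smoothed absolute value for the
    sign, and the regularised entropy. The derivatives of [Phi] are asked on the range of [f] only,
    since the last of these is smooth near nonnegative arguments but not everywhere. *)
Lemma energy_identity : \int[dx]_x (p (f x) * ut x) =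
  kappa * \int[dx]_x ((p (f x) * f x - Phi (f x)) * \sum_i W i x) -
  \int[dx]_x (dp (f x) * \sum_i partial i f x ^+ 2).
Proof.
have bP i : bmeas (partial i (fun z => f z * V i z)).
  rewrite (_ : partial _ _ = fun x => f x * W i x + V i x * partial i f x).
    by apply: bmeasD; exact: bmeasM.
  apply/funext => x.
  have H : is_derive x (e i) (fun z => f z * V i z) (f x * W i x + V i x * partial i f x).
    by apply: is_deriveM; [exact: df|exact: drift_derive].
  by rewrite /partial; have [_ ->] := H.
have I1 i : intg dx (fun x => p (f x) * partial i (fun z => f z * V i z) x).
  by apply: bmeas_intg; exact: bmeasM.
have I2 i : intg dx (fun x => p (f x) * partials [:: i; i] f x).
  by apply: bmeas_intg; exact: (bmeasM bp (bppf i)).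
transitivity (\int[dx]_x (kappa * (\sum_i p (f x) * partial i (fun z => f z * V i z) x) +
   \sum_i p (f x) * partials [:: i; i] f x)).
  by apply: eq_Rintegral => x _; rewrite pde mulrDr mulrCA !mulr_sumr.
rewrite RintD; [|by apply: intgZ; exact: intg_sum|exact: intg_sum].
rewrite RintZ; last exact: intg_sum.
rewrite !Rint_sum//; congr (_ * _ + _).
- under eq_bigr do rewrite ibp_drift; rewrite -Rint_sum; last first.
    move=> i; apply: bmeas_intg; apply: bmeasM => //; apply: bmeasB => //; exact: bmeasM.
  by apply: eq_Rintegral => x _; rewrite mulr_sumr.
- under eq_bigr do rewrite ibp_lap; rewrite sumrN -Rint_sum; last first.
    by move=> i; apply: bmeas_intg; apply: bmeasM => //; under eq_fun do rewrite expr2; exact: bmeasM.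
  by congr (- _); apply: eq_Rintegral => x _; rewrite mulr_sumr.
Qed.

End energy.

(** * Logarithmic Sobolev inequality on the torus *)

Section elementary.
Context {R : realType}.
Implicit Types x : R.

(** Integral inequalities in one variable are handled below through primitives, and this comparison
    stands for the monotonicity of the integral. *)
Lemma derive_le (F G f g : R -> R) a b : a <= b ->
  (forall x, a <= x <= b -> is_derive x 1 F (f x)) ->
  (forall x, a <= x <= b -> is_derive x 1 G (g x)) ->
  (forall x, a <= x <= b -> f x <= g x) -> F b - F a <= G b - G a.
Proof.
move=> ab dF dG fg; pose H := G - F.
have dH x : a <= x <= b -> is_derive x 1 H (g x - f x).
  by move=> h; have := dF _ h; have := dG _ h => ? ?; apply: is_deriveB.
have [] := @MVT_segment _ H (fun x => g x - f x) a b ab.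
- by move=> x; rewrite in_itv/= => /andP[/ltW h1 /ltW h2]; apply: dH; rewrite h1.
- apply: derivable_within_continuous => x; rewrite in_itv/= => h.
  by have [] := dH _ h.
move=> c; rewrite in_itv/= => /fg; rewrite -subr_ge0 /H => h e.
have : 0 <= (g c - f c) * (b - a) by rewrite mulr_ge0// subr_ge0.
by rewrite -e /= !fctE; lra.
Qed.

Lemma derive_eq (F G f : R -> R) a b :
  (forall x, is_derive x 1 F (f x)) ->
  (forall x, is_derive x 1 G (f x)) -> F b - F a = G b - G a.
Proof.
move=> dF dG.
wlog ab : a b / a <= b.
  by move=> h; have [|/ltW] := leP a b => /h //; lra.
apply/eqP; rewrite eq_le !(derive_le (f := f) (g := f))//.
Qed.

Lemma ge0_of_derive (h dh : R -> R) : (forall x, 0 <= x -> is_derive x 1 h (dh x)) ->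
  (forall x, 0 <= x -> 0 <= dh x) -> h 0 = 0 -> forall x, 0 <= x -> 0 <= h x.
Proof.
move=> dd dh0 h0 x x0.
have h1 (y : R) : 0 <= y <= x -> is_derive y 1 (fun=> 0 : R) (0 : R).
  by move=> _; exact: is_derive_cst.
have h2 y : 0 <= y <= x -> is_derive y 1 h (dh y) by move=> /andP[/dd].
have h3 y : 0 <= y <= x -> 0 <= dh y by move=> /andP[/dh0].
by have := derive_le x0 h1 h2 h3; rewrite h0 !subr0.
Qed.

Lemma sin_le x : 0 <= x -> sin x <= x.
Proof.
move=> x0; rewrite -subr_ge0.
have h1 (y : R) : 0 <= y -> is_derive y 1 (fun x => x - sin x) (1 - cos y).
  by move=> _; apply: is_derive_eq.
have h2 (y : R) : 0 <= y -> 0 <= 1 - cos y by rewrite subr_ge0 cos_le1.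
by have := ge0_of_derive h1 h2; apply => //; rewrite sin0 subrr.
Qed.

Lemma cos_ge x : 0 <= x -> 1 - x ^+ 2 / 2 <= cos x.
Proof.
move=> x0; have E : cos x = 1 - 2 * sin (x / 2) ^+ 2.
  by rewrite {1}[x]splitr cosD -!expr2 cos2sin2; ring.
rewrite E lerD2l lerN2; have h0 : 0 <= x / 2 by lra.
have h1 := sin_le h0; have h2 : 0 <= x / 2 + sin (x / 2).
  have h1' (y : R) : 0 <= y -> is_derive y 1 (fun x => x + sin x) (1 + cos y).
    by move=> _; apply: is_derive_eq.
  have h2 (y : R) : 0 <= y -> 0 <= 1 + cos y by have := cos_geN1 y; lra.
  by have := ge0_of_derive h1' h2; apply => //; rewrite sin0 addr0.
by nra.
Qed.

Lemma sin_ge x : 0 <= x -> x - x ^+ 3 / 6 <= sin x.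
Proof.
move=> x0; rewrite -subr_ge0.
have h1 (y : R) : 0 <= y ->
    is_derive y 1 (fun x => sin x - (x - x ^+ 3 / 6)) (cos y - (1 - y ^+ 2 / 2)).
  by move=> _; apply: is_derive_eq; rewrite /GRing.scale/=; lra.
have h2 (y : R) : 0 <= y -> 0 <= cos y - (1 - y ^+ 2 / 2).
  by rewrite subr_ge0; exact: cos_ge.
by have := ge0_of_derive h1 h2; apply => //; rewrite sin0; lra.
Qed.

(** Serves [cubic_moment_le] as [2 * pi <= 32 / 5]. If it failed, [8 / 5] would be at most [pi / 2]
    and [cos (8 / 5) = 1 - 2 sin (4 / 5) ^ 2] nonnegative, against the cubic lower bound of the
    sine. *)
Lemma pi_lt : pi < 16 / 5 :> R.
Proof.
rewrite ltNge; apply/negP => h.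
have : 0 <= cos (8 / 5 : R) by apply: cos_ge0_pihalf; apply/andP; split; lra.
have -> : 8 / 5 = 4 / 5 + 4 / 5 :> R by lra.
rewrite cosD -!expr2 cos2sin2.
have := @sin_ge (4 / 5); move=> /(_ _)/wrap[]; first lra.
by nra.
Qed.

Lemma expR_ge3 x : 0 <= x -> 1 + x + x ^+ 2 / 2 + x ^+ 3 / 6 <= expR x.
Proof.
move=> x0.
have h2 (y : R) : 0 <= y -> 0 <= expR y - (1 + y + y ^+ 2 / 2).
  move=> y0.
  have h1 (z : R) : 0 <= z ->
      is_derive z 1 (fun x => expR x - (1 + x + x ^+ 2 / 2)) (expR z - (1 + z)).
    by move=> _; apply: is_derive_eq; rewrite /GRing.scale/=; lra.
  have h2 (z : R) : 0 <= z -> 0 <= expR z - (1 + z).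
    by rewrite subr_ge0 expR_ge1Dx.
  by have := ge0_of_derive h1 h2; apply => //; rewrite expR0; lra.
rewrite -subr_ge0.
have h1 (z : R) : 0 <= z -> is_derive z 1
    (fun x => expR x - (1 + x + x ^+ 2 / 2 + x ^+ 3 / 6)) (expR z - (1 + z + z ^+ 2 / 2)).
  by move=> _; apply: is_derive_eq; rewrite /GRing.scale/=; lra.
by have := ge0_of_derive h1 h2; apply => //; rewrite expR0; lra.
Qed.

Lemma cubic_moment_end (v d : R) : 0 <= v -> 0 <= d ->
  (1 - v / 2 - v ^+ 2 / 8) * (1 + 2 * v) + (347 / 100 * (v + d) + 4617 / 10000) * v <=
  1 + 2 * (v + d) + (2 * (v + d)) ^+ 2 / 2 + (2 * (v + d)) ^+ 3 / 6.
Proof.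
move=> v0 d0.
(* At [d = 0] the right side minus the left side is [v] times a positive quadratic in [v] whose
   minimum is near [11 / 100]; every monomial containing [d] has a nonnegative coefficient. *)
have t0 : 0 <= v * (v - 11 / 100) ^+ 2 by rewrite mulr_ge0 ?sqr_ge0.
have t1 : 0 <= v * d by rewrite mulr_ge0.
have t6 : 0 <= v * v by rewrite mulr_ge0.
have t2 : 0 <= v * v * d by rewrite mulr_ge0 ?mulr_ge0.
have t3 : 0 <= v * d * d by rewrite mulr_ge0 ?mulr_ge0.
have t4 : 0 <= d * d by rewrite mulr_ge0.
have t5 : 0 <= d * d * d by rewrite mulr_ge0 ?mulr_ge0.
lra.
Qed.

(** [m] is [sqrt (1 - v)], and the bound is its second-order Taylor polynomial, whose square exceeds
    [1 - v] by [v ^ 3 / 8 + v ^ 4 / 64]. *)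
Lemma cubic_moment_mean (m v : R) : 0 <= m -> m ^+ 2 + v = 1 -> 0 <= v ->
  m <= 1 - v / 2 - v ^+ 2 / 8.
Proof.
move=> m0 mv v0; have v1 : v <= 1 by have := sqr_ge0 m; lra.
have vv : v ^+ 2 <= v by rewrite expr2 ler_piMr.
rewrite -(@ler_pXn2r _ 2) ?nnegrE//; last lra.
have -> : m ^+ 2 = 1 - v by lra.
rewrite -subr_ge0 [leRHS](_ : _ = v ^+ 3 / 8 + v ^+ 4 / 64); last by field.
by rewrite addr_ge0// divr_ge0// exprn_ge0.
Qed.

(* Applied to the mean [m] and the variance [v] of [g = sqrt(f / avg f)], so that
   [m^2 + v = 1], with [s] a bound on [g - m]. *)
Lemma cubic_moment_le (m v s E : R) : 0 <= m -> m ^+ 2 + v = 1 -> 0 <= v <= E -> 0 <= s ->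
  s ^+ 2 <= 2 * pi * E -> m ^+ 3 + 3 * m * v + s * v <= expR (2 * E).
Proof.
move=> m0 mv /andP[v0 vE] s0 sE; have E0 : 0 <= E by exact: le_trans vE.
apply: le_trans (expR_ge3 _); last by rewrite mulr_ge0.
have sE' : s ^+ 2 <= 32 / 5 * E.
  apply: (le_trans sE); rewrite ler_wpM2r//.
  by have := pi_lt; clear; lra.
have -> : m ^+ 3 + 3 * m * v = m * (1 + 2 * v).
  have -> : m ^+ 3 = m * m ^+ 2 by rewrite exprS.
  have -> : m ^+ 2 = 1 - v by move: mv; clear; lra.
  by ring.
have h1 : m * (1 + 2 * v) <= (1 - v / 2 - v ^+ 2 / 8) * (1 + 2 * v).
  by rewrite ler_wpM2r ?addr_ge0 ?mulr_ge0//; exact: cubic_moment_mean.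
(* The inequality [2 s c <= s ^ 2 + c ^ 2] at [c = 923 / 1000]; the two coefficients are roundings
   up of [6.4 / 1.846] and [0.923 / 2]. *)
have h2 : s <= 347 / 100 * E + 4617 / 10000.
  have := sqr_ge0 (s - 923 / 1000); move: E0 sE'; clear => E0; rewrite sqrrB => h1 h2.
  have : 1846 / 1000 * s <= s ^+ 2 + (923 / 1000) ^+ 2 by lra.
  by lra.
have h3 : s * v <= (347 / 100 * E + 4617 / 10000) * v by rewrite ler_wpM2r.
apply: (le_trans (lerD h1 h3)); have -> : E = v + (E - v) by rewrite addrC subrK.
by apply: cubic_moment_end; rewrite // subr_ge0.
Qed.

Lemma FTC (F f : R -> R) a b : a <= b -> continuous f ->
  (forall x, is_derive x 1 F (f x)) ->
  \int[lebesgue_measure]_(x in `[a, b]) f x = F b - F a.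
Proof.
rewrite le_eqVlt => /predU1P[<- _ _|ab cf dF].
  by rewrite set_itv1 Rintegral_set1 subrr.
have cF : continuous F.
  by move=> x; apply: differentiable_continuous; rewrite -derivable1_diffP; have [] := dF x.
rewrite /Rintegral (@continuous_FTC2 _ f F)//=.
- by apply: continuous_subspaceT.
- split=> [x _|//|//]; first by have [] := dF x.
  + by apply: cvg_at_right_filter; exact: cF.
  + by apply: cvg_at_left_filter; exact: cF.
- by move=> x _; rewrite derive1E; have [] := dF x.
Qed.

Lemma is_derive_shift (F : R -> R) c x l : is_derive (x + c) 1 F l ->
  is_derive x 1 (fun y => F (y + c)) l.
Proof.
move=> h; have dc : is_derive x 1 (fun y : R => y + c) 1 by apply: is_derive_eq; rewrite addr0.
by have := @is_derive1_comp _ F (fun y => y + c) x l 1 h dc; rewrite mulr1.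
Qed.

Let primitive_right (f : R -> R) : continuous f -> exists F, forall x, -1 < x -> is_derive x 1 F (f x).
Proof.
move=> cf; exists (fun x => \int[lebesgue_measure]_(t in `[-1, x]) f t) => x x1.
have [||] := @continuous_FTC1_closed _ f (-1) x (x + 1) _ _ x1 (cf x).
- by lra.
- by apply: continuous_compact_integrable; [exact: segment_compact|exact: continuous_subspaceT].
by move=> h1 h2; split; [exact: h1|rewrite -derive1E; exact: h2].
Qed.

(** The integral from [-1] is a primitive to the right of [-1] only. The same construction for
    [f (- x)] covers the left side, and both, normalised to vanish at 0, agree on [(-1, 1)]. *)
Lemma primitive (f : R -> R) : continuous f -> exists F, forall x, is_derive x 1 F (f x).
Proof.
move=> cf; have [G dG] := primitive_right cf.
have cf' : continuous (fun x => f (- x)).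
  by move=> x; apply: continuous_comp; [exact: opp_continuous|exact: cf].
have [H0 dH0] := primitive_right cf'.
pose H x := - H0 (- x).
have dH x : x < 1 -> is_derive x 1 H (f x).
  move=> x1; have dn : -1 < - x by lra.
  have dc : is_derive x 1 (fun y : R => - y) (-1) by apply: is_derive_eq.
  have := @is_derive1_comp _ H0 (fun y => - y) x _ _ (dH0 _ dn) dc.
  by rewrite opprK => h; rewrite /H; apply: is_derive_eq; rewrite mulrN1 opprK.
have GH x : -1 < x < 1 -> G x - G 0 = H x - H 0.
  move=> /andP[x1 x2]; have [x0|/ltW x0] := leP 0 x.
    by apply/eqP; rewrite eq_le; apply/andP; split;
      apply: (@derive_le _ _ f f) => //;
      move=> y /andP[y0 y1]; (apply: dG || apply: dH); lra.
  suff : G 0 - G x = H 0 - H x by lra.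
  by apply/eqP; rewrite eq_le; apply/andP; split;
      apply: (@derive_le _ _ f f) => //;
      move=> y /andP[y0 y1]; (apply: dG || apply: dH); lra.
exists (fun x => if 0 <= x then G x - G 0 else H x - H 0) => x.
have dG' (y : R) : -1 < y -> is_derive y 1 (fun x => G x - G 0) (f y).
  by move=> /dG h; apply: is_derive_eq; rewrite subr0.
have dH' (y : R) : y < 1 -> is_derive y 1 (fun x => H x - H 0) (f y).
  by move=> /dH h; apply: is_derive_eq; rewrite subr0.
have [x0|x0] := leP 0 x.
  apply: near_eq_is_derive (dG' _ _); last lra.
  near=> y; case: leP => // y0; apply: GH; apply/andP; split; last lra.
  by near: y; apply: lt_nbhsr; lra.
apply: near_eq_is_derive (dH' _ _); last lra.
near=> y; rewrite ifF//; apply/negbTE; rewrite -ltNge.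
by near: y; exact: lt_nbhsl.
Unshelve. all: by end_near. Qed.

End elementary.

(** * Logarithmic Sobolev inequality on a circle of length [L] *)

Section lsi1.
Context {R : realType} (L : R) (L0 : 0 < L).
Implicit Types x : R.

Lemma primitive_period (F f : R -> R) a b : (forall x, is_derive x 1 F (f x)) ->
  (forall x, f (x + L) = f x) -> F (a + L) - F a = F (b + L) - F b.
Proof.
move=> dF fL; apply: (@is_derive_0_is_cst R (fun x => F (x + L) - F x)) => x.
have h := is_derive_shift (dF (x + L)); have h' := dF x.
by apply: is_derive_eq; rewrite fL subrr.
Qed.

(* With [t = omega tan(omega (x - mid))], [-t z^2] vanishes at both end points
   and its derivative is at most [z'^2 - omega^2 z^2]. *)
Lemma wirtinger_lt (z dz Z P : R -> R) c l w : 0 < w -> w * l < pi -> 0 < l ->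
  (forall x, is_derive x 1 z (dz x)) ->
  (forall x, is_derive x 1 Z (z x ^+ 2)) ->
  (forall x, is_derive x 1 P (dz x ^+ 2)) ->
  z c = 0 -> z (c + l) = 0 ->
  w ^+ 2 * (Z (c + l) - Z c) <= P (c + l) - P c.
Proof.
move=> w0 wl l0 dzd dZ dP z0 z1.
pose m := c + l / 2; pose t x := tan (w * (x - m)).
pose F x := - (w * t x * z x ^+ 2); pose G x := P x - w ^+ 2 * Z x.
suff : F (c + l) - F c <= G (c + l) - G c.
  by rewrite /F /G z0 z1 expr0n/= !mulr0 subrr; lra.
have hcos x : c <= x <= c + l -> cos (w * (x - m)) != 0.
  move=> /andP[h1 h2]; rewrite gt_eqF// cos_gt0_pihalf//.
  have h3 : - (l / 2) <= x - m by rewrite /m; lra.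
  have h4 : x - m <= l / 2 by rewrite /m; lra.
  have := ler_wpM2l (ltW w0) h3; have := ler_wpM2l (ltW w0) h4.
  rewrite mulrN => h5 h6; have h7 : w * (l / 2) = w * l / 2 by rewrite mulrA.
  by apply/andP; split; lra.
pose F' x := - (w * (w * (1 + t x ^+ 2)) * z x ^+ 2 + w * t x * (2 * z x * dz x)).
pose G' x := dz x ^+ 2 - w ^+ 2 * z x ^+ 2.
have dF x : c <= x <= c + l -> is_derive x 1 F (F' x).
  move=> /hcos cx; have hz := dzd x.
  have dl : is_derive x 1 (fun x => w * (x - m)) w.
    by apply: is_derive_eq; rewrite /GRing.scale/= subr0 mulr1.
  have dt : is_derive x 1 t (w * (1 + t x ^+ 2)).
    have := @is_derive1_comp _ tan (fun x => w * (x - m)) x _ _ (is_derive_tan cx) dl.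
    by rewrite cos2_tan2// mulrC.
  by rewrite /F /F'; apply: is_derive_eq; rewrite /GRing.scale/=; ring.
have dG x : c <= x <= c + l -> is_derive x 1 G (G' x).
  move=> _; have hz := dZ x; have hp := dP x.
  by rewrite /G /G'; apply: is_derive_eq; rewrite /GRing.scale/=; ring.
have FG x : c <= x <= c + l -> F' x <= G' x.
  move=> _; rewrite -subr_ge0 /F' /G'.
  by have := sqr_ge0 (dz x + w * t x * z x); congr (_ <= _); ring.
by have := derive_le _ dF dG FG; apply; rewrite lerDl ltW.
Qed.

Lemma wirtinger (z dz Z P : R -> R) c l : 0 < l ->
  (forall x, is_derive x 1 z (dz x)) ->
  (forall x, is_derive x 1 Z (z x ^+ 2)) ->
  (forall x, is_derive x 1 P (dz x ^+ 2)) ->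
  z c = 0 -> z (c + l) = 0 ->
  (pi / l) ^+ 2 * (Z (c + l) - Z c) <= P (c + l) - P c.
Proof.
move=> l0 dzd dZ dP z0 z1.
have cl : c <= c + l by rewrite lerDl ltW.
have h0 (x : R) : c <= x <= c + l -> is_derive x 1 (fun=> 0 : R) (0 : R).
  by move=> _; exact: is_derive_cst.
have dP' (x : R) : c <= x <= c + l -> is_derive x 1 P (dz x ^+ 2) by [].
have P0 : 0 <= P (c + l) - P c.
  by have := derive_le cl h0 dP'; rewrite subrr; apply => x _; exact: sqr_ge0.
rewrite leNgt; apply/negP => h; set S := (pi / l) ^+ 2 * _ in h.
set p := P (c + l) - P c in P0 h.
have S0 : 0 < S by exact: le_lt_trans h.
(* A factor below 1, for which [wirtinger_lt] gives [th ^ 2 <= p / S]; but with [x = p / S] the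
   square of [(1 + x) / 2] exceeds [x] unless [x = 1]. *)
pose th := (1 + p / S) / 2.
have q0 : 0 <= p / S by rewrite divr_ge0// ltW.
have q1 : p / S < 1 by rewrite ltr_pdivrMr// mul1r.
have t0 : 0 < th by rewrite /th; lra.
have t1 : th < 1 by rewrite /th; lra.
have pl0 : 0 < pi / l by rewrite divr_gt0// pi_gt0.
have := @wirtinger_lt z dz Z P c l (th * (pi / l)) (mulr_gt0 t0 pl0) _ l0 dzd dZ dP z0 z1.
move=> /(_ _)/wrap[].
  by rewrite -mulrA divfK ?gt_eqF// gtr_pMl// pi_gt0.
rewrite exprMn -mulrA -/S -/p.
have pS : p = (p / S) * S by rewrite divfK// gt_eqF.
rewrite {1}pS ler_pM2r// /th.
have := sqr_ge0 (1 - p / S); nra.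
Qed.

(** The difference of the values at antipodal points changes sign over half a period. Subtracting
    the common value gives a function vanishing at both ends of two intervals of length [L / 2], on
    which the Dirichlet constant is the periodic one, [(2 pi / L) ^ 2]. *)
Lemma midpoint_value (g : R -> R) : continuous g -> (forall x, g (x + L) = g x) ->
  exists c, g (c + L / 2) = g c.
Proof.
move=> cg gL; pose u x := g (x + L / 2) - g x.
have cu : continuous u.
  move=> x; apply: continuousB; last exact: cg.
  by apply: (@continuous_comp _ _ _ (fun x => x + L / 2) g); [apply: continuousD; [exact: cvg_id|exact: cst_continuous]|exact: cg].
have u1 : u (L / 2) = - u 0.
  by rewrite /u -splitr -{1}[L]add0r gL add0r opprB.
have [] := @IVT _ u 0 (L / 2) 0.
- by rewrite divr_ge0// ltW.
- exact: continuous_subspaceT.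
- rewrite u1; apply/andP; split; rewrite ?ge_min ?le_max.
    by rewrite oppr_le0; have [//|/ltW ->] := leP (u 0) 0; rewrite orbT.
  by rewrite oppr_ge0; have [//|/ltW ->] := leP 0 (u 0); rewrite orbT.
by move=> c _ /eqP; rewrite subr_eq0 => /eqP h; exists c.
Qed.

Lemma derive_pos_incr (A f : R -> R) a b : a < b -> (forall x, is_derive x 1 A (f x)) ->
  exists2 c, a <= c <= b & A b - A a = f c * (b - a).
Proof.
move=> ab dA; have [] := @MVT_segment _ A f a b (ltW ab).
  by apply: derivable_within_continuous => x _; have [] := dA x.
by move=> c; rewrite in_itv/= => h e; exists c.
Qed.

(** Write [f = M g ^ 2], so that [g ^ 2] has mean 1, and let [E] be the normalised energy of [g].
    The claim becomes: the mean of [g ^ 2 ln g] is at most [2 E]. The tangent line of [ln] at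
    [expR (2 E)] bounds it by [2 E - 1] plus [expR (- 2 E)] times the mean of [g ^ 3], so it
    suffices that this cubic moment is at most [expR (2 E)]. Expanding about the mean [m] of [g]
    leads to [cubic_moment_le]. The functions [A], [N], [I] are primitives standing for
    integrals. *)
Lemma log_sobolev1 (f df A N I : R -> R) (a M : R) :
  (forall x, 0 < f x) -> (forall x, f (x + L) = f x) -> (forall x, df (x + L) = df x) ->
  continuous df -> (forall x, is_derive x 1 f (df x)) ->
  (forall x, is_derive x 1 A (f x)) -> A (a + L) - A a = L * M ->
  (forall x, is_derive x 1 N (f x * ln (f x / M))) ->
  (forall x, is_derive x 1 I (df x ^+ 2 / f x)) ->
  N (a + L) - N a <= L ^+ 2 / (4 * pi ^+ 2) * (I (a + L) - I a).
Proof.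
move=> f0 fL dfL cdf df1 dA AM dN dI.
have pi0 := @pi_gt0 R.
have M0 : 0 < M.
  have [|c _ e] := @derive_pos_incr A f a (a + L) _ dA; first by rewrite ltrDl.
  by rewrite -(@pmulr_rgt0 _ L)// -AM e mulr_gt0// addrC addKr.
pose g x := Num.sqrt (f x / M); pose dg x := df x / (2 * M * g x).
have fM x : 0 < f x / M by rewrite divr_gt0.
have g0 x : 0 < g x by rewrite sqrtr_gt0.
have g2 x : g x ^+ 2 = f x / M by rewrite sqr_sqrtr// ltW.
have fg x : f x = M * g x ^+ 2 by rewrite g2 mulrC divfK// gt_eqF.
have dfg x : df x = 2 * M * g x * dg x by rewrite /dg mulrC divfK// gt_eqF// !mulr_gt0.
have dgd x : is_derive x 1 g (dg x).
  have d1 := df1 x; have d2 : is_derive x 1 (fun x => f x / M) (df x / M).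
    by apply: is_derive_eq; rewrite /GRing.scale/= mulr0 add0r mulrC.
  have := @is_derive1_comp _ Num.sqrt (fun x => f x / M) x _ _ (is_derive1_sqrt (fM x)) d2.
  congr (is_derive _ _ _ _); rewrite /dg -/(g x); have := g0 x => ?; field.
  by apply/andP; split; rewrite gt_eqF.
have cg : continuous g.
  by move=> x; apply: differentiable_continuous; rewrite -derivable1_diffP; have [] := dgd x.
have cdg : continuous dg.
  move=> x; apply: (@continuousM R R df (fun x => (2 * M * g x)^-1)); first exact: cdf.
  apply: continuousV; first by rewrite gt_eqF// !mulr_gt0.
  by apply: (@continuousM R R (fun=> 2 * M) g); [exact: cst_continuous|exact: cg].
have gL x : g (x + L) = g x by rewrite /g fL.
have dgL x : dg (x + L) = dg x by rewrite /dg dfL gL.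
have cX (h : R -> R) n : continuous h -> continuous (fun x => h x ^+ n).
  by move=> ch x; apply: (@continuous_comp _ _ _ h (fun y => y ^+ n)); [exact: ch|exact: exprn_continuous].
have cB (h : R -> R) k : continuous h -> continuous (fun x => h x - k).
  by move=> ch x; apply: continuousB; [exact: ch|exact: cst_continuous].
have [G dG] := primitive cg.
have [P dP] := primitive (cX _ 2 cdg).
have [C dC] := primitive (cX _ 3 cg).
pose m := (G (a + L) - G a) / L.
(* The period is made to start at a point where [g] equals its mean, so that [g - m] vanishes at
   both ends. *)
have [|x0 _] := @derive_pos_incr G g a (a + L) _ dG; first by rewrite ltrDl.
rewrite addrAC subrr add0r => hx0.
have gm : g x0 = m by rewrite /m hx0 mulfK// gt_eqF.
have m0 : 0 < m by rewrite -gm.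
rewrite (@primitive_period _ _ a x0 dN); last by move=> x; rewrite fL.
rewrite (@primitive_period _ _ a x0 dI); last by move=> x; rewrite fL dfL.
have {}AM : A (x0 + L) - A x0 = L * M by rewrite -AM; exact: (primitive_period _ _ dA).
have Gm : G (x0 + L) - G x0 = L * m.
  by rewrite (@primitive_period _ _ x0 a dG)// /m mulrC divfK// gt_eqF.
have var k Z : (forall x, is_derive x 1 Z ((g x - k) ^+ 2)) -> forall b,
    Z (b + L) - Z b = L * (1 - m ^+ 2) + L * (k - m) ^+ 2.
  move=> dZ b; rewrite (@primitive_period _ _ b x0 dZ); last by move=> x; rewrite gL.
  have dY x : is_derive x 1 (fun x => M^-1 * A x - 2 * k * G x + k ^+ 2 * x) ((g x - k) ^+ 2).
    have h1 := dA x; have h2 := dG x; apply: is_derive_eq.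
    by rewrite /GRing.scale/= fg; field; rewrite gt_eqF.
  rewrite (derive_eq _ _ dZ dY).
  have -> : M^-1 * A (x0 + L) - 2 * k * G (x0 + L) + k ^+ 2 * (x0 + L) -
        (M^-1 * A x0 - 2 * k * G x0 + k ^+ 2 * x0) =
        M^-1 * (A (x0 + L) - A x0) - 2 * k * (G (x0 + L) - G x0) + k ^+ 2 * L by ring.
  by rewrite AM Gm; field; rewrite gt_eqF.
pose v := 1 - m ^+ 2; pose E := (L / (2 * pi)) ^+ 2 * (P (x0 + L) - P x0) / L.
have [W dW] := primitive (cX _ 2 (cB _ m cg)).
have WL : W (x0 + L) - W x0 = L * v by rewrite (var _ _ dW) subrr expr0n/= mulr0 addr0.
(* Wirtinger's inequality on the two half periods where [g - g c] vanishes at the ends; replacing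
   the mean [m] by [g c] can only increase the variance. *)
have vE : v <= E.
  have [c hc] := midpoint_value cg gL.
  have [Z dZ] := primitive (cX _ 2 (cB _ (g c) cg)).
  have dz (x : R) : is_derive x 1 (fun x => g x - g c) (dg x).
    by have h := dgd x; apply: is_derive_eq; rewrite subr0.
  have L2 : 0 < L / 2 by rewrite divr_gt0.
  have := wirtinger (c := c) L2 dz dZ dP; rewrite hc subrr => /(_ erefl erefl) h1.
  have := wirtinger (c := c + L / 2) L2 dz dZ dP.
  rewrite -addrA -splitr hc gL subrr => /(_ erefl erefl) h2.
  have := var _ _ dZ c; have := @primitive_period _ _ x0 c dP (fun x => congr1 (fun y => y ^+ 2) (dgL x)).
  move=> h3 h4; rewrite -(@ler_pM2l _ (L * (2 * pi / L) ^+ 2)); last first.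
    by rewrite mulr_gt0// exprn_gt0// divr_gt0// mulr_gt0.
  have -> : L * (2 * pi / L) ^+ 2 * E = P (c + L) - P c.
    rewrite /E -h3; move: (@pi R) pi0 => q q0; field.
    by apply/andP; split; rewrite gt_eqF.
  have e : pi / (L / 2) = 2 * pi / L by move: (@pi R) => q; field; rewrite gt_eqF.
  rewrite e in h1 h2.
  apply: (@le_trans _ _ ((2 * pi / L) ^+ 2 * (Z (c + L) - Z c))).
    rewrite (mulrC L) -(mulrA (_ ^+ 2)) ler_wpM2l ?sqr_ge0// h4 lerDl.
    by rewrite mulr_ge0 ?sqr_ge0// ltW.
  by move: h1 h2; set q := (_ / L) ^+ 2; lra.
have v0 : 0 <= v.
  rewrite -(@pmulr_rge0 _ L)// -WL.
  have h0 (x : R) : x0 <= x <= x0 + L -> is_derive x 1 (fun=> 0 : R) (0 : R).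
    by move=> _; exact: is_derive_cst.
  have hW (x : R) : x0 <= x <= x0 + L -> is_derive x 1 W ((g x - m) ^+ 2) by [].
  have := derive_le _ h0 hW; rewrite subrr; apply; first by rewrite lerDl ltW.
  by move=> x _; exact: sqr_ge0.
have E0 : 0 <= E by exact: le_trans vE.
pose s := Num.sqrt (2 * pi * E).
have s2 : s ^+ 2 = 2 * pi * E by rewrite sqr_sqrtr// mulr_ge0// mulr_ge0// ltW.
have PE : P (x0 + L) - P x0 = (2 * pi / L) ^+ 2 * L * E.
  by rewrite /E; move: (@pi R) pi0 => q q0; field; apply/andP; split; rewrite gt_eqF.
have gs x : x0 <= x <= x0 + L -> g x - m <= s.
  move=> /andP[x01 x02].
  have al0 : 0 < 2 * pi / L by rewrite divr_gt0// mulr_gt0.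
  move: al0; set al := 2 * pi / L => al0.
  (* [F] vanishes at both ends, so twice [F x] is at most its total variation. The weight [al] in
     [|2 u w| <= al u ^ 2 + w ^ 2 / al] balances the two integrals, each contributing at most
     [2 pi E]. *)
  pose F x := (g x - m) ^+ 2; pose K x := al * W x + al^-1 * P x.
  have dF (y : R) : is_derive y 1 F (2 * (g y - m) * dg y).
    by have h := dgd y; rewrite /F; apply: is_derive_eq; rewrite /GRing.scale/=; ring.
  have dNF (y : R) : is_derive y 1 (fun x => - F x) (- (2 * (g y - m) * dg y)).
    by have h := dF y; apply: is_derive_eq.
  have dK (y : R) : is_derive y 1 K (al * (g y - m) ^+ 2 + al^-1 * dg y ^+ 2).
    by have h1 := dW y; have h2 := dP y; rewrite /K; apply: is_derive_eq.
  have amgm (u w : R) : `|2 * u * w| <= al * u ^+ 2 + al^-1 * w ^+ 2.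
    have h1 := sqr_ge0 (al * u - w); have h2 := sqr_ge0 (al * u + w).
    have e : al * (al * u ^+ 2 + al^-1 * w ^+ 2) = (al * u) ^+ 2 + w ^+ 2.
      by field; rewrite gt_eqF.
    rewrite -(ler_pM2l al0) e -[al in al * `|_|](gtr0_norm al0) -normrM ler_norml.
    by apply/andP; split; nra.
  have F1 : F x - F x0 <= K x - K x0.
    apply: (derive_le x01 (fun y _ => dF y) (fun y _ => dK y)) => y _.
    exact: le_trans (ler_norm _) (amgm _ _).
  have F2 : - F (x0 + L) - - F x <= K (x0 + L) - K x.
    apply: (derive_le x02 (fun y _ => dNF y) (fun y _ => dK y)) => y _.
    apply: le_trans (amgm _ _); rewrite -normrN; exact: ler_norm.
  have F0 : F x0 = 0 by rewrite /F gm subrr expr0n.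
  have FL0 : F (x0 + L) = 0 by rewrite /F gL gm subrr expr0n.
  have KL : K (x0 + L) - K x0 <= 4 * pi * E.
    have -> : K (x0 + L) - K x0 = al * (W (x0 + L) - W x0) + al^-1 * (P (x0 + L) - P x0).
      by rewrite /K; ring.
    rewrite WL PE -/al; have -> : al^-1 * (al ^+ 2 * L * E) = al * (L * E).
      by field; rewrite gt_eqF.
    have -> : 4 * pi * E = al * (L * E) + al * (L * E).
      by rewrite /al; move: (@pi R) => q; field; rewrite gt_eqF.
    by rewrite lerD2r ler_pM2l// ler_pM2l.
  have Fx : F x <= s ^+ 2 by rewrite s2; move: F1 F2 KL; rewrite F0 FL0; clear; lra.
  have [h|h] := leP (g x - m) 0; first exact: le_trans h (sqrtr_ge0 _).
  by rewrite -(@ler_sqr _ _ s) ?nnegrE ?sqrtr_ge0// ltW.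
have CE : C (x0 + L) - C x0 <= L * expR (2 * E).
  pose K x := m ^+ 3 * x + 3 * m ^+ 2 * (G x - m * x) + 3 * m * W x + s * W x.
  have dK (x : R) : is_derive x 1 K (m ^+ 3 + 3 * m ^+ 2 * (g x - m) + 3 * m * (g x - m) ^+ 2 + s * (g x - m) ^+ 2).
    have h1 := dW x; have h2 := dG x; rewrite /K; apply: is_derive_eq.
    by rewrite /GRing.scale/=; ring.
  have xL : x0 <= x0 + L by rewrite lerDl ltW.
  have h := derive_le xL (fun y _ => dC y) (fun y _ => dK y).
  apply: (le_trans (h _)) => [x /gs hx|].
    rewrite -subr_ge0; have : 0 <= (s - (g x - m)) * (g x - m) ^+ 2.
      by rewrite mulr_ge0 ?sqr_ge0 ?subr_ge0.
    by congr (_ <= _); ring.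
  have -> : K (x0 + L) - K x0 = L * (m ^+ 3 + 3 * m * v + s * v).
    transitivity (m ^+ 3 * L + 3 * m ^+ 2 * (G (x0 + L) - G x0 - m * L) + (3 * m + s) * (W (x0 + L) - W x0)).
      by rewrite /K; ring.
    by rewrite Gm WL; ring.
  rewrite ler_pM2l//; apply: cubic_moment_le (sqrtr_ge0 _) _ => //.
  - exact: ltW.
  - by rewrite /v addrC subrK.
  - by rewrite v0.
  - by rewrite -/s s2.
(* Primitive of the bound that the tangent line of [ln] gives for
   [f ln (f / M) = 2 M g ^ 2 ln g]. *)
pose K x := 2 * M * ((2 * E - 1) * (M^-1 * A x) + (expR (2 * E))^-1 * C x).
have dK (x : R) : is_derive x 1 K (2 * M * ((2 * E - 1) * (g x ^+ 2) + (expR (2 * E))^-1 * g x ^+ 3)).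
  have h1 := dA x; have h2 := dC x; rewrite /K; apply: is_derive_eq.
  by rewrite /GRing.scale/= g2; ring.
have NK : N (x0 + L) - N x0 <= K (x0 + L) - K x0.
  apply: (derive_le _ (fun y _ => dN y) (fun y _ => dK y)); first by rewrite lerDl ltW.
  move=> x _; rewrite -g2 fg lnXn//.
  have h : ln (g x) <= 2 * E - 1 + (expR (2 * E))^-1 * g x.
    have e0 := expR_gt0 (2 * E); have ge : 0 < g x / expR (2 * E) by rewrite divr_gt0.
    have := @le_ln1Dx R (g x / expR (2 * E) - 1).
    rewrite subrKC ln_div ?posrE// expRK => /(_ _)/wrap[]; first by lra.
    by rewrite [_^-1 * _]mulrC; lra.
  have : 0 <= 2 * M * g x ^+ 2 * (2 * E - 1 + (expR (2 * E))^-1 * g x - ln (g x)).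
    by rewrite !mulr_ge0 ?subr_ge0// ?sqr_ge0// ltW.
  by rewrite -mulr_natl; lra.
apply: (le_trans NK).
have dJ (x : R) : is_derive x 1 (fun x => 4 * M * P x) (df x ^+ 2 / f x).
  have h := dP x; apply: is_derive_eq; rewrite /GRing.scale/= fg dfg.
  by have := g0 x => ?; field; apply/andP; split; rewrite gt_eqF.
rewrite (derive_eq _ _ dI dJ).
have -> : 4 * M * P (x0 + L) - 4 * M * P x0 = 4 * M * (P (x0 + L) - P x0) by rewrite mulrBr.
rewrite PE.
apply: (@le_trans _ _ (2 * M * (L * (2 * E)))); last first.
  by rewrite le_eqVlt; apply/orP; left; apply/eqP; move: (@pi R) pi0 => q q0; field; apply/andP; split; rewrite gt_eqF.
have -> : K (x0 + L) - K x0 = 2 * M * ((2 * E - 1) * (M^-1 * (A (x0 + L) - A x0)) + (expR (2 * E))^-1 * (C (x0 + L) - C x0)).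
  by rewrite /K; ring.
rewrite AM ler_pM2l ?mulr_gt0//.
have -> : M^-1 * (L * M) = L by rewrite mulrC mulfK// gt_eqF.
have : (expR (2 * E))^-1 * (C (x0 + L) - C x0) <= L.
  by rewrite mulrC ler_pdivrMr// expR_gt0.
by lra.
Qed.

Lemma log_sobolev_interval (f df : R -> R) (a : R) :
  (forall x, 0 < f x) -> (forall x, f (x + L) = f x) -> (forall x, df (x + L) = df x) ->
  continuous df -> (forall x, is_derive x 1 f (df x)) ->
  let M := (\int[lebesgue_measure]_(x in `[a, (a + L)%R]) f x) / L in
  0 < M /\
  \int[lebesgue_measure]_(x in `[a, (a + L)%R]) (f x * ln (f x / M)) <=
  L ^+ 2 / (4 * pi ^+ 2) * \int[lebesgue_measure]_(x in `[a, (a + L)%R]) (df x ^+ 2 / f x).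
Proof.
move=> f0 fL dfL cdf df1 M.
have cf : continuous f.
  by move=> x; apply: differentiable_continuous; rewrite -derivable1_diffP; have [] := df1 x.
have aL : a <= a + L by rewrite lerDl ltW.
have [A dA] := primitive cf.
have AM : A (a + L) - A a = L * M by rewrite /M (FTC aL cf dA) mulrC divfK// gt_eqF.
have M0 : 0 < M.
  have [|c _ e] := @derive_pos_incr A f a (a + L) _ dA; first by rewrite ltrDl.
  by rewrite -(@pmulr_rgt0 _ L)// -AM e mulr_gt0// addrC addKr.
have cN : continuous (fun x => f x * ln (f x / M)).
  move=> x; apply: (@continuousM R R f (fun x => ln (f x / M))); first exact: cf.
  apply: (@continuous_comp _ _ _ (fun x => f x / M) (@ln R)).
    by apply: (@continuousM R R f (fun=> M^-1)); [exact: cf|exact: cst_continuous].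
  by apply: continuous_ln; rewrite divr_gt0.
have cI : continuous (fun x => df x ^+ 2 / f x).
  move=> x; apply: (@continuousM R R (fun x => df x ^+ 2) (fun x => (f x)^-1)).
    by apply: (@continuous_comp _ _ _ df (fun y => y ^+ 2)); [exact: cdf|exact: exprn_continuous].
  by apply: continuousV; [rewrite gt_eqF|exact: cf].
have [N dN] := primitive cN; have [I dI] := primitive cI.
split=> //; rewrite (FTC aL cN dN) (FTC aL cI dI).
exact: log_sobolev1 AM dN dI.
Qed.

End lsi1.

(** * Fubini for real integrals, and averages along one coordinate *)

Section fubini_Rintegral.
Context {R : realType} d1 d2 (T1 : measurableType d1) (T2 : measurableType d2).

Lemma measurable_Rint (m2 : {sigma_finite_measure set T2 -> \bar R}) (F : T1 * T2 -> R) :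
  measurable_fun setT F -> measurable_fun setT (fun x => \int[m2]_y F (x, y)).
Proof.
move=> mF; have mE : measurable_fun setT (EFin \o F) by exact/measurable_EFinP.
have mp := measurable_funepos mE; have mn := measurable_funeneg mE.
have hp := @measurable_fun_fubini_tonelli_F _ _ _ _ _ m2 _ mp (fun x => funepos_ge0 _ x).
have hn := @measurable_fun_fubini_tonelli_F _ _ _ _ _ m2 _ mn (fun x => funeneg_ge0 _ x).
rewrite (_ : (fun x => _) = fine \o (fun x => fubini_F m2 (EFin \o F)^\+ x - fubini_F m2 (EFin \o F)^\- x)%E).
  by apply: measurableT_comp => //; exact: emeasurable_funB.
apply/funext => x; rewrite /Rintegral integralE /=; congr (fine (_ - _)%E).
- by apply: eq_integral => y _; rewrite !funeposE.
- by apply: eq_integral => y _; rewrite !funenegE.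
Qed.

Lemma Rint_fubini (m1 : {finite_measure set T1 -> \bar R}) (m2 : {finite_measure set T2 -> \bar R})
    (F : T1 * T2 -> R) C : measurable_fun setT F -> (forall z, `|F z| <= C) ->
  \int[m1]_x \int[m2]_y F (x, y) = \int[m2]_y \int[m1]_x F (x, y).
Proof.
move=> mF FC.
have I2 x : intg m2 (fun y => F (x, y)).
  apply: (intg_bdd (C := C)); last by apply: aeW => y.
  by apply: measurableT_comp => //; exact: measurable_pair1.
have I1 y : intg m1 (fun x => F (x, y)).
  apply: (intg_bdd (C := C)); last by apply: aeW => x.
  by apply: measurableT_comp => //; exact: measurable_pair2.
have E : (fun z : T1 * T2 => (F z)%:E) = EFin \o F by [].
have I : (m1 \x m2)%E.-integrable setT (EFin \o F).
  apply/integrableP; split; first exact/measurable_EFinP.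
  apply: (@le_lt_trans _ _ (\int[(m1 \x m2)%E]_z (cst (C%:E)) z)%E).
    apply: ge0_le_integral => //=.
    - have mn : measurable_fun setT (fun z => `|F z|) by exact: measurableT_comp.
      exact/measurable_EFinP.
    - by move=> z _; rewrite lee_fin.
  have mT : (m1 \x m2)%E setT = (m1 setT * m2 setT)%E.
    by rewrite -[in LHS]setXTT product_measure1E.
  rewrite (@integral_cst _ _ _ (m1 \x m2)%E _ measurableT) [X in (_ * X)%E](_ : _ = (m1 setT * m2 setT)%E); last exact: mT.
  rewrite -(fineK (fin_num_measure m1 _ measurableT)).
  by rewrite -(fineK (fin_num_measure m2 _ measurableT)) -!EFinM ltry.
have := Fubini I => /(congr1 fine); rewrite /Rintegral.
congr (_ = _); congr fine; apply: eq_integral => x _; rewrite fineK//.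
- exact: integrable_fin_num (I2 x).
- exact: integrable_fin_num (I1 x).
Qed.

End fubini_Rintegral.

Section average.
Context {R : realType} (L : R) (n : nat).
Hypothesis L0 : 0 < L.
Local Notation dx := (dx L (d:=n)).
Local Notation dr := (Defs.dx L (d:=1)).
Local Notation e i := (delta_mx ord0 i : 'rV[R]_n).
Implicit Types (F G f : 'rV[R]_n -> R).
Local Notation bmeas := (@bmeas R n).

Lemma Rint_dx1 (g : R -> R) : measurable_fun setT g ->
  \int[dr]_r g (r ord0 ord0) = \int[lebesgue_measure]_(s in `[- (L / 2), L / 2]) g s.
Proof.
move=> mg; have mE : measurable_fun setT (EFin \o g) by exact/measurable_EFinP.
have H (G : R -> \bar R) : measurable_fun setT G -> (forall x, 0 <= G x)%E ->
    (\int[dr]_r G (r ord0 ord0) = \int[lebesgue_measure]_(s in `[(- (L / 2))%R, (L / 2)%R]) G s)%E.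
  move=> mG G0; rewrite ge0_integral_dxS//; last first.
    by apply: measurableT_comp mG _; exact: measurable_coord.
  apply: eq_integral => s _; under eq_integral do rewrite cons_rV_head/=.
  rewrite (@integral_cst _ _ _ (Defs.dx L (d:=0)) _ measurableT).
  rewrite [X in (_ * X)%E](_ : _ = 1%E) ?mule1//.
  by have := dx_setT 0 (ltW L0); rewrite expr0.
rewrite /Rintegral integralE [in RHS]integralE; congr (fine (_ - _)%E).
- rewrite -H; [|exact: measurable_funepos|by move=> x; exact: funepos_ge0].
  by apply: eq_integral => y _; rewrite !funeposE.
- rewrite -H; [|exact: measurable_funeneg|by move=> x; exact: funeneg_ge0].
  by apply: eq_integral => y _; rewrite !funenegE.
Qed.

(** The parameter runs over the one-dimensional torus ['rV_1] instead of an interval, so that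
    translation invariance and Fubini for finite measures apply to it directly. *)
Definition avg i F x := L^-1 * \int[dr]_r F (x + r ord0 ord0 *: e i).

Lemma measurable_line i : measurable_fun setT (fun p : 'rV[R]_n * 'rV[R]_1 => p.1 + p.2 ord0 ord0 *: e i).
Proof.
apply/measurable_fun_rVP => j; under eq_fun do rewrite !mxE.
apply: measurable_funD; first exact: (measurableT_comp (measurable_coord j) measurable_fst).
apply: measurable_funM => //.
exact: (measurableT_comp (measurable_coord ord0) measurable_snd).
Qed.

Lemma measurable_Rint_line i F : measurable_fun setT F ->
  measurable_fun setT (fun x : 'rV[R]_n => \int[dr]_r F (x + r ord0 ord0 *: e i)).
Proof.
move=> mF; have h := measurableT_comp mF (measurable_line i).
exact: (@measurable_Rint _ _ _ _ _ dr _ h).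
Qed.

Lemma fine_dr : fine (dr setT) = L.
Proof. by rewrite dx_setT ?ltW// expr1. Qed.

Lemma bmeas_line i F x : bmeas F -> intg dr (fun r => F (x + r ord0 ord0 *: e i)).
Proof.
move=> [mF [C hC]]; apply: (intg_bdd (C := C)); last exact: aeW.
have := measurableT_comp mF (measurable_line i) => h.
exact: (measurableT_comp h (measurable_pair1 x)).
Qed.

Lemma le_avg i F G x : bmeas F -> bmeas G -> (forall x, F x <= G x) -> avg i F x <= avg i G x.
Proof.
move=> bF bG FG; rewrite ler_pM2l ?invr_gt0//.
by apply: Rint_ae_le; [exact: bmeas_line..|exact: aeW].
Qed.

Lemma avg_cst i c x : avg i (fun=> c) x = c.
Proof. by rewrite /avg Rint_cst fine_dr mulrC mulfK// gt_eqF. Qed.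

Lemma bmeas_avg i F : bmeas F -> bmeas (avg i F).
Proof.
move=> bF; have [mF [C hC]] := bF; split.
  apply: measurable_funM => //.
  exact: measurable_Rint_line.
exists C => x; rewrite ler_norml; apply/andP; split.
  rewrite -[X in X <= _](avg_cst i (-C) x); apply: le_avg => //; first exact: bmeas_cst.
  by move=> y; have := hC y; rewrite ler_norml => /andP[].
rewrite -[X in _ <= X](avg_cst i C x); apply: le_avg => //; first exact: bmeas_cst.
by move=> y; have := hC y; rewrite ler_norml => /andP[].
Qed.

Lemma avg_periodic i F : periodic L F -> periodic L (avg i F).
Proof.
move=> pF x j; congr (_ * _); apply: eq_Rintegral => r _.
by rewrite addrAC pF.
Qed.

Lemma Rint_avg i F : bmeas F -> periodic L F -> \int[dx]_x avg i F x = \int[dx]_x F x.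
Proof.
move=> bF pF; have [mF [C hC]] := bF; rewrite RintZ; last first.
  have [m1 [C' h1]] := bmeas_avg i bF.
  apply: (intg_bdd (C := L * C')); first exact: measurable_Rint_line.
  apply: aeW => x; have := h1 x; rewrite /avg normrM gtr0_norm ?invr_gt0//.
  by rewrite mulrC ler_pdivrMr// mulrC.
rewrite (@Rint_fubini _ _ _ _ _ _ _ (fun p : 'rV[R]_n * 'rV[R]_1 => F (p.1 + p.2 ord0 ord0 *: e i)) C)//; last first.
  exact: (measurableT_comp mF (measurable_line i)).
under eq_Rintegral do rewrite /= Rint_translate//.
by rewrite Rint_cst fine_dr mulrC mulfK// gt_eqF.
Qed.

Lemma avg_invariant i F x s : bmeas F -> periodic L F -> avg i F (x + s *: e i) = avg i F x.
Proof.
move=> [mF _] pF; congr (_ * _).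
pose a : 'rV[R]_1 := const_mx s.
rewrite -[RHS](@Rint_translate _ L 1 L0 a (fun r : 'rV[R]_1 => F (x + r ord0 ord0 *: e i))).
- by apply: eq_Rintegral => r _; rewrite !mxE scalerDl addrA addrAC.
- have := measurableT_comp mF (measurable_line i) => h.
  exact: (measurableT_comp h (measurable_pair1 x)).
- by move=> r j; rewrite !mxE !ord1 eqxx mulr1 scalerDl addrA pF.
Qed.

Lemma avg_shift i j F x s : (forall x s, F (x + s *: e j) = F x) ->
  avg i F (x + s *: e j) = avg i F x.
Proof. by move=> h; congr (_ * _); apply: eq_Rintegral => r _; rewrite addrAC h. Qed.

Lemma avgMr i F G x : bmeas F -> (forall x s, G (x + s *: e i) = G x) ->
  avg i (fun x => F x * G x) x = avg i F x * G x.
Proof.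
move=> bF h; rewrite /avg -mulrA [X in _ = _ * X]mulrC -(RintZ _ (bmeas_line i x bF)).
by congr (_ * _); apply: eq_Rintegral => r _; rewrite h mulrC.
Qed.

Lemma avg_between i F a b : bmeas F -> (forall x, a <= F x <= b) -> forall x, a <= avg i F x <= b.
Proof.
move=> bF ab x; rewrite -[X in X <= _](avg_cst i a x) -[X in _ && (_ <= X)](avg_cst i b x).
by apply/andP; split; apply: le_avg => //; (exact: bmeas_cst || by move=> y; have /andP[] := ab y).
Qed.

End average.

(** * Tensorisation of the logarithmic Sobolev inequality *)

Section log_sobolev.
Context {R : realType} (L : R) (n : nat).
Hypothesis L0 : 0 < L.
Local Notation dx := (dx L (d:=n)).
Local Notation e i := (delta_mx ord0 i : 'rV[R]_n).
Implicit Types (F G : 'rV[R]_n -> R).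
Local Notation bmeas := (@bmeas R n).

Definition bpos F := bmeas F /\ exists2 a, 0 < a & forall x, a <= F x.

Lemma bpos_gt0 F x : bpos F -> 0 < F x.
Proof. by move=> [_ [a a0 h]]; exact: lt_le_trans (h x). Qed.

Lemma bposV F : bpos F -> bpos (fun x => (F x)^-1).
Proof.
move=> bF; have [[mF [C hC]] [a a0 ha]] := bF.
have F0 x := bpos_gt0 x bF.
have C0 : 0 < C by exact: lt_le_trans (F0 0) (le_trans (ler_norm _) (hC 0)).
split; last first.
  exists C^-1; first by rewrite invr_gt0.
  by move=> x; rewrite lef_pV2 ?posrE//; exact: le_trans (ler_norm _) (hC x).
split; last first.
  exists a^-1 => x; rewrite gtr0_norm ?invr_gt0//.
  by rewrite lef_pV2 ?posrE.
rewrite (_ : (fun x => (F x)^-1) = fun x => expR (- ln (F x))).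
  have mln : measurable_fun setT (fun x => ln (F x)).
    by apply: measurableT_comp => //; exact: measurable_ln.
  by apply: measurableT_comp => //; exact: measurable_funN.
by apply/funext => x; rewrite expRN lnK// posrE.
Qed.

Lemma bpos_ln F : bpos F -> bmeas (fun x => ln (F x)).
Proof.
move=> bF; have [[mF [C hC]] [a a0 ha]] := bF.
have F0 x := bpos_gt0 x bF.
have FC x : F x <= C by exact: le_trans (ler_norm _) (hC x).
split; first by apply: measurableT_comp => //; exact: measurable_ln.
exists (`|ln a| + `|ln C|) => x; have h1 : ln a <= ln (F x) by rewrite ler_ln ?posrE.
have h2 : ln (F x) <= ln C by rewrite ler_ln ?posrE//; exact: lt_le_trans (FC x).
have := ler_norm (ln C); have := ler_norm (- ln a); rewrite normrN => h3 h4.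
have := normr_ge0 (ln C); have := normr_ge0 (ln a) => h5 h6.
by rewrite ler_norml; apply/andP; split; lra.
Qed.

Lemma bposM F G : bpos F -> bpos G -> bpos (fun x => F x * G x).
Proof.
move=> [bF [a a0 ha]] [bG [b b0 hb]]; split; first exact: bmeasM.
exists (a * b); first exact: mulr_gt0.
by move=> x; apply: ler_pM; rewrite ?ha ?hb ?ltW.
Qed.

Lemma bpos_avg i F : bpos F -> bpos (avg L i F).
Proof.
move=> [bF [a a0 ha]]; split; first exact: bmeas_avg.
exists a => // x; have [mF [C hC]] := bF.
have h y : a <= F y <= C by rewrite ha/=; exact: le_trans (ler_norm _) (hC y).
by have /andP[] := avg_between L0 i bF h x.
Qed.

Variable f : 'rV[R]_n -> R.
Hypotheses (cf : continuous f) (pf : periodic L f) (f0 : forall x, 0 < f x).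
Hypotheses (df : forall i x, derivable f x (e i)) (cdf : forall i, continuous (partial i f)).

Let bf : bpos f.
Proof.
split; first exact: (bmeas_continuous L0).
have cV : continuous (fun x => (f x)^-1).
  by move=> x; apply: continuousV; [rewrite gt_eqF|exact: cf].
have pV : periodic L (fun x => (f x)^-1) by move=> x i; rewrite pf.
have [C hC] := continuous_periodic_bounded L0 cV pV.
have C0 : 0 < C.
  by apply: lt_le_trans (hC 0); rewrite gtr0_norm ?invr_gt0.
exists C^-1; first by rewrite invr_gt0.
by move=> x; rewrite -[f x]invrK lef_pV2 ?posrE ?invr_gt0// (le_trans (ler_norm _) (hC x)).
Qed.

Let I i x := partial i f x ^+ 2 / f x.

Let bI i : bmeas (I i).
Proof.
apply: bmeasM; last by case: (bposV bf).
have b : bmeas (partial i f).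
  by apply: (bmeas_continuous L0); [exact: cdf|exact: partial_periodic].
by under eq_fun do rewrite expr2; exact: bmeasM.
Qed.

Let pI i : periodic L (I i).
Proof. by move=> x j; rewrite /I pf (partial_periodic i pf). Qed.

Let bent F : bpos F -> bmeas (fun x => f x * ln (f x / F x)).
Proof.
move=> bF; apply: bmeasM; first by case: bf.
by apply: bpos_ln; apply: bposM => //; exact: bposV.
Qed.

Let log_sobolev_line i x :
  avg L i (fun x => f x * ln (f x / avg L i f x)) x <= L ^+ 2 / (4 * pi ^+ 2) * avg L i (I i) x.
Proof.
pose g r := f (x + r *: e i); pose dg r := partial i f (x + r *: e i).
have dgd (r : R) : is_derive r 1 g (dg r) by apply: is_derive_line; exact: df.
have gp r : g (r + L) = g r by rewrite /g scalerDl addrA pf.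
have dgp r : dg (r + L) = dg r.
  by rewrite /dg scalerDl addrA (partial_periodic i pf).
have cl : continuous (fun r : R => x + r *: e i).
  move=> r; apply: (@cvgD _ _ _ _ _ (fun=> x) (fun r : R => r *: e i)); first exact: cvg_cst.
  by apply: cvgZr_tmp; exact: cvg_id.
have cdg : continuous dg.
  by move=> r; apply: continuous_comp; [exact: cl|exact: cdf].
have cg : continuous g.
  by move=> r; apply: continuous_comp; [exact: cl|exact: cf].
have eL : - (L / 2) + L = L / 2 by lra.
have := @log_sobolev_interval _ _ L0 g dg (- (L / 2)) (fun r => f0 _) gp dgp cdg dgd.
rewrite /= eL; set M := _ / L => -[M0].
have mg := continuous_measurable_fun cg; have mdg := continuous_measurable_fun cdg.
have EM : avg L i f x = M by rewrite /avg (@Rint_dx1 _ L L0 g)// mulrC.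
have mgM : measurable_fun setT (fun r => g r * ln (g r / M)).
  apply: measurable_funM => //; apply: measurableT_comp; first exact: measurable_ln.
  exact: measurable_funM.
have mI : measurable_fun setT (fun r => dg r ^+ 2 / g r).
  apply: measurable_funM; first exact: measurable_funX.
  apply: continuous_measurable_fun => r; apply: continuousV; last exact: cg.
  by rewrite gt_eqF// f0.
rewrite -(Rint_dx1 L0 mgM) -(Rint_dx1 L0 mI) => h.
rewrite /avg mulrCA ler_pM2l ?invr_gt0//; move: h; congr (_ <= _).
apply: eq_Rintegral => r _; rewrite -/(avg L i f _) avg_invariant ?EM//.
exact: bf.1.
Qed.

Let log_sobolev_dir i :
  \int[dx]_x (f x * ln (f x / avg L i f x)) <= L ^+ 2 / (4 * pi ^+ 2) * \int[dx]_x I i x.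
Proof.
have ba := bpos_avg i bf; have bE := bent ba.
rewrite -(Rint_avg L0 i bE); last first.
  by move=> x j; rewrite pf (avg_periodic i pf).
rewrite -(Rint_avg L0 i (bI i) (pI i)) -(RintZ _ (bmeas_intg L (bmeas_avg L0 i (bI i)))).
apply: Rint_ae_le; first exact: (bmeas_intg L (bmeas_avg L0 i bE)).
- exact: (intgZ _ (bmeas_intg L (bmeas_avg L0 i (bI i)))).
- by apply: aeW => x; exact: log_sobolev_line.
Qed.

Let favg (s : seq 'I_n) := foldr (@avg R L n) f s.

Let favg_spec s : [/\ bpos (favg s), periodic L (favg s),
  \int[dx]_x favg s x = \int[dx]_x f x &
  forall i x r, i \in s -> favg s (x + r *: e i) = favg s x].
Proof.
elim: s => [|i s [b p h inv]] //=; split.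
- exact: bpos_avg.
- exact: avg_periodic.
- by rewrite Rint_avg//; exact: b.1.
- move=> j x r; rewrite inE => /predU1P[->|js]; first by apply: avg_invariant => //; exact: b.1.
  by apply: avg_shift => y t; exact: inv.
Qed.

(* Subadditivity of the entropy: averaging successively over the coordinates,
   [f ln u <= f ln (f / E_i f) + (u E_i f - f)] with [u = g / E_i g] and the
   last bracket integrates to zero. *)
Let log_sobolev_seq s : \int[dx]_x (f x * ln (f x / favg s x)) <=
  L ^+ 2 / (4 * pi ^+ 2) * \sum_(i <- s) \int[dx]_x I i x.
Proof.
elim: s => [|i s IH] /=.
  rewrite big_nil mulr0 (_ : (fun x => _) = fun=> 0) ?Rint_cst ?mul0r//.
  by apply/funext => x; rewrite divff ?gt_eqF// ln1 mulr0.
have [bg pg _ _] := favg_spec s; set g := favg s in bg pg IH *.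
have ba := bpos_avg i bg; have bfa := bpos_avg i bf.
rewrite big_cons mulrDr addrC.
have bu : bpos (fun x => g x / avg L i g x) by apply: bposM => //; exact: bposV.
have b1 := bent bg; have b3 := bent bfa.
have b2 : bmeas (fun x => f x * ln (g x / avg L i g x)) by apply: bmeasM; [exact: bf.1|exact: bpos_ln].
have -> : \int[dx]_x (f x * ln (f x / avg L i g x)) =
    \int[dx]_x (f x * ln (f x / g x)) + \int[dx]_x (f x * ln (g x / avg L i g x)).
  rewrite -RintD; [|exact: bmeas_intg..].
  apply: eq_Rintegral => x _; rewrite -mulrDr -lnM ?posrE ?divr_gt0 ?(bpos_gt0 _ bg) ?(bpos_gt0 _ ba)//.
  by rewrite mulrA divfK// gt_eqF// (bpos_gt0 _ bg).
apply: lerD => //; apply: le_trans (log_sobolev_dir i).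
pose h x := avg L i f x / avg L i g x.
have bh : bpos h by apply: bposM => //; exact: bposV.
have hinv x r : h (x + r *: e i) = h x.
  by rewrite /h (avg_invariant L0 i x r bf.1 pf) (avg_invariant L0 i x r bg.1 pg).
have bgh := bmeasM bg.1 bh.1.
(* [h] does not vary along coordinate [i], so it leaves the average of [g h] and cancels against the
   average of [g]. *)
have E : \int[dx]_x (g x * h x) = \int[dx]_x f x.
  rewrite -(Rint_avg L0 i bgh); last first.
    by move=> x j; rewrite /h pg (avg_periodic i pf) (avg_periodic i pg).
  rewrite -(Rint_avg L0 i bf.1 pf); apply: eq_Rintegral => x _.
  rewrite (avgMr L _ bg.1 hinv) /h mulrCA mulfV ?mulr1// gt_eqF//; exact: bpos_gt0.
have -> : \int[dx]_x (f x * ln (f x / avg L i f x)) =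
    \int[dx]_x (f x * ln (f x / avg L i f x)) + (\int[dx]_x (g x * h x) - \int[dx]_x f x).
  by rewrite E subrr addr0.
have If := bmeas_intg L bf.1.
rewrite -RintB//; last exact: bmeas_intg.
rewrite -RintD; [|exact: bmeas_intg|apply: intgB => //; exact: bmeas_intg].
apply: Rint_ae_le; first exact: bmeas_intg.
  by apply: intgD; [exact: bmeas_intg|apply: intgB => //; exact: bmeas_intg].
apply: aeW => x.
have u0 := bpos_gt0 x bu; have a0 := bpos_gt0 x bfa.
have := @le_ln1Dx R (g x / avg L i g x * avg L i f x / f x - 1).
have q0 : 0 < g x / avg L i g x * avg L i f x / f x by rewrite divr_gt0// mulr_gt0.
rewrite subrKC => /(_ _)/wrap[]; first by lra.
rewrite -mulrA lnM ?posrE// ?divr_gt0// !ln_div ?posrE ?(bpos_gt0 _ bg) ?(bpos_gt0 _ ba)//.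
move=> h1; have := ler_wpM2l (ltW (f0 x)) h1; rewrite !(mulrDr (f x)) mulrN1.
rewrite /h.
have -> : f x * (g x / avg L i g x * (avg L i f x / f x)) = g x * (avg L i f x / avg L i g x).
  by field; rewrite !gt_eqF//; exact: bpos_gt0.
by lra.
Qed.

Lemma rV_sum_delta (x : 'rV[R]_n) : x = \sum_i x ord0 i *: e i.
Proof.
apply/rowP => j; rewrite summxE (bigD1 j)//= !mxE !eqxx mulr1 big1 ?addr0// => i ij.
by rewrite !mxE (eq_sym j) (negbTE ij) mulr0.
Qed.

(** After averaging over all coordinates the function is invariant under every translation, hence
    equal to the mean [m]. The directional Fisher informations add up, so the constant of the circle
    is kept in every dimension. *)
Theorem log_sobolev : let m := (\int[dx]_x f x) / L ^+ n in
  0 < m /\ \int[dx]_x (f x * ln (f x / m)) <=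
    L ^+ 2 / (4 * pi ^+ 2) * \int[dx]_x (\sum_i partial i f x ^+ 2 / f x).
Proof.
move=> m; have [b p hI inv] := favg_spec (enum 'I_n).
have cst x : favg (enum 'I_n) x = favg (enum 'I_n) 0.
  rewrite (rV_sum_delta x); elim/big_rec: _ => // i y _ IH.
  by rewrite addrC inv ?mem_enum.
have Em : favg (enum 'I_n) 0 = m.
  rewrite /m -hI; under eq_Rintegral do rewrite cst.
  rewrite Rint_cst [X in _ * fine X](_ : _ = (L ^+ n)%:E); last exact: (dx_setT n (ltW L0)).
  by rewrite mulfK// expf_neq0// gt_eqF.
split; first by rewrite -Em; exact: bpos_gt0.
have := log_sobolev_seq (enum 'I_n).
under eq_Rintegral do rewrite cst Em.
rewrite big_enum/= -Rint_sum//; first by move=> i; exact: bmeas_intg.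
Qed.

End log_sobolev.

(** * Averages over equators *)

Section hatbox.
Context {R : realType}.
Local Notation leb := (@lebesgue_measure R).

Lemma asin1 : asin 1 = pi / 2 :> R.
Proof. by rewrite -[X in asin X]sin_pihalf sinK// in_itv/=; have := @pi_gt0 R; lra. Qed.

Lemma asin0 : asin 0 = 0 :> R.
Proof. by rewrite -[X in asin X]sin0 sinK// in_itv/=; have := @pi_gt0 R; lra. Qed.

(** Both arcsines in the antiderivative [Q] below reach 1 at the upper end, where differentiability
    is lost and only this limit from below remains. *)
Lemma cvg_asin1 {T : Type} (F : set_system T) {FF : Filter F} (f : T -> R) :
  f @ F --> (1 : R) -> (\forall t \near F, f t < 1) -> asin (f t) @[t --> F] --> pi / 2.
Proof.
move=> f1 flt; have pi0 := @pi_gt0 R.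
have : {within `[sin (- (pi / 2)), sin (pi / 2)], continuous (@asin R)}.
  apply: segment_can_le_continuous; first lra.
  - exact/continuous_subspaceT/continuous_sin.
  - by move=> x hx; exact: sinK.
rewrite sinN sin_pihalf => /continuous_within_itvP; rewrite asin1 => -[|_ _ h]; first lra.
apply/cvgrPdist_lt => e e0.
move/cvgrPdist_lt : h => /(_ e e0) h.
have h' := f1 _ h; near=> t; have : f t < 1 by near: t.
by near: t; exact: h'.
Unshelve. all: by end_near. Qed.

Lemma ge0_integral_reflect_itv (a b : R) G :
  measurable_fun setT G -> (forall x, (0 <= G x)%E) ->
  (\int[leb]_(x in `[(- b)%R, (- a)%R]) G (- x)%R = \int[leb]_(x in `[a, b]) G x)%E.
Proof.
move=> mG G0.
transitivity (\int[pushforward leb (-%R : _ -> measurableTypeR R)]_(x in `[a, b]) G x)%E.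
  rewrite ge0_integral_pushforward//=; last exact: measurable_funTS.
  congr (integral _ _ _); apply/seteqP; split => x /=; rewrite !in_itv/= => /andP[? ?]; apply/andP; split; lra.
by apply: eq_measure_integral => A mA _; exact: lebesgue_measureN.
Qed.

Section ray.
Variable w : R.
Hypotheses (w0 : 0 < w) (w1 : w < 1).
Let s := Num.sqrt (1 - w ^+ 2).
Local Ltac wlra := have ? := w0; have ? := w1; lra.
Let w2 : 0 < 1 - w ^+ 2. Proof. by have ? := w0; have ? := w1; nra. Qed.
Let s0 : 0 < s. Proof. by rewrite sqrtr_gt0. Qed.
Let s2 : s ^+ 2 = 1 - w ^+ 2. Proof. by rewrite sqr_sqrtr// ltW. Qed.

(** Half the length of the set of [z] with [w < sqrt (1 - z ^ 2) * a], as [uniform_ray] shows. The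
    maximum makes it continuous in [a] and equal to 0 for [a <= w]. *)
Let m (a : R) := Num.sqrt (1 - (w / Num.max a w) ^+ 2).

Let cm : continuous m.
Proof.
move=> a; apply: (@continuous_comp _ _ _ (fun a => 1 - (w / Num.max a w) ^+ 2) (@Num.sqrt R)); last exact: sqrt_continuous.
apply: continuousB; first exact: cst_continuous.
apply: (@continuous_comp _ _ _ (fun a => w / Num.max a w) (fun y => y ^+ 2)); last exact: exprn_continuous.
apply: (@continuousM R R (fun=> w) (fun a => (Num.max a w)^-1)); first exact: cst_continuous.
apply: continuousV; first by rewrite gt_eqF// lt_max w0 orbT.
by apply: continuous_max; [exact: cvg_id|exact: cst_continuous].
Qed.

(** With [r = sqrt (1 - (w / cos t) ^ 2)] one has [r = 1 / r - w ^ 2 / (r cos t ^ 2)]: the first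
    arcsine integrates [1 / r], the second [w / (r cos t ^ 2)]. *)
Let Q (t : R) := asin (sin t / s) - w * asin (w * tan t / s).

Let t0 := acos w.
Let t0_gt0 : 0 < t0. Proof. by apply: acos_gt0; apply/andP; split => //; wlra. Qed.
Let cost0 : cos t0 = w. Proof. by rewrite acosK// in_itv/=; apply/andP; split; wlra. Qed.
Let t0pi : t0 < pi / 2.
Proof.
rewrite ltNge; apply/negP => h; have pi0 := @pi_gt0 R.
have := @ltr_cos R t0 (pi / 2); rewrite !in_itv/= cos_pihalf cost0 => /(_ _ _)/wrap[].
- by rewrite acos_ge0 ?acos_lepi//; apply/andP; split; wlra.
- by apply/andP; split; lra.
by rewrite w0 ltNge h.
Qed.

Let cos_gt t : 0 <= t < t0 -> w < cos t.
Proof.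
move=> /andP[h1 h2]; have pi0 := @pi_gt0 R; rewrite -cost0 ltr_cos ?in_itv//=.
  by apply/andP; split; have := t0pi; have := t0_gt0; lra.
by apply/andP; split; have := t0pi; lra.
Qed.

Let sin_lt t : 0 <= t < t0 -> sin t < s.
Proof.
move=> h; have := cos_gt h; have := cos2Dsin2 t => e c.
have [|sg] := leP (sin t) 0; first by move=> /le_lt_trans; apply; exact: s0.
rewrite -ltr_sqr ?nnegrE; [|exact: ltW|exact: ltW].
by rewrite s2; have := w0; nra.
Qed.

Let tan_lt t : 0 <= t < t0 -> w * tan t / s < 1.
Proof.
move=> h; have c := cos_gt h; have si := sin_lt h.
rewrite ltr_pdivrMr; last exact: s0.
rewrite mul1r /tan mulrA ltr_pdivrMr; last exact: lt_trans c.
have := w0; have := s0; nra.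
Qed.

Let dQ t : 0 < t < t0 -> is_derive t 1 Q (m (cos t)).
Proof.
move=> /andP[tg tl]; have h : 0 <= t < t0 by rewrite ltW.
have c := cos_gt h; have si := sin_lt h; have ta := tan_lt h.
have c0 : 0 < cos t by exact: lt_trans c.
have sg : 0 <= sin t by apply: sin_ge0_pi; have := @pi_gt0 R; have := t0pi; move=> ? ?; apply/andP; split; lra.
have cs := cos2Dsin2 t.
have -> : m (cos t) = Num.sqrt (1 - (w / cos t) ^+ 2).
  by rewrite /m; congr (Num.sqrt (1 - (_ / _) ^+ 2)); apply/max_idPl; exact: ltW.
have q0 : 0 < 1 - (w / cos t) ^+ 2.
  by rewrite subr_gt0 expr_div_n ltr_pdivrMr ?exprn_gt0// mul1r ltr_sqr ?nnegrE// ltW// w0.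
set r := Num.sqrt _; have r0 : 0 < r by rewrite sqrtr_gt0.
have r2 : r ^+ 2 = 1 - (w / cos t) ^+ 2 by rewrite sqr_sqrtr// ltW.
have d1 : is_derive t 1 (fun t => asin (sin t / s)) (r^-1).
  have a1 : -1 < sin t / s < 1.
    rewrite ltr_pdivrMr// mul1r si andbT; apply: lt_le_trans (_ : 0 <= _); first lra.
    by rewrite divr_ge0// ltW.
  have b1 : is_derive t 1 (fun t => sin t / s) (cos t / s).
    by apply: is_derive_eq; rewrite /GRing.scale/= mulr0 add0r mulrC.
  have := @is_derive1_comp _ asin (fun t => sin t / s) t _ _ (is_derive1_asin a1) b1.
  have -> : 1 - (sin t / s) ^+ 2 = (cos t * r / s) ^+ 2.
    rewrite !expr_div_n exprMn r2; apply: (@mulIf _ (s ^+ 2)); first by rewrite gt_eqF// exprn_gt0.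
    rewrite mulrBl !divfK ?gt_eqF ?exprn_gt0// mul1r s2 expr_div_n.
    have -> : sin t ^+ 2 = 1 - cos t ^+ 2 by rewrite -cs; ring.
    by field; rewrite gt_eqF.
  rewrite sqrtr_sqr gtr0_norm ?divr_gt0 ?mulr_gt0//.
  by congr (is_derive _ _ _ _); field; rewrite !gt_eqF.
have d2 : is_derive t 1 (fun t => asin (w * tan t / s)) (w / (r * cos t ^+ 2)).
  have a1 : -1 < w * tan t / s < 1.
    rewrite ta andbT; apply: lt_le_trans (_ : 0 <= _); first lra.
    have tt : 0 <= tan t by rewrite /tan divr_ge0// ltW.
    by apply: divr_ge0; [apply: mulr_ge0 => //|]; apply/ltW; [exact: w0|exact: s0].
  have cn : cos t != 0 by rewrite gt_eqF.
  have b0 := is_derive_tan cn.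
  have b1 : is_derive t 1 (fun t => w * tan t / s) (w / (s * cos t ^+ 2)).
    apply: is_derive_eq; rewrite /GRing.scale/=; field.
    by rewrite cn gt_eqF.
  have := @is_derive1_comp _ asin (fun t => w * tan t / s) t _ _ (is_derive1_asin a1) b1.
  have -> : 1 - (w * tan t / s) ^+ 2 = (r / s) ^+ 2.
    rewrite !expr_div_n r2; apply: (@mulIf _ (s ^+ 2)); first by rewrite gt_eqF// exprn_gt0.
    rewrite mulrBl !divfK ?gt_eqF ?exprn_gt0// mul1r s2 exprMn /tan !expr_div_n.
    have -> : sin t ^+ 2 = 1 - cos t ^+ 2 by rewrite -cs; ring.
    by field.
  rewrite sqrtr_sqr gtr0_norm ?divr_gt0//.
  by congr (is_derive _ _ _ _); field; rewrite cn !gt_eqF.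
have -> : r = r^-1 - w * (w / (r * cos t ^+ 2)).
  have -> : r^-1 - w * (w / (r * cos t ^+ 2)) = (1 - (w / cos t) ^+ 2) / r.
    by field; rewrite !gt_eqF.
  by rewrite -r2 expr2 mulfK// gt_eqF.
by rewrite /Q; apply: is_derive_eq; rewrite /GRing.scale/=.
Qed.

Let Q0 : Q 0 = 0.
Proof. by rewrite /Q /tan sin0 !mul0r mulr0 mul0r asin0 mulr0 subrr. Qed.

Let sint0 : sin t0 = s.
Proof. by rewrite sin_acos//; apply/andP; split; wlra. Qed.

Let Qt0 : Q t0 = pi / 2 * (1 - w).
Proof.
have sn : s != 0 by rewrite gt_eqF// s0.
have wn : w != 0 by rewrite gt_eqF// w0.
rewrite /Q /tan sint0 cost0 divff// asin1.
have -> : w * (s / w) / s = 1 by field; rewrite sn wn.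
by rewrite asin1; ring.
Qed.

Let near_lt : \forall t \near t0^'-, 0 <= t < t0.
Proof.
near=> t; apply/andP; split; last by near: t; exact: nbhs_left_lt.
by apply/ltW; near: t; apply: nbhs_left_gt; exact: t0_gt0.
Unshelve. all: by end_near. Qed.

Let Qleft : Q t @[t --> t0^'-] --> Q t0.
Proof.
rewrite Qt0; have -> : pi / 2 * (1 - w) = pi / 2 - w * (pi / 2) :> R by ring.
apply: cvgB; last apply: cvgMl_tmp; apply: cvg_asin1.
- apply: cvg_at_left_filter; have := @continuous_sin R t0.
  have <- : sin t0 / s = 1 by rewrite sint0 divff// gt_eqF// s0.
  by move=> h; apply: cvgMr_tmp; exact: h.
- by apply: filterS near_lt => t h; rewrite ltr_pdivrMr// mul1r sin_lt.
- apply: cvg_at_left_filter.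
  have e : w * tan t0 / s = 1.
    by rewrite /tan sint0 cost0; field; rewrite !gt_eqF ?s0 ?w0.
  rewrite -e; apply: cvgMr_tmp; apply: cvgMl_tmp; apply: continuous_tan.
  by rewrite cost0 gt_eqF.
- by apply: filterS near_lt => t h; exact: tan_lt.
Qed.

Let Qright : Q t @[t --> 0^'+] --> Q 0.
Proof.
apply: cvg_at_right_filter.
have a1 : {for 0, continuous (@asin R)} by apply: continuous_asin; lra.
apply: cvgB; last apply: cvgMl_tmp.
- apply: continuous_comp; last by rewrite sin0 mul0r.
  by apply: cvgMr_tmp; exact: continuous_sin.
- apply: (@continuous_comp _ _ _ (fun t => w * tan t / s) (@asin R)); last by rewrite /tan sin0 mul0r mulr0 mul0r.
  apply: cvgMr_tmp; apply: cvgMl_tmp; apply: continuous_tan.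
  by rewrite cos0 oner_neq0.
Qed.

Let cmc : continuous (fun t => m (cos t)).
Proof. by move=> t; apply: continuous_comp; [exact: continuous_cos|exact: cm]. Qed.

Let mm : measurable_fun setT (fun t => (m (cos t))%:E).
Proof. by apply/measurable_EFinP; exact: continuous_measurable_fun. Qed.

Let int_half : (\int[leb]_(t in `[0%R, t0]) (m (cos t))%:E = (pi / 2 * (1 - w))%:E)%E.
Proof.
rewrite (@continuous_FTC2 _ (fun t => m (cos t)) Q)//.
- by rewrite Q0 Qt0 sube0.
- exact: continuous_subspaceT.
- split; [|exact: Qright|exact: Qleft].
  by move=> t; rewrite in_itv/= => /dQ[].
- by move=> t; rewrite in_itv/= derive1E => /dQ[].
Qed.

Let m_eq0 a : a <= w -> m a = 0.
Proof.
move=> aw; rewrite /m (_ : Num.max a w = w); last exact/max_idPr.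
by rewrite divff ?gt_eqF// expr1n subrr sqrtr0.
Qed.

Lemma int_ray_cos : (\int[leb]_(t in `[(- pi)%R, pi]) (m (cos t))%:E = (pi * (1 - w))%:E)%E.
Proof.
have pi0 := @pi_gt0 R.
have mge0 t : (0 <= (m (cos t))%:E)%E by rewrite lee_fin sqrtr_ge0.
have half : (\int[leb]_(t in `[0%R, pi]) (m (cos t))%:E = (pi / 2 * (1 - w))%:E)%E.
  have ? := t0pi; have ? := t0_gt0.
  rewrite (@ge0_integral_cat _ _ t0)//; [|lra..].
  have h0 t : `[t0, pi]%classic t -> (m (cos t))%:E = 0%E.
    rewrite /= in_itv/= => /andP[h1 h2]; rewrite m_eq0// -cost0 leNgt ltr_cos -?leNgt//.
    - by rewrite in_itv/=; apply/andP; split; lra.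
    - by rewrite in_itv/=; apply/andP; split; lra.
  rewrite int_half [X in (_ + X)%E](_ : _ = 0%E) ?adde0//.
  exact: integral0_eq.
rewrite (@ge0_integral_cat _ _ 0%R)//; [|lra..].
rewrite half [X in (X + _)%E](_ : _ = (pi / 2 * (1 - w))%:E).
  by rewrite -EFinD; congr EFin; lra.
rewrite -half -(@ge0_integral_reflect_itv 0 pi (fun t => (m (cos t))%:E))// oppr0.
by apply: eq_integral => t _; rewrite cosN.
Qed.

Lemma uniform_ray (h : (-1 : R) < 1) (a : R) :
  uniform_prob h [set z | w < Num.sqrt (1 - z ^+ 2) * a] = (m a)%:E.
Proof.
have E : [set z | w < Num.sqrt (1 - z ^+ 2) * a] = `](- m a), (m a)[%classic.
  apply/seteqP; suff H z : (w < Num.sqrt (1 - z ^+ 2) * a) = (- m a < z < m a).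
    by split => z /=; rewrite in_itv/= H.
  have wn := w0; have [aw|wa] := leP a w.
    rewrite m_eq0// oppr0; apply/idP/idP => [|/andP[h1 h2]]; last by have := lt_trans h1 h2; rewrite ltxx.
    rewrite ltNge => /negP; apply: contra_notT => _; have [a0|a0] := leP 0 a.
      apply: le_trans aw; rewrite ler_piMl// -[X in _ <= X]sqrtr1 ler_sqrt//.
      by rewrite lerBlDr lerDl sqr_ge0.
    apply: le_trans (ltW w0); rewrite nmulr_lle0//; exact: sqrtr_ge0.
  have a0 : 0 < a by exact: lt_trans wa.
  rewrite -ltr_pdivrMr// /m (_ : Num.max a w = a); last exact/max_idPl/ltW.
  set b := w / a; have b0 : 0 < b by rewrite divr_gt0.
  have b1 : b < 1 by rewrite ltr_pdivrMr// mul1r.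
  have b2 : 0 < 1 - b ^+ 2 by rewrite subr_gt0 expr_lt1// ltW.
  rewrite -ltr_norml -sqrtr_sqr ltr_sqrt// -[b in LHS](gtr0_norm b0) -sqrtr_sqr.
  have [z1|z1] := ltP 0 (1 - z ^+ 2); first by rewrite ltr_sqrt//; apply/idP/idP; lra.
  rewrite (ler0_sqrtr z1) ltNge sqrtr_ge0/=; apply/esym/negbTE; rewrite -leNgt.
  by have := sqr_ge0 b; lra.
rewrite E /uniform_prob.
have m1 : m a <= 1 by rewrite /m -[X in _ <= X]sqrtr1 ler_sqrt// lerBlDr lerDl sqr_ge0.
rewrite (eq_integral (fun=> (2^-1)%:E)); last first.
  move=> x; rewrite inE/= in_itv/= => /andP[h1 h2]; rewrite /uniform_pdf ifT; first by rewrite opprK.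
  by apply/andP; split; lra.
have m0 : 0 <= m a by exact: sqrtr_ge0.
rewrite integral_cst//= lebesgue_measure_itv/= lte_fin.
case: ifPn => h1; first by rewrite -EFinD -EFinM; congr EFin; lra.
by rewrite mule0; congr EFin; lra.
Qed.

(** [sg] stands for [sin] and for [- sin], whose upper tails are the two tails of the law of
    [sqrt (1 - z ^ 2) sin t]. The shift by [pi] recentres [[0, 2 pi]] on the interval of
    [int_ray_cos]. *)
Lemma archimedes_ray (h1 : (-1 : R) < 1) (h2 : (0 : R) < 2 * pi) (sg : R -> R) c :
  continuous sg -> (forall x, sg (x + pi) = cos (x + c)) ->
  (uniform_prob h1 \x uniform_prob h2)%E [set p | w < Num.sqrt (1 - p.1 ^+ 2) * sg p.2] =
  ((1 - w) / 2)%:E.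
Proof.
move=> csg hsg; set A := [set p | _].
have pi0 := @pi_gt0 R.
have mA : measurable A.
  have mf : measurable_fun setT (fun p : R * R => Num.sqrt (1 - p.1 ^+ 2) * sg p.2).
    apply: measurable_funM; last first.
      exact: (measurableT_comp (continuous_measurable_fun csg)).
    apply: (measurableT_comp (continuous_measurable_fun (@sqrt_continuous R))).
    apply: measurable_funB => //; exact: measurable_funX.
  rewrite (_ : A = (fun p : R * R => Num.sqrt (1 - p.1 ^+ 2) * sg p.2) @^-1` `]w, +oo[).
    by rewrite -[X in measurable X]setTI; exact: mf.
  by apply/seteqP; split => p /=; rewrite in_itv/= andbT.
have mI : measurable_fun setT (fun p => (\1_A p : R)%:E).
  by apply/measurable_EFinP; exact: measurable_indic.
have := integral_indic (uniform_prob h1 \x uniform_prob h2)%E measurableT mA.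
rewrite setIT => <-; rewrite fubini_tonelli2//=.
rewrite /fubini_G.
have -> : (\int[uniform_prob h2]_y \int[uniform_prob h1]_x (\1_A (x, y))%:E =
  \int[uniform_prob h2]_y (m (sg y))%:E)%E.
  apply: eq_integral => y _; rewrite -(uniform_ray h1).
  have mB : measurable [set z | w < Num.sqrt (1 - z ^+ 2) * sg y].
    rewrite (_ : [set z | _] = ysection A y); first exact: measurable_ysection.
    by apply/seteqP; split => z; rewrite /ysection/= inE.
  have := integral_indic (uniform_prob h1) measurableT mB; rewrite setIT => <-.
  apply: eq_integral => z _.
  by rewrite !indicE; congr ((nat_of_bool _)%:R%:E); apply/idP/idP; rewrite !inE.
have cms : continuous (fun y => m (sg y)).
  by move=> y; apply: continuous_comp; [exact: csg|exact: cm].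
have mms : measurable_fun setT (fun y => (m (sg y))%:E).
  by apply/measurable_EFinP; exact: continuous_measurable_fun.
have mge0 a : (0 <= (m a)%:E)%E by rewrite lee_fin sqrtr_ge0.
rewrite integral_uniform// subr0.
rewrite [X in (_ * X)%E](_ : _ = (pi * (1 - w))%:E).
  by rewrite -EFinM; congr EFin; move: pi0; move: (@pi R) => p p0; field; rewrite gt_eqF.
rewrite -int_ray_cos.
have := @ge0_integral_shift _ pi (- pi) pi (fun y => (m (sg y))%:E) mms (fun y => mge0 _).
rewrite addNr -mulr2n mulr_natl => <-.
have p2 : (0 : R) < 2 * pi by [].
have := @ge0_integral_periodic1 _ (2 * pi) p2 c (fun t => (m (cos t))%:E) mm (fun y => mge0 _) _.
have -> : 2 * pi / 2 = pi :> R by lra.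
move=> /(_ _)/wrap[]; first by move=> x; rewrite mulr_natl cosD2pi.
by move=> <-; apply: eq_integral => x _; rewrite hsg.
Qed.

End ray.

Lemma uniform_gt (h : (-1 : R) < 1) w : 0 < w < 1 ->
  uniform_prob h `]w, +oo[%classic = ((1 - w) / 2)%:E.
Proof.
move=> /andP[w0 w1]; rewrite /uniform_prob integral_uniform_pdf.
rewrite (_ : _ `&` _ = `]w, 1]%classic); last first.
  apply/seteqP; split => x /=; rewrite !in_itv/= andbT; first by move=> [-> /andP[]].
  by move=> /andP[h1 h2]; split => //; apply/andP; split => //; lra.
rewrite (eq_integral (fun=> (2^-1)%:E)); last first.
  move=> x; rewrite inE/= in_itv/= => /andP[h1 h2]; rewrite /uniform_pdf ifT; first by rewrite opprK.
  by apply/andP; split; lra.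
rewrite integral_cst//= lebesgue_measure_itv/= lte_fin w1.
by rewrite -EFinD -EFinM; congr EFin; lra.
Qed.

Lemma uniform_lt (h : (-1 : R) < 1) w : 0 < w < 1 ->
  uniform_prob h `]-oo, (- w)[%classic = ((1 - w) / 2)%:E.
Proof.
move=> /andP[w0 w1]; rewrite /uniform_prob integral_uniform_pdf.
rewrite (_ : _ `&` _ = `[-1, (- w)[%classic); last first.
  apply/seteqP; split => x /=; rewrite !in_itv/=; first by move=> [-> /andP[->]].
  by move=> /andP[h1 h2]; split => //; apply/andP; split => //; lra.
rewrite (eq_integral (fun=> (2^-1)%:E)); last first.
  move=> x; rewrite inE/= in_itv/= => /andP[h1 h2]; rewrite /uniform_pdf ifT; first by rewrite opprK.
  by apply/andP; split; lra.
rewrite integral_cst//= lebesgue_measure_itv/= lte_fin ltrN2 w1.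
by rewrite -EFinD -EFinM; congr EFin; lra.
Qed.

(** Complementing the left tails yields the right tails at negative thresholds up to a possible atom
    at the end point. Monotonicity between neighbouring thresholds removes this ambiguity; each
    witness below is a threshold that contradicts a strict inequality. *)
Lemma measure_ray (k : {measure set (measurableTypeR R) -> \bar R}) : k setT = 1%E ->
  (forall w, 0 < w < 1 -> k `]w, +oo[%classic = ((1 - w) / 2)%:E) ->
  (forall w, 0 < w < 1 -> k `]-oo, (- w)[%classic = ((1 - w) / 2)%:E) ->
  forall w, k `]w, +oo[%classic = ((1 - Num.max (-1) (Num.min 1 w)) / 2)%:E.
Proof.
move=> kT pos neg w; set I := `]w, +oo[%classic.
have k1 A : measurable A -> (k A <= 1)%E by move=> mA; rewrite -kT; apply: le_measure; rewrite ?inE.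
have mI : measurable (I : set (measurableTypeR R)) by exact: measurable_itv.
have Ifin : k I \is a fin_num.
  have : (k I <= 1)%E by apply: k1; exact: measurable_itv.
  by rewrite ge0_fin_numE// => /le_lt_trans; apply; rewrite ltry.
have ub1 : fine (k I) <= 1 by rewrite -lee_fin fineK//; apply: k1; exact: measurable_itv.
have ub0 : 0 <= fine (k I) by rewrite fine_ge0.
have upos v : 0 < v < 1 -> v <= w -> fine (k I) <= (1 - v) / 2.
  move=> v01 vw; rewrite -lee_fin fineK// -pos//; apply: le_measure; rewrite ?inE//.
  by move=> x; rewrite /I/= !in_itv/= !andbT; exact: le_lt_trans.
have lpos v : 0 < v < 1 -> w <= v -> (1 - v) / 2 <= fine (k I).
  move=> v01 vw; rewrite -lee_fin fineK// -pos//; apply: le_measure; rewrite ?inE//.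
  by move=> x; rewrite /I/= !in_itv/= !andbT; exact: le_lt_trans.
have uneg v : 0 < v < 1 -> - v <= w -> fine (k I) <= (1 + v) / 2.
  move=> v01 vw; suff : (k I + k `]-oo, (- v)%R[%classic <= 1)%E.
    by rewrite neg// -(fineK Ifin) -EFinD lee_fin; lra.
  rewrite -measureU//; first exact: k1 (measurableU _ _ _ _).
  apply/seteqP; split => x //=; rewrite /I/= !in_itv/= andbT => -[h1 h2].
  by have := lt_trans h2 (le_lt_trans vw h1); rewrite ltxx.
have lneg v : 0 < v < 1 -> w < - v -> (1 + v) / 2 <= fine (k I).
  move=> v01 vw; suff : (1 <= k I + k `]-oo, (- v)%R[%classic)%E.
    by rewrite neg// -(fineK Ifin) -EFinD lee_fin; lra.
  rewrite -kT; apply: le_trans (measureU2 _ _ _) => //.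
  apply: le_measure; rewrite ?inE//; first exact: measurableU.
  move=> x _; rewrite /I/= !in_itv/= andbT; have [h|h] := ltP w x; first by left.
  by right; exact: le_lt_trans vw.
rewrite -(fineK Ifin); congr EFin; set p := fine _ in ub0 ub1 upos lpos uneg lneg *.
have [w1|w1] := leP 1 w.
  rewrite (_ : Num.max _ _ = 1); last by apply/max_idPr; lra.
  apply/eqP; rewrite subrr mul0r eq_le ub0 andbT leNgt; apply/negP => p0.
  by have := upos (1 - p / 2); move=> /(_ _ _)/wrap[]; [apply/andP; split; lra|lra|lra].
have [w0|w0] := ltP 0 w.
  rewrite (_ : Num.max _ _ = w); last by apply/max_idPr; lra.
  by apply/eqP; rewrite eq_le lpos ?upos// w0 w1.
have [w00|wn0] := eqVneq w 0.
  rewrite w00.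
  rewrite (_ : Num.max _ _ = 0); last by apply/max_idPr; lra.
  apply/eqP; rewrite eq_le; apply/andP; split; rewrite leNgt; apply/negP => h.
    by have := uneg (p - 1 / 2); move=> /(_ _ _)/wrap[]; [apply/andP; split; lra|lra|lra].
  by have := lpos (1 / 2 - p); move=> /(_ _ _)/wrap[]; [apply/andP; split; lra|lra|lra].
have {}w0 : w < 0 by rewrite lt_neqAle wn0.
have [wN1|wN1] := leP w (-1).
  apply/eqP; rewrite eq_le; apply/andP; split; first lra.
  rewrite leNgt; apply/negP => h; have [p0|p0] := leP (2 * p - 1) 0.
    by have := lneg (1 / 2); move=> /(_ _ _)/wrap[]; [apply/andP; split; lra|lra|lra].
  by have := lneg p; move=> /(_ _ _)/wrap[]; [apply/andP; split; lra|lra|lra].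
apply/eqP; rewrite eq_le; apply/andP; split.
  by have := uneg (- w); move=> /(_ _ _)/wrap[]; [apply/andP; split; lra|lra|lra].
rewrite leNgt; apply/negP => h; have [p0|p0] := leP (2 * p - 1) 0.
  by have := lneg (- w / 2); move=> /(_ _ _)/wrap[]; [apply/andP; split; lra|lra|lra].
by have := lneg ((2 * p - 1 - w) / 2); move=> /(_ _ _)/wrap[]; [apply/andP; split; lra|lra|lra].
Qed.

Lemma measure_eq_rays (k1 k2 : {measure set (measurableTypeR R) -> \bar R}) :
  k1 setT = 1%E -> k2 setT = 1%E ->
  (forall w, 0 < w < 1 -> k1 `]w, +oo[%classic = ((1 - w) / 2)%:E) ->
  (forall w, 0 < w < 1 -> k1 `]-oo, (- w)[%classic = ((1 - w) / 2)%:E) ->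
  (forall w, 0 < w < 1 -> k2 `]w, +oo[%classic = ((1 - w) / 2)%:E) ->
  (forall w, 0 < w < 1 -> k2 `]-oo, (- w)[%classic = ((1 - w) / 2)%:E) ->
  forall A, measurable A -> k1 A = k2 A.
Proof.
move=> k1T k2T p1 n1 p2 n2 A mA.
refine (@measure_unique _ R (measurableTypeR R) (@RGenOInfty.G R) (fun n => `](- n%:R), +oo[%classic) _ _ _ _ k1 k2 _ _ A mA).
- exact: RGenOInfty.measurableE.
- move=> _ _ [x ->] [y ->]; exists (Num.max x y).
  apply/seteqP; split => z /=; rewrite !in_itv/= !andbT gt_max; first by move=> [-> ->].
  by move=> /andP[].
- by move=> n; exists (- n%:R).
- apply/seteqP; split => // x _; exists (Num.bound `|- x|) => //=; rewrite in_itv/= andbT.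
  rewrite ltrNl (le_lt_trans (ler_norm _))//; exact: archi_boundP.
- by move=> _ [w ->]; rewrite (measure_ray k1T p1 n1) (measure_ray k2T p2 n2).
- move=> n; apply: (@le_lt_trans _ _ (k1 setT)); last by rewrite k1T ltry.
  by apply: le_measure; rewrite ?inE.
Qed.

(** The horizontal coordinate [sqrt (1 - z ^ 2) sin t] of a uniform point of the sphere has the same
    law as the height [z]. Rays generate the Borel sets and are stable under intersection, so it is
    enough to compare tails. *)
Lemma hatbox (h1 : (-1 : R) < 1) (h2 : (0 : R) < 2 * pi) (G : R -> \bar R) :
  measurable_fun setT G -> (forall x, 0 <= G x)%E ->
  (\int[uniform_prob h1]_z \int[uniform_prob h2]_t G (Num.sqrt (1 - z ^+ 2) * sin t)%R =
  \int[uniform_prob h1]_z G z)%E.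
Proof.
move=> mG G0; pose X (p : R * R) : measurableTypeR R := Num.sqrt (1 - p.1 ^+ 2) * sin p.2.
have mX : measurable_fun setT X.
  apply: measurable_funM; last first.
    exact: (measurableT_comp (continuous_measurable_fun (@continuous_sin R))).
  apply: (measurableT_comp (continuous_measurable_fun (@sqrt_continuous R))).
  apply: measurable_funB => //; exact: measurable_funX.
pose P := (uniform_prob h1 \x uniform_prob h2)%E.
pose k := pushforward P X.
suff H (A : set (measurableTypeR R)) : measurable A -> k A = uniform_prob h1 A.
  transitivity (\int[pushforward (uniform_prob h1 \x uniform_prob h2)%E X]_z G z)%E; last first.
    by apply: eq_measure_integral => A mA _; exact: H.
  rewrite ge0_integral_pushforward// fubini_tonelli1//=.
  exact: measurableT_comp.
move=> mA.
have pos w : 0 < w < 1 -> k `]w, +oo[%classic = ((1 - w) / 2)%:E.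
  move=> /andP[w0 w1].
  rewrite -(archimedes_ray w0 w1 h1 h2 (@continuous_sin R) (c := pi / 2)).
    by congr (P _); apply/seteqP; split => p /=; rewrite in_itv/= andbT.
  by move=> x; rewrite -cosBpihalf; congr cos; lra.
have neg w : 0 < w < 1 -> k `]-oo, (- w)[%classic = ((1 - w) / 2)%:E.
  move=> /andP[w0 w1].
  have cNs : continuous (fun x : R => - sin x).
    by move=> x; apply: continuousN; exact: continuous_sin.
  rewrite -(archimedes_ray w0 w1 h1 h2 cNs (c := - (pi / 2))).
    by congr (P _); apply/seteqP; split => p /=; rewrite in_itv/= mulrN ltrNr.
  by move=> x; rewrite sinDpi opprK cosBpihalf.
have PT : P setT = 1%E by exact: probability_setT.
refine (@measure_eq_rays (pushforward (uniform_prob h1 \x uniform_prob h2)%E X) (uniform_prob h1) _ _ _ _ _ _ A mA).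
- exact: PT.
- exact: (@probability_setT _ _ _ (uniform_prob h1)).
- exact: pos.
- exact: neg.
- exact: uniform_gt.
- exact: uniform_lt.
Unshelve. all: exact: mX.
Qed.

End hatbox.

(** * Averaging over equators preserves the mean over the sphere *)

Section sphere_mean.
Context {R : realType}.
Local Notation leb := (@lebesgue_measure R).
Local Notation S := (sphere R).

Lemma measurable_sphere_val : measurable_fun setT (fun xi : S => \val xi).
Proof. by move=> _ B mB; exists B. Qed.

Lemma measurable_sphere_coord i : measurable_fun setT (fun xi : S => \val xi ord0 i).
Proof. exact: (measurableT_comp (measurable_coord i) measurable_sphere_val). Qed.

Lemma measurable_frame1 : measurable_fun setT (@frame1 R).
Proof.
pose x (xi : S) := \val xi ord0 0; pose y (xi : S) := \val xi ord0 1.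
pose r (xi : S) := Num.sqrt (x xi ^+ 2 + y xi ^+ 2).
pose q (xi : S) := expR (- ln (r xi)).
have mx : measurable_fun setT x by exact: measurable_sphere_coord.
have my : measurable_fun setT y by exact: measurable_sphere_coord.
have mr : measurable_fun setT r.
  apply: (measurableT_comp (continuous_measurable_fun (@sqrt_continuous R))).
  by apply: measurable_funD; exact: measurable_funX.
have mq : measurable_fun setT q.
  apply: measurableT_comp => //.
  have mln : measurable_fun setT (fun xi => ln (r xi)).
    by apply: measurableT_comp => //; exact: measurable_ln.
  exact: measurable_funN.
rewrite (_ : @frame1 R = fun xi => if r xi == 0 then vec3 1 0 0
    else vec3 (- (y xi * q xi)) (x xi * q xi) 0); last first.
  apply/funext => xi; rewrite /frame1 -/(x xi) -/(y xi) -/(r xi).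
  case: eqVneq => // r0.
  have rp : 0 < r xi by rewrite lt_neqAle eq_sym r0 sqrtr_ge0.
  by rewrite /q expRN lnK.
apply: measurable_fun_if => //.
- exact: measurable_fun_eqr.
- apply: measurable_funTS; apply: measurable_vec3 => //; last exact: measurable_funM.
  have m1 : measurable_fun setT (fun xi => y xi * q xi) by exact: measurable_funM.
  exact: measurable_funN.
Qed.

Lemma measurable_cross d (T : measurableType d) (f g : T -> 'rV[R]_3) :
  measurable_fun setT f -> measurable_fun setT g ->
  measurable_fun setT (fun t => cross (f t) (g t)).
Proof.
move=> /measurable_fun_rVP mf /measurable_fun_rVP mg.
by apply: measurable_vec3; apply: measurable_funB; exact: measurable_funM.
Qed.

Lemma measurable_circle : measurable_fun setT (fun p : S * R => circle_chart p.1 p.2).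
Proof.
have m1 : measurable_fun setT (fun p : S * R => frame1 p.1).
  exact: (measurableT_comp measurable_frame1 measurable_fst).
have m2 : measurable_fun setT (fun p : S * R => frame2 p.1).
  apply: measurable_cross => //.
  exact: (measurableT_comp measurable_sphere_val measurable_fst).
have mc : measurable_fun setT (fun p : S * R => cos p.2).
  exact: (measurableT_comp (continuous_measurable_fun (@continuous_cos R)) measurable_snd).
have ms : measurable_fun setT (fun p : S * R => sin p.2).
  exact: (measurableT_comp (continuous_measurable_fun (@continuous_sin R)) measurable_snd).
apply/measurable_insubd_sphere/measurable_fun_rVP => i.
rewrite (_ : (fun _ => _) = fun p : S * R => cos p.2 * frame1 p.1 ord0 i + sin p.2 * frame2 p.1 ord0 i); last first.
  by apply/funext => p; rewrite !mxE.
move/measurable_fun_rVP : m1 => /(_ i) m1; move/measurable_fun_rVP : m2 => /(_ i) m2.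
by apply: measurable_funD; exact: measurable_funM.
Qed.

Lemma angle_exists (a b : R) : exists psi,
  a = Num.sqrt (a ^+ 2 + b ^+ 2) * cos psi /\ b = Num.sqrt (a ^+ 2 + b ^+ 2) * sin psi.
Proof.
set r := Num.sqrt _; have r2 : r ^+ 2 = a ^+ 2 + b ^+ 2.
  by rewrite sqr_sqrtr// addr_ge0// sqr_ge0.
have [r0|r0] := eqVneq r 0.
  exists 0; move: r2; rewrite r0 !mul0r expr0n/= => /esym/eqP.
  by rewrite paddr_eq0 ?sqr_ge0// !sqrf_eq0 => /andP[/eqP-> /eqP->].
have rp : 0 < r by rewrite lt_neqAle eq_sym r0 sqrtr_ge0.
have e : (a / r) ^+ 2 + (b / r) ^+ 2 = 1.
  by rewrite !expr_div_n -mulrDl -r2 divff// sqrf_eq0.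
have h1 : -1 <= a / r <= 1.
  by rewrite -ler_norml -(@ler_sqr _ `|_|) ?nnegrE// real_normK ?num_real// expr1n -e lerDl sqr_ge0.
have s1 : sin (acos (a / r)) = `|b / r|.
  rewrite sin_acos// -sqrtr_sqr; congr Num.sqrt; rewrite -e; ring.
have c1 : cos (acos (a / r)) = a / r by rewrite acosK// in_itv.
have [b0|b0] := leP 0 b.
  exists (acos (a / r)); rewrite c1 s1 ger0_norm; last by rewrite divr_ge0// ltW.
  by rewrite ![r * _]mulrC !divfK.
exists (- acos (a / r)); rewrite cosN sinN c1 s1 ltr0_norm; last by rewrite pmulr_llt0 ?invr_gt0.
by rewrite opprK ![r * _]mulrC !divfK.
Qed.

(* Up to a rotation about the polar axis the equator of [chart (z, phi)] is
   parametrized by the heights [sqrt (1 - z^2) sin t]. *)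
Lemma circle_chart_chart (z t : R) : -1 < z < 1 -> exists psi, forall phi,
  circle_chart (sphere_chart (z, phi)) t =
  sphere_chart (Num.sqrt (1 - z ^+ 2) * sin t, phi + psi).
Proof.
move=> /andP[z1 z2]; set s := Num.sqrt _.
have z3 : 0 < 1 - z ^+ 2 by nra.
have s0 : 0 < s by rewrite sqrtr_gt0.
have s2 : s ^+ 2 = 1 - z ^+ 2 by rewrite sqr_sqrtr// ltW.
have [psi] := angle_exists (- z * sin t) (cos t).
have cs := cos2Dsin2 t.
have -> : (- z * sin t) ^+ 2 + cos t ^+ 2 = 1 - (s * sin t) ^+ 2.
  rewrite !exprMn s2; have -> : cos t ^+ 2 = 1 - sin t ^+ 2 by rewrite -cs; ring.
  by ring.
set q := Num.sqrt _ => -[e1 e2].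
exists psi => phi; apply: val_inj.
have cs2 := cos2Dsin2 phi.
have st1 : -1 <= s * sin t <= 1.
  have : (s * sin t) ^+ 2 <= 1.
    rewrite exprMn s2; have : sin t ^+ 2 <= 1 by rewrite -cs lerDr sqr_ge0.
    have := sqr_ge0 z; have := sqr_ge0 (sin t); nra.
  by rewrite -ler_norml -(@ler_sqr _ `|_|) ?nnegrE// real_normK ?num_real// expr1n.
rewrite val_circle_chart (@val_sphere_chart _ (s * sin t, phi + psi))//= -/q.
have vx : \val (sphere_chart (z, phi)) = vec3 (s * cos phi) (s * sin phi) z.
  by rewrite val_sphere_chart//=; apply/andP; split; exact: ltW.
have f1 : frame1 (sphere_chart (z, phi)) = vec3 (- sin phi) (cos phi) 0.
  rewrite /frame1 vx !mxE /=.
  have -> : (s * cos phi) ^+ 2 + (s * sin phi) ^+ 2 = s ^+ 2.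
    by rewrite !exprMn -mulrDr cs2 mulr1.
  rewrite sqrtr_sqr gtr0_norm// gt_eqF//.
  by congr vec3; rewrite mulrAC divff ?mul1r// gt_eqF.
rewrite /frame2 f1 /cross vx !mxE /=.
apply/rowP => -[[|[|[|//]]] i3]; rewrite !mxE /=.
- transitivity (cos phi * (q * cos psi) - sin phi * (q * sin psi)); first by rewrite -e1 -e2; ring.
  by rewrite cosD; ring.
- transitivity (sin phi * (q * cos psi) + cos phi * (q * sin psi)); first by rewrite -e1 -e2; ring.
  by rewrite sinD; ring.
- transitivity (s * sin t * (cos phi ^+ 2 + sin phi ^+ 2)); first by ring.
  by rewrite cs2 mulr1.
Qed.

Lemma sphere_chart_2pi w phi : sphere_chart (w, phi + 2 * pi) = sphere_chart (w, phi) :> S.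
Proof. by rewrite /sphere_chart/= mulr_natl cosD2pi sinD2pi. Qed.

Lemma integral_uniform_translate (h : (0 : R) < 2 * pi) (G : R -> \bar R) c :
  measurable_fun setT G -> (forall x, 0 <= G x)%E -> (forall x, G (x + 2 * pi) = G x) ->
  (\int[uniform_prob h]_x G (x + c)%R = \int[uniform_prob h]_x G x)%E.
Proof.
move=> mG G0 pG.
have H (F : R -> \bar R) : measurable_fun setT F -> (forall x, 0 <= F x)%E -> (forall x, F (x + 2 * pi) = F x) ->
   (\int[leb]_(x in `[0%R, (2 * pi)%R]) F x = \int[leb]_(x in `[(- (2 * pi / 2))%R, (2 * pi / 2)%R]) F x)%E.
  move=> mF F0 pF; have := @ge0_integral_shift _ pi (- pi) pi F mF F0.
  rewrite addNr -mulr2n mulr_natl => <-; rewrite -mulr_natl.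
  have e : pi = 2 * pi / 2 :> R by lra.
  rewrite {1 2}e; exact: ge0_integral_periodic1.
have mGc : measurable_fun setT (fun x : R => G (x + c)).
  by apply: measurableT_comp mG _; exact: measurable_funD.
rewrite !integral_uniform// !H//; last by move=> x; rewrite addrAC pG.
by congr (_ * _)%E; exact: ge0_integral_periodic1.
Qed.

Lemma integral_equator (xi : S) (g : S -> \bar R) : measurable_fun setT g -> (forall x, 0 <= g x)%E ->
  forall h : (0 : R) < 2 * pi,
  (\int[equator_unif xi]_eta g eta = \int[uniform_prob h]_t g (circle_chart xi t))%E.
Proof.
move=> mg g0 h; have mc := measurable_circle_chart xi.
rewrite (_ : h = Defs.twopi_gt0_subproof); last exact: eq_irrelevance.
transitivity (\int[pushforward (uniform_prob Defs.twopi_gt0_subproof) (circle_chart xi)]_eta g eta)%E; first by [].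
by rewrite ge0_integral_pushforward.
Qed.

Lemma integral_sphere (h1 : (-1 : R) < 1) (h2 : (0 : R) < 2 * pi) (g : S -> \bar R) :
  measurable_fun setT g -> (forall x, 0 <= g x)%E ->
  (\int[sphere_unif]_xi g xi =
   \int[uniform_prob h1]_z \int[uniform_prob h2]_phi g (sphere_chart (z, phi)))%E.
Proof.
move=> mg g0; have mc := @measurable_sphere_chart R.
rewrite (_ : h1 = Defs.ltN11_subproof); last exact: eq_irrelevance.
rewrite (_ : h2 = Defs.twopi_gt0_subproof); last exact: eq_irrelevance.
transitivity (\int[pushforward (uniform_prob (@Defs.ltN11_subproof R) \x uniform_prob Defs.twopi_gt0_subproof)%E (@sphere_chart R)]_xi g xi)%E; first by [].
rewrite ge0_integral_pushforward// fubini_tonelli1//=.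
exact: measurableT_comp.
Qed.

Lemma measurable_equator_integral (g : S -> \bar R) : measurable_fun setT g -> (forall x, 0 <= g x)%E ->
  measurable_fun setT (fun xi => \int[equator_unif xi]_eta g eta)%E.
Proof.
move=> mg g0; have h2 : (0 : R) < 2 * pi by rewrite mulr_gt0// pi_gt0.
under eq_fun do rewrite (integral_equator _ mg g0 h2).
have m := measurableT_comp mg measurable_circle.
exact: (@measurable_fun_fubini_tonelli_F _ _ _ _ _ (uniform_prob h2) _ m (fun p => g0 _)).
Qed.

(** At a fixed angle [t], [circle_chart_chart] turns the integral over the longitude of the pole
    into an integral over the parallel of height [sqrt (1 - z ^ 2) sin t], the rotation [psi]
    disappearing by periodicity. The hat-box theorem then replaces this height by a uniform one. *)
Lemma equator_mean (g : S -> \bar R) : measurable_fun setT g -> (forall x, 0 <= g x)%E ->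
  (\int[sphere_unif]_xi \int[equator_unif xi]_eta g eta = \int[sphere_unif]_xi g xi)%E.
Proof.
move=> mg g0; have h2 : (0 : R) < 2 * pi by rewrite mulr_gt0// pi_gt0.
have h1 : (-1 : R) < 1 by lra.
have mK := measurable_equator_integral mg g0.
have K0 xi : (0 <= \int[equator_unif xi]_eta g eta)%E by exact: integral_ge0.
rewrite (integral_sphere h1 h2 mK K0) (integral_sphere h1 h2 mg g0).
pose G w := (\int[uniform_prob h2]_phi g (sphere_chart (w, phi)))%E.
have mgc := measurableT_comp mg (@measurable_sphere_chart R).
have mG : measurable_fun setT G.
  exact: (@measurable_fun_fubini_tonelli_F _ _ _ _ _ (uniform_prob h2) _ mgc (fun p => g0 _)).
have G0 w : (0 <= G w)%E by exact: integral_ge0.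
rewrite -(hatbox h1 h2 mG G0).
have mF1 : measurable_fun setT (fun z => \int[uniform_prob h2]_phi \int[equator_unif (sphere_chart (z, phi))]_eta g eta)%E.
  have m := measurableT_comp mK (@measurable_sphere_chart R).
  exact: (@measurable_fun_fubini_tonelli_F _ _ _ _ _ (uniform_prob h2) _ m (fun p => K0 _)).
have mX : measurable_fun setT (fun p : R * R => Num.sqrt (1 - p.1 ^+ 2) * sin p.2).
  apply: measurable_funM; last first.
    exact: (measurableT_comp (continuous_measurable_fun (@continuous_sin R))).
  apply: (measurableT_comp (continuous_measurable_fun (@sqrt_continuous R))).
  apply: measurable_funB => //; exact: measurable_funX.
have mF2 : measurable_fun setT (fun z : R => \int[uniform_prob h2]_t G (Num.sqrt (1 - z ^+ 2) * sin t)%R)%E.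
  have m := measurableT_comp mG mX.
  exact: (@measurable_fun_fubini_tonelli_F _ _ _ _ _ (uniform_prob h2) _ m (fun p => G0 _)).
rewrite (integral_uniform h1 mF1); last by move=> z; exact: integral_ge0.
rewrite (integral_uniform h1 mF2); last by move=> z; exact: integral_ge0.
refine (congr1 (fun u => ((1 - -1)^-1)%:E * u)%E _).
rewrite -(integral_itv_bndo_bndc (measurable_funTS mF1)) -(integral_itv_bndo_bndc (measurable_funTS mF2)).
rewrite -(integral_itv_obnd_cbnd (measurable_funTS mF1)) -(integral_itv_obnd_cbnd (measurable_funTS mF2)).
apply: eq_integral => z; rewrite inE/= in_itv/= => z1.
under eq_integral do rewrite (integral_equator _ mg g0 h2).
have m2 : measurable_fun setT (fun p : R * R => g (circle_chart (sphere_chart (z, p.1)) p.2)).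
  apply: (measurableT_comp mg).
  have m3 : measurable_fun setT (fun p : R * R => (sphere_chart (z, p.1), p.2)).
    apply/measurable_fun_pairP; split; last exact: measurable_snd.
    exact: (measurableT_comp (measurableT_comp (@measurable_sphere_chart R) (measurable_pair1 z)) measurable_fst).
  exact: (measurableT_comp measurable_circle m3).
apply: (etrans (@fubini_tonelli _ _ _ _ _ (uniform_prob h2) (uniform_prob h2) _ m2 (fun p => g0 _))) => /=.
apply: eq_integral => t _; have [psi hpsi] := circle_chart_chart t z1.
under eq_integral do rewrite hpsi.
rewrite (@integral_uniform_translate h2 (fun phi => g (sphere_chart (Num.sqrt (1 - z ^+ 2) * sin t, phi))))//.
- exact: (measurableT_comp mgc (measurable_pair1 _)).
- by move=> x; rewrite sphere_chart_2pi.
Qed.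

End sphere_mean.

(** * Positivity and mass of the slices *)

Section drift_mean.
Context {R : realType} (L : R) (n : nat).
Hypothesis L0 : 0 < L.
Local Notation dx := (dx L (d:=n)).
Local Notation M D := (Linfty_norm L (weak_laplacian L D)).
Local Notation W D w i := (conv L (weak_partials L [:: i; i] D) w).
Variables (D : 'rV[R]_n -> R) (D2 : sobolev L 2 +oo%E D).

Let wp_measurable s : (size s <= 2)%N -> measurable_fun setT (weak_partials L s D).
Proof. by move=> /(weak_partialsP L0 D2)[[_ _ _ /Lfun1_integrable/intg_measurable]]. Qed.

Let wp_periodic s : (size s <= 2)%N -> periodic L (weak_partials L s D).
Proof. by move=> /(weak_partialsP L0 D2)[[_ +]]. Qed.

Lemma drift_derive_cst (c : R) i x : W D (fun=> c) i x = 0.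
Proof.
have Ic : intg dx (fun=> c) by exact: intg_cst.
have [_ E] := drift_derive L0 D2 Ic i x; rewrite -E.
have [mg [C _ hC]] := @weak_partialsP _ _ _ L0 _ D2 [:: i] isT.
rewrite (_ : conv L (weak_partials L [:: i] D) (fun=> c) =
   fun=> \int[dx]_y (weak_partials L [:: i] D y * c)); first exact: derive_cst.
apply/funext => z; rewrite /conv.
rewrite -[RHS](@Rint_reflect _ L n L0 z)//.
- apply: measurable_funM => //; exact: wp_measurable.
- by move=> y j; rewrite wp_periodic.
Qed.

(** Convolving with a constant gives a constant, whose derivative is zero, so only the deviation of
    [w] from [c] counts. The factor [|w - m|_1] of the entropy estimate originates here. *)
Lemma drift_div_le_centered (w : 'rV[R]_n -> R) c x : intg dx w ->
  `|\sum_i W D w i x| <= M D * \int[dx]_y `|w y - c|.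
Proof.
move=> Iw; have Ic : intg dx (fun=> c) by exact: intg_cst.
have Iwc : intg dx (fun y => w y - c) by exact: intgB.
rewrite (_ : \sum_i W D w i x = \sum_i W D (fun y => w y - c) i x).
  exact: drift_div_le.
apply: eq_bigr => i _; have [_ [C C0 hC]] := @weak_partialsP _ _ _ L0 _ D2 [:: i; i] isT.
rewrite (convB L0 _ _ hC)//; [|exact: wp_measurable|exact: wp_periodic].
by rewrite (drift_derive_cst c) subr0.
Qed.

(** Lets a constant be subtracted from the factor that multiplies the divergence; this produces
    [u - m] in [entropy_rate]. *)
Lemma Rint_drift_div (w : 'rV[R]_n -> R) : intg dx w -> \int[dx]_x (\sum_i W D w i x) = 0.
Proof.
move=> Iw; rewrite Rint_sum; last first.
  by move=> i; apply: bmeas_intg; split; [exact: drift_derive_measurable|exact: drift_derive_bounded].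
rewrite big1// => i _; have dV := drift_derive L0 D2 Iw i.
have [C hC] := drift_derive_bounded L0 D2 Iw i.
have E : partial i (conv L (weak_partials L [:: i] D) w) = W D w i.
  by apply/funext => x; rewrite /partial; have [_ ->] := dV x.
rewrite -E; apply: (Rint_partial_eq0 L0 (C := C)).
- exact: drift_periodic.
- by apply: bmeas_intg; split; [exact: drift_measurable|exact: drift_bounded].
- by move=> x; have [] := dV x.
- by move=> x; rewrite E.
Qed.

End drift_mean.

(** * Differentiating integrals of a slice in time *)

Section orbit_derivative.
Context {R : realType} (L : R) (n : nat).
Hypothesis L0 : 0 < L.
Local Notation dx := (dx L (d:=n)).
Implicit Types (u : R -> 'rV[R]_n -> R) (v : 'rV[R]_n -> R) (t : R).

(** Differentiability in time, uniformly in [x]: what is retained of [C1_C2] besides the regularity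
    in [x]. Without a quotient, [h = 0] is covered too. *)
Definition unif_derive u (u' : 'rV[R]_n -> R) t := forall e, 0 < e ->
  exists2 del, 0 < del & forall h x, `|h| < del -> `|u (t + h) x - u t x - h * u' x| <= e * `|h|.

Lemma C1_C2_unif u : C1_C2 L u -> exists u' : R -> 'rV[R]_n -> R, forall t, 0 < t ->
  [/\ Ck_torus L 2 (u t), Ck_torus L 2 (u' t) & unif_derive u (u' t) t].
Proof.
move=> [u' hu]; exists u' => t t0; have [C1 C2 H _] := hu t t0; split => // e e0.
have : \forall h \near (0:R)^', (C2norm (fun x : 'rV[R]_n => h^-1 * (u (t + h)%R x - u t x) - u' t x)%R < e%:E)%E.
  have N : nbhs 0%E [set z : \bar R | (z < e%:E)%E].
    by apply: open_nbhs_nbhs; split; [exact: open_ereal_lt_ereal|rewrite /= lte_fin].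
  exact: H N.
move=> [del /= del0 hdel]; exists del => // h x hd.
have [->|h0] := eqVneq h 0.
  by rewrite addr0 subrr mul0r subr0 !normr0 mulr0.
have := hdel h; rewrite /ball/= sub0r normrN => /(_ hd h0) /ltW hh.
have : (`|h^-1 * (u (t + h)%R x - u t x) - u' t x|%R%:E <= e%:E)%E.
  apply: le_trans hh; apply: ereal_sup_ubound; exists [::], x; split => //.
rewrite lee_fin => h1.
have -> : u (t + h) x - u t x - h * u' t x = h * (h^-1 * (u (t + h) x - u t x) - u' t x).
  by rewrite mulrBr mulVKf.
by rewrite normrM mulrC ler_wpM2r.
Qed.

Lemma unif_derive_pt u v t x : unif_derive u v t -> is_derive t 1 (fun r => u r x) (v x).
Proof.
move=> H; have h : is_derive (0:R) 1 (fun s => u (t + s) x) (v x).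
  by apply: is_derive0_small => e /H [del d0 hd]; exists del => // s /hd; rewrite addr0; apply.
have := @is_derive_shift R (fun s => u (t + s) x) (- t) t (v x).
rewrite subrr => /(_ h); rewrite (_ : (fun y => _) = (fun r => u r x))//.
by apply/funext => r; rewrite addrCA subrr addr0.
Qed.

Variables (Phi p dp : R -> R) (Dm : R -> Prop) (C : R).
Hypothesis convD : forall a b c, Dm a -> Dm b -> a <= c <= b -> Dm c.
Hypothesis dPhi : forall y, Dm y -> is_derive y 1 Phi (p y).
Hypothesis dp1 : forall y, Dm y -> is_derive y 1 p (dp y).
Hypothesis dpC : forall y, Dm y -> `|dp y| <= C.

Lemma mvt_abs (F f : R -> R) a b K : Dm a -> Dm b ->
  (forall y, Dm y -> is_derive y 1 F (f y)) -> (forall y, (a <= y <= b) || (b <= y <= a) -> `|f y| <= K) ->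
  `|F b - F a| <= K * `|b - a|.
Proof.
move=> Da Db dF; wlog ab : a b Da Db / a <= b => [H hK|hK].
  have [ab|/ltW ab] := leP a b; first exact: H.
  by rewrite distrC [`|b - a|]distrC; apply: H => // y; rewrite orbC; exact: hK.
have dF' y : a <= y <= b -> is_derive y 1 F (f y) by move=> h; apply: dF; exact: convD h.
have [] := @MVT_segment _ F f a b ab.
- by move=> y; rewrite in_itv/= => /andP[h1 h2]; apply: dF'; rewrite !ltW.
- apply: derivable_within_continuous => y; rewrite in_itv/= => /dF'.
  by case.
move=> c; rewrite in_itv/= => hc ->; rewrite normrM ler_wpM2r//.
by apply: hK; rewrite hc.
Qed.

(** Two applications of the mean value inequality, whence the constant [C] where Taylor's formula
    would give [C / 2]. *)
Lemma taylor1 a b : Dm a -> Dm b -> `|Phi b - Phi a - p a * (b - a)| <= C * (b - a) ^+ 2.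
Proof.
move=> Da Db; pose F y := Phi y - p a * y.
have dF y : Dm y -> is_derive y 1 F (p y - p a).
  by move=> /dPhi h; apply: is_derive_eq; rewrite /GRing.scale/= mulr1.
have K y : (a <= y <= b) || (b <= y <= a) -> `|p y - p a| <= C * `|b - a|.
  move=> h; have Dy : Dm y by case/orP: h => h; [exact: convD Da Db h|exact: convD Db Da h].
  have C0 : 0 <= C by exact: le_trans (dpC Da).
  apply: (@le_trans _ _ (C * `|y - a|)).
    apply: (mvt_abs Da Dy dp1) => c hc; apply: dpC.
    by case/orP: hc => hc; [exact: convD Da Dy hc|exact: convD Dy Da hc].
  rewrite ler_wpM2l//; case/orP: h => /andP[h1 h2].
    by rewrite !ger0_norm ?subr_ge0 ?(le_trans h1)// lerD2r.
  by rewrite !ler0_norm ?subr_le0 ?(le_trans h1)// lerN2 lerD2r.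
have := mvt_abs Da Db dF K; rewrite /F -mulrA -normrM -expr2 ger0_norm ?sqr_ge0//.
by congr (`|_| <= _); ring.
Qed.

Lemma Phi_cont y : Dm y -> {for y, continuous Phi}.
Proof. by move=> /dPhi[h _]; apply: differentiable_continuous; exact/derivable1_diffP. Qed.

Lemma p_cont y : Dm y -> {for y, continuous p}.
Proof. by move=> /dp1[h _]; apply: differentiable_continuous; exact/derivable1_diffP. Qed.

Lemma bmeas_comp (q : R -> R) (f : 'rV[R]_n -> R) : (forall y, Dm y -> {for y, continuous q}) ->
  continuous f -> periodic L f -> (forall x, Dm (f x)) -> bmeas (fun x => q (f x)).
Proof.
move=> cq cf pf Df; apply: (bmeas_continuous L0); last by move=> x i; rewrite pf.
by move=> x; apply: continuous_comp; [exact: cf|exact: cq].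
Qed.

Lemma Rint_Phi_derive u v t : 0 < t -> (forall r, 0 < r -> continuous (u r) /\ periodic L (u r)) ->
  (forall r x, 0 < r -> Dm (u r x)) ->
  continuous v -> periodic L v -> unif_derive u v t ->
  is_derive t 1 (fun r => \int[dx]_x Phi (u r x)) (\int[dx]_x (p (u t x) * v x)).
Proof.
move=> t0 cu Du cv pv ud.
have bP r : 0 < r -> bmeas (fun x => Phi (u r x)).
  move=> r0; have [c pe] := cu r r0.
  by apply: bmeas_comp => //; [exact: Phi_cont|move=> x; exact: Du].
have bp : bmeas (fun x => p (u t x)).
  have [c pe] := cu t t0.
  by apply: bmeas_comp => //; [exact: p_cont|move=> x; exact: Du].
have bv : bmeas v by exact: (bmeas_continuous L0).
have [_ [K hK]] := bv; have [_ [Kp hKp]] := bp.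
have K0 : 0 <= K by exact: le_trans (hK 0).
have Kp0 : 0 <= Kp by exact: le_trans (hKp 0).
have C0 : 0 <= C by exact: le_trans (dpC (Du t 0 t0)).
pose V := fine (dx setT); have V0 : 0 <= V by rewrite fine_ge0.
have := @is_derive_shift R (fun s => \int[dx]_x Phi (u (t + s) x)) (- t) t (\int[dx]_x (p (u t x) * v x)).
have -> : (fun y => \int[dx]_x Phi (u (t + (y + - t)) x)) = (fun r => \int[dx]_x Phi (u r x)).
  by apply/funext => r; rewrite addrCA subrr addr0.
rewrite subrr; apply; apply: is_derive0_small => e e0; rewrite addr0.
(* [e1] and [d3] give each half of [e] to one of the two errors, the uniform one in the time
   derivative and the quadratic one of [taylor1]. The bound [t] on the step keeps [t + s]
   positive. *)
pose e1 := e / (2 * (V * Kp + 1)).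
have e10 : 0 < e1 by rewrite divr_gt0// mulr_gt0// ltr_wpDl// mulr_ge0.
have [d1 d10 hd1] := ud _ e10; have [d2 d20 hd2] := ud _ (ltr01 : (0:R) < 1).
pose d3 := e / (2 * (V * C * (K + 1) ^+ 2 + 1)).
have q3 : 0 <= V * C * (K + 1) ^+ 2 by rewrite mulr_ge0 ?sqr_ge0// mulr_ge0.
have d30 : 0 < d3 by rewrite divr_gt0// mulr_gt0// ltr_wpDl.
exists (Num.min (Num.min d1 d2) (Num.min d3 t)); first by rewrite !lt_min d10 d20 d30 t0.
move=> s; rewrite !lt_min => /andP[/andP[s1 s2] /andP[s3 s4]].
have ts : 0 < t + s by have := ler_norm (- s); rewrite normrN; lra.
have I1 := bmeas_intg L (bP _ ts); have I2 := bmeas_intg L (bP _ t0).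
have I3 := bmeas_intg L (bmeasM bp bv).
rewrite -RintZ// -RintB// -RintB//; [|exact: intgB|exact: intgZ].
have I4 : intg dx (fun x => Phi (u (t + s) x) - Phi (u t x) - s * (p (u t x) * v x)).
  by apply: intgB; [exact: intgB|exact: intgZ].
apply: (le_trans (Rint_norm_le I4)).
pose Q := C * (K + 1) ^+ 2 * `|s| ^+ 2 + Kp * (e1 * `|s|).
apply: (@le_trans _ _ (\int[dx]_x Q)).
  apply: Rint_ae_le; [exact: intg_norm|exact: intg_cst|].
  apply: aeW => x; have T := taylor1 (Du t x t0) (Du _ x ts).
  have h1 := hd1 s x s1; have h2 := hd2 s x s2; rewrite mul1r in h2.
  have h3 : `|u (t + s) x - u t x| <= (K + 1) * `|s|.
    rewrite -[u (t + s) x - u t x](subrK (s * v x)).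
    rewrite (le_trans (ler_normD _ _))// mulrDl mul1r addrC lerD// normrM mulrC ler_wpM2r//.
  have h4 : (u (t + s) x - u t x) ^+ 2 <= (K + 1) ^+ 2 * `|s| ^+ 2.
    by rewrite -exprMn -[leLHS]real_normK ?num_real// lerXn2r ?nnegrE// mulr_ge0// addr_ge0.
  have -> : Phi (u (t + s) x) - Phi (u t x) - s * (p (u t x) * v x) =
     (Phi (u (t + s) x) - Phi (u t x) - p (u t x) * (u (t + s) x - u t x)) +
     p (u t x) * (u (t + s) x - u t x - s * v x) by ring.
  rewrite (le_trans (ler_normD _ _))// lerD//.
    by rewrite (le_trans T)// -mulrA ler_wpM2l.
  by rewrite normrM ler_pM.
rewrite Rint_cst -/V /Q mulrC.
have q1 : V * (C * (K + 1) ^+ 2 * `|s| ^+ 2) <= e / 2 * `|s|.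
  have : (V * C * (K + 1) ^+ 2) * `|s| <= e / 2.
    apply: (@le_trans _ _ ((V * C * (K + 1) ^+ 2 + 1) * d3)).
      apply: ler_pM => //; last exact: ltW.
      by rewrite lerDl.
    rewrite /d3 le_eqVlt; apply/orP; left; apply/eqP; field.
    by rewrite gt_eqF// ltr_wpDl.
  by move=> /(ler_wpM2r (normr_ge0 s)); congr (_ <= _); ring.
have q2 : V * (Kp * (e1 * `|s|)) <= e / 2 * `|s|.
  have : (V * Kp) * e1 <= e / 2.
    apply: (@le_trans _ _ ((V * Kp + 1) * e1)); first by apply: ler_wpM2r; [exact: ltW|rewrite lerDl].
    rewrite /e1 le_eqVlt; apply/orP; left; apply/eqP; field.
    by rewrite gt_eqF// ltr_wpDl// mulr_ge0.
  by move=> /(ler_wpM2r (normr_ge0 s)); congr (_ <= _); ring.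
by rewrite mulrDr; lra.
Qed.

End orbit_derivative.

Lemma measurable_sg {R : realType} : measurable_fun setT (@Num.sg R).
Proof.
rewrite (_ : @Num.sg R = fun y => \1_(`]0, +oo[ : set R) y - \1_(`]-oo, 0[ : set R) y).
  by apply: measurable_funB; exact: measurable_indic.
apply/funext => y; rewrite !indicE; have [->|y0|y0] := sgrP y.
- by rewrite !memNset ?subrr//= in_itv/= ltxx.
- by rewrite mem_set ?memNset ?subr0//= in_itv/= ?andbT// ltNge (ltW y0).
- by rewrite memNset ?mem_set ?sub0r//= in_itv/= ?andbT// ltNge (ltW y0).
Qed.

Section positivity.
Context {R : realType} (L : R) (n : nat).
Hypothesis L0 : 0 < L.
Local Notation dx := (dx L (d:=n)).

(** A positive value at [x0] would persist on a cube around [x0]. Translation by [x0] centres this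
    cube in the cell, where its measure is [l ^ n]; hence the choice [l <= L]. *)
Lemma continuous_Rint_eq0 (f : 'rV[R]_n -> R) : continuous f -> periodic L f ->
  (forall x, 0 <= f x) -> \int[dx]_x f x = 0 -> forall x, f x = 0.
Proof.
move=> cf pf f0 If x0; apply/eqP; rewrite eq_le f0 andbT leNgt; apply/negP => fx0.
have bf := bmeas_continuous L0 cf pf.
have /nbhs_ballP[r /= r0 hr] : nbhs x0 (fun y => f x0 / 2 < f y).
  have : f x0 / 2 < f x0 by lra.
  exact: (cvgr_gt _ (cf x0)).
pose l := Num.min r L; have l0 : 0 < l by rewrite lt_min r0.
have lr : l <= r by rewrite ge_min lexx.
have lL : l <= L by rewrite ge_min lexx orbT.
have mC := @measurable_cell R l n.
have Ic : intg dx (fun y => f x0 / 2 * (\1_(cell l) y : R)).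
  apply: intgZ; apply: (intg_bdd (C := 1)); first exact: measurable_indic.
  by apply: aeW => y; rewrite indicE ger0_norm// lern1; case: (_ \in _).
have h : f x0 / 2 * \int[dx]_y (\1_(cell l) y : R) <= \int[dx]_y f (y + x0).
  have Ii : intg dx (fun y => (\1_(cell l) y : R)).
    apply: (intg_bdd (C := 1)); first exact: measurable_indic.
    by apply: aeW => y; rewrite indicE ger0_norm// lern1; case: (_ \in _).
  rewrite -(RintZ _ Ii); apply: Rint_ae_le => //.
    by apply: intg_translate => //; exact: bmeas_intg.
  apply: aeW => y; rewrite indicE; case: (boolP (y \in _)) => [|_]; last by rewrite mulr0.
  rewrite inE mulr1 => yl; apply/ltW/hr; split => // i j; rewrite !mxE /ball/=.
  rewrite opprD addrCA subrr addr0 normrN (ord1 i).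
  have := yl j; move=> /andP[h1 h2]; apply: le_lt_trans (_ : l / 2 < _); last lra.
  by rewrite ler_norml h1.
rewrite Rint_translate// ?If in h; last by case: bf.
have : 0 < \int[dx]_y (\1_(cell l) y : R).
  rewrite /Rintegral integral_indic// setIT.
  suff -> : fine (Defs.dx L (cell l : set 'rV[R]_n)) = l ^+ n by rewrite exprn_gt0.
  rewrite -[RHS]/(fine (l ^+ n)%:E) -(dx_setT n (ltW l0)); congr fine; rewrite /Defs.dx /mrestr setTI; congr (lebesgue_rV _).
  apply/seteqP; split=> [y [] //|y yl]; split => // i; have := yl i.
  by move=> /andP[h1 h2]; apply/andP; split; lra.
by move=> /(mulr_gt0 (_ : 0 < f x0 / 2))-/(_ _)/wrap[]; lra.
Qed.

End positivity.

(** Meant for the integral of [|u|], whose variation is controlled from the left only. The infimum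
    of [S] belongs to [S] by the first hypothesis, and the second would push it further left unless
    it is [a]; the slack [e] makes room for the strict step. *)
Lemma dini_noninc {R : realType} (f : R -> R) (a b : R) : a <= b ->
  (forall r, a <= r < b -> forall e, 0 < e -> exists2 d, 0 < d & forall h, 0 < h < d -> f (r + h) <= f r + e) ->
  (forall r, a < r <= b -> forall e, 0 < e -> exists2 d, 0 < d & forall h, 0 < h < d -> f r - f (r - h) <= e * h) ->
  f b <= f a.
Proof.
move=> ab usc dini; apply/ler_addgt0Pr => eta eta0.
pose e := eta / (b - a + 1); have e0 : 0 < e by rewrite divr_gt0//; lra.
suff : f b - f a <= e * (b - a).
  have : e * (b - a) <= eta.
    by rewrite /e mulrAC ler_pdivrMr; [rewrite ler_pM2l//; lra|lra].
  by lra.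
pose S := [set r | a <= r <= b /\ f b - f r <= e * (b - r)].
have Sb : S b by split; [rewrite ab lexx|rewrite !subrr mulr0].
have hS : has_inf S by split; [exists b|exists a => r [/andP[]]].
pose r0 := inf S.
have ar0 : a <= r0 by apply: lb_le_inf; [exists b|move=> r [/andP[]]].
have r0b : r0 <= b by apply: ge_inf => //; case: hS.
have Sr0 : f b - f r0 <= e * (b - r0).
  have [r0b'|] := ltP r0 b; last first.
    by move=> h; have -> : r0 = b by [apply/eqP; rewrite eq_le r0b]; rewrite !subrr mulr0.
  apply/ler_addgt0Pr => eta' eta'0.
  have [|d d0 hd] := usc r0 _ _ eta'0; first by rewrite ar0.
  have [r [rab hr] rlt] := inf_adherent d0 hS.
  have r0r : r0 <= r by apply: ge_inf => //; case: hS.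
  have [r0r'|] := ltP r0 r; last first.
    move=> h; have <- : r = r0 by apply/eqP; rewrite eq_le r0r h.
    by lra.
  have := hd (r - r0); rewrite subrKC => /(_ _)/wrap[].
    by rewrite subr_gt0 r0r' ltrBlDl.
  have : e * (b - r) <= e * (b - r0) by rewrite ler_pM2l//; lra.
  by lra.
have [ar0'|] := ltP a r0; last first.
  by move=> h; have <- : r0 = a by apply/eqP; rewrite eq_le ar0 h.
have [|d d0 hd] := dini r0 _ _ e0; first by rewrite ar0'.
pose h := Num.min (d / 2) (r0 - a).
have h0 : 0 < h by rewrite lt_min; apply/andP; split; lra.
have h1 : h <= d / 2 by rewrite ge_min lexx.
have h2 : h <= r0 - a by rewrite ge_min lexx orbT.
have := hd h; move=> /(_ _)/wrap[]; first by apply/andP; split; lra.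
move=> h3; have : S (r0 - h).
  split; first by apply/andP; split; lra.
  have -> : e * (b - (r0 - h)) = e * (b - r0) + e * h by ring.
  by lra.
by move=> /(ge_inf (proj2 hS)); rewrite -/r0; lra.
Qed.

(** * Mass conservation and positivity of one slice *)

Section orbit.
Context {R : realType} (L : R) (n : nat).
Hypothesis L0 : 0 < L.
Local Notation dx := (dx L (d:=n)).
Local Notation V := (fine (dx setT)).

Lemma fine_dxT : V = L ^+ n.
Proof. by have := dx_setT n (ltW L0) => /(congr1 fine). Qed.

Lemma V_gt0 : 0 < V. Proof. by rewrite fine_dxT exprn_gt0. Qed.

(* [|f| <= (eta + f^2 / eta) / 2] *)
Lemma Rint_norm_le_sqr (f : 'rV[R]_n -> R) eta : 0 < eta -> intg dx f -> intg dx (fun x => f x ^+ 2) ->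
  \int[dx]_x `|f x| <= (eta * V + (\int[dx]_x f x ^+ 2) / eta) / 2.
Proof.
move=> e0 If If2; have I : intg dx (fun x => 2^-1 * (eta + eta^-1 * f x ^+ 2)).
  by apply: intgZ; apply: intgD; [exact: intg_cst|exact: intgZ].
have -> : (eta * V + (\int[dx]_x f x ^+ 2) / eta) / 2 = \int[dx]_x (2^-1 * (eta + eta^-1 * f x ^+ 2)).
  rewrite RintZ; last by apply: intgD; [exact: intg_cst|exact: intgZ].
  rewrite RintD; [|exact: intg_cst|exact: intgZ].
  by rewrite Rint_cst RintZ// mulrC; congr (_ * (_ + _)); rewrite mulrC.
apply: Rint_ae_le; [exact: intg_norm|exact: I|].
apply: aeW => x; rewrite -(ler_pM2l (_ : 0 < 2 * eta)); last by rewrite mulr_gt0.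
have -> : 2 * eta * (2^-1 * (eta + eta^-1 * f x ^+ 2)) = eta ^+ 2 + `|f x| ^+ 2.
  by rewrite real_normK ?num_real//; field; rewrite gt_eqF.
by have := sqr_ge0 (eta - `|f x|); rewrite sqrrB; lra.
Qed.

Variables (u : R -> 'rV[R]_n -> R) (u0 : 'rV[R]_n -> R).
Hypotheses (Iu0 : intg dx u0)
  (u00 : ('N[dx]_2%:E[EFin \o (fun x => u t x - u0 x)%R])%E @[t --> (0:R)^'+] --> 0%E).
Hypothesis cu : forall t, 0 < t -> continuous (u t) /\ periodic L (u t).

Let bu t : 0 < t -> bmeas (u t).
Proof. by move=> /cu[c p]; exact: (bmeas_continuous L0). Qed.

Lemma initial_L2 e : 0 < e -> exists2 d, 0 < d & forall s, 0 < s < d ->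
  intg dx (fun x => (u s x - u0 x) ^+ 2) /\ \int[dx]_x (u s x - u0 x) ^+ 2 <= e.
Proof.
move=> e0; pose e' := Num.sqrt e; have e'0 : 0 < e' by rewrite sqrtr_gt0.
have N : nbhs 0%E [set z : \bar R | (z < e'%:E)%E].
  by apply: open_nbhs_nbhs; split; [exact: open_ereal_lt_ereal|rewrite /= lte_fin].
have [d /= d0 hd] := u00 N; exists d => // s /andP[s0 sd].
have := hd s; rewrite /ball/= sub0r normrN gtr0_norm// => /(_ sd s0).
have ms : measurable_fun setT (fun x => u s x - u0 x).
  by apply: measurable_funB; [case: (bu s0)|exact: intg_measurable Iu0].
have m2 : measurable_fun setT (fun x => (u s x - u0 x) ^+ 2) by exact: measurable_funX.
rewrite unlock/= => h.
have E : (\int[dx]_x (`|u s x - u0 x| `^ 2)%R%:E = \int[dx]_x ((u s x - u0 x) ^+ 2)%R%:E)%E.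
  by apply: eq_integral => x _; rewrite powR_mulrn// real_normK ?num_real.
rewrite E in h.
have I0 : (0 <= \int[dx]_x ((u s x - u0 x) ^+ 2)%R%:E)%E.
  by apply: integral_ge0 => x _; rewrite lee_fin sqr_ge0.
have {}h : (\int[dx]_x ((u s x - u0 x) ^+ 2)%R%:E < e%:E)%E.
  rewrite ltNge; apply/negP => h'; move: h; rewrite ltNge => /negP; apply.
  have -> : e'%:E = (e%:E `^ 2^-1)%E by rewrite poweR_EFin powR12_sqrt// ltW.
  apply: gt0_ler_poweR => //; rewrite ?in_itv/= ?leey ?andbT// lee_fin; exact: ltW.
have I : intg dx (fun x => (u s x - u0 x) ^+ 2).
  apply/integrableP; split; first exact/measurable_EFinP.
  have -> : (\int[dx]_x `|(EFin \o (fun x => (u s x - u0 x) ^+ 2)%R) x| = \int[dx]_x ((u s x - u0 x) ^+ 2)%R%:E)%E.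
    by apply: eq_integral => x _; rewrite /= ger0_norm// sqr_ge0.
  exact: lt_le_trans h (leey _).
split => //; rewrite -lee_fin EFin_Rint//; exact: ltW.
Qed.

Lemma initial_L1 e : 0 < e -> exists2 d, 0 < d & forall s, 0 < s < d -> \int[dx]_x `|u s x - u0 x| <= e.
Proof.
(* With this [eta] and the L^2 tolerance [e * eta], both terms of [Rint_norm_le_sqr] are at most
   [e / 2]. *)
move=> e0; pose eta := e / V; have Vp := V_gt0.
have eta0 : 0 < eta by rewrite divr_gt0.
have [d d0 hd] := initial_L2 (mulr_gt0 e0 eta0); exists d => // s sd.
have [I2 h] := hd s sd; have /andP[s0 _] := sd.
have I1 : intg dx (fun x => u s x - u0 x) by apply: intgB => //; exact/bmeas_intg/bu.
apply: (le_trans (Rint_norm_le_sqr eta0 I1 I2)).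
have -> : eta * V = e by rewrite divfK// gt_eqF.
have : (\int[dx]_x (u s x - u0 x) ^+ 2) / eta <= e by rewrite ler_pdivrMr.
by lra.
Qed.

(** At a small positive time [u] is bounded and [u - u0] square integrable. The square of [u0] is
    what dominates its entropy through [entr_bound]. *)
Lemma intg_initial_sqr : intg dx (fun x => u0 x ^+ 2).
Proof.
have [d d0 hd] := initial_L2 ltr01; have sd : 0 < d / 2 < d by apply/andP; split; lra.
have [I2 _] := hd _ sd; have /andP[s0 _] := sd.
apply: (@intg_ae_le _ _ _ _ _ (fun x => 2 * (u (d / 2) x - u0 x) ^+ 2 + 2 * u (d / 2) x ^+ 2)).
- by apply: measurable_funX; exact: intg_measurable Iu0.
- apply: intgD; first exact: intgZ.
  by apply/intgZ/bmeas_intg; under eq_fun do rewrite expr2; apply: bmeasM; exact: bu.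
- apply: aeW => x; rewrite ger0_norm ?sqr_ge0//.
  have := sqr_ge0 (u0 x - 2 * u (d / 2) x); nra.
Qed.

Variables (kappa : R) (D : 'rV[R]_n -> R) (w : R -> 'rV[R]_n -> R) (u' : R -> 'rV[R]_n -> R).
Hypotheses (kappa0 : 0 < kappa) (D2 : sobolev L 2 +oo%E D) (Iw : forall t, 0 < t -> intg dx (w t)).
Hypothesis uu' : forall t, 0 < t -> [/\ Ck_torus L 2 (u t), Ck_torus L 2 (u' t) & unif_derive u (u' t) t].
Hypothesis pde : forall t x, 0 < t -> u' t x =
  kappa * \sum_i partial i (fun z => u t z * conv L (weak_partials L [:: i] D) (w t) z) x +
  \sum_i partials [:: i; i] (u t) x.
Hypotheses (u0_ge0 : {ae dx, forall x, 0 <= u0 x}) (u0_mass : \int[dx]_x u0 x = 1).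
Local Notation M := (Linfty_norm L (weak_laplacian L D)).
Local Notation divV t x := (\sum_i conv L (weak_partials L [:: i; i] D) (w t) x).

Let cu' t : 0 < t -> continuous (u' t) /\ periodic L (u' t).
Proof. by move=> /uu'[_ /C2P[] ? ? _ _ _ _]. Qed.

Let bu' t : 0 < t -> bmeas (u' t).
Proof. by move=> /cu'[c p]; exact: (bmeas_continuous L0). Qed.

Let bdiv t : 0 < t -> bmeas (fun x => divV t x).
Proof.
move=> t0; apply: bmeas_sum => i; split; first exact: (drift_derive_measurable L0 D2 (Iw t0)).
exact: (drift_derive_bounded L0 D2 (Iw t0)).
Qed.

Lemma orbit_mass t : 0 < t -> \int[dx]_x u t x = 1.
Proof.
move=> t0.
have dmass (r : R) : 0 < r -> is_derive r 1 (fun r => \int[dx]_x u r x) 0.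
  move=> r0; have [Cu Cu' ud] := uu' r0; have [cv pv] := cu' r0.
  have dPhi (y : R) : True -> is_derive y 1 id (1:R) by move=> _; exact: is_derive_id.
  have dp (y : R) : True -> is_derive y 1 (fun=> 1 : R) (0:R) by move=> _; exact: is_derive_cst.
  have dpC (y : R) : True -> `|0 : R| <= 0 by rewrite normr0.
  have := @Rint_Phi_derive R L n L0 id (fun=> 1) (fun=> 0) (fun=> True) 0 (fun _ _ _ _ _ _ => I)
    dPhi dp dpC u (u' r) r r0 cu (fun _ _ _ => I) cv pv ud.
  rewrite (energy_identity L0 D2 (Iw r0) Cu (fun x => pde x r0) (Phi := id) (p := fun=> 1) (dp := fun=> 0)).
  - under eq_Rintegral do rewrite mul1r subrr mul0r.
    by under [X in _ - X]eq_Rintegral do rewrite mul0r; rewrite !Rint_cst !mul0r mulr0 subrr.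
  - by move=> x; exact: cst_continuous.
have cst s : 0 < s -> \int[dx]_x u s x = \int[dx]_x u t x.
  have dd a b (r : R) : 0 < a -> a <= r <= b -> is_derive r 1 (fun r => \int[dx]_x u r x) 0.
    by move=> a0 /andP[/(lt_le_trans a0) r0 _]; exact: dmass.
  have d0 a b (r : R) : a <= r <= b -> is_derive r 1 (fun=> 0 : R) (0:R) by move=> _; exact: is_derive_cst.
  have H a b : 0 < a -> a <= b -> \int[dx]_x u a x = \int[dx]_x u b x.
    move=> a0 ab; have h1 := derive_le ab (dd a b ^~ a0) (@d0 a b) (fun _ _ => lexx _).
    have h2 := derive_le ab (@d0 a b) (dd a b ^~ a0) (fun _ _ => lexx _).
    by lra.
  move=> s0; have [st|/ltW ts] := leP s t; first exact: H.
  by apply/esym; exact: H.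
apply/eqP; rewrite -subr_eq0 -normr_le0; apply/ler_addgt0Pr => e e0; rewrite add0r.
have [d d0 hd] := initial_L1 e0; have sd : 0 < d / 2 < d by apply/andP; split; lra.
have /andP[s0 _] := sd; have Is := bmeas_intg L (bu s0).
have -> : \int[dx]_x u t x - 1 = \int[dx]_x (u (d / 2) x - u0 x) by rewrite RintB// (cst _ s0) u0_mass.
by apply: le_trans (hd _ sd); apply: Rint_norm_le; exact: intgB.
Qed.

Let sgn_reg k (y : R) := y / Num.sqrt (y ^+ 2 + k.+1%:R^-1 ^+ 2).

(** The sign is approximated by the derivative of [Phi y = sqrt (y ^ 2 + eps ^ 2)] with
    [eps = 1 / (k + 1)]. The diffusion term has a sign because [Phi] is convex, and [|p(y) y -
    Phi(y)| = eps ^ 2 / Phi(y) <= eps], so the drift term vanishes in the limit. *)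
Let Rint_sg_le0 t : 0 < t -> \int[dx]_x (Num.sg (u t x) * u' t x) <= 0.
Proof.
move=> t0; have [Cu Cu' ud] := uu' t0; have [cv pv] := cu' t0.
pose q k (y : R) := y ^+ 2 + k.+1%:R^-1 ^+ 2 : R.
have k0 k : 0 < k.+1%:R^-1 :> R by rewrite invr_gt0.
have q0 k y : 0 < q k y by rewrite /q ltr_wpDl ?sqr_ge0// exprn_gt0.
pose Phi k y := Num.sqrt (q k y).
have P0 k y : 0 < Phi k y by rewrite sqrtr_gt0.
have P2 k y : Phi k y ^+ 2 = q k y by rewrite sqr_sqrtr// ltW.
have dq k (y : R) : is_derive y 1 (q k) (2 * y).
  by rewrite /q; apply: is_derive_eq; rewrite /GRing.scale/=; ring.
have dPhi k (y : R) : is_derive y 1 (Phi k) (sgn_reg k y).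
  have := @is_derive1_comp _ Num.sqrt (q k) y _ _ (is_derive1_sqrt (q0 k y)) (dq k y).
  by congr (is_derive _ _ _ _); rewrite /sgn_reg -/(q k y) -/(Phi k y); field; rewrite gt_eqF.
pose dp k y := k.+1%:R^-1 ^+ 2 / Phi k y ^+ 3.
have dp1 k (y : R) : is_derive y 1 (sgn_reg k) (dp k y).
  have P1 : Phi k y != 0 by rewrite gt_eqF.
  have dv : is_derive y 1 (fun y => (Phi k y)^-1) (- (Phi k y) ^- 2 *: sgn_reg k y).
    exact: is_deriveV P1 (dPhi k y).
  rewrite (_ : sgn_reg k = (fun y => y * (Phi k y)^-1))//.
  apply: is_derive_eq; rewrite /GRing.scale/= /dp.
  have -> : k.+1%:R^-1 ^+ 2 = Phi k y ^+ 2 - y ^+ 2 by rewrite P2 /q; ring.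
  by rewrite /sgn_reg -/(q k y) -/(Phi k y); field.
pose N k := \int[dx]_x (sgn_reg k (u t x) * u' t x).
have ms k : measurable_fun setT (fun x => sgn_reg k (u t x) * u' t x).
  apply: measurable_funM; last by case: (bu' t0).
  apply: continuous_measurable_rV => x; have [c _] := cu t0.
  apply: continuous_comp; first exact: c.
  by apply: differentiable_continuous; apply/derivable1_diffP; have [] := dp1 k (u t x).
have cvs (y : R) : sgn_reg k y @[k --> \oo] --> Num.sg y.
  have [->|y0] := eqVneq y 0.
    by rewrite sgr0 /sgn_reg; under eq_fun do rewrite mul0r; exact: cvg_cst.
  have -> : Num.sg y = y / Num.sqrt (y ^+ 2 + 0 ^+ 2).
    by rewrite expr0n/= addr0 sqrtr_sqr {2}[y]numEsg mulfK// normr_eq0.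
  apply: cvgM; first exact: cvg_cst.
  apply: cvgV; first by rewrite expr0n/= addr0 sqrtr_sqr normr_eq0.
  apply: (continuous_cvg _ (@sqrt_continuous R _)).
  apply: cvgD; first exact: cvg_cst.
  rewrite expr2; under eq_fun do rewrite expr2.
  by apply: cvgM; exact: cvg_harmonic.
have msg : measurable_fun setT (fun x => Num.sg (u t x) * u' t x).
  apply: (measurable_fun_cvg ms) => x _; apply: cvgM; [exact: cvs|exact: cvg_cst].
have cvN : N k @[k --> \oo] --> \int[dx]_x (Num.sg (u t x) * u' t x).
  apply: (@Rint_dct _ _ _ _ _ _ (fun x => `|u' t x|)) => //.
  - exact/intg_norm/bmeas_intg/bu'.
  - apply: aeW => x k; rewrite normrM ler_piMl// /sgn_reg normrM normfV -/(q k _) -/(Phi k _).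
    rewrite (gtr0_norm (P0 _ _)) ler_pdivrMr// mul1r -sqrtr_sqr; apply: ler_wsqrtr.
    by rewrite /q lerDl sqr_ge0.
  - by apply: aeW => x; apply: cvgM; [exact: cvs|exact: cvg_cst].
have NK k : N k <= (kappa * \int[dx]_x `|divV t x|) * k.+1%:R^-1.
  have cdp : continuous (fun x => dp k (u t x)).
    move=> x; have [c _] := cu t0; apply: continuous_comp; first exact: c.
    apply: (@continuousM R R (fun=> k.+1%:R^-1 ^+ 2) (fun y => (Phi k y ^+ 3)^-1)); first exact: cst_continuous.
    apply: continuousV; first by rewrite gt_eqF// exprn_gt0.
    apply: (@continuous_comp _ _ _ (Phi k) (fun y => y ^+ 3)); last exact: exprn_continuous.
    by apply: differentiable_continuous; apply/derivable1_diffP; have [] := dPhi k (u t x).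
  rewrite /N (energy_identity L0 D2 (Iw t0) Cu (fun x => pde x t0) (fun x => dPhi k _) (fun x => dp1 k _) cdp).
  have b1 : bmeas (fun x => (sgn_reg k (u t x) * u t x - Phi k (u t x)) * divV t x).
    apply: bmeasM; last exact: bdiv.
    have [c pu] := cu t0.
    apply: (bmeas_continuous L0); last by move=> x i; rewrite pu.
    move=> x; apply: (@continuous_comp _ _ _ (u t) (fun y => sgn_reg k y * y - Phi k y)); first exact: c.
    have [h1 _] := dp1 k (u t x); have [h2 _] := dPhi k (u t x).
    apply: differentiable_continuous; apply/derivable1_diffP.
    have h3 := @derivableM _ _ (sgn_reg k) id (u t x) 1 h1 (ltac:(exact: derivable_id)).
    exact: (@derivableB _ _ _ ((sgn_reg k) * id) (Phi k) (u t x) 1 h3 h2).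
  have Id := intg_norm (bmeas_intg L (bdiv t0)).
  have h1 : 0 <= \int[dx]_x (dp k (u t x) * \sum_i partial i (u t) x ^+ 2).
    apply: Rintegral_ge0 => x _; rewrite mulr_ge0//.
      by rewrite /dp divr_ge0 ?exprn_ge0// ltW.
    by apply: sumr_ge0 => i _; exact: sqr_ge0.
  have h2 : \int[dx]_x ((sgn_reg k (u t x) * u t x - Phi k (u t x)) * divV t x) <=
      k.+1%:R^-1 * \int[dx]_x `|divV t x|.
    rewrite -RintZ//; apply: Rint_ae_le; [exact: bmeas_intg|exact: intgZ|].
    apply: aeW => x; apply: (le_trans (ler_norm _)); rewrite normrM ler_wpM2r//.
    have -> : sgn_reg k (u t x) * u t x - Phi k (u t x) = - (k.+1%:R^-1 ^+ 2 / Phi k (u t x)).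
      have -> : k.+1%:R^-1 ^+ 2 = Phi k (u t x) ^+ 2 - u t x ^+ 2 by rewrite P2 /q; ring.
      by rewrite /sgn_reg -/(q k (u t x)) -/(Phi k (u t x)); field; rewrite gt_eqF.
    rewrite normrN ger0_norm; last by rewrite divr_ge0 ?exprn_ge0// ltW.
    rewrite ler_pdivrMr// expr2 ler_pM2l//.
    rewrite -[leLHS](gtr0_norm (k0 k)) -sqrtr_sqr; apply: ler_wsqrtr.
    by rewrite /q lerDr sqr_ge0.
  have := ler_wpM2l (ltW kappa0) h2; rewrite mulrCA => h3.
  rewrite [leRHS]mulrC; apply: le_trans h3; by rewrite gerBl.
have : (kappa * \int[dx]_x `|divV t x|) * k.+1%:R^-1 @[k --> \oo] --> (kappa * \int[dx]_x `|divV t x|) * 0.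
  by apply: cvgM; [exact: cvg_cst|exact: cvg_harmonic].
rewrite mulr0 => c0; apply: (ler_cvg_to cvN c0); exact: nearW.
Qed.

(** Convexity gives [|u(r)| - |u(r - h)| <= sg(u(r)) (u(r) - u(r - h))], an estimate from the left
    in which the sign is frozen at time [r]; this is the form that [dini_noninc] expects. *)
Lemma orbit_norm_le s t : 0 < s -> s <= t -> \int[dx]_x `|u t x| <= \int[dx]_x `|u s x|.
Proof.
move=> s0 st; have Vp := V_gt0.
apply: (@dini_noninc R (fun r => \int[dx]_x `|u r x|) s t st) => r /andP[sr rt] e e0.
  have r0 : 0 < r by exact: lt_le_trans sr.
  have [_ _ ud] := uu' r0; have [_ [K hK]] := bu' r0.
  have K0 : 0 <= K by exact: le_trans (hK 0).
  have [d d0 hd] := ud 1 ltr01.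
  have dd0 : 0 < e / ((K + 1) * V) by rewrite divr_gt0// mulr_gt0// ltr_wpDl.
  exists (Num.min d (e / ((K + 1) * V))); first by rewrite lt_min d0.
  move=> h; rewrite lt_min => /andP[h0 /andP[h1 h2]].
  have rh : 0 < r + h by lra.
  have I1 := bmeas_intg L (bu rh); have I2 := bmeas_intg L (bu r0).
  rewrite -lerBlDl -RintB; [|exact: intg_norm..].
  apply: (@le_trans _ _ (\int[dx]_x ((K + 1) * h))); last first.
    rewrite Rint_cst mulrAC; move: h2; rewrite ltr_pdivlMr; first by rewrite mulrC => /ltW.
    by rewrite mulr_gt0// ltr_wpDl.
  apply: Rint_ae_le; [by apply: intgB; exact: intg_norm|exact: intg_cst|].
  apply: aeW => x; apply: (le_trans (lerB_dist _ _)).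
  have := hd h x; rewrite gtr0_norm// mul1r => /(_ h1) h3.
  rewrite -[u (r + h) x - u r x](subrK (h * u' r x)) (le_trans (ler_normD _ _))//.
  rewrite mulrDl mul1r addrC lerD// normrM gtr0_norm// mulrC ler_wpM2r// ltW//.
have r0 : 0 < r by exact: lt_trans sr.
have [_ _ ud] := uu' r0.
have [d d0 hd] := ud (e / V) (divr_gt0 e0 Vp).
exists (Num.min d r); first by rewrite lt_min d0.
move=> h; rewrite lt_min => /andP[h0 /andP[h1 h2]].
have rh : 0 < r - h by lra.
have I1 := bmeas_intg L (bu rh); have I2 := bmeas_intg L (bu r0).
have I3 := bmeas_intg L (bu' r0).
have msg : measurable_fun setT (fun x => Num.sg (u r x)).
  by apply: (measurableT_comp measurable_sg); case: (bu r0).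
have Isg F : bmeas F -> intg dx (fun x => Num.sg (u r x) * F x).
  move=> bF; rewrite (_ : (fun x => _) = (fun x => F x * Num.sg (u r x))); last by apply/funext => x; rewrite mulrC.
  apply: (intgM_bdd (C := 1)) => //; first exact: bmeas_intg.
  by apply: aeW => x; rewrite normr_sg lern1; case: (_ != _).
rewrite -RintB; [|exact: intg_norm..].
apply: (@le_trans _ _ (\int[dx]_x (h * (Num.sg (u r x) * u' r x) + e / V * h))).
  apply: Rint_ae_le; [by apply: intgB; exact: intg_norm| |].
    by apply: intgD; [apply/intgZ/Isg/bu'|exact: intg_cst].
  apply: aeW => x.
  have := hd (- h) x; rewrite normrN gtr0_norm// => /(_ h1) h3.
  have h4 : `|u r x| - `|u (r - h) x| <= Num.sg (u r x) * (u r x - u (r - h) x).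
    rewrite mulrBr -normrEsg lerD2l lerN2.
    apply: (le_trans (ler_norm _)); rewrite normrM ler_piMl// normr_sg lern1; case: (_ != _) => //.
  apply: (le_trans h4).
  have -> : Num.sg (u r x) * (u r x - u (r - h) x) = h * (Num.sg (u r x) * u' r x) -
     Num.sg (u r x) * (u (r - h) x - u r x - - h * u' r x) by ring.
  rewrite lerD2l; apply: (le_trans (ler_norm _)); rewrite normrN normrM.
  apply: le_trans h3; rewrite ler_piMl// normr_sg lern1; case: (_ != _) => //.
rewrite RintD; [|exact/intgZ/Isg/bu'|exact: intg_cst].
rewrite RintZ; last exact/Isg/bu'.
rewrite Rint_cst; have := Rint_sg_le0 r0 => h5.
have : h * \int[dx]_x (Num.sg (u r x) * u' r x) <= 0 by rewrite pmulr_rle0.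
have -> : e / V * h * V = e * h by rewrite mulrAC divfK// gt_eqF.
by lra.
Qed.

(** The L^1 norm never exceeds its initial value 1, which is also the mass at time [t]; hence
    [|u| - u] has zero integral and, being continuous and nonnegative, vanishes. *)
Lemma orbit_ge0 t x : 0 < t -> 0 <= u t x.
Proof.
move=> t0; have [c pu] := cu t0; have It := bmeas_intg L (bu t0).
have h1 : \int[dx]_x `|u t x| <= 1.
  apply/ler_addgt0Pr => e e0; have [d d0 hd] := initial_L1 e0.
  pose s := Num.min (d / 2) t.
  have s0 : 0 < s by rewrite lt_min t0 divr_gt0.
  have sd : s < d by rewrite gt_min; apply/orP; left; lra.
  have st : s <= t by rewrite ge_min lexx orbT.
  apply: (le_trans (orbit_norm_le s0 st)).
  have := hd s; rewrite s0 sd => /(_ isT) h.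
  have Is := bmeas_intg L (bu s0).
  apply: (@le_trans _ _ (\int[dx]_x (`|u s x - u0 x| + u0 x))).
    apply: Rint_ae_le; [exact: intg_norm|apply: intgD => //; exact/intg_norm/intgB|].
    apply: filterS u0_ge0 => y y0; rewrite -{2}(ger0_norm y0) -{1}[u s y](subrK (u0 y)).
    exact: ler_normD.
  rewrite RintD//; last exact/intg_norm/intgB.
  by rewrite u0_mass; lra.
have h2 := continuous_Rint_eq0 L0 (f := fun x => `|u t x| - u t x).
have : `|u t x| - u t x = 0.
  apply: h2.
  - move=> y; apply: (@continuous_comp _ _ _ (u t) (fun z : R => `|z| - z)); first exact: c.
    by apply: cvgB; [exact: norm_continuous|exact: cvg_id].
  - by move=> y i; rewrite pu.
  - by move=> y; rewrite subr_ge0 ler_norm.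
  - apply/eqP; rewrite eq_le; apply/andP; split; last first.
      by apply: Rintegral_ge0 => y _; rewrite subr_ge0 ler_norm.
    rewrite RintB//; last exact: intg_norm.
    by rewrite orbit_mass// subr_le0.
by move/eqP; rewrite subr_eq0 => /eqP <-; exact: normr_ge0.
Qed.

End orbit.

(** * Entropy of the slices *)

Section scalar_entropy.
Context {R : realType}.
Implicit Types (s y z m q e : R).

Lemma ln_le_sub1 z : 0 < z -> ln z <= z - 1.
Proof. by move=> z0; have := @le_ln1Dx R (z - 1); rewrite subrKC; apply; lra. Qed.

Lemma ln_ge_1sub z : 0 < z -> 1 - z^-1 <= ln z.
Proof. by move=> z0; have := @ln_le_sub1 z^-1; rewrite invr_gt0 lnV ?posrE// => /(_ z0); lra. Qed.

Lemma xlnx_ge s : 0 <= s -> s - 1 <= s * ln s.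
Proof.
rewrite le_eqVlt => /predU1P[<-|s0]; first by rewrite mul0r; lra.
have := ler_wpM2l (ltW s0) (ln_ge_1sub s0); rewrite mulrBr mulr1 mulfV//.
by rewrite gt_eqF.
Qed.

(** The difference [F] of the two sides has derivative [4 g]; [g] is nondecreasing and vanishes at
    1, so [F] has its minimum there, equal to 0. *)
Lemma pinsker_pointwise s : 0 <= s ->
  3 * (s - 1) ^+ 2 <= (2 * s + 4) * (s * ln s - s + 1).
Proof.
rewrite le_eqVlt => /predU1P[<-|s0]; first by rewrite mul0r; lra.
pose F (y : R) := (2 * y + 4) * (y * ln y - y + 1) - 3 * (y - 1) ^+ 2.
pose g (y : R) := (y + 1) * ln y - 2 * (y - 1).
have dg (y : R) : 0 < y -> is_derive y 1 g (ln y + (y + 1) / y - 2).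
  move=> y0; have h := is_derive1_ln y0.
  by apply: is_derive_eq; rewrite /GRing.scale/=; ring.
have dF (y : R) : 0 < y -> is_derive y 1 F (4 * g y).
  move=> y0; have h := is_derive1_ln y0.
  by apply: is_derive_eq; rewrite /GRing.scale/= /g; field; rewrite gt_eqF.
have d0 (y : R) : is_derive y 1 (fun=> 0 : R) (0:R) by exact: is_derive_cst.
have g'0 y : 0 < y -> 0 <= ln y + (y + 1) / y - 2.
  by move=> y0; have := ln_ge_1sub y0; rewrite mulrDl divff ?gt_eqF// mul1r; lra.
have g1 : g 1 = 0 by rewrite /g ln1; ring.
have gp y : 1 <= y -> 0 <= g y.
  move=> y1; have := @derive_le R (fun=> 0) g (fun=> 0) _ 1 y y1 (fun z _ => d0 z) _ _.
  move=> /(_ (fun z => ln z + (z + 1) / z - 2)).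
  have p z : 1 <= z <= y -> 0 < z by move=> /andP[h _]; lra.
  by move=> /(_ (fun z hz => dg z (p z hz)) (fun z hz => g'0 z (p z hz))); rewrite g1; lra.
have gn y : 0 < y -> y <= 1 -> g y <= 0.
  move=> y0 y1; have := @derive_le R (fun=> 0) g (fun=> 0) _ y 1 y1 (fun z _ => d0 z) _ _.
  move=> /(_ (fun z => ln z + (z + 1) / z - 2)).
  have p z : y <= z <= 1 -> 0 < z by move=> /andP[h _]; lra.
  by move=> /(_ (fun z hz => dg z (p z hz)) (fun z hz => g'0 z (p z hz))); rewrite g1; lra.
have F1 : F 1 = 0 by rewrite /F ln1; ring.
rewrite -subr_ge0 -/(F s); have [s1|/ltW s1] := leP 1 s.
  have := @derive_le R (fun=> 0) F (fun=> 0) _ 1 s s1 (fun z _ => d0 z) _ _.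
  move=> /(_ (fun z => 4 * g z)).
  have p z : 1 <= z <= s -> 0 < z by move=> /andP[h _]; lra.
  move=> /(_ (fun z hz => dF z (p z hz)))/(_ _)/wrap[].
    by move=> z /andP[h _]; rewrite mulr_ge0// gp.
  by rewrite F1; lra.
have := @derive_le R F (fun=> 0) _ (fun=> 0) s 1 s1 _ (fun z _ => d0 z) _.
move=> /(_ (fun z => 4 * g z)).
have p z : s <= z <= 1 -> 0 < z by move=> /andP[h _]; lra.
move=> /(_ (fun z hz => dF z (p z hz)))/(_ _)/wrap[].
  by move=> z hz; have /andP[_ h] := hz; rewrite mulr_ge0_le0// gn// p.
by rewrite F1; lra.
Qed.

(** The reference [m] is shifted along with [y]: the density [u + e] has mean [m + e], so the
    logarithmic Sobolev inequality applies to it as it stands. *)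
Definition entr m e y := (y + e) * ln ((y + e) / (m + e)).

(** Uniform in [e], including [e = 0]: the dominating function for removing the regularisation. *)
Lemma entr_bound m e y : 0 < m -> 0 <= e <= 1 -> 0 <= y ->
  `|entr m e y| <= (y + 1) ^+ 2 / m + (m + 1).
Proof.
move=> m0 /andP[e0 e1] y0; rewrite /entr.
set z := y + e; have z0 : 0 <= z by rewrite addr_ge0.
have me0 : 0 < m + e by lra.
have h1 : 0 <= (y + 1) ^+ 2 / m by rewrite divr_ge0// ?sqr_ge0// ltW.
rewrite ler_norml; apply/andP; split.
  have := @xlnx_ge (z / (m + e)) (divr_ge0 z0 (ltW me0)) => h.
  have : (m + e) * (z / (m + e) - 1) <= (m + e) * (z / (m + e) * ln (z / (m + e))).
    by rewrite ler_pM2l.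
  rewrite mulrBr mulr1 mulrA mulrCA divff ?mulr1 ?gt_eqF//.
  by lra.
move: z0; rewrite le_eqVlt => /predU1P[<-|z0]; first by rewrite mul0r addr_ge0//; lra.
have zm : 0 < z / (m + e) by rewrite divr_gt0.
have h2 := ln_le_sub1 zm; have h3 : z * ln (z / (m + e)) <= z * (z / (m + e)).
  by rewrite ler_pM2l//; lra.
apply: (le_trans h3); rewrite mulrA -expr2.
apply: (@le_trans _ _ ((y + 1) ^+ 2 / m)); last by lra.
apply: ler_pM; rewrite ?sqr_ge0 ?invr_ge0 ?(ltW me0)//.
  by rewrite lerXn2r ?nnegrE ?(ltW z0)//; rewrite /z; lra.
by rewrite lef_pV2 ?posrE//; lra.
Qed.

(* [e = q^2]: the logarithm is at most of order [1 / q]. *)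
Lemma entr_log_small m q y : 0 < m -> 0 < q -> q <= 1 -> 0 <= y ->
  q ^+ 2 * `|ln ((y + q ^+ 2) / (m + q ^+ 2))| <= q * (m^-1 * (y + 1) + 2 * (m + 1)).
Proof.
move=> m0 q0 q1 y0; set e := q ^+ 2.
have e0 : 0 < e by rewrite exprn_gt0.
have eq : e <= q by rewrite /e expr2; nra.
have me0 : 0 < m + e by lra.
have ye0 : 0 < y + e by lra.
have z0 : 0 < (y + e) / (m + e) by rewrite divr_gt0.
have mi : 0 < m^-1 by rewrite invr_gt0.
have A : 0 <= m^-1 * (y + 1) by rewrite mulr_ge0 ?ltW//; lra.
have h1 : ln ((y + e) / (m + e)) <= m^-1 * (y + 1).
  apply: (@le_trans _ _ ((y + e) / (m + e))); first by have := ln_le_sub1 z0; lra.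
  rewrite [leRHS]mulrC; apply: ler_pM; [exact: ltW|by rewrite invr_ge0 ltW|by lra|].
  by rewrite lef_pV2 ?posrE//; lra.
have h2 : - ln ((y + e) / (m + e)) <= 2 * (m + 1) / q.
  rewrite -lnV ?posrE// invf_div.
  have q2 : 0 < (m + 1) / q by rewrite divr_gt0//; lra.
  apply: (@le_trans _ _ (ln (((m + 1) / q) ^+ 2))).
    rewrite ler_ln ?posrE ?divr_gt0 ?exprn_gt0// expr_div_n -/e.
    apply: ler_pM; [exact: ltW|by rewrite invr_ge0 ltW|by nra|].
    by rewrite lef_pV2 ?posrE//; lra.
  have -> : ln (((m + 1) / q) ^+ 2) = 2 * ln ((m + 1) / q) by rewrite lnXn// mulr_natl.
  rewrite -mulrA ler_pM2l//.
  by have := ln_le_sub1 q2; lra.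
have h3 : `|ln ((y + e) / (m + e))| <= m^-1 * (y + 1) + 2 * (m + 1) / q.
  have B : 0 <= 2 * (m + 1) / q by rewrite divr_ge0 ?ltW//; lra.
  by rewrite ler_norml; apply/andP; split; lra.
apply: (le_trans (ler_wpM2l (ltW e0) h3)).
have -> : e * (m^-1 * (y + 1) + 2 * (m + 1) / q) = q * (q * (m^-1 * (y + 1)) + 2 * (m + 1)).
  by rewrite /e; field; rewrite !gt_eqF.
by rewrite ler_pM2l// lerD2r ler_piMl.
Qed.

Lemma entr_cvg m y : 0 < m -> 0 <= y ->
  entr m (k.+1%:R^-1 ^+ 2) y @[k --> \oo] --> y * ln (y / m).
Proof.
move=> m0 y0; have ce : (k.+1%:R^-1 : R) ^+ 2 @[k --> \oo] --> (0:R).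
  under eq_fun do rewrite expr2; rewrite -(mulr0 (0:R)).
  by apply: cvgM; exact: cvg_harmonic.
move: y0; rewrite le_eqVlt => /predU1P[<-|y0].
  rewrite mul0r; apply/norm_cvg0P.
  apply: (@squeeze_cvgr _ _ _ _ (fun=> 0) (fun k => k.+1%:R^-1 * (m^-1 * (0 + 1) + 2 * (m + 1)))).
  - apply: nearW => k; rewrite normr_ge0/= /entr normrM add0r (ger0_norm (sqr_ge0 _)).
    have := @entr_log_small m k.+1%:R^-1 0 m0; rewrite !add0r; apply => //.
    by rewrite invf_le1// ler1n.
  - exact: cvg_cst.
  - rewrite -[X in _ --> X](mul0r (m^-1 * (0 + 1) + 2 * (m + 1))); apply: cvgM; last exact: cvg_cst.
    exact: cvg_harmonic.
have c1 : y + k.+1%:R^-1 ^+ 2 @[k --> \oo] --> y.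
  by rewrite -[X in _ --> X]addr0; apply: cvgD; [exact: cvg_cst|exact: ce].
have c2 : m + k.+1%:R^-1 ^+ 2 @[k --> \oo] --> m.
  by rewrite -[X in _ --> X]addr0; apply: cvgD; [exact: cvg_cst|exact: ce].
apply: cvgM => //; apply: continuous_cvg.
  by apply: continuous_ln; rewrite divr_gt0.
by apply: cvgM => //; apply: cvgV => //; rewrite gt_eqF.
Qed.

End scalar_entropy.

(** * Pinsker's inequality and removal of the regularisation *)

Section relative_entropy.
Context {R : realType} (L : R) (n : nat).
Hypothesis L0 : 0 < L.
Local Notation dx := (dx L (d:=n)).
Local Notation V := (fine (dx setT)).
Local Notation m := (L ^- n).
Local Notation harm k := (k.+1%:R^-1 : R).

Lemma m_gt0 : 0 < m. Proof. by rewrite invr_gt0 exprn_gt0. Qed.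
Let m0 := m_gt0.

Lemma mV1 : m * V = 1.
Proof. by rewrite (fine_dxT n L0) mulVf// gt_eqF// exprn_gt0. Qed.

Lemma harm_gt0 k : 0 < harm k. Proof. by []. Qed.
Lemma harm_le1 k : harm k <= 1. Proof. by rewrite invf_le1// ler1n. Qed.

Lemma measurable_entr e f : measurable_fun setT f -> measurable_fun setT (fun x : 'rV[R]_n => entr m e (f x)).
Proof.
move=> mf; have mfe : measurable_fun setT (fun x => f x + e) by exact: measurable_funD.
apply: measurable_funM => //; apply: (measurableT_comp (@measurable_ln R)).
exact: measurable_funM.
Qed.

Section density.
Variable f : 'rV[R]_n -> R.
Hypotheses (f0 : {ae dx, forall x, 0 <= f x}) (If : intg dx f) (If2 : intg dx (fun x => f x ^+ 2)).
Hypothesis f1 : \int[dx]_x f x = 1.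

Let Ibd : intg dx (fun x => (f x + 1) ^+ 2 / m + (m + 1)).
Proof.
apply: intgD; last exact: intg_cst.
rewrite (_ : (fun x => _) = fun x => m^-1 * (f x ^+ 2 + (2 * f x + 1))).
  by apply: intgZ; apply: intgD => //; apply: intgD; [exact: intgZ|exact: intg_cst].
by apply/funext => x; rewrite mulrC sqrrD1; congr (_ * _); ring.
Qed.

Lemma intg_entr e : 0 <= e <= 1 -> intg dx (fun x => entr m e (f x)).
Proof.
move=> he; apply: (intg_ae_le _ Ibd).
  by apply: measurable_entr; exact: intg_measurable If.
by apply: filterS f0 => x x0; exact: entr_bound.
Qed.

Let entr0 : (fun x => f x * ln (f x / m)) = fun x => entr m 0 (f x).
Proof. by apply/funext => x; rewrite /entr !addr0. Qed.

Lemma intg_entropy : intg dx (fun x => f x * ln (f x / m)).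
Proof. by rewrite entr0; apply: intg_entr; rewrite lexx ler01. Qed.

Lemma entropy_cvg : \int[dx]_x entr m (harm k ^+ 2) (f x) @[k --> \oo] -->
  \int[dx]_x (f x * ln (f x / m)).
Proof.
have mf := intg_measurable If.
apply: (Rint_dct _ _ Ibd).
- by move=> k; exact: measurable_entr.
- by rewrite entr0; exact: measurable_entr.
- apply: filterS f0 => x x0 k; apply: entr_bound => //.
  by rewrite sqr_ge0 expr_le1// harm_le1.
- by apply: filterS f0 => x x0; exact: entr_cvg.
Qed.

Lemma mass_gap_le2 : \int[dx]_x `|f x - m| <= 2.
Proof.
apply: (@le_trans _ _ (\int[dx]_x (f x + m))).
  apply: Rint_ae_le; [by apply/intg_norm/intgB => //; exact: intg_cst|by apply: intgD => //; exact: intg_cst|].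
  by apply: filterS f0 => x x0; rewrite ler_norml; apply/andP; split; have := m0; lra.
by rewrite RintD//; [rewrite f1 Rint_cst mV1; lra|exact: intg_cst].
Qed.

(** The Cauchy-Schwarz step of the classical proof is replaced by the family of linear bounds
    [a <= eta + H / (2 eta)], each an integrated form of [pinsker_pointwise], and [eta] is optimised
    at the end. *)
Lemma pinsker : (\int[dx]_x `|f x - m|) ^+ 2 <= 2 * \int[dx]_x (f x * ln (f x / m)).
Proof.
set a := \int[dx]_x `|f x - m|; set H := \int[dx]_x (f x * ln (f x / m)).
have a0 : 0 <= a by apply: Rintegral_ge0 => x _.
have IH := intg_entropy.
have mn : m != 0 by rewrite gt_eqF.
have If' : intg dx (fun x => f x - m) by apply: intgB => //; exact: intg_cst.
pose h x := f x * ln (f x / m) - f x + m.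
have Ih : intg dx h by apply: intgD; [exact: intgB|exact: intg_cst].
have EH : \int[dx]_x h x = H.
  by rewrite RintD; [rewrite RintB// Rint_cst mV1 f1 subrK|exact: intgB|exact: intg_cst].
have hs x : h x = m * ((f x / m) * ln (f x / m) - f x / m + 1) by rewrite /h; move: (m) mn => q q0; field.
have h0 : {ae dx, forall x, 0 <= h x}.
  apply: filterS f0 => x x0; rewrite hs mulr_ge0 ?(ltW m0)//.
  by have := @xlnx_ge R (f x / m) (divr_ge0 x0 (ltW m0)); lra.
have H0 : 0 <= H.
  rewrite -EH -(_ : \int[dx]_x 0 = 0); last by rewrite Rint_cst mul0r.
  by apply: Rint_ae_le => //; exact: intg_cst.
have key eta : 0 < eta -> a <= eta + H / (2 * eta).
  (* Half the sum in the inequality between arithmetic and geometric means, with weight [eta]; the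
     factor [1 / 3] is there because [f + 2 m] has integral 3. *)
  move=> e0; pose B x := eta / 3 * (f x + 2 * m) + (2 * eta)^-1 * h x.
  have IB : intg dx B.
    by apply: intgD; apply: intgZ => //; apply: intgD => //; exact: intg_cst.
  have -> : eta + H / (2 * eta) = \int[dx]_x B x.
    rewrite RintD; [|by apply: intgZ; apply: intgD => //; exact: intg_cst|exact: intgZ].
    rewrite !RintZ//; last by apply: intgD => //; exact: intg_cst.
    rewrite RintD//; last exact: intg_cst.
    rewrite f1 Rint_cst EH -[2 * m * V]mulrA mV1 mulr1 [in RHS](mulrC _ H); lra.
  apply: Rint_ae_le => //; first exact: intg_norm.
  apply: filterS f0 => x x0; pose s := f x / m.
  have s0 : 0 <= s by rewrite divr_ge0// ltW.
  have := pinsker_pointwise s0; set y := s * ln s - s + 1 => hp.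
  have fx : f x = m * s by rewrite /s mulrCA mulfV// mulr1.
  have Bx : B x = m * (eta / 3 * (s + 2) + (2 * eta)^-1 * y).
    by rewrite /B hs -/s -/y fx; ring.
  have -> : f x - m = m * (s - 1) by rewrite fx; ring.
  rewrite Bx normrM (gtr0_norm m0) ler_pM2l//.
  set T := eta / 3 * (s + 2) + _.
  have y0 : 0 <= y by rewrite /y; have := xlnx_ge s0; lra.
  have T0 : 0 <= T.
    apply: addr_ge0; apply: mulr_ge0 => //; first by lra.
    - by lra.
    - by rewrite invr_ge0; lra.
  rewrite -(ger0_norm T0) -ler_sqr ?nnegrE// !real_normK ?num_real//.
  have : (s - 1) ^+ 2 <= 4 * (eta / 3 * (s + 2)) * ((2 * eta)^-1 * y).
    rewrite -(ler_pM2l (ltr0n R 3)); apply: (le_trans hp); rewrite le_eqVlt; apply/orP; left; apply/eqP.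
    by field; rewrite gt_eqF.
  move=> /le_trans; apply; rewrite /T -subr_ge0.
  set A1 := eta / 3 * _; set A2 := _^-1 * y.
  have -> : (A1 + A2) ^+ 2 - 4 * A1 * A2 = (A1 - A2) ^+ 2 by ring.
  exact: sqr_ge0.
move: a0; rewrite le_eqVlt => /predU1P[<-|a0]; first by rewrite expr0n/= mulr_ge0.
(* With [eta = a / 2] the bound reads [a <= a / 2 + H / a], which is the claim. *)
have := key (a / 2); rewrite divr_gt0// => /(_ isT).
have -> : 2 * (a / 2) = a by lra.
move=> h1; have : a * a <= a * (a / 2 + H / a) by rewrite ler_pM2l.
by rewrite mulrDr [a * (H / a)]mulrCA mulfV ?gt_eqF// mulr1 expr2; lra.
Qed.

End density.

End relative_entropy.

(** * Evolution of the entropy of one slice *)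

Section entropy_orbit.
Context {R : realType} (L : R) (n : nat).
Hypothesis L0 : 0 < L.
Implicit Types t q e y : R.
Local Notation dx := (dx L (d:=n)).
Local Notation V := (fine (dx setT)).
Local Notation m := (L ^- n).
Local Notation harm k := (k.+1%:R^-1 : R).
Let m0 : 0 < m := m_gt0 n L0.

Variables (u u' : R -> 'rV[R]_n -> R) (kappa : R) (D : 'rV[R]_n -> R) (w : R -> 'rV[R]_n -> R).
Hypotheses (kappa0 : 0 < kappa) (D2 : sobolev L 2 +oo%E D) (Iw : forall t, 0 < t -> intg dx (w t)).
Hypothesis uu' : forall t, 0 < t -> [/\ Ck_torus L 2 (u t), Ck_torus L 2 (u' t) & unif_derive u (u' t) t].
Hypothesis pde : forall t x, 0 < t -> u' t x =
  kappa * \sum_i partial i (fun z => u t z * conv L (weak_partials L [:: i] D) (w t) z) x +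
  \sum_i partials [:: i; i] (u t) x.
Hypotheses (u_ge0 : forall t x, 0 < t -> 0 <= u t x) (u_mass : forall t, 0 < t -> \int[dx]_x u t x = 1).
Local Notation M := (Linfty_norm L (weak_laplacian L D)).
Local Notation divV t x := (\sum_i conv L (weak_partials L [:: i; i] D) (w t) x).
Local Notation a t := (\int[dx]_x `|u t x - m|).
Local Notation G q t := (\int[dx]_x entr m (q ^+ 2) (u t x)).
Local Notation H t := (\int[dx]_x (u t x * ln (u t x / m))).
(** The integral of [m^-1 * (u + 1) + 2 * (m + 1)], the bound of [entr_log_small], for a density [u]
    of mass 1. *)
Local Notation K0 := (m^-1 * (1 + V) + 2 * (m + 1) * V).

Let cu t : 0 < t -> continuous (u t) /\ periodic L (u t).
Proof. by move=> /uu'[/C2P[]]. Qed.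

Let bu t : 0 < t -> bmeas (u t).
Proof. by move=> /cu[c p]; exact: (bmeas_continuous L0). Qed.

Let bdiv t : 0 < t -> bmeas (fun x => divV t x).
Proof.
move=> t0; apply: bmeas_sum => i; split; first exact: (drift_derive_measurable L0 D2 (Iw t0)).
exact: (drift_derive_bounded L0 D2 (Iw t0)).
Qed.

Let M0 : 0 <= M.
Proof. by rewrite /Linfty_norm fine_ge0// Lnorm_ge0. Qed.

Let entr' (e y : R) := ln ((y + e) / (m + e)) + 1.

Let entr_derive e y : 0 < e -> 0 <= y -> is_derive y 1 (entr m e) (entr' e y).
Proof.
move=> e0 y0; have ye : 0 < y + e by lra.
have me : 0 < m + e by have := m0; lra.
have z0 : 0 < (y + e) / (m + e) by rewrite divr_gt0.
have h1 : is_derive y 1 (fun z : R => (z + e) / (m + e)) (m + e)^-1.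
  by apply: is_derive_eq; rewrite /GRing.scale/=; ring.
have h2 := @is_derive1_comp R (@ln R) (fun z => (z + e) / (m + e)) y _ _ (is_derive1_ln z0) h1.
have h3 : is_derive y 1 (fun z : R => z + e) 1 by apply: is_derive_eq; rewrite addr0.
have h4 := is_deriveM h3 h2.
apply: (@is_derive_eq _ _ _ _ _ _ _ _ h4); rewrite /GRing.scale/= /entr' mulr1 addrC; congr (_ + _).
by move: ye me; move: (y + e) (m + e) => b c b0 c0; field; rewrite !gt_eqF.
Qed.

Let entr'_derive e y : 0 < e -> 0 <= y -> is_derive y 1 (entr' e) (y + e)^-1.
Proof.
move=> e0 y0; have ye : 0 < y + e by lra.
have me : 0 < m + e by have := m0; lra.
have z0 : 0 < (y + e) / (m + e) by rewrite divr_gt0.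
have h1 : is_derive y 1 (fun z : R => (z + e) / (m + e)) (m + e)^-1.
  by apply: is_derive_eq; rewrite /GRing.scale/=; ring.
have h2 := @is_derive1_comp R (@ln R) (fun z => (z + e) / (m + e)) y _ _ (is_derive1_ln z0) h1.
have h3 : is_derive y 1 (fun=> 1 : R) (0:R) by exact: is_derive_cst.
have h4 := is_deriveD h2 h3.
apply: (@is_derive_eq _ _ _ _ _ _ _ _ h4); rewrite addr0.
by move: ye me; move: (y + e) (m + e) => b c b0 c0; field; rewrite !gt_eqF.
Qed.

Local Notation fisher q t := (\int[dx]_x ((u t x + q ^+ 2)^-1 * \sum_i partial i (u t) x ^+ 2)).

Lemma entr_rate_ge0 q : 0 < q -> 0 <= q * K0.
Proof.
move=> q0; have V0 := V_gt0 n L0; have ? := m0; rewrite mulr_ge0 ?(ltW q0)//.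
have mi : 0 < m^-1 by rewrite invr_gt0 m0.
by move: (m^-1) (m) mi m0 => b c b0 c0; apply: addr_ge0; apply: mulr_ge0; lra.
Qed.

Lemma is_derive_entr q t : 0 < q -> 0 < t ->
  is_derive t 1 (fun r => G q r) (\int[dx]_x (entr' (q ^+ 2) (u t x) * u' t x)).
Proof.
move=> q0 t0; have e0 : 0 < q ^+ 2 by rewrite exprn_gt0.
have [C1 /C2P[pv cv _ _ _] ud] := uu' t0.
apply: (@Rint_Phi_derive R L n L0 (entr m (q ^+ 2)) (entr' (q ^+ 2)) (fun y => (y + q ^+ 2)^-1) (fun y => 0 <= y) (q ^+ 2)^-1) => //.
- by move=> b c z b0 c0 /andP[h _]; exact: le_trans h.
- by move=> y; exact: entr_derive.
- by move=> y; exact: entr'_derive.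
- move=> y y0; have ye : 0 < y + q ^+ 2 by lra.
  by rewrite gtr0_norm ?invr_gt0// lef_pV2 ?posrE//; lra.
Qed.

(** The regularisation costs [q * K0], which comes from the term [e ln ((u + e) / (m + e))] with
    [e = q ^ 2]. The Fisher information is kept, to be bounded by [fisher_ge] or discarded. *)
Lemma entropy_rate t q c : 0 < t -> 0 < q -> q <= 1 -> \int[dx]_y `|w t y - m| <= c ->
  \int[dx]_x (entr' (q ^+ 2) (u t x) * u' t x) <= kappa * (M * c * (a t + q * K0)) - fisher q t.
Proof.
move=> t0 q0 q1 hc; set e := q ^+ 2; have e0 : 0 < e by rewrite exprn_gt0.
have [C1 _ _] := uu' t0; have [c1 p1] := cu t0.
have up x : 0 < u t x + e by have := u_ge0 x t0; lra.
have mi : 0 < m^-1 by rewrite invr_gt0 m0.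
have cdp : continuous (fun x => (u t x + e)^-1).
  move=> x; apply: (@continuousV _ _ (fun x => u t x + e)); first by rewrite gt_eqF.
  apply: (@continuous_comp _ _ _ (u t) (fun y => y + e)); first exact: c1.
  by apply: cvgD; [exact: cvg_id|exact: cvg_cst].
have E := energy_identity L0 D2 (Iw t0) C1 (fun x => pde x t0) (Phi := entr m e) (p := entr' e)
  (dp := fun y => (y + e)^-1) (fun x => entr_derive e0 (u_ge0 x t0))
  (fun x => entr'_derive e0 (u_ge0 x t0)) cdp.
rewrite E.
rewrite lerD2r ler_pM2l//.
pose l x := e * ln ((u t x + e) / (m + e)).
have bl : bmeas l.
  apply: bmeasM; first exact: bmeas_cst.
  apply: (bmeas_continuous L0); last by move=> x i; rewrite p1.
  have me : 0 < m + e by have := m0; lra.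
  move=> x; apply: (@continuous_comp _ _ _ (fun x => (u t x + e) / (m + e)) (@ln R)).
    apply: (@continuous_comp _ _ _ (u t) (fun y => (y + e) / (m + e))); first exact: c1.
    by apply: cvgM; [apply: cvgD; [exact: cvg_id|exact: cvg_cst]|exact: cvg_cst].
  by apply: continuous_ln; rewrite divr_gt0.
have bg : bmeas (fun x => u t x - m - l x).
  by apply: bmeasB => //; apply: bmeasB; [exact: bu|exact: bmeas_cst].
have bd := bdiv t0.
(* For this [Phi], [p(u) u - Phi(u) = u - l]. The constant [m] is split off because the divergence
   has zero mean. *)
have -> : \int[dx]_x ((entr' e (u t x) * u t x - entr m e (u t x)) * divV t x) =
    \int[dx]_x ((u t x - m - l x) * divV t x + m * divV t x).
  by apply: eq_Rintegral => x _; rewrite /entr' /entr /l; ring.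
rewrite RintD; [|exact/bmeas_intg/bmeasM|exact/intgZ/bmeas_intg].
rewrite RintZ; last exact: bmeas_intg.
rewrite (Rint_drift_div L0 D2 (Iw t0)) mulr0 addr0.
have c0 : 0 <= c by apply: le_trans hc; apply: Rintegral_ge0 => x _.
have Mc0 : 0 <= M * c by rewrite mulr_ge0.
pose B x := M * c * (`|u t x - m| + q * (m^-1 * (u t x + 1) + 2 * (m + 1))).
have Iu := bmeas_intg L (bu t0).
have Ia : intg dx (fun x => `|u t x - m|) by apply/intg_norm/intgB => //; exact: intg_cst.
have Ib1 : intg dx (fun x => u t x + 1) by apply: intgD => //; exact: intg_cst.
have Ib2 : intg dx (fun x => m^-1 * (u t x + 1)) by exact: intgZ.
have Ib3 : intg dx (fun x => m^-1 * (u t x + 1) + 2 * (m + 1)) by apply: intgD => //; exact: intg_cst.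
have Ib4 : intg dx (fun x => q * (m^-1 * (u t x + 1) + 2 * (m + 1))) by exact: intgZ.
have Ib5 : intg dx (fun x => `|u t x - m| + q * (m^-1 * (u t x + 1) + 2 * (m + 1))) by exact: intgD.
have -> : M * c * (a t + q * K0) = \int[dx]_x B x.
  rewrite RintZ// RintD// RintZ// RintD//; last exact: intg_cst.
  rewrite RintZ// RintD//; last exact: intg_cst.
  by rewrite !Rint_cst u_mass// mul1r.
apply: Rint_ae_le; [exact/bmeas_intg/bmeasM|exact: intgZ|].
apply: aeW => x; apply: (le_trans (ler_norm _)); rewrite normrM mulrC /B.
apply: ler_pM => //.
  by apply: (le_trans (drift_div_le_centered L0 D2 m x (Iw t0))); rewrite ler_wpM2l.
apply: (le_trans (ler_normB _ _)); rewrite lerD2l /l normrM (gtr0_norm e0).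
exact: (entr_log_small m0 q0 q1 (u_ge0 x t0)).
Qed.

Local Notation lam := (4 * pi ^+ 2 / L ^+ 2).

Lemma fisher_ge t q : 0 < t -> 0 < q -> lam * G q t <= fisher q t.
Proof.
move=> t0 q0; set e := q ^+ 2; have e0 : 0 < e by rewrite exprn_gt0.
have [/C2P[p1 c1 d1 dc1 _] _ _] := uu' t0.
have Iu := bmeas_intg L (bu t0).
have dpart i x : is_derive x (delta_mx ord0 i : 'rV[R]_n) (fun x => u t x + e) (partial i (u t) x).
  have h1 : is_derive x (delta_mx ord0 i : 'rV[R]_n) (u t) (partial i (u t) x) by apply/derivableP/d1.
  have h2 : is_derive x (delta_mx ord0 i : 'rV[R]_n) (fun=> e) 0 by exact: is_derive_cst.
  by have := is_deriveD h1 h2; rewrite addr0.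
have Ep i : partial i (fun x => u t x + e) = partial i (u t).
  by apply/funext => x; have [_] := dpart i x.
have := @log_sobolev R L n L0 (fun x => u t x + e).
move=> /(_ _ _ _ _ _)/wrap[].
- move=> x; apply: (@continuous_comp _ _ _ (u t) (fun y => y + e)); first exact: c1.
  by apply: cvgD; [exact: cvg_id|exact: cvg_cst].
- by move=> x i; rewrite p1.
- by move=> x; have := u_ge0 x t0; lra.
- by move=> i x; have [] := dpart i x.
- by move=> i; rewrite Ep.
have -> : (\int[dx]_x (u t x + e)) / L ^+ n = m + e.
  rewrite RintD//; last exact: intg_cst.
  rewrite u_mass// Rint_cst mulrDl mul1r -mulrA (mulrC V) (mV1 n L0) mulr1//.
have -> : \int[dx]_x (\sum_i partial i (fun x => u t x + e) x ^+ 2 / (u t x + e)) = fisher q t.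
  by apply: eq_Rintegral => x _; rewrite mulrC mulr_suml; apply: eq_bigr => i _; rewrite Ep.
cbv zeta; move=> [_].
rewrite -/(G q t) => h.
have l0 : 0 < lam by rewrite divr_gt0 ?mulr_gt0 ?exprn_gt0 ?pi_gt0.
have := ler_wpM2l (ltW l0) h; rewrite [leRHS]mulrA.
have -> : lam * (L ^+ 2 / (4 * pi ^+ 2)) = 1.
  by have L1 := L0; move: (@pi R) (pi_gt0 R) => p p0; field; rewrite !gt_eqF.
by rewrite mul1r.
Qed.

Lemma fisher_ge0 t q : 0 < t -> 0 < q -> 0 <= fisher q t.
Proof.
move=> t0 q0; apply: Rintegral_ge0 => x _; rewrite mulr_ge0//.
  by rewrite invr_ge0 addr_ge0 ?sqr_ge0// u_ge0.
by apply: sumr_ge0 => i _; exact: sqr_ge0.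
Qed.

Lemma gap_continuous t : 0 < t -> {for t, continuous (fun r => a r)}.
Proof.
move=> t0; have [_ /C2P[pv cv _ _ _] ud] := uu' t0.
have [_ [K hK]] := bmeas_continuous L0 cv pv.
have K0 : 0 <= K by exact: le_trans (hK 0).
have Vp := V_gt0 n L0.
apply/cvgrPdist_le => eps eps0; have [d d0 hd] := ud 1 ltr01.
have dd0 : 0 < eps / ((K + 1) * V) by rewrite divr_gt0// mulr_gt0// ltr_wpDl.
apply/nbhs_ballP; exists (Num.min t (Num.min d (eps / ((K + 1) * V)))); first by rewrite /= !lt_min t0 d0 dd0.
move=> r; rewrite /ball/= !lt_min distrC => /andP[rt /andP[rd re]].
have r0 : 0 < r by move: rt; rewrite ltr_norml => /andP[h _]; lra.
have I1 : intg dx (fun x => u t x - m) by apply: intgB; [exact/bmeas_intg/bu|exact: intg_cst].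
have I2 : intg dx (fun x => u r x - m) by apply: intgB; [exact/bmeas_intg/bu|exact: intg_cst].
rewrite -RintB; [|exact: intg_norm..].
have I3 : intg dx (fun x => `|u t x - m| - `|u r x - m|) by apply: intgB; exact: intg_norm.
apply: (le_trans (Rint_norm_le I3)).
apply: (@le_trans _ _ (\int[dx]_x ((K + 1) * `|r - t|))); last first.
  rewrite Rint_cst mulrAC; move: re; rewrite ltr_pdivlMr; first by rewrite mulrC => /ltW.
  by rewrite mulr_gt0// ltr_wpDl.
apply: Rint_ae_le; [exact: intg_norm|exact: intg_cst|].
apply: aeW => x; apply: (le_trans (ler_dist_dist _ _)).
have := hd (r - t) x; rewrite subrKC mul1r => /(_ rd) h3.
have -> : u t x - m - (u r x - m) = - (u r x - u t x - (r - t) * u' t x) - (r - t) * u' t x by ring.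
apply: (le_trans (ler_normB _ _)); rewrite normrN [leRHS]mulrDl (mul1r `|r - t|) addrC lerD//.
by rewrite normrM mulrC ler_wpM2r.
Qed.

Let Iu2 t : 0 < t -> intg dx (fun x => u t x ^+ 2).
Proof.
by move=> t0; apply: (bmeas_intg L); under eq_fun do rewrite expr2; apply: bmeasM; exact: bu.
Qed.

Let ucvg t : 0 < t -> G (harm k) t @[k --> \oo] --> H t.
Proof.
move=> t0; apply: (entropy_cvg L0); [|exact/bmeas_intg/bu|exact: Iu2].
by apply: aeW => x; exact: u_ge0.
Qed.

Lemma gap_le2 t : 0 < t -> a t <= 2.
Proof.
move=> t0; apply: (mass_gap_le2 L0); [|exact/bmeas_intg/bu|exact: u_mass].
by apply: aeW => x; exact: u_ge0.
Qed.

Lemma gap_ge0 t : 0 <= a t. Proof. by apply: Rintegral_ge0 => x _. Qed.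

(** The integrating factor [expR (lam * r)] absorbs the Fisher term. The estimate holds for the
    regularised entropy with [q = 1 / (k + 1)], up to an error proportional to [q], and [k] tends to
    infinity. [c] is a continuous majorant of the gap of [w], whose dependence on time is not
    controlled. *)
Lemma entropy_duhamel (c : R -> R) s t : 0 < s -> s <= t ->
  (forall r, s <= r -> \int[dx]_x `|w r x - m| <= c r) -> (forall r, c r <= 2) -> continuous c ->
  expR (lam * t) * H t <= expR (lam * s) * H s +
    kappa * M * \int[lebesgue_measure]_(r in `[s, t]) (expR (lam * r) * (a r * c r)).
Proof.
move=> s0 st hc c2 cc.
(* Times below [s] are replaced by [s], which makes the integrand continuous on the whole line, as
   [primitive] requires. *)
have ms r : 0 < Num.max s r by rewrite lt_max s0.
have cmax : continuous (fun r => Num.max s r).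
  by move=> r; apply: continuous_max; [exact: cst_continuous|exact: cvg_id].
have cexp : continuous (fun r : R => expR (lam * r)).
  move=> r; apply: (@continuous_comp _ _ _ (fun r => lam * r) expR); last exact: continuous_expR.
  by apply: cvgM; [exact: cvg_cst|exact: cvg_id].
pose g1 r := expR (lam * r) * (a (Num.max s r) * c r).
have cg1 : continuous g1.
  move=> r; apply: (@continuousM R R (fun r => expR (lam * r)) (fun r => a (Num.max s r) * c r)); first exact: cexp.
  apply: (@continuousM R R (fun r => a (Num.max s r)) c); last exact: cc.
  by apply: (@continuous_comp _ _ _ (fun r => Num.max s r) (fun r => a r)); [exact: cmax|exact: gap_continuous].
have [P1 dP1] := primitive cg1; have [P2 dP2] := primitive cexp.
have -> : \int[lebesgue_measure]_(r in `[s, t]) (expR (lam * r) * (a r * c r)) = P1 t - P1 s.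
  rewrite -(FTC st cg1 dP1); apply: eq_Rintegral => r; rewrite inE/= in_itv/= => /andP[sr _].
  by rewrite /g1 max_r.
have t0 : 0 < t by exact: lt_le_trans st.
have key k : expR (lam * t) * G (harm k) t <= expR (lam * s) * G (harm k) s +
    (kappa * M * (P1 t - P1 s) + harm k * (kappa * M * 2 * K0 * (P2 t - P2 s))).
  set q := harm k; have q0 : 0 < q := @harm_gt0 R k; have q1 : q <= 1 := @harm_le1 R k.
  pose F r := expR (lam * r) * G q r.
  pose B r := kappa * M * P1 r + q * (kappa * M * 2 * K0) * P2 r.
  pose F' r := expR (lam * r) * (lam * G q r + \int[dx]_x (entr' (q ^+ 2) (u r x) * u' r x)).
  pose B' r := kappa * M * g1 r + q * (kappa * M * 2 * K0) * expR (lam * r).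
  have dF r : s <= r <= t -> is_derive r 1 F (F' r).
    move=> /andP[/(lt_le_trans s0) r0 _]; have h1 := is_derive_entr q0 r0.
    have h2 : is_derive r 1 (fun r : R => lam * r) lam by apply: is_derive_eq; rewrite /GRing.scale/=; ring.
    have h3 := @is_derive1_comp R expR (fun r => lam * r) r _ _ (is_derive_expR _) h2.
    have h4 := is_deriveM h3 h1.
    by apply: (@is_derive_eq _ _ _ _ _ _ _ _ h4); rewrite /F' /GRing.scale/=; ring.
  have dB r : s <= r <= t -> is_derive r 1 B (B' r).
    move=> _; have h1 := dP1 r; have h2 := dP2 r.
    by apply: is_derive_eq; rewrite /B' /GRing.scale/=; ring.
  have := derive_le st dF dB; move=> /(_ _)/wrap[].
    move=> r /andP[sr _]; have r0 := lt_le_trans s0 sr.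
    have e0 : 0 < expR (lam * r) by exact: expR_gt0.
    rewrite /F' /B' /g1 max_r//.
    have h1 := entropy_rate r0 q0 q1 (hc r sr).
    have h2 := fisher_ge r0 q0; have h3 := entr_rate_ge0 q0; have a0 := gap_ge0 r.
    have h4 : kappa * (M * c r * (a r + q * K0)) <= kappa * M * (a r * c r) + q * (kappa * M * 2 * K0).
      have km : 0 <= kappa * M by rewrite mulr_ge0 ?(ltW kappa0).
      have -> : kappa * (M * c r * (a r + q * K0)) = kappa * M * (a r * c r) + (kappa * M) * (c r * (q * K0)) by ring.
      have -> : q * (kappa * M * 2 * K0) = (kappa * M) * (2 * (q * K0)) by ring.
      by rewrite lerD2l ler_wpM2l// ler_wpM2r.
    have -> : kappa * M * (expR (lam * r) * (a r * c r)) + q * (kappa * M * 2 * K0) * expR (lam * r) =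
      expR (lam * r) * (kappa * M * (a r * c r) + q * (kappa * M * 2 * K0)) by ring.
    rewrite ler_pM2l//; apply: (le_trans _ h4); apply: (le_trans (lerD h2 h1)).
    by rewrite addrC subrK.
  by rewrite /F /B => h; rewrite -lerBlDl; apply: (le_trans h); rewrite le_eqVlt; apply/orP; left; apply/eqP; ring.
have L1 : expR (lam * t) * G (harm k) t @[k --> \oo] --> expR (lam * t) * H t.
  by apply: cvgM; [exact: cvg_cst|exact: ucvg].
have L2 : expR (lam * s) * G (harm k) s +
    (kappa * M * (P1 t - P1 s) + harm k * (kappa * M * 2 * K0 * (P2 t - P2 s))) @[k --> \oo] -->
    expR (lam * s) * H s + (kappa * M * (P1 t - P1 s) + 0 * (kappa * M * 2 * K0 * (P2 t - P2 s))).
  apply: cvgD; first by apply: cvgM; [exact: cvg_cst|exact: ucvg].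
  apply: cvgD; first exact: cvg_cst.
  by apply: cvgM; [exact: cvg_harmonic|exact: cvg_cst].
rewrite mul0r addr0 in L2.
by apply: (ler_cvg_to L1 L2); exact: nearW.
Qed.

Variable u0 : 'rV[R]_n -> R.
Hypotheses (u0_ge0 : {ae dx, forall x, 0 <= u0 x}) (Iu0 : intg dx u0)
  (Iu02 : intg dx (fun x => u0 x ^+ 2)).
Hypothesis u00 : forall e, 0 < e -> exists2 d, 0 < d & forall s, 0 < s < d ->
  intg dx (fun x => (u s x - u0 x) ^+ 2) /\ \int[dx]_x (u s x - u0 x) ^+ 2 <= e.

(** For fixed [q] the derivative of the integrand grows at most linearly, so it is square integrable
    along [u0]; Taylor's inequality and convergence in L^2 then give an upper bound as [s] tends to
    0. *)
Let entr_initial q e : 0 < q -> q <= 1 -> 0 < e -> exists2 d, 0 < d & forall s, 0 < s < d ->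
  G q s <= \int[dx]_x entr m (q ^+ 2) (u0 x) + e.
Proof.
move=> q0 q1 e0; set r := q ^+ 2; have r0 : 0 < r by rewrite exprn_gt0.
have r1 : r <= 1 by rewrite expr_le1// ltW.
pose p x := entr' r (u0 x); have mu0 := intg_measurable Iu0.
have mp : measurable_fun setT p.
  apply: measurable_funD => //; apply: (measurableT_comp (@measurable_ln R)).
  by apply: measurable_funM => //; exact: measurable_funD.
pose al := q / r * m^-1; pose be := q / r * (m^-1 + 2 * (m + 1)) + 1.
have Ip : intg dx (fun x => p x ^+ 2).
  apply: (@intg_ae_le _ _ _ _ _ (fun x => al ^+ 2 * u0 x ^+ 2 + (2 * al * be * u0 x + be ^+ 2))).
  - exact: measurable_funX.
  - by apply: intgD; [exact: intgZ|apply: intgD; [exact: intgZ|exact: intg_cst]].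
  apply: filterS u0_ge0 => x x0; rewrite ger0_norm ?sqr_ge0//.
  have -> : al ^+ 2 * u0 x ^+ 2 + (2 * al * be * u0 x + be ^+ 2) = (al * u0 x + be) ^+ 2 by ring.
  have h : `|p x| <= al * u0 x + be.
    rewrite /p /entr'; apply: (le_trans (ler_normD _ _)); rewrite normr1.
    have -> : al * u0 x + be = q / r * (m^-1 * (u0 x + 1) + 2 * (m + 1)) + 1 by rewrite /al /be; ring.
    rewrite lerD2r mulrAC ler_pdivlMr// mulrC; exact: (entr_log_small m0 q0 q1 x0).
  rewrite -(real_normK (num_real _)) lerXn2r// ?nnegrE//; exact: le_trans h.
set P := \int[dx]_x p x ^+ 2; have P0 : 0 <= P by apply: Rintegral_ge0 => x _; exact: sqr_ge0.
(* Weight of Young's inequality for [p * (u - u0)], making [eta * P <= e / 2]. [C] collects the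
   coefficients of [(u - u0) ^ 2], and the L^2 distance is taken so small that this part is at most
   [e / 2]. *)
pose eta := e / (2 * (P + 1)).
have eta0 : 0 < eta by rewrite divr_gt0//; lra.
pose C := (4 * eta)^-1 + r^-1; have C0 : 0 < C by rewrite addr_gt0 ?invr_gt0// mulr_gt0.
have [|d d0 hd] := u00 (_ : 0 < e / (2 * C)); first by rewrite divr_gt0// mulr_gt0.
exists d => // s sd; have [I2 h2] := hd s sd; have /andP[s0 _] := sd.
have Ie0 : intg dx (fun x => entr m r (u0 x)).
  by apply: (intg_entr L0) => //; rewrite r1 ltW.
have Ies : intg dx (fun x => entr m r (u s x)).
  apply: (intg_entr L0); [|exact/bmeas_intg/bu|exact: Iu2|by rewrite r1 ltW].
  by apply: aeW => x; exact: u_ge0.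
apply: (@le_trans _ _ (\int[dx]_x (entr m r (u0 x) + (eta * p x ^+ 2 + C * (u s x - u0 x) ^+ 2)))).
  apply: Rint_ae_le => //; first by apply: intgD => //; apply: intgD; exact: intgZ.
  apply: filterS u0_ge0 => x x0.
  have := @taylor1 R (entr m r) (entr' r) (fun y => (y + r)^-1) (fun y => 0 <= y) r^-1.
  move=> /(_ _ _ _ _ (u0 x) (u s x) x0 (u_ge0 x s0))/wrap[].
  - by move=> b c z b0 c0 /andP[h _]; exact: le_trans h.
  - by move=> y; exact: entr_derive.
  - by move=> y; exact: entr'_derive.
  - move=> y y0; have ye : 0 < y + r by lra.
    by rewrite gtr0_norm ?invr_gt0// lef_pV2 ?posrE//; lra.
  rewrite -/(p x); set de := u s x - u0 x => h.
  have h3 : p x * de <= eta * p x ^+ 2 + (4 * eta)^-1 * de ^+ 2.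
    rewrite -subr_ge0.
    have -> : eta * p x ^+ 2 + (4 * eta)^-1 * de ^+ 2 - p x * de = eta * (p x - de / (2 * eta)) ^+ 2.
      by field; rewrite gt_eqF.
    by rewrite mulr_ge0 ?sqr_ge0// ltW.
  have h4 := le_trans (ler_norm _) h; have h5 : C * de ^+ 2 = (4 * eta)^-1 * de ^+ 2 + r^-1 * de ^+ 2 by rewrite /C mulrDl.
  rewrite -lerBlDl h5 addrA; apply: le_trans (lerD h3 h4); by rewrite [leRHS]addrC subrK.
rewrite RintD//; last by apply: intgD; exact: intgZ.
rewrite lerD2l RintD; [|exact: intgZ..].
rewrite !RintZ//.
have h3 : eta * P <= e / 2.
  rewrite /eta -mulrA ler_pM2l// invfM -mulrA ger_pMr// mulrC ler_pdivrMr; lra.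
have h4 : C * \int[dx]_x (u s x - u0 x) ^+ 2 <= e / 2.
  have := ler_wpM2l (ltW C0) h2.
  by have -> : C * (e / (2 * C)) = e / 2 by field; rewrite gt_eqF.
by rewrite -/P; lra.
Qed.

(** With the Fisher information discarded, the entropy grows at rate at most [kappa * M * 2 * 2],
    each of the two gaps being at most 2. The regularised entropy is followed from a small time [s1]
    given by [entr_initial], before [k] tends to infinity. *)
Lemma entropy_initial_bound s : (forall r, 0 < r -> \int[dx]_x `|w r x - m| <= 2) -> 0 < s ->
  H s <= \int[dx]_x (u0 x * ln (u0 x / m)) + kappa * M * 4 * s.
Proof.
move=> w2 s0; set H0 := \int[dx]_x (u0 x * ln (u0 x / m)); have km : 0 <= kappa * M by rewrite mulr_ge0 ?(ltW kappa0).
have key k : G (harm k) s <= \int[dx]_x entr m (harm k ^+ 2) (u0 x) + (kappa * M * 4 * s + harm k * (kappa * M * 2 * K0 * s)).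
  set q := harm k; have q0 : 0 < q := @harm_gt0 R k; have q1 : q <= 1 := @harm_le1 R k.
  apply/ler_addgt0Pr => e e0; have [d d0 hd] := entr_initial q0 q1 e0.
  pose s1 := Num.min (d / 2) s.
  have s10 : 0 < s1 by rewrite lt_min s0 divr_gt0.
  have sd : s1 < d by rewrite gt_min; apply/orP; left; lra.
  have ss : s1 <= s by rewrite ge_min lexx orbT.
  have := hd s1; rewrite s10 sd => /(_ isT) h1.
  pose C := kappa * M * 4 + q * (kappa * M * 2 * K0).
  have C0 : 0 <= C.
    have h := entr_rate_ge0 q0; apply: addr_ge0; first by rewrite mulr_ge0.
    have -> : q * (kappa * M * 2 * K0) = kappa * M * 2 * (q * K0) by ring.
    by rewrite mulr_ge0// mulr_ge0.
  have dG r : s1 <= r <= s -> is_derive r 1 (fun r => G q r) (\int[dx]_x (entr' (q ^+ 2) (u r x) * u' r x)).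
    by move=> /andP[/(lt_le_trans s10) r0 _]; exact: is_derive_entr.
  have dC r : s1 <= r <= s -> is_derive r 1 (fun r : R => C * r) C.
    by move=> _; apply: is_derive_eq; rewrite /GRing.scale/=; ring.
  have := derive_le ss dG dC; move=> /(_ _)/wrap[].
    move=> r /andP[/(lt_le_trans s10) r0 _].
    have h2 := entropy_rate r0 q0 q1 (w2 r r0); have h3 := fisher_ge0 r0 q0.
    have h4 : kappa * (M * 2 * (a r + q * K0)) <= C.
      have -> : C = kappa * (M * 2 * (2 + q * K0)) by rewrite /C; ring.
      by rewrite ler_pM2l// ler_wpM2l ?mulr_ge0// lerD2r gap_le2.
    by move: h2 h3 h4; lra.
  move=> h2; have h3 : C * s1 >= 0 by rewrite mulr_ge0// ltW.
  have h4 : C * s = kappa * M * 4 * s + q * (kappa * M * 2 * K0 * s) by rewrite /C; ring.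
  by move: h1 h2 h3; rewrite h4; lra.
have L1 := ucvg s0.
have L2 : \int[dx]_x entr m (harm k ^+ 2) (u0 x) + (kappa * M * 4 * s + harm k * (kappa * M * 2 * K0 * s)) @[k --> \oo] -->
    H0 + (kappa * M * 4 * s + 0 * (kappa * M * 2 * K0 * s)).
  apply: cvgD; first exact: (entropy_cvg L0).
  by apply: cvgD; [exact: cvg_cst|apply: cvgM; [exact: cvg_harmonic|exact: cvg_cst]].
rewrite mul0r addr0 in L2.
by apply: (ler_cvg_to L1 L2); exact: nearW.
Qed.

End entropy_orbit.

(** * Decay of the mean entropy *)

Section nonmeasurable_integral.
Context d (T : measurableType d) (R : realType) (mu : {measure set T -> \bar R}).
Local Open Scope ereal_scope.
Implicit Types f g : T -> \bar R.

(** Immediate from the integral as a supremum over simple functions, hence valid for arbitrary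
    nonnegative functions. *)
Lemma ge0_le_integral_any f g : (forall x, 0 <= f x) -> (forall x, f x <= g x) ->
  \int[mu]_x f x <= \int[mu]_x g x.
Proof.
move=> f0 fg; rewrite !ge0_integralTE//; last by move=> x; exact: le_trans (fg x).
apply: ge_ereal_sup => /= _ [h hf <-]; apply: ereal_sup_ubound.
by exists h => //= x; exact: le_trans (fg x).
Qed.

Variable N : set T.
Hypotheses (mN : measurable N) (N0 : mu N = 0).

Let mmN : measurable_fun setT (fun x => x \in N).
Proof.
apply: (measurable_fun_bool true); rewrite setTI (_ : _ @^-1` _ = N)//.
by apply/seteqP; split=> x /=; [move/set_mem|move/mem_set].
Qed.

Let patchN g x := if x \in N then +oo else g x.

Let integral_patchN g : measurable_fun setT g -> (forall x, 0 <= g x) ->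
  \int[mu]_x patchN g x = \int[mu]_x g x.
Proof.
move=> mg g0; apply: ge0_ae_eq_integral => //.
- exact: measurable_fun_ifT.
- by move=> x _; rewrite /patchN; case: ifP.
- exists N; split => // x /= /not_implyP[_]; rewrite /patchN; case: ifPn => [|//].
  by rewrite inE.
Qed.

(* [f] need not be measurable: the slices of a solution are controlled only off
   the null set [N]. *)
Lemma integral_le_null f g : measurable_fun setT g -> (forall x, 0 <= g x) ->
  (forall x, ~ N x -> f x <= g x) -> \int[mu]_x f x <= \int[mu]_x g x.
Proof.
move=> mg g0 fg; rewrite integralE -(integral_patchN mg g0).
apply: (@le_trans _ _ (\int[mu]_x f^\+ x)).
  rewrite -[leRHS]sube0; apply: leeB => //.
  by apply: integral_ge0 => x _; exact: funeneg_ge0.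
apply: ge0_le_integral_any => x; first exact: funepos_ge0.
rewrite /patchN; case: ifPn => [|xN]; first by rewrite leey.
by rewrite funeposE ge_max g0 andbT fg//; move: xN; rewrite notin_setE.
Qed.

(** The lower counterpart, for the initial entropy. Off [N] the negative part of [f] vanishes, so
    its integral is bounded by that of a function infinite on [N] and 0 elsewhere, which is 0. *)
Lemma integral_ge_null f g : measurable_fun setT g -> (forall x, 0 <= g x) ->
  (forall x, ~ N x -> g x <= f x) -> \int[mu]_x g x <= \int[mu]_x f x.
Proof.
move=> mg g0 gf; rewrite [leRHS]integralE.
have -> : \int[mu]_x f^\- x = 0.
  apply/eqP; rewrite eq_le; apply/andP; split; last by apply: integral_ge0 => x _; exact: funeneg_ge0.
  have <- : \int[mu]_x patchN (cst 0) x = 0 by rewrite integral_patchN// integral0.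
  apply: ge0_le_integral_any => x; first exact: funeneg_ge0.
  rewrite /patchN; case: ifPn => [|xN]; first by rewrite leey.
  rewrite funenegE ge_max lexx andbT leeNl oppe0 (le_trans (g0 x))// gf//.
  by move: xN; rewrite notin_setE.
rewrite sube0.
pose h x := if x \in N then 0 else g x.
have -> : \int[mu]_x g x = \int[mu]_x h x.
  apply: ge0_ae_eq_integral => //.
  - exact: measurable_fun_ifT.
  - by move=> x _; rewrite /h; case: ifP.
  - exists N; split => // x /= /not_implyP[_]; rewrite /h; case: ifPn => [|//].
    by rewrite inE.
apply: ge0_le_integral_any => x; rewrite /h; case: ifPn => // xN.
by rewrite funeposE le_max gf//; move: xN; rewrite notin_setE.
Qed.

End nonmeasurable_integral.

(** * The graphop and null sets *)

Section equator_null.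
Context {R : realType}.
Local Notation S := (sphere R).
Local Notation mu := (@sphere_unif R).

(** The mean over the sphere of [equator_unif xi N] is the measure of [N], by [equator_mean] for an
    indicator. For almost every [xi] the graphop therefore ignores the slices in [N]. *)
Lemma equator_null (N : set S) : measurable N -> mu N = 0%E ->
  {ae mu, forall xi, equator_unif xi N = 0%E}.
Proof.
move=> mN N0; pose g (x : S) : \bar R := (\1_N x)%:E.
have mg : measurable_fun setT g by exact/measurable_EFinP/measurable_indic.
have g0 x : (0 <= g x)%E by rewrite lee_fin.
have E (m : {measure set S -> \bar R}) : (\int[m]_eta g eta = m N)%E by rewrite integral_indic// setIT.
have mE : measurable_fun setT (fun xi : S => equator_unif xi N).
  rewrite (_ : (fun xi => _) = fun xi => (\int[equator_unif xi]_eta g eta)%E).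
    exact: measurable_equator_integral.
  by apply/funext => xi; rewrite E.
have := (@ae_eq_integral_abs _ _ _ mu setT measurableT _ mE).1.
move=> /(_ _)/wrap[].
  rewrite -[RHS]N0 -E -(equator_mean mg g0); apply: eq_integral => xi _.
  by rewrite gee0_abs// E.
by apply: filterS => xi /(_ Logic.I).
Qed.

Lemma measurable_equator (xi : S) : measurable (equator xi).
Proof.
have m : measurable_fun setT (fun eta : S => dot (\val xi) (\val eta)).
  by apply: measurable_dot => //; exact: measurable_sphere_val.
have := m measurableT [set 0] (measurable_set1 0); rewrite setTI.
by congr measurable.
Qed.

Lemma equator_unifC (xi : S) : equator_unif xi (~` equator xi) = 0%E.
Proof.
rewrite /equator_unif /pushforward (_ : _ @^-1` _ = set0) ?measure0//.
by apply/seteqP; split=> // t /=; apply; exact: circle_chart_equator.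
Qed.

Lemma spherical_graphop_null (N : set S) (xi : S) (f g : S -> R) : measurable N -> equator_unif xi N = 0%E ->
  measurable_fun setT f -> measurable_fun setT g -> (forall eta, ~ N eta -> f eta = g eta) ->
  spherical_graphop f xi = \int[equator_unif xi]_eta g eta.
Proof.
move=> mN N0 mf mg fg; rewrite /spherical_graphop /Rintegral; congr fine.
rewrite [RHS](_ : _ = \int[equator_unif xi]_(eta in setT) (g \_ (equator xi) eta)%:E)%E.
  rewrite integral_mkcond; apply: ae_eq_integral => //.
  - apply/(measurable_restrictT _ (measurable_equator xi)).1/measurable_EFinP.
    exact: measurable_funTS.
  - apply/measurable_EFinP/(measurable_restrictT _ (measurable_equator xi)).1.
    exact: measurable_funTS.
  - exists N; split => // eta /= /not_implyP[_]; rewrite !patchE; case: ifP => //= _.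
    by move=> h; apply: contrapT => hN; apply: h; rewrite fg.
apply: ae_eq_integral => //; first exact/measurable_EFinP.
  apply/measurable_EFinP/(measurable_restrictT _ (measurable_equator xi)).1.
  exact: measurable_funTS.
exists (~` equator xi); split; [exact/measurableC/measurable_equator|exact: equator_unifC|].
move=> eta /= /not_implyP[_]; rewrite patchE; case: ifPn => //=; rewrite notin_setE => h _; exact: h.
Qed.

Lemma Rint_equator_mean (g : S -> R) C : measurable_fun setT g -> (forall x, 0 <= g x <= C) ->
  \int[mu]_xi (\int[equator_unif xi]_eta g eta) = \int[mu]_xi g xi.
Proof.
move=> mg g0; have mE : measurable_fun setT (EFin \o g) by exact/measurable_EFinP.
have := equator_mean mE => /(_ _)/wrap[].
  by move=> x; rewrite /= lee_fin; have /andP[] := g0 x.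
move=> E; rewrite /Rintegral -E; congr fine; apply: eq_integral => xi _.
rewrite /= fineK//; apply: integrable_fin_num => //.
apply: (@intg_bdd _ _ _ (equator_unif xi) _ C) => //.
by apply: aeW => x; have /andP[h1 h2] := g0 x; rewrite ger0_norm.
Qed.

End equator_null.

(** * Gronwall's lemma and exchange of time and sphere integrals *)

Section gronwall.
Context {R : realType}.

(** [Z] is not assumed continuous: the argument is run on its differentiable majorant [J], for which
    [expR (- 2 k r) * J r] is nonincreasing. *)
Lemma gronwall (Z K : R -> R) k s t : s <= t -> 0 <= k -> continuous K ->
  (forall r, s <= r <= t -> Z r <= Z s + k * \int[lebesgue_measure]_(q in `[s, r]) K q) ->
  (forall r, s <= r <= t -> K r <= 2 * Z r) ->
  Z t <= expR (2 * k * (t - s)) * Z s.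
Proof.
move=> st k0 cK hZ hK; have [P dP] := primitive cK.
pose J r := Z s + k * (P r - P s); pose b := 2 * k.
have ZJ r : s <= r <= t -> Z r <= J r.
  by move=> /[dup] /andP[sr _] /hZ; rewrite (FTC sr cK dP).
have dJ (r : R) : is_derive r 1 J (k * K r).
  have h := dP r; by apply: is_derive_eq; rewrite /GRing.scale/=; ring.
have dF (r : R) : s <= r <= t -> is_derive r 1 (fun r => expR (- (b * r)) * J r) (expR (- (b * r)) * (k * K r - b * J r)).
  move=> _; have h1 : is_derive r 1 (fun r : R => - (b * r)) (- b).
    by apply: is_derive_eq; rewrite /GRing.scale/=; ring.
  have h2 := @is_derive1_comp R expR (fun r => - (b * r)) r _ _ (is_derive_expR _) h1.
  have h4 := is_deriveM h2 (dJ r).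
  by apply: (@is_derive_eq _ _ _ _ _ _ _ _ h4); rewrite /GRing.scale/=; ring.
have d0 (r : R) : s <= r <= t -> is_derive r 1 (fun=> 0 : R) (0 : R) by move=> _; exact: is_derive_cst.
have := derive_le st dF d0; move=> /(_ _)/wrap[].
  move=> r hr; apply: mulr_ge0_le0; first exact: expR_ge0.
  have -> : b * J r = k * (2 * J r) by rewrite /b; ring.
  rewrite subr_le0 ler_wpM2l//.
  by apply: (le_trans (hK r hr)); rewrite ler_pM2l// ZJ.
rewrite subrr subr_le0 => h.
have tt : s <= t <= t by rewrite st lexx.
apply: (le_trans (ZJ t tt)); rewrite -(ler_pM2l (expR_gt0 (- (b * t)))); apply: (le_trans h).
rewrite mulrA -expRD /J subrr mulr0 addr0 le_eqVlt; apply/orP; left; apply/eqP; congr (expR _ * _).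
by rewrite /b; ring.
Qed.

Lemma Rint_prob_cst d (T : measurableType d) (P : probability T R) (c : R) : \int[P]_x c = c.
Proof.
have -> : \int[P]_x c = c * fine (P setT) by exact: Rint_cst.
by have := @probability_setT _ _ _ P => ->; rewrite mulr1.
Qed.

(** An integral over [[s, t]] is [t - s] times a mean for the uniform law, so that Fubini for
    bounded functions and finite measures applies. *)
Lemma Rint_swap_itv d (T : measurableType d) (mu : probability T R) (f : R -> T -> R) s t C :
  s < t -> measurable_fun setT (fun p : R * T => f p.1 p.2) -> (forall r x, 0 <= f r x <= C) ->
  \int[mu]_x \int[lebesgue_measure]_(r in `[s, t]) f r x =
  \int[lebesgue_measure]_(r in `[s, t]) \int[mu]_x f r x /\
  intg mu (fun x => \int[lebesgue_measure]_(r in `[s, t]) f r x).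
Proof.
move=> st mf f0; have C0 : 0 <= C by have /andP[] := f0 0 point; exact: le_trans.
have mfx x : measurable_fun setT (f ^~ x) by exact: (measurableT_comp mf (measurable_pair2 x)).
have mfr r : measurable_fun setT (f r) by exact: (measurableT_comp mf (measurable_pair1 r)).
have ts : 0 < t - s by lra.
have E (g : R -> R) : measurable_fun setT g -> (forall r, 0 <= g r <= C) ->
    \int[lebesgue_measure]_(r in `[s, t]) g r = (t - s) * \int[uniform_prob st]_r g r.
  move=> mg g0; have mE : measurable_fun setT (EFin \o g) by exact/measurable_EFinP.
  have := integral_uniform st mE => /(_ _)/wrap[].
    by move=> x; rewrite /= lee_fin; have /andP[] := g0 x.
  rewrite /Rintegral /comp => ->.
  case: (\int[lebesgue_measure]_(x in `[s, t]) _)%E => [r| |].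
  - by rewrite -EFinM/= mulrA divff ?mul1r// gt_eqF.
  - by rewrite gt0_muley ?lte_fin ?invr_gt0//= mulr0.
  - by rewrite gt0_muleNy ?lte_fin ?invr_gt0//= mulr0.
have mI : measurable_fun setT (fun r => \int[mu]_x f r x) by exact: (measurable_Rint mu mf).
have If (r : R) : 0 <= \int[mu]_x f r x <= C.
  have I1 : intg mu (f r) by apply: (intg_bdd (C := C)) => //; apply: aeW => x; have /andP[h1 h2] := f0 r x; rewrite ger0_norm.
  apply/andP; split; first by apply: Rintegral_ge0 => x _; have /andP[] := f0 r x.
  rewrite -[leRHS](_ : \int[mu]_x C = C); last exact: Rint_prob_cst.
  by apply: Rint_ae_le => //; [exact: intg_cst|apply: aeW => x; have /andP[] := f0 r x].
have I : intg mu (fun x => \int[uniform_prob st]_r f r x).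
  have mf' : measurable_fun setT (fun p : T * R => f p.2 p.1).
    have h := @measurableT_comp _ _ _ _ _ _ _ _ (fun q : T * R => (q.2, q.1)) mf.
    apply: h; apply/measurable_fun_pairP; split; [exact: measurable_snd|exact: measurable_fst].
  apply: (intg_bdd (C := C)); first exact: (measurable_Rint (uniform_prob st) mf').
  apply: aeW => x; have I1 : intg (uniform_prob st) (f ^~ x).
    by apply: (intg_bdd (C := C)); [exact: mfx|]; apply: aeW => r; have /andP[h1 h2] := f0 r x; rewrite ger0_norm.
  rewrite ger0_norm; last by apply: Rintegral_ge0 => r _; have /andP[] := f0 r x.
  rewrite -[leRHS](_ : \int[uniform_prob st]_r C = C); last exact: Rint_prob_cst.
  by apply: Rint_ae_le => //; [exact: intg_cst|apply: aeW => r; have /andP[] := f0 r x].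
have Ex x := E _ (mfx x) (fun r => f0 r x).
split; last by under eq_fun do rewrite Ex; exact: intgZ.
rewrite (E _ mI If); under eq_Rintegral do rewrite Ex.
rewrite RintZ//; congr (_ * _); symmetry.
by apply: (@Rint_fubini _ _ _ _ _ (uniform_prob st) mu (fun p => f p.1 p.2) C) => // -[r x]; have /andP[h1 h2] := f0 r x; rewrite ger0_norm.
Qed.

End gronwall.

Lemma continuous_seq {R : realType} (f : R -> R) :
  (forall p (u : nat -> R), u k @[k --> \oo] --> p -> f (u k) @[k --> \oo] --> f p) -> continuous f.
Proof. by move=> h p; have := (@cvg_nbhsP R R^o f p (f p)).2; apply; exact: h. Qed.

Lemma seq_continuous {R : realType} (f : R -> R) (u : nat -> R) p : continuous f ->
  u k @[k --> \oo] --> p -> f (u k) @[k --> \oo] --> f p.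
Proof. by move=> cf h; apply: continuous_cvg => //; exact: cf. Qed.

Lemma measurable_caratheodory1 {R : realType} d (T : measurableType d) (F : R -> T -> R) :
  (forall w, continuous (F ^~ w)) -> (forall r, measurable_fun setT (F r)) ->
  measurable_fun setT (fun p : R * T => F p.1 p.2).
Proof.
move=> cF mF.
have h := @measurable_caratheodory R _ T 1 (fun x w => F (x ord0 ord0) w).
have {}h : measurable_fun setT (fun p : 'rV[R]_1 * T => F (p.1 ord0 ord0) p.2).
  apply: h => // w x.
  apply: (@continuous_comp _ _ _ (fun x : 'rV[R]_1 => x ord0 ord0) (F ^~ w)); last exact: cF.
  exact: coord_continuous.
have m : measurable_fun setT (fun p : R * T => (\row_(i < 1) p.1, p.2)).
  apply/measurable_fun_pairP; split; last exact: measurable_snd.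
  apply/measurable_fun_rVP => i; rewrite (_ : (fun x => _) = fst)//.
  by apply/funext => p /=; rewrite mxE.
have := measurableT_comp h m; rewrite (_ : _ \o _ = fun p : R * T => F p.1 p.2)//.
by apply/funext => p /=; rewrite mxE.
Qed.

(** * The family of slices, averaged over the sphere *)

Section sphere_process.
Context {R : realType} (L : R) (n : nat).
Hypothesis L0 : 0 < L.
Local Notation S := (sphere R).
Local Notation mu := (@sphere_unif R).
Local Notation dx := (dx L (d:=n)).
Local Notation V := (fine (dx setT)).
Local Notation m := (L ^- n).
Implicit Types (t r s : R) (xi : S).
Let m0 : 0 < m := m_gt0 n L0.

Variables (v : R -> 'rV[R]_n -> S -> R) (N : set S).
Hypotheses (mN : measurable N) (N0 : mu N = 0%E).
Hypothesis cv : forall t xi, 0 < t -> continuous (v t ^~ xi) /\ periodic L (v t ^~ xi).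
Hypothesis mv : forall t x, 0 < t -> measurable_fun setT (v t x).
Hypothesis v_ge0 : forall t x xi, 0 < t -> 0 <= v t x xi.
Hypothesis v_mass : forall t xi, 0 < t -> ~ N xi -> \int[dx]_x v t x xi = 1.
Hypothesis v_null : forall t x xi, N xi -> v t x xi = 0.
Hypothesis cgap : forall t xi, 0 < t -> {for t, continuous (fun r => \int[dx]_x `|v r x xi - m|)}.

Let jv t : 0 < t -> measurable_fun setT (fun p : 'rV[R]_n * S => v t p.1 p.2).
Proof.
move=> t0; apply: measurable_caratheodory; [by move=> xi; have [] := cv xi t0|by move=> x; exact: mv].
Qed.

Let jv' t : 0 < t -> measurable_fun setT (fun p : S * 'rV[R]_n => v t p.2 p.1).
Proof.
move=> /jv m1; have h := @measurableT_comp _ _ _ _ _ _ _ _ (fun q : S * 'rV[R]_n => (q.2, q.1)) m1.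
apply: h; apply/measurable_fun_pairP; split; [exact: measurable_snd|exact: measurable_fst].
Qed.

Let bv t xi : 0 < t -> bmeas (fun x => v t x xi).
Proof. by move=> t0; have [c p] := cv xi t0; exact: (bmeas_continuous L0). Qed.

Let Iv t xi : 0 < t -> intg dx (fun x => v t x xi).
Proof. by move=> t0; exact/bmeas_intg/bv. Qed.

Let Iv2 t xi : 0 < t -> intg dx (fun x => v t x xi ^+ 2).
Proof.
by move=> t0; apply: (bmeas_intg L); under eq_fun do rewrite expr2; apply: bmeasM; exact: bv.
Qed.

Definition gap t xi := \int[dx]_x `|v t x xi - m|.
Definition gap_avg t xi := \int[equator_unif xi]_eta gap t eta.
Definition entropy_at t xi := \int[dx]_x (v t x xi * ln (v t x xi / m)).

Lemma measurable_gap t : 0 < t -> measurable_fun setT (gap t).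
Proof.
move=> t0; apply: (@measurable_Rint _ _ _ _ _ dx (fun p : S * 'rV[R]_n => `|v t p.2 p.1 - m|)).
by apply: measurableT_comp => //; apply: measurable_funB => //; exact: jv'.
Qed.

Lemma gap_bounds t xi : 0 < t -> 0 <= gap t xi <= 2.
Proof.
move=> t0; rewrite /gap; apply/andP; split; first by apply: Rintegral_ge0 => x _.
have [xN|xN] := pselect (N xi); last first.
  by apply: (mass_gap_le2 L0); [apply: aeW => x; exact: v_ge0|exact: Iv|exact: v_mass].
(* On [N] the slice is zero, and its gap is the integral of [m], that is 1. *)
under eq_Rintegral do rewrite v_null// sub0r normrN.
by rewrite Rint_cst (gtr0_norm m0) mV1//; lra.
Qed.

Lemma measurable_entropy_at t : 0 < t -> measurable_fun setT (entropy_at t).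
Proof.
move=> t0; apply: (@measurable_Rint _ _ _ _ _ dx (fun p : S * 'rV[R]_n => v t p.2 p.1 * ln (v t p.2 p.1 / m))).
apply: measurable_funM; first exact: jv'.
apply: (measurableT_comp (@measurable_ln R)); apply: measurable_funM => //; exact: jv'.
Qed.

Lemma gap_entropy t xi : 0 < t -> ~ N xi -> gap t xi ^+ 2 <= 2 * entropy_at t xi.
Proof.
move=> t0 xN; apply: (pinsker L0); [|exact: Iv|exact: Iv2|exact: v_mass].
by apply: aeW => x; exact: v_ge0.
Qed.

Lemma entropy_at_ge0 t xi : 0 < t -> 0 <= entropy_at t xi.
Proof.
move=> t0; have [xN|xN] := pselect (N xi).
  rewrite /entropy_at; under eq_Rintegral do rewrite v_null// mul0r.
  by rewrite Rint_cst mul0r.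
by have := gap_entropy t0 xN; have := sqr_ge0 (gap t xi); lra.
Qed.

Lemma intg_gap t xi : 0 < t -> intg (equator_unif xi) (gap t).
Proof.
move=> t0; apply: (intg_bdd (C := 2)); first exact: measurable_gap.
by apply: aeW => eta; have /andP[h1 h2] := gap_bounds eta t0; rewrite ger0_norm.
Qed.

Lemma gap_avg_bounds t xi : 0 < t -> 0 <= gap_avg t xi <= 2.
Proof.
move=> t0; apply/andP; split.
  by apply: Rintegral_ge0 => eta _; have /andP[] := gap_bounds eta t0.
rewrite -[leRHS](Rint_prob_cst (equator_unif xi) 2).
apply: Rint_ae_le; [exact: intg_gap|exact: intg_cst|].
by apply: aeW => eta; have /andP[] := gap_bounds eta t0.
Qed.

Lemma measurable_gap_avg t : 0 < t -> measurable_fun setT (gap_avg t).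
Proof.
move=> t0; apply: measurableT_comp => //; apply: measurable_equator_integral.
  exact/measurable_EFinP/measurable_gap.
by move=> eta; rewrite lee_fin; have /andP[] := gap_bounds eta t0.
Qed.

(* Jensen on each equator, then invariance of the mean under the graphop. *)
Lemma gap_product t : 0 < t ->
  \int[mu]_xi (gap t xi * gap_avg t xi) <= \int[mu]_xi gap t xi ^+ 2.
Proof.
move=> t0; have mg := measurable_gap t0; have mc := measurable_gap_avg t0.
have g2 xi : 0 <= gap t xi ^+ 2 <= 4.
  have /andP[h1 h2] := gap_bounds xi t0; rewrite sqr_ge0/=.
  by have := ler_pM h1 h1 h2 h2; rewrite -expr2; lra.
have mg2 : measurable_fun setT (fun xi => gap t xi ^+ 2) by exact: measurable_funX.
have Ig2 (P : probability S R) : intg P (fun xi => gap t xi ^+ 2).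
  by apply: (intg_bdd (C := 4)) => //; apply: aeW => xi; have /andP[h1 h2] := g2 xi; rewrite ger0_norm.
have Ic2 : intg mu (fun xi => gap_avg t xi ^+ 2).
  apply: (intg_bdd (C := 4)); first exact: measurable_funX.
  apply: aeW => xi; have /andP[h1 h2] := gap_avg_bounds xi t0; rewrite ger0_norm ?sqr_ge0//.
  by have := ler_pM h1 h1 h2 h2; rewrite -expr2; lra.
have jensen xi : gap_avg t xi ^+ 2 <= \int[equator_unif xi]_eta (gap t eta ^+ 2).
  set c := gap_avg t xi; have If := intg_gap xi t0.
  have I1 : intg (equator_unif xi) (fun eta => 2 * c * gap t eta - c ^+ 2).
    by apply: intgB; [exact: intgZ|exact: intg_cst].
  have -> : c ^+ 2 = \int[equator_unif xi]_eta (2 * c * gap t eta - c ^+ 2).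
    rewrite RintB; [|exact: intgZ|exact: intg_cst].
    rewrite RintZ// Rint_prob_cst -/(gap_avg t xi) -/c; ring.
  apply: Rint_ae_le; [exact: I1|exact: Ig2|]; apply: aeW => eta; rewrite -subr_ge0.
  have -> : gap t eta ^+ 2 - (2 * c * gap t eta - c ^+ 2) = (gap t eta - c) ^+ 2 by ring.
  exact: sqr_ge0.
have Ia2 : intg mu (fun xi => \int[equator_unif xi]_eta (gap t eta ^+ 2)).
  apply: (intg_bdd (C := 4)).
    apply: measurableT_comp => //; apply: measurable_equator_integral.
      exact/measurable_EFinP.
    by move=> eta; rewrite lee_fin; have /andP[] := g2 eta.
  apply: aeW => xi; rewrite ger0_norm; last by apply: Rintegral_ge0 => eta _; have /andP[] := g2 eta.
  rewrite -[leRHS](Rint_prob_cst (equator_unif xi) 4).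
  by apply: Rint_ae_le; [exact: Ig2|exact: intg_cst|apply: aeW => eta; have /andP[] := g2 eta].
have E := Rint_equator_mean mg2 g2.
apply: (@le_trans _ _ (\int[mu]_xi (2^-1 * gap t xi ^+ 2 + 2^-1 * \int[equator_unif xi]_eta (gap t eta ^+ 2)))).
  apply: Rint_ae_le.
  - apply: (intg_bdd (C := 4)); first exact: measurable_funM.
    apply: aeW => xi; have /andP[h1 h2] := gap_bounds xi t0; have /andP[h3 h4] := gap_avg_bounds xi t0.
    by rewrite ger0_norm ?mulr_ge0//; have := ler_pM h1 h3 h2 h4; lra.
  - by apply: intgD; apply: intgZ => //; exact: Ig2.
  - apply: aeW => xi; have := jensen xi; have := sqr_ge0 (gap t xi - gap_avg t xi).
    by rewrite sqrrB; move: (\int[_]_eta _) => q; nra.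
rewrite RintD; [|exact/intgZ/Ig2|exact: intgZ].
rewrite !RintZ ?E//; last exact: Ig2.
by move: (\int[_]_xi _) => q; lra.
Qed.

(** Minkowski's inequality in L^1: the triangle inequality inside the mean over the equator, then
    Tonelli. The constant [m] passes inside because [equator_unif] is a probability. *)
Lemma graphop_gap t xi (f : 'rV[R]_n -> S -> R) : 0 < t -> equator_unif xi N = 0%E ->
  (forall x, measurable_fun setT (f x)) -> (forall x eta, ~ N eta -> f x eta = v t x eta) ->
  intg dx (fun y => spherical_graphop (f y) xi) ->
  \int[dx]_y `|spherical_graphop (f y) xi - m| <= gap_avg t xi.
Proof.
move=> t0 NN mf fv Iw.
have E y : spherical_graphop (f y) xi = \int[equator_unif xi]_eta v t y eta.
  by apply: (spherical_graphop_null mN NN (mf y) (mv y t0)) => eta; exact: fv.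
have j1 : measurable_fun setT (fun p : 'rV[R]_n * S => (`|v t p.1 p.2 - m|%R)%:E).
  by apply/measurable_EFinP; apply: measurableT_comp => //; apply: measurable_funB => //; exact: jv.
have IW : intg dx (fun y => `|spherical_graphop (f y) xi - m|).
  by apply/intg_norm/intgB => //; exact: intg_cst.
rewrite -lee_fin !EFin_Rint//; last exact: intg_gap.
have -> : (\int[equator_unif xi]_eta (gap t eta)%:E =
    \int[equator_unif xi]_eta \int[dx]_y (`|v t y eta - m|%R)%:E)%E.
  apply: eq_integral => eta _; rewrite EFin_Rint//.
  by apply/intg_norm/intgB; [exact: Iv|exact: intg_cst].
have FT := @fubini_tonelli _ _ _ _ _ dx (equator_unif xi) _ j1 (fun p => _).
rewrite -(FT _)/=; last by move=> p; rewrite lee_fin.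
have mF := @measurable_fun_fubini_tonelli_F _ _ _ _ _ (equator_unif xi) _ j1 (fun p => _).
apply: ge0_le_integral => //.
- exact/measurable_EFinP/intg_measurable/IW.
- by apply: mF => p; rewrite lee_fin.
move=> y _; rewrite E; set B := (\int[_]_eta _)%E.
(* For this particular [y], [v t y] need not be integrable on the equator; where [B] is infinite the
   bound is trivial. *)
have [Boo|Boo] := ltP B +oo%E; last first.
  by apply: le_trans Boo; rewrite leey.
have Iy : intg (equator_unif xi) (fun eta => v t y eta - m).
  apply/integrableP; split; last exact: Boo.
  by apply/measurable_EFinP/measurable_funB => //; exact: mv.
have Iy' : intg (equator_unif xi) (v t y).
  have := intgD Iy (intg_cst (equator_unif xi) m).
  by under eq_fun do rewrite subrK.
have -> : \int[equator_unif xi]_eta v t y eta - m = \int[equator_unif xi]_eta (v t y eta - m).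
  by rewrite RintB//; [rewrite Rint_prob_cst|exact: intg_cst].
by rewrite -[B]EFin_Rint; [rewrite lee_fin; exact: Rint_norm_le|exact: intg_norm].
Qed.

Section decay.
Variable s : R.
Hypothesis s0 : 0 < s.
Let ms r : 0 < Num.max s r. Proof. by rewrite lt_max s0. Qed.

Let cmax : continuous (fun r => Num.max s r).
Proof. by move=> r; apply: continuous_max; [exact: cst_continuous|exact: cvg_id]. Qed.

Let cA xi : continuous (fun r => gap (Num.max s r) xi).
Proof.
by move=> r; apply: (@continuous_comp _ _ _ (fun r => Num.max s r) (gap ^~ xi)); [exact: cmax|exact: cgap].
Qed.

Lemma continuous_gap_avg xi : continuous (fun r => gap_avg (Num.max s r) xi).
Proof.
apply: continuous_seq => r u ur.
apply: (@Rint_dct _ _ _ _ _ _ (fun=> 2)).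
- by move=> k; exact: measurable_gap.
- exact: measurable_gap.
- exact: intg_cst.
- by apply: aeW => eta k; have /andP[h1 h2] := gap_bounds eta (ms (u k)); rewrite ger0_norm.
- apply: aeW => eta.
  exact: (seq_continuous (@cA eta) ur).
Qed.

Let F r xi := gap (Num.max s r) xi * gap_avg (Num.max s r) xi.

Let F_bounds r xi : 0 <= F r xi <= 4.
Proof.
have /andP[h1 h2] := gap_bounds xi (ms r); have /andP[h3 h4] := gap_avg_bounds xi (ms r).
by rewrite /F mulr_ge0//=; have := ler_pM h1 h3 h2 h4; lra.
Qed.

Let mF r : measurable_fun setT (F r).
Proof. by apply: measurable_funM; [exact: measurable_gap|exact: measurable_gap_avg]. Qed.

Let cF xi : continuous (fun q => F q xi).
Proof.
move=> r; apply: (@continuousM R R (fun r => gap (Num.max s r) xi) (fun r => gap_avg (Num.max s r) xi)).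
  exact: cA.
exact: continuous_gap_avg.
Qed.

Let IF r : intg mu (F r).
Proof.
apply: (intg_bdd (C := 4)) => //.
by apply: aeW => xi; have /andP[h1 h2] := F_bounds r xi; rewrite ger0_norm.
Qed.

Let cK : continuous (fun r => \int[mu]_xi F r xi).
Proof.
apply: continuous_seq => r u ur.
apply: (@Rint_dct _ _ _ _ _ _ (fun=> 4)) => //.
- exact: intg_cst.
- by apply: aeW => xi k; have /andP[h1 h2] := F_bounds (u k) xi; rewrite ger0_norm.
- by apply: aeW => xi; exact: (seq_continuous (@cF xi) ur).
Qed.

Variables (k lam t : R) (N' : set S).
Hypotheses (st : s <= t) (k0 : 0 <= k) (l0 : 0 <= lam) (mN' : measurable N') (N'0 : mu N' = 0%E).
Hypothesis NN' : N `<=` N'.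
Hypothesis IH : forall r, s <= r <= t -> intg mu (entropy_at r).
Hypothesis duhamel : forall r xi, ~ N' xi -> s <= r <= t -> expR (lam * r) * entropy_at r xi <=
  expR (lam * s) * entropy_at s xi +
  k * \int[lebesgue_measure]_(q in `[s, r]) (expR (lam * q) * (gap q xi * gap_avg q xi)).

Let aeN' (P : S -> Prop) : (forall xi, ~ N' xi -> P xi) -> {ae mu, forall xi, P xi}.
Proof.
by move=> h; exists N'; split => // xi /= nP; apply: contrapT => /h.
Qed.

(** Gronwall's lemma for [Z], the mean entropy times [expR (lam * r)]. The source [K] is the mean
    product of gaps, which [gap_product] and Pinsker's inequality bound by [2 Z]; this gives the
    growth [2 k] to set against [lam]. *)
Lemma entropy_mean_decay : \int[mu]_xi entropy_at t xi <=
  expR (- (lam - 2 * k) * (t - s)) * \int[mu]_xi entropy_at s xi.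
Proof.
pose Z r := expR (lam * r) * \int[mu]_xi entropy_at r xi.
pose K r := expR (lam * r) * \int[mu]_xi F r xi.
have cexp : continuous (fun r : R => expR (lam * r)).
  move=> r; apply: (@continuous_comp _ _ _ (fun r => lam * r) expR); last exact: continuous_expR.
  by apply: cvgM; [exact: cvg_cst|exact: cvg_id].
have cKK : continuous K.
  by move=> r; apply: (@continuousM R R (fun r => expR (lam * r)) (fun r => \int[mu]_xi F r xi)); [exact: cexp|exact: cK].
have ss : s <= s <= t by rewrite lexx.
have KZ r : s <= r <= t -> K r <= 2 * Z r.
  move=> hr; have /andP[sr _] := hr; have r0 : 0 < r by exact: lt_le_trans sr.
  have -> : 2 * Z r = expR (lam * r) * (2 * \int[mu]_xi entropy_at r xi) by rewrite /Z; ring.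
  rewrite /K ler_pM2l ?expR_gt0//; under eq_Rintegral do rewrite /F max_r//.
  apply: (le_trans (gap_product r0)); rewrite -RintZ; last exact: IH.
  apply: Rint_ae_le; last by apply: aeN' => xi xN; apply: gap_entropy => // /NN'.
  - apply: (intg_bdd (C := 4)); first by apply: measurable_funX; exact: measurable_gap.
    apply: aeW => xi; have /andP[h1 h2] := gap_bounds xi r0; rewrite ger0_norm ?sqr_ge0//.
    by have := ler_pM h1 h1 h2 h2; rewrite -expr2; lra.
  - exact/intgZ/IH.
have ZK r : s <= r <= t -> Z r <= Z s + k * \int[lebesgue_measure]_(q in `[s, r]) K q.
  move=> hr; have /andP[sr rt] := hr.
  have [->|sr'] := eqVneq r s.
    rewrite lerDl mulr_ge0//; apply: Rintegral_ge0 => q _; rewrite mulr_ge0 ?expR_ge0//.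
    by apply: Rintegral_ge0 => xi _; have /andP[] := F_bounds q xi.
  have {}sr : s < r by rewrite lt_neqAle eq_sym sr' sr.
  (* Agrees with the integrand on [[s, r]]; capping the time in the exponential by [r] makes it
     bounded for every [q], as [Rint_swap_itv] requires. *)
  pose f q xi := expR (lam * Num.min r q) * F q xi.
  have f_bounds q xi : 0 <= f q xi <= expR (lam * r) * 4.
    have /andP[h1 h2] := F_bounds q xi; rewrite mulr_ge0 ?expR_ge0//=.
    apply: ler_pM => //; rewrite ?expR_ge0// ler_expR ler_wpM2l//.
    by rewrite ge_min lexx.
  have mf : measurable_fun setT (fun p : R * S => f p.1 p.2).
    apply: measurable_caratheodory1 => [xi q|q]; last by apply: measurable_funM.
    apply: (@continuousM R R (fun q => expR (lam * Num.min r q)) (F ^~ xi)); last exact: cF.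
    apply: (@continuous_comp _ _ _ (fun q => Num.min r q) (fun y => expR (lam * y))); last exact: cexp.
    by apply: continuous_min; [exact: cst_continuous|exact: cvg_id].
  have [E I] := @Rint_swap_itv _ _ _ mu f s r _ sr mf f_bounds.
  have Eq xi : \int[lebesgue_measure]_(q in `[s, r]) (expR (lam * q) * (gap q xi * gap_avg q xi)) =
      \int[lebesgue_measure]_(q in `[s, r]) f q xi.
    apply: eq_Rintegral => q; rewrite inE/= in_itv/= => /andP[sq qr].
    by rewrite /f /F max_r// min_r.
  have -> : \int[lebesgue_measure]_(q in `[s, r]) K q = \int[mu]_xi \int[lebesgue_measure]_(q in `[s, r]) f q xi.
    rewrite E; apply: eq_Rintegral => q; rewrite inE/= in_itv/= => /andP[sq qr].
    by rewrite /K /f min_r// RintZ.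
  rewrite /Z -!RintZ//; [|exact: IH..].
  rewrite -RintD; [|exact/intgZ/IH|exact: intgZ].
  apply: Rint_ae_le; [exact/intgZ/IH|by apply: intgD; [exact/intgZ/IH|exact: intgZ]|].
  by apply: aeN' => xi xN; rewrite -Eq; exact: duhamel.
have := gronwall st k0 cKK ZK KZ; rewrite /Z mulrA -expRD => h.
rewrite -(ler_pM2l (expR_gt0 (lam * t))); apply: (le_trans h).
rewrite mulrA -expRD le_eqVlt; apply/orP; left; apply/eqP; congr (expR _ * _); ring.
Qed.

End decay.

End sphere_process.

(** * From almost every slice to the theorem *)

Section orbit_summary.
Context {R : realType} (L : R) (n : nat).
Hypothesis L0 : 0 < L.
Local Notation dx := (dx L (d:=n)).
Local Notation m := (L ^- n).
Local Notation lam := (4 * pi ^+ 2 / L ^+ 2).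
Variables (u : R -> 'rV[R]_n -> R) (u0 : 'rV[R]_n -> R) (kappa : R) (D : 'rV[R]_n -> R) (w : R -> 'rV[R]_n -> R).
Local Notation M := (Linfty_norm L (weak_laplacian L D)).
Local Notation H t := (\int[dx]_x (u t x * ln (u t x / m))).
Local Notation H0 := (\int[dx]_x (u0 x * ln (u0 x / m))).
Hypotheses (kappa0 : 0 < kappa) (D2 : sobolev L 2 +oo%E D).
Hypothesis u0P : Pac L u0.
Hypothesis u00 : ('N[dx]_2%:E[EFin \o (fun x => u t x - u0 x)%R])%E @[t --> (0:R)^'+] --> 0%E.
Hypothesis uC : C1_C2 L u.
Hypothesis Iw : forall t, 0 < t -> w t \in Lfun dx 1%:E.
Hypothesis pde : forall t x, 0 < t -> derive1 (fun r => u r x) t =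
  kappa * \sum_i partial i (fun z => u t z * conv L (weak_partials L [:: i] D) (w t) z) x +
  \sum_i partials [:: i; i] (u t) x.

(** What the average over the sphere needs from one slice, with [w] any family of integrable fields.
    In the final proof [w] is [A rho] at [xi], and [c] the mean gap over the equator of [xi]. *)
Lemma orbit_summary : [/\
  [/\ forall t : R, 0 < t -> continuous (u t) /\ periodic L (u t),
      forall (t : R) x, 0 < t -> 0 <= u t x,
      forall t : R, 0 < t -> \int[dx]_x u t x = 1 &
      forall t : R, 0 < t -> {for t, continuous (fun r => \int[dx]_x `|u r x - m|)}],
  forall (c : R -> R) (s t : R), 0 < s -> s <= t ->
    (forall r, s <= r -> \int[dx]_x `|w r x - m| <= c r) -> (forall r, c r <= 2) -> continuous c ->
    expR (lam * t) * H t <= expR (lam * s) * H s +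
      kappa * M * \int[lebesgue_measure]_(r in `[s, t]) (expR (lam * r) * (\int[dx]_x `|u r x - m| * c r)),
  forall s : R, 0 < s -> (forall r, 0 < r -> \int[dx]_x `|w r x - m| <= 2) ->
    H s <= H0 + kappa * M * 4 * s,
  0 <= H0 &
  intg dx (fun x => u0 x * ln (u0 x / m))].
Proof.
have [/Lfun1_integrable Iu0 u0_ge0 u0_mass] := u0P.
have [u' uu'] := C1_C2_unif uC.
have Iw' t : 0 < t -> intg dx (w t) by move=> /Iw/Lfun1_integrable.
have pde' t x : 0 < t -> u' t x = kappa * \sum_i partial i (fun z => u t z * conv L (weak_partials L [:: i] D) (w t) z) x +
  \sum_i partials [:: i; i] (u t) x.
  move=> t0; rewrite -pde// derive1E; have [_ _ ud] := uu' t t0.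
  by have [_ ->] := unif_derive_pt x ud.
have cu t : 0 < t -> continuous (u t) /\ periodic L (u t).
  by move=> /uu'[/C2P[]].
have u_ge0 t x : 0 < t -> 0 <= u t x.
  exact: (orbit_ge0 L0 Iu0 u00 cu kappa0 D2 Iw' uu' pde' u0_ge0 u0_mass).
have u_mass t : 0 < t -> \int[dx]_x u t x = 1.
  exact: (orbit_mass L0 Iu0 u00 cu D2 Iw' uu' pde' u0_mass).
have Iu02 := intg_initial_sqr L0 Iu0 u00 cu.
split.
- split => // t t0; exact: (gap_continuous L0 uu' t0).
- move=> c s t s0 st hc c2 cc.
  exact: (entropy_duhamel L0 kappa0 D2 Iw' uu' pde' u_ge0 u_mass s0 st hc c2 cc).
- move=> s s0 w2.
  exact: (entropy_initial_bound L0 kappa0 D2 Iw' uu' pde' u_ge0 u_mass u0_ge0 Iu0 Iu02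
    (@initial_L2 _ _ _ L0 _ _ Iu0 u00 cu) w2 s0).
- have := pinsker L0 u0_ge0 Iu0 Iu02 u0_mass; have := sqr_ge0 (\int[dx]_x `|u0 x - m|); lra.
- exact: (intg_entropy L0 u0_ge0 Iu0 Iu02).
Qed.

End orbit_summary.

Theorem proposition26 (R : realType) (d : nat) (L kappa : R)
    (D : 'rV[R]_d -> R)
    (d_ge1 : (1 <= d)%N) (L_gt0 : 0 < L)
    (D_W2oo : sobolev L 2 +oo%E D)
    (kappa_gt0 : 0 < kappa)
    (kappa_lt : Linfty_norm L (weak_laplacian L D) != 0 ->
      kappa < 2 * pi ^+ 2 / (L ^+ 2 * Linfty_norm L (weak_laplacian L D)))
    (rho0 : 'rV[R]_d -> sphere R -> R)
    (rho0_adm : admissible L sphere_unif rho0)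
    (rho0_entropy : (entropy L sphere_unif rho0 < +oo)%E)
    (rho : R -> 'rV[R]_d -> sphere R -> R)
    (rho_sol : classical_solution L sphere_unif (@spherical_graphop R)
                 kappa D rho0 rho)
    (t : R) (t_ge0 : 0 <= t) :
  let alpha := 4 * pi ^+ 2 / L ^+ 2
               - 2 * kappa * Linfty_norm L (weak_laplacian L D) in
  (entropy L sphere_unif (rho t) <=
   (expR (- (alpha * t)))%:E * entropy L sphere_unif rho0)%E.
Proof.
cbv zeta; set alpha := 4 * pi ^+ 2 / L ^+ 2 - _; have [rho_per rho_L2 rho_A rho_pde [rho_0 rho_lim]] := rho_sol.
move: t_ge0; rewrite le_eqVlt => /predU1P[<-|t0].
  by rewrite rho_0 mulr0 oppr0 expR0 mul1e.
have [_ adm _] := rho0_adm.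
pose M := Linfty_norm L (weak_laplacian L D); pose lam := 4 * pi ^+ 2 / L ^+ 2.
pose w xi (r : R) y := spherical_graphop (rho r y) xi.
pose good xi := [/\ Pac L (rho0 ^~ xi),
  ('N[dx L]_2%:E[EFin \o (fun x => rho r x xi - rho0 x xi)%R])%E @[r --> (0:R)^'+] --> 0%E,
  C1_C2 L (fun r => rho r ^~ xi),
  forall r, 0 < r -> w xi r \in Lfun (dx L) 1%:E &
  forall r x, 0 < r -> solves_at L (@spherical_graphop R) kappa D rho r x xi].
have [N [mN N0 hN]] : {ae (@sphere_unif R), forall xi, good xi}.
  near=> xi; have [_ h1] : sobolev L (3 + d)%N 2%:E (rho0 ^~ xi) /\ Pac L (rho0 ^~ xi) by near: xi.
  have h2 : forall r, 0 < r -> (fun y => spherical_graphop (rho r y) xi) \in Lfun (dx L) 1%:E by near: xi.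
  have [h3 h4] : C1_C2 L (fun t => rho t ^~ xi) /\
        forall t x, 0 < t -> solves_at L (@spherical_graphop R) kappa D rho t x xi by near: xi.
  by split => //; near: xi.
have gd xi : ~ N xi -> good xi by move=> h; apply: contrapT => /hN.
have [N2 [mN2 N20 hN2]] := equator_null mN N0.
(* [N] contains the slices for which the equation or the datum misbehaves, [N2] the points whose
   equator gives positive measure to [N]. *)
pose N' := N `|` N2.
have mN' : measurable N' by exact: measurableU.
have N'0 : (@sphere_unif R) N' = 0%E by exact: etrans (measureU0 mN mN2 N20) N0.
have NN' : N `<=` N' by left.
have eqN xi : ~ N' xi -> equator_unif xi N = 0%E.
  by move=> h; apply: contrapT => /hN2 h2; apply: h; right.
have summ xi (h : ~ N xi) := let: And5 a b c e f := gd xi h in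
  @orbit_summary R L d L_gt0 (fun r => rho r ^~ xi) (rho0 ^~ xi) kappa D (w xi) kappa_gt0 D_W2oo a b c e f.
(* Slices in [N] are replaced by zero, so that continuity, sign and measurability hold for every
   [xi]. *)
pose v r x xi := if xi \in N then 0 else rho r x xi.
have vE r x xi : ~ N xi -> v r x xi = rho r x xi by rewrite /v => h; rewrite memNset.
have v_null r x xi : N xi -> v r x xi = 0 by rewrite /v => h; rewrite mem_set.
have cv (r : R) xi : 0 < r -> continuous (v r ^~ xi) /\ periodic L (v r ^~ xi).
  move=> r0; have [xN|xN] := pselect (N xi).
    have -> : v r ^~ xi = fun=> 0 by apply/funext => x; exact: v_null.
    by split => // x; exact: cst_continuous.
  have -> : v r ^~ xi = rho r ^~ xi by apply/funext => x; exact: vE.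
  by have [[h _ _ _] _ _ _ _] := summ xi xN; exact: h.
have mrho (r : R) x : 0 < r -> measurable_fun setT (rho r x).
  by move=> r0; have /sub_Lfun_mfun := rho_L2 r x r0; rewrite inE.
have mv (r : R) x : 0 < r -> measurable_fun setT (v r x).
  move=> r0; apply: measurable_fun_ifT => //; last exact: mrho.
  apply: (measurable_fun_bool true); rewrite setTI (_ : _ @^-1` _ = N)//.
  by apply/seteqP; split=> x1 /=; [move/set_mem|move/mem_set].
have v_ge0 (r : R) x xi : 0 < r -> 0 <= v r x xi.
  move=> r0; have [xN|xN] := pselect (N xi); first by rewrite v_null.
  by rewrite vE//; have [[_ h _ _] _ _ _ _] := summ xi xN; exact: h.
have v_mass (r : R) xi : 0 < r -> ~ N xi -> \int[dx L]_x v r x xi = 1.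
  move=> r0 xN; under eq_Rintegral do rewrite vE//.
  by have [[_ _ h _] _ _ _ _] := summ xi xN; exact: h.
have cgap (r : R) xi : 0 < r -> {for r, continuous (fun r => \int[dx L]_x `|v r x xi - L ^- d|)}.
  move=> r0; have [xN|xN] := pselect (N xi).
    have -> : (fun r => \int[dx L]_x `|v r x xi - L ^- d|) = fun=> \int[@dx R L d]_x `|0 - L ^- d|.
      by apply/funext => r1; apply: eq_Rintegral => x _; rewrite v_null.
    exact: cst_continuous.
  have -> : (fun r => \int[dx L]_x `|v r x xi - L ^- d|) = fun r => \int[dx L]_x `|rho r x xi - L ^- d|.
    by apply/funext => r1; apply: eq_Rintegral => x _; rewrite vE.
  by have [[_ _ _ h] _ _ _ _] := summ xi xN; exact: h.
have gapE (r : R) xi : ~ N xi -> \int[dx L]_x `|rho r x xi - L ^- d| = gap L v r xi.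
  by move=> xN; apply: eq_Rintegral => x _; rewrite vE.
have HE (r : R) xi : ~ N xi -> \int[dx L]_x (rho r x xi * ln (rho r x xi / L ^- d)) = entropy_at L v r xi.
  by move=> xN; apply: eq_Rintegral => x _; rewrite vE.
have wgap (r : R) xi : 0 < r -> ~ N' xi -> \int[dx L]_x `|w xi r x - L ^- d| <= gap_avg L v r xi.
  move=> r0 xN; apply: (graphop_gap L_gt0 mN cv mv v_ge0 v_mass v_null r0 (eqN _ xN)).
  - by move=> x; exact: mrho.
  - by move=> x eta eN; rewrite vE.
  - by have [_ _ _ h _] := gd xi (fun h => xN (NN' _ h)); exact/Lfun1_integrable/h.
have M0 : 0 <= M by rewrite /M /Linfty_norm fine_ge0// Lnorm_ge0.
have k0 : 0 <= kappa * M by rewrite mulr_ge0// ltW.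
have lam0 : 0 <= lam by apply: divr_ge0; rewrite ?sqr_ge0// mulr_ge0 ?sqr_ge0.
have mH (r : R) (r0 : 0 < r) := measurable_entropy_at cv mv r0.
have H_ge0 (r : R) xi : 0 < r -> 0 <= entropy_at L v r xi.
  exact: (entropy_at_ge0 L_gt0 cv v_ge0 v_mass v_null).
have init (s : R) xi : 0 < s -> ~ N' xi -> entropy_at L v s xi - kappa * M * 4 * s <=
    \int[dx L]_x (rho0 x xi * ln (rho0 x xi / L ^- d)).
  move=> s0 xN; have xN1 : ~ N xi by move=> /NN'.
  have [_ _ h _ _] := summ xi xN1.
  rewrite -HE// lerBlDr; apply: h => // r r0.
  apply: (le_trans (wgap r xi r0 xN)).
  by have /andP[] := gap_avg_bounds L_gt0 cv mv v_ge0 v_mass v_null xi r0.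
pose E0 := fine (entropy L (@sphere_unif R) rho0).
have H_int (s : R) : 0 < s -> intg (@sphere_unif R) (entropy_at L v s) /\
    \int[(@sphere_unif R)]_xi entropy_at L v s xi <= E0 + kappa * M * 4 * s.
  move=> s0; set q := kappa * M * 4 * s.
  (* The initial entropy of a slice is not known to be measurable in [xi]; the positive part of its
     lower bound [init] is, and it is nonnegative as [integral_ge_null] requires. Finiteness of the
     mean entropy at time [s] follows. *)
  pose F xi := Num.max 0 (entropy_at L v s xi - q).
  have mF : measurable_fun setT F.
    by apply: measurable_maxr => //; apply: measurable_funB => //; exact: mH.
  have F0 xi : 0 <= F xi by rewrite le_max lexx.
  have hF : (\int[(@sphere_unif R)]_xi (F xi)%:E <= entropy L (@sphere_unif R) rho0)%E.
    apply: (integral_ge_null mN' N'0); first exact/measurable_EFinP.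
      by move=> xi; rewrite lee_fin.
    move=> xi xN; have xN1 : ~ N xi by move=> /NN'.
    have [_ _ _ h0 hI] := summ xi xN1.
    by rewrite -EFin_Rint// lee_fin ge_max h0/=; exact: init.
  have IF : intg (@sphere_unif R) F.
    apply/integrableP; split; first exact/measurable_EFinP.
    under eq_integral do rewrite /= ger0_norm//.
    exact: le_lt_trans hF rho0_entropy.
  have E0fin : entropy L (@sphere_unif R) rho0 \is a fin_num.
    rewrite ge0_fin_numE//; apply: le_trans hF; apply: integral_ge0 => xi _.
    by rewrite lee_fin.
  have HF xi : entropy_at L v s xi <= F xi + q by rewrite -lerBlDr le_max lexx orbT.
  have IFq : intg (@sphere_unif R) (fun xi => F xi + q) by apply: intgD => //; exact: intg_cst.
  have IH : intg (@sphere_unif R) (entropy_at L v s).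
    apply: (intg_ae_le (mH s s0) IFq); apply: aeW => xi.
    by rewrite ger0_norm ?H_ge0.
  split => //; apply: (@le_trans _ _ (\int[(@sphere_unif R)]_xi (F xi + q))).
    by apply: Rint_ae_le => //; exact: aeW.
  rewrite RintD//; last exact: intg_cst.
  by rewrite Rint_prob_cst lerD2r -lee_fin EFin_Rint// /E0 fineK.
have decay (s : R) : 0 < s -> s <= t -> \int[(@sphere_unif R)]_xi entropy_at L v t xi <=
    expR (- alpha * (t - s)) * (E0 + kappa * M * 4 * s).
  move=> s0 st; have [_ hs] := H_int s s0.
  apply: (@le_trans _ _ (expR (- alpha * (t - s)) * \int[(@sphere_unif R)]_xi entropy_at L v s xi)); last first.
    by rewrite ler_pM2l ?expR_gt0.
  have -> : alpha = lam - 2 * (kappa * M) by rewrite /alpha mulrA.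
  apply: (entropy_mean_decay L_gt0 cv mv v_ge0 v_mass v_null cgap s0 st k0 lam0 mN' N'0 NN').
    by move=> r /andP[sr _]; have [] := H_int r (lt_le_trans s0 sr).
  move=> r xi xN /andP[sr rt]; have xN1 : ~ N xi by move=> /NN'.
  have [_ h _ _ _] := summ xi xN1.
  have ms q : 0 < Num.max s q by rewrite lt_max s0.
  (* Freezing times below [s] makes this majorant continuous and at most 2 for every real [q]. *)
  have := h (fun q => gap_avg L v (Num.max s q) xi) s r s0 sr.
  move=> /(_ _ _ _)/wrap[].
  - by move=> q sq; rewrite max_r//; apply: wgap => //; exact: lt_le_trans sq.
  - by move=> q; have /andP[] := gap_avg_bounds L_gt0 cv mv v_ge0 v_mass v_null xi (ms q).
  - exact: (@continuous_gap_avg _ _ _ L_gt0 _ _ cv mv v_ge0 v_mass v_null cgap _ s0 xi).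
  have -> : \int[lebesgue_measure]_(q in `[s, r]) (expR (lam * q) * (gap L v q xi * gap_avg L v q xi)) =
      \int[lebesgue_measure]_(q in `[s, r]) (expR (lam * q) *
        (\int[dx L]_x `|rho q x xi - L ^- d| * gap_avg L v (Num.max s q) xi)).
    apply: eq_Rintegral => q; rewrite inE/= in_itv/= => /andP[sq _].
    by rewrite (gapE q xi xN1) max_r.
  by rewrite (HE r xi xN1) (HE s xi xN1).
have final : \int[(@sphere_unif R)]_xi entropy_at L v t xi <= expR (- alpha * t) * E0.
  (* Starting times tending to 0, along which the correction [kappa * M * 4 * s] disappears. *)
  pose s k := t * k.+1%:R^-1.
  have cs : s k @[k --> \oo] --> 0.
    by rewrite -(mulr0 t); apply: cvgM; [exact: cvg_cst|exact: cvg_harmonic].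
  have cE : expR (- alpha * (t - s k)) * (E0 + kappa * M * 4 * s k) @[k --> \oo] -->
      expR (- alpha * (t - 0)) * (E0 + kappa * M * 4 * 0).
    apply: cvgM.
      apply: continuous_cvg; first exact: continuous_expR.
      by apply: cvgM; [exact: cvg_cst|apply: cvgB; [exact: cvg_cst|exact: cs]].
    by apply: cvgD; [exact: cvg_cst|apply: cvgM; [exact: cvg_cst|exact: cs]].
  rewrite subr0 mulr0 addr0 in cE.
  apply: (ler_cvg_to (cvg_cst _) cE); apply: nearW => k; apply: decay.
    by rewrite mulr_gt0// invr_gt0.
  by rewrite ler_piMr ?(ltW t0)// invf_le1// ler1n.
have [IH _] := H_int t t0.
(* Inside [entropy] the original [rho] appears, uncontrolled on [N]; [integral_le_null] passes from
   it to the modified slices. *)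
apply: (@le_trans _ _ (\int[(@sphere_unif R)]_xi (entropy_at L v t xi)%:E)%E).
  apply: (integral_le_null mN N0); first exact/measurable_EFinP/mH.
    by move=> xi; rewrite lee_fin H_ge0.
  move=> xi xN; rewrite -HE// /rho_infty EFin_Rint//.
  have [[h1 h2 _ _] _ _ _ _] := summ xi xN; have [c p] := h1 t t0.
  have b := bmeas_continuous L_gt0 c p.
  apply: (intg_entropy L_gt0); [by apply: aeW => x; exact: h2|exact: bmeas_intg|].
  by apply: (bmeas_intg L); under eq_fun do rewrite expr2; apply: bmeasM.
have E0fin : entropy L (@sphere_unif R) rho0 \is a fin_num.
  rewrite ge0_fin_numE//.
  apply: (@le_trans _ _ (\int[(@sphere_unif R)]_xi (0%R : R)%:E)%E); first by rewrite integral0.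
  apply: (integral_ge_null mN N0) => //.
  by move=> xi xN; have [_ _ _ h0 hI] := summ xi xN; rewrite -EFin_Rint// lee_fin.
rewrite -EFin_Rint// -(fineK E0fin) -EFinM lee_fin -mulNr; exact: final.
Unshelve. all: by end_near. Qed.
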